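(* Let $\frac Q2<q_1<Q$, let $\frac1{p_1}=\frac1{q_1}-\frac1Q$, and let $V(g)=|g|^{-Q/q_1}\psi(g)$ on $\mathbb{H}^n$, where $\psi(g)=\frac{|x|^2}{|(x,t)|^2}$ for $0\ne g=(x,t)\in\mathbb{H}^n$. Then $V\in B_q$ for every $1<q<q_1$, but, for $L=-\Delta_{\mathbb{H}^n}+V$, the Riesz transforms $R^L_j=X_jL^{-1/2}$, $j=1,\dots,2n$, are not all bounded on $L^{p_1}(\mathbb{H}^n)$.
   Context: The Heisenberg group $\mathbb{H}^n$ is $\mathbb{R}^{2n}\times\mathbb{R}$ with product $(x,t)(y,s)=\big(x+y,\,t+s+2\sum_{j=1}^n(x_{n+j}y_j-x_jy_{n+j})\big)$, with Lebesgue (Haar) measure, homogeneous norm $|g|=|(x,t)|=(|x|^4+|t|^2)^{1/4}$ for $g=(x,t)$, balls $B(g,r)=\{h:|g^{-1}h|<r\}$, and homogeneous dimension $Q=2n+2$. Left-invariant vector fields: $X_j=\partial_{x_j}+2x_{n+j}\partial_t$, $X_{n+j}=\partial_{x_{n+j}}-2x_j\partial_t$ ($j=1,\dots,n$), and $\Delta_{\mathbb{H}^n}=\sum_{j=1}^{2n}X_j^2$. For $1<q<\infty$, a nonnegative locally $L^q$-integrable $V$ belongs to $B_q$ if there is $C>0$ with $\big(\frac1{|B|}\int_B V^q\big)^{1/q}\le \frac{C}{|B|}\int_B V$ for every ball $B\subset\mathbb{H}^n$. (For $V\in B_q$ with $\frac Q2\le q<Q$ it is known that the $R^L_j$ are bounded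 on $L^p(\mathbb{H}^n)$ for $1<p\le\frac{Qq}{Q-q}$; note $p_1=\frac{Qq_1}{Q-q_1}$.) *)

(* Defs.v *)
From HB Require Import structures.
From mathcomp Require Import all_boot all_order all_algebra.
From mathcomp Require Import all_classical all_reals all_analysis.

Set Implicit Arguments.
Unset Strict Implicit.
Unset Printing Implicit Defensive.
Import Order.TTheory GRing.Theory Num.Theory.
Import numFieldNormedType.Exports.

Local Open Scope classical_set_scope.
Local Open Scope ring_scope.

Definition measure_rV_display : measure_display -> measure_display.
Proof. exact. Qed.

(* Row vectors carry the sigma-algebra generated by the coordinates. *)
Section measurable_rV.
Context {d} {T : measurableType d} (m : nat).

Let coors : 'I_m -> 'rV[T]_m -> T := fun i x => x ord0 i.

Let rV_set0 : g_sigma_preimage coors set0.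
Proof. exact: sigma_algebra0. Qed.

Let rV_setC A : g_sigma_preimage coors A -> g_sigma_preimage coors (~` A).
Proof. exact: sigma_algebraC. Qed.

Let rV_bigcup (F : _^nat) : (forall i, g_sigma_preimage coors (F i)) ->
  g_sigma_preimage coors (\bigcup_i (F i)).
Proof. exact: sigma_algebra_bigcup. Qed.

HB.instance Definition _ := @isMeasurable.Build (measure_rV_display d)
  'rV[T]_m (g_sigma_preimage coors) rV_set0 rV_setC rV_bigcup.

End measurable_rV.

Section measurable_rV_lemmas.
Context {d d'} {T : measurableType d} {T' : measurableType d'}.

Lemma measurable_coord m (i : 'I_m) :
  measurable_fun [set: 'rV[T]_m] (fun x => x ord0 i).
Proof.
move=> _ Y mY; rewrite setTI; apply: sub_sigma_algebra => /=.
rewrite -bigcup_seq/=; exists i => /=; first by rewrite mem_index_enum.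
by exists Y => //; rewrite setTI.
Qed.

Lemma measurable_fun_rV m (f : T' -> 'rV[T]_m) :
  (forall i, measurable_fun [set: T'] (fun t => f t ord0 i)) ->
  measurable_fun [set: T'] f.
Proof.
move=> mf _ A mA; rewrite setTI.
have /(_ A mA) : measurable `<=`
    [set B : set 'rV[T]_m | measurable (f @^-1` B)].
  apply: smallest_sub.
    split => /=; first by rewrite preimage_set0.
      by move=> B mB; rewrite setTD preimage_setC; exact: measurableC.
    by move=> F mF; rewrite preimage_bigcup; exact: bigcupT_measurable.
  rewrite -bigcup_seq/= => B [i _ [C mC <-]] /=.
  by have := mf i measurableT C mC; rewrite !setTI.
by [].
Qed.

End measurable_rV_lemmas.

(* [lebesgue_measure] is declared on [measurableTypeR R]; the measurable sets
   of [R] are convertible to those of [measurableTypeR R]. *)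
Section lebesgue_R.
Context {R : realType}.

Definition lebesgue_R : set R -> \bar R := @lebesgue_measure R.

HB.instance Definition _ := @isMeasure.Build _ R R lebesgue_R
  (measure0 (@lebesgue_measure R)) (measure_ge0 (@lebesgue_measure R))
  (@measure_semi_sigma_additive _ _ _ (@lebesgue_measure R)).

Let sfin : sigma_finite [set: R] lebesgue_R.
Proof. exact: (sigma_finiteT (@lebesgue_measure R)). Qed.

HB.instance Definition _ := @Measure_isSigmaFinite.Build _ R R lebesgue_R sfin.

End lebesgue_R.
Section lebesgue_rV.
Context {R : realType}.

Definition cons_rV m (p : R * 'rV[R]_m) : 'rV[R]_m.+1 :=
  \row_(i < m.+1) oapp (fun j => p.2 ord0 j) p.1 (unlift ord0 i).

Lemma measurable_cons_rV m : measurable_fun [set: R * 'rV[R]_m] (@cons_rV m).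
Proof.
apply: measurable_fun_rV => i; rewrite /cons_rV.
under eq_fun do rewrite mxE.
case: unliftP => [j _|_] /=; last exact: measurable_fst.
by apply: measurableT_comp (measurable_coord j) _; exact: measurable_snd.
Qed.

Section step.
Variables (m : nat) (mu : {sigma_finite_measure set 'rV[R]_m -> \bar R}).

Definition lebesgue_rV_step : set 'rV[R]_m.+1 -> \bar R :=
  pushforward (@lebesgue_R R \x mu)%E (@cons_rV m).

Let step0 : lebesgue_rV_step set0 = 0%E.
Proof. by rewrite /lebesgue_rV_step /pushforward preimage_set0 measure0. Qed.

Let step_ge0 A : (0 <= lebesgue_rV_step A)%E.
Proof. exact: (measure_ge0 (@lebesgue_R R \x mu)%E). Qed.

Let step_sigma_additive : semi_sigma_additive lebesgue_rV_step.
Proof.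
have mpre A : measurable A -> measurable (@cons_rV m @^-1` A).
  by move=> mA; rewrite -[X in measurable X]setTI; exact: measurable_cons_rV.
move=> F mF tF mUF; rewrite /lebesgue_rV_step /pushforward preimage_bigcup.
apply: measure_semi_sigma_additive => [k||]; first exact: mpre.
  apply/trivIsetP => /= i j _ _ ij; rewrite -preimage_setI.
  by move/trivIsetP : tF => /(_ _ _ _ _ ij) ->//; rewrite preimage_set0.
by rewrite -preimage_bigcup; exact: mpre.
Qed.

HB.instance Definition _ := isMeasure.Build _ _ _ lebesgue_rV_step
  step0 step_ge0 step_sigma_additive.

Let sfin : sigma_finite setT lebesgue_rV_step.
Proof.
have /sigma_finiteP[F [TF ndF Foo]] := sigma_finiteT (@lebesgue_R R).
have /sigma_finiteP[G [TG ndG Goo]] := sigma_finiteT mu.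
pose u (v : 'rV[R]_m.+1) := (v ord0 ord0, \row_j v ord0 (lift ord0 j)).
have mu_ : measurable_fun setT u.
  apply/measurable_fun_pairP; split; first exact: measurable_coord.
  apply: measurable_fun_rV => i; under eq_fun do rewrite mxE.
  exact: measurable_coord.
have uK : cancel (@cons_rV m) u.
  case=> a v; rewrite /u /cons_rV mxE unlift_none /=; congr pair.
  by apply/rowP => j; rewrite !mxE liftK.
exists (fun k => u @^-1` (F k `*` G k)).
  rewrite -preimage_bigcup (_ : \bigcup_k _ = setT) ?preimage_setT//.
  rewrite -subTset => -[x y] _.
  have [i _ Fi] : (\bigcup_k F k) x by rewrite -TF.
  have [j _ Gj] : (\bigcup_k G k) y by rewrite -TG.
  exists (maxn i j) => //; split => /=.
    by move: x Fi; exact/subsetPset/ndF/leq_maxl.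
  by move: y Gj; exact/subsetPset/ndG/leq_maxr.
move=> k; have [mFk Fk] := Foo k; have [mGk Gk] := Goo k.
have mFG : measurable (F k `*` G k) by exact: measurableX.
split; first by rewrite -[X in measurable X]setTI; exact: mu_.
rewrite /lebesgue_rV_step /pushforward -comp_preimage.
rewrite (_ : u \o _ = id); last by apply/funext => x /=; rewrite uK.
by rewrite preimage_id product_measure1E// lte_mul_pinfty// ge0_fin_numE.
Qed.

HB.instance Definition _ := Measure_isSigmaFinite.Build _ _ _
  lebesgue_rV_step sfin.

End step.

Fixpoint lebesgue_rV m : {sigma_finite_measure set 'rV[R]_m -> \bar R} :=
  if m is m'.+1 then lebesgue_rV_step (lebesgue_rV m') else \d_(0 : 'rV[R]_0).

End lebesgue_rV.

(* The Heisenberg group: g = (x, t), where [lshift n j] and [rshift n j] index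
   the coordinates x_j and x_{n+j}. *)
Notation heis R n := ('rV[R]_(n + n) * R)%type.

Section Heisenberg.
Context {R : realType} {n : nat}.
Implicit Types (g h : heis R n) (f u v : heis R n -> R).

Definition hom_dim : R := (2 * n + 2)%:R.

Definition heis_mul g h : heis R n :=
  (g.1 + h.1,
   g.2 + h.2 + 2 * \sum_(j < n) (g.1 ord0 (rshift n j) * h.1 ord0 (lshift n j)
                               - g.1 ord0 (lshift n j) * h.1 ord0 (rshift n j))).

Definition heis_inv g : heis R n := (- g.1, - g.2).

(* the squared Euclidean norm |x|^2 of the horizontal component *)
Definition sqnorm_hor g : R := \sum_i g.1 ord0 i ^+ 2.

Definition heis_norm g : R := (sqnorm_hor g ^+ 2 + g.2 ^+ 2) `^ 4^-1.

Definition heis_ball g (r : R) : set (heis R n) :=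
  [set h | heis_norm (heis_mul (heis_inv g) h) < r].

Definition heis_leb : {measure set (heis R n) -> \bar R} :=
  (lebesgue_rV (n + n) \x @lebesgue_R R)%E.

Local Notation mu := heis_leb.

Definition partial_x (k : 'I_(n + n)) f g : R := 'D_(delta_mx ord0 k, 0) f g.

Definition partial_t f g : R := 'D_(0, 1) f g.

Definition heis_X (k : 'I_(n + n)) f g : R :=
  match fintype.split k with
  | inl j => partial_x k f g + 2 * g.1 ord0 (rshift n j) * partial_t f g
  | inr j => partial_x k f g - 2 * g.1 ord0 (lshift n j) * partial_t f g
  end.

Definition iter_derive (vs : seq (heis R n)) f : heis R n -> R :=
  foldr (fun e f' => 'D_e f') f vs.

Definition smooth f : Prop :=
  forall vs, continuous (iter_derive vs f) /\
    forall g e, derivable (iter_derive vs f) g e.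

Definition test_fun f : Prop :=
  smooth f /\ compact (closure [set g | f g != 0]).

(* X_k u = w in the sense of distributions; X_k is divergence free, hence
   formally skew-adjoint. *)
Definition weak_X (k : 'I_(n + n)) u (w : heis R n -> R) : Prop :=
  forall phi, test_fun phi ->
    \int[mu]_g (u g * heis_X k phi g) = - \int[mu]_g (w g * phi g).

Definition L2 f : Prop := f \in Lfun mu 2%:E.

Definition dot f u : R := \int[mu]_g (f g * u g).

Definition rev_holder (q : R) (V : heis R n -> R) : Prop :=
  [/\ forall g, 0 <= V g,
      measurable_fun setT V,
      forall K : set (heis R n), measurable K -> compact K ->
        (\int[mu]_(g in K) (V g `^ q)%:E < +oo)%E &
      exists2 C : R, 0 < C &
        forall g r, 0 < r -> let B := heis_ball g r in
          ((fine (mu B))^-1 * \int[mu]_(h in B) (V h `^ q)) `^ q^-1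
            <= C / fine (mu B) * \int[mu]_(h in B) V h].

Section Schrodinger.
Variable V : heis R n -> R.

(* [form_dom u U]: u belongs to the domain of the quadratic form
   a(u, v) = \sum_k <X_k u, X_k v> + <V u, v>, and U is its horizontal
   gradient. *)
Definition form_dom u (U : 'I_(n + n) -> heis R n -> R) : Prop :=
  [/\ L2 u, forall k, L2 (U k) /\ weak_X k u (U k) &
      (\int[mu]_g (V g * u g ^+ 2)%:E < +oo)%E].

(* [schrodinger u f]: u is in the domain of L = - \sum_k X_k^2 + V and L u = f,
   where L is the nonnegative self-adjoint operator on (real-valued) L^2
   associated with the form a.  [f] and [U] are determined by [u] up to null
   sets. *)
Definition schrodinger u f : Prop :=
  L2 f /\ exists2 U, form_dom u U &
    forall v W, form_dom v W ->
      \sum_k dot (U k) (W k) + \int[mu]_g (V g * u g * v g) = dot f v.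

(* [resolvent lam f u]: (L + lam) u = f *)
Definition resolvent (lam : R) f u : Prop :=
  L2 f /\ schrodinger u (fun g => f g - lam * u g).

(* [inv_sqrt f u]: f is in the domain of L^(-1/2) and L^(-1/2) f = u, where
     L^(-1/2) f = pi^-1 \int_0^oo lam^(-1/2) (L + lam)^-1 f dlam
   is a weak (Pettis) integral in L^2. *)
Definition inv_sqrt f u : Prop :=
  L2 u /\ exists2 J : R -> heis R n -> R,
    forall lam, 0 < lam -> resolvent lam f (J lam) &
    forall v, L2 v ->
      lebesgue_R.-integrable `]0, +oo[
        (fun lam => (lam `^ (- 2^-1) * dot (J lam) v)%:E) /\
      dot u v = pi^-1 *
        \int[lebesgue_R]_(lam in `]0, +oo[) (lam `^ (- 2^-1) * dot (J lam) v).

(* [riesz k f w]: f is in the domain of L^(-1/2) and X_k L^(-1/2) f = w *)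
Definition riesz (k : 'I_(n + n)) f w : Prop :=
  L2 w /\ exists2 u, inv_sqrt f u & weak_X k u w.

End Schrodinger.

(* Boundedness on L^p of an operator on L^2, given by its graph: the L^p
   estimate on the part of its domain that lies in L^p. *)
Definition bounded_Lp (p : R) (T : (heis R n -> R) -> (heis R n -> R) -> Prop) :
    Prop :=
  exists C : R, forall f w, f \in Lfun mu p%:E -> T f w ->
    (Lnorm mu p%:E (EFin \o w) <= C%:E * Lnorm mu p%:E (EFin \o f))%E.

(* Both factors of [crit_V] take the value 0 at g = 0. *)
Definition psi g : R := sqnorm_hor g / heis_norm g ^+ 2.

Definition crit_V (q1 : R) g : R := heis_norm g `^ (- (hom_dim / q1)) * psi g.

End Heisenberg.

Arguments hom_dim {R} n.

(* Main.v *)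
(* Put N = |g|^4, rho = |x|^2 and b = (2 - Q / q1) / 4, so that V = rho N^(b-1) is
   homogeneous of degree -Q / q1 and 0 < b < 1/4.

   By homogeneity the reverse Hoelder inequality reduces to balls of radius 1.
   Far from the origin V is comparable on such a ball B(g, 1) to
   (rho(g) + 1) N(g)^(b-1) on average and at most a multiple of it everywhere;
   near the origin V^q is integrable, as q Q / q1 < Q.

   For the Riesz transforms, there is u = H(N), smooth away from 0 and supported
   in the unit ball, with H(y) = 1 + c y^b + ..., such that f = L u is bounded:
   the finitely many terms of the expansion of H are chosen so that the
   singularities of V u and of the sublaplacian of u at 0 cancel.  Then
   h = L^(1/2) u = pi^-1 \int_0^oo lam^(-1/2) (L + lam)^-1 f dlam is in L^2, and
   it is bounded since lam (L + lam)^-1 is a contraction for the sup norm; so h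
   is in L^p1.  On the other hand X_k L^(-1/2) h = X_k u behaves like
   N^(b-1) X_k N at 0, and the p1-th power of the horizontal gradient, which is
   homogeneous of degree -Q, is not integrable.

   That L^(-1/2) h is a positive multiple of u follows from the resolvent
   identity: for monotone F, the integral over x, y > 0 of
   (x y)^(-1/2) (F(x) - F(y)) / (y - x) is a multiple of F(0+) - F(+oo). *)
From HB Require Import structures.
From mathcomp Require Import all_boot all_order all_algebra.
From mathcomp Require Import all_classical all_reals all_analysis.
From mathcomp Require Import measurable_realfun.
From mathcomp Require Import ring lra.
Require Import Defs.
Set Implicit Arguments.
Unset Strict Implicit.
Unset Printing Implicit Defensive.
Import Order.TTheory GRing.Theory Num.Theory.
Import numFieldNormedType.Exports.
Local Open Scope classical_set_scope.
Local Open Scope ring_scope.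

(** * Lebesgue measure under affine maps *)

(** Everything is extracted from the quadratic form; neither a spectral theorem nor a heat semigroup
    enters. The resolvent comes from Riesz representation, its sup-norm contraction from the
    variational principle, and the functional calculus is replaced by monotonicity in lam of <L (L +
    lam)^-1 z, z>: polarization turns pairings with the resolvent into differences of two monotone
    functions. A radial profile works because rho factors out of every term: the squared horizontal
    gradient of N is 16 rho N, its sublaplacian is 8 (n + 2) rho, and V = rho N^(b-1). Hence L u is
    rho times an ordinary differential expression in y = N, whose Frobenius series runs in powers of
    y^b. Finitely many terms are enough as soon as the first uncancelled power y^(m b - 1) is
    bounded. The contraction property applied to f alone does not make the integral for h converge
    at lam = 0. There the identity (L + lam)^-1 f = u - lam (L + lam)^-1 u gives the bound 2 sup
    |u|. *)

Section affine_R.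
Context {R : realType}.
Local Open Scope ereal_scope.

Lemma measurable_affine (a b : R) :
  measurable_fun setT (fun x : R => a * x + b)%R.
Proof. by apply: measurable_funD => //; apply: measurable_funM. Qed.

(** Uniqueness of Lebesgue measure: |a| times its pushforward has the right value on the intervals
    ]c, d]. For a < 0 the preimage is half-open on the other side, with the same length. *)
Lemma lebesgue_R_affine (a b : R) (A : set R) : a != 0%R -> measurable A ->
  lebesgue_R ((fun x => a * x + b)%R @^-1` A) = (`|a|^-1)%:E * lebesgue_R A.
Proof.
move=> a0 mA.
pose phi := (fun x : measurableTypeR R => a * x + b : measurableTypeR R)%R.
have mphi : measurable_fun setT phi by exact: measurable_affine.
have na0 : (0 <= `|a|)%R by [].
pose m0 := mscale (NngNum na0) (pushforward (@lebesgue_measure R) phi)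
  : {measure set (measurableTypeR R) -> \bar R}.
pose m := m0 mphi.
have mE B : m B = `|a|%:E * lebesgue_measure (phi @^-1` B) by [].
have H : forall X, ocitv X -> lebesgue_measure X = m X.
  move=> _ [[c d]] /= _ <-; rewrite mE.
  have [apos|aneg] : (0 < a)%R \/ (a < 0)%R.
    by case: (ltgtP a 0%R) a0 => // ? _; [right|left].
  - have -> : phi @^-1` `]c, d] = `]((c - b) / a)%R, ((d - b) / a)%R]%classic.
      apply/seteqP; split => x; rewrite /phi /= !in_itv /= ltr_pdivrMr//
        ler_pdivlMr// ltrBlDr lerBrDr (mulrC x) => //.
    rewrite !lebesgue_measure_itv /= !lte_fin ltr_pM2r ?invr_gt0// ltrD2r.
    case: ifP => _; last by rewrite mule0.
    rewrite -!EFinB -EFinM gtr0_norm//; congr _%:E.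
    by field; rewrite gt_eqF.
  - have -> : phi @^-1` `]c, d] = `[((d - b) / a)%R, ((c - b) / a)%R[%classic.
      apply/seteqP; split => x; rewrite /phi /= !in_itv /= ler_ndivrMr//
        ltr_ndivlMr// ltrBlDr lerBrDr (mulrC x) andbC => //.
    rewrite !lebesgue_measure_itv /= !lte_fin ltr_nM2r ?invr_lt0// ltrD2r.
    case: ifP => _; last by rewrite mule0.
    rewrite -!EFinB -EFinM ltr0_norm//; congr _%:E.
    by field; rewrite lt_eqF.
rewrite [X in _ = _ * X](lebesgue_measure_unique H mA) mE muleA -EFinM.
by rewrite mulVf ?mul1e// normr_eq0.
Qed.

Lemma ge0_integral_affine_R (a b : R) (f : R -> \bar R) : a != 0%R ->
  measurable_fun setT f -> (forall x, 0 <= f x) ->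
  \int[lebesgue_R]_x f (a * x + b)%R =
  (`|a|^-1)%:E * \int[lebesgue_R]_x f x.
Proof.
move=> a0 mf f0.
have mphi := measurable_affine a b.
pose phi := (fun x : R => a * x + b)%R.
pose m1 := pushforward (@lebesgue_R R) phi : {measure set R -> \bar R}.
have := @ge0_integral_pushforward _ _ _ _ _ _ mphi (@lebesgue_R R) setT f
  measurableT mf (fun y _ => f0 y).
rewrite preimage_setT => <-.
have na0 : (0 <= `|a|^-1)%R by rewrite invr_ge0.
transitivity (\int[mscale (NngNum na0) (@lebesgue_R R)]_x f x).
  apply: (@eq_measure_integral _ _ _ _ _ (m1 mphi)).
  move=> A mA _.
  by rewrite -[RHS]/(`|a|^-1%:E * lebesgue_R A)%E -(lebesgue_R_affine b).
by rewrite ge0_integral_mscale.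
Qed.

End affine_R.

Section affine_rV.
Context {R : realType}.
Local Open Scope ereal_scope.

Lemma ge0_integral_cons_rV m (f : 'rV[R]_m.+1 -> \bar R) :
  measurable_fun setT f -> (forall x, 0 <= f x) ->
  \int[lebesgue_rV m.+1]_v f v =
  \int[lebesgue_R]_x \int[lebesgue_rV m]_w f (cons_rV (x, w)).
Proof.
move=> mf f0.
pose m1 := pushforward (@lebesgue_R R \x lebesgue_rV m) (@cons_rV R m)
  : {measure set 'rV[R]_m.+1 -> \bar R}.
transitivity (\int[m1 (@measurable_cons_rV R m)]_v f v).
  exact: eq_measure_integral.
rewrite ge0_integral_pushforward//; last exact: measurable_cons_rV.
rewrite preimage_setT fubini_tonelli1//=.
by apply: measurableT_comp => //; exact: measurable_cons_rV.
Qed.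

Lemma measurable_affine_rV m (a : R) (b : 'rV[R]_m) :
  measurable_fun setT (fun v : 'rV[R]_m => a *: v + b)%R.
Proof.
apply: measurable_fun_rV => i; under eq_fun do rewrite !mxE.
by apply: measurable_funD => //; apply: measurable_funM => //; exact: measurable_coord.
Qed.

Lemma ge0_integral_affine_rV m (a : R) (b : 'rV[R]_m) (f : 'rV[R]_m -> \bar R) :
  a != 0%R -> measurable_fun setT f -> (forall x, 0 <= f x) ->
  \int[lebesgue_rV m]_v f (a *: v + b)%R =
  (`|a|^-1 ^+ m)%:E * \int[lebesgue_rV m]_v f v.
Proof.
elim: m b f => [|m IH] b f a0 mf f0.
  rewrite expr0 mul1e; apply: eq_integral => x _; congr f.
  by apply/rowP => -[].
have mfc : measurable_fun setT (fun z => f (cons_rV z)).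
  by apply: measurableT_comp => //; exact: measurable_cons_rV.
rewrite !ge0_integral_cons_rV//; last first.
  by apply: measurableT_comp => //; exact: measurable_affine_rV.
pose b' : 'rV[R]_m := \row_j b ord0 (lift ord0 j).
have E x w : (a *: cons_rV (x, w) + b = cons_rV (a * x + b ord0 ord0, a *: w + b') :> 'rV[R]_m.+1)%R.
  apply/rowP => i; rewrite !mxE; case: (unliftP ord0 i) => [j ->|->] /=.
    by rewrite !mxE.
  by [].
under eq_integral => x _.
  under eq_integral => w _ do rewrite E.
  rewrite (IH b' (fun w => f (cons_rV ((a * x + b ord0 ord0)%R, w))))//; last first.
    exact: (measurableT_comp mfc (pair1_measurable _)).
  over.
have mF : measurable_fun setT (fun x => \int[lebesgue_rV m]_w f (cons_rV (x, w))).
  exact: (@measurable_fun_fubini_tonelli_F _ _ _ _ _ (lebesgue_rV m) _ mfc (fun=> f0 _)).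
rewrite ge0_integralZl; first last.
- by [].
- by move=> x _; apply: integral_ge0.
- exact: (measurableT_comp mF (measurable_affine a (b ord0 ord0))).
- exact: measurableT.
rewrite (ge0_integral_affine_R _ a0 mF); last by move=> x; apply: integral_ge0.
by rewrite exprS EFinM muleCA muleA.
Qed.

End affine_rV.

Section heis_measure.
Context {R : realType} {n : nat}.
Local Notation mu := (@heis_leb R n).
Local Open Scope ereal_scope.

Lemma ge0_integral_heisE (f : heis R n -> \bar R) :
  measurable_fun setT f -> (forall x, 0 <= f x) ->
  \int[mu]_g f g = \int[lebesgue_rV (n + n)]_x \int[lebesgue_R]_t f (x, t).
Proof. by move=> mf f0; rewrite /heis_leb fubini_tonelli1. Qed.

(** The translation s in t may depend on x: integrating in t first removes it. This one change of
    variables covers left translations, the flows of the X_k, reflection and dilations. *)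
Lemma ge0_integral_affine_heis (a : R) (b : 'rV[R]_(n + n)) (a' : R)
    (s : 'rV[R]_(n + n) -> R) (f : heis R n -> \bar R) :
  a != 0%R -> a' != 0%R -> measurable_fun setT s ->
  measurable_fun setT f -> (forall x, 0 <= f x) ->
  \int[mu]_g f (a *: g.1 + b, a' * g.2 + s g.1)%R =
  (`|a|^-1 ^+ (n + n) * `|a'|^-1)%:E * \int[mu]_g f g.
Proof.
move=> a0 a'0 ms mf f0.
have m1 : measurable_fun setT (fun g : heis R n => (a *: g.1 + b, a' * g.2 + s g.1)%R).
  apply/measurable_fun_pairP; split => /=.
    by apply: (measurableT_comp (measurable_affine_rV a b)); exact: measurable_fst.
  apply: measurable_funD; first by apply: measurable_funM => //; exact: measurable_snd.
  by apply: (measurableT_comp ms); exact: measurable_fst.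
rewrite !ge0_integral_heisE//; last exact: (measurableT_comp mf m1).
under eq_integral => x _.
  rewrite (@ge0_integral_affine_R _ a' (s x) (fun t => f ((a *: x + b)%R, t)))//; last first.
    exact: (measurableT_comp mf (pair1_measurable _)).
  over.
have mF : measurable_fun setT (fun x => \int[lebesgue_R]_t f (x, t)).
  exact: (@measurable_fun_fubini_tonelli_F _ _ _ _ _ (@lebesgue_R R) _ mf f0).
rewrite ge0_integralZl; first last.
- by [].
- by move=> x _; apply: integral_ge0.
- exact: (measurableT_comp mF (measurable_affine_rV a b)).
- exact: measurableT.
rewrite (ge0_integral_affine_rV b a0 mF); last by move=> x; apply: integral_ge0.
by rewrite muleA -EFinM mulrC.
Qed.

End heis_measure.

(** * The Heisenberg group: flows, dilations and measure-preserving maps *)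

Section heis_basics.
Context {R : realType} {n : nat}.
Local Notation H := (heis R n).
Local Notation mu := (@heis_leb R n).
Implicit Types (g h : H).

(* The vector field X_k is d_{x_k} + 2 (pcoef k x) d_t. *)
Definition pcoef (k : 'I_(n + n)) (x : 'rV[R]_(n + n)) : R :=
  match fintype.split k with
  | inl j => x ord0 (rshift n j)
  | inr j => - x ord0 (lshift n j)
  end.

(** The flow of X_k, that is right translation by s times the k-th basis vector. It runs along
    straight lines because [pcoef k] does not change in the direction k. *)
Definition flow (k : 'I_(n + n)) (s : R) g : H :=
  (g.1 + s *: delta_mx ord0 k, g.2 + s * (2 * pcoef k g.1)).

(** The fourth power of the homogeneous norm: a polynomial, hence smooth also at 0. *)
Definition homN g : R := sqnorm_hor g ^+ 2 + g.2 ^+ 2.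

Lemma heis_normE g : heis_norm g = homN g `^ 4^-1.
Proof. by []. Qed.

Lemma sqnorm_hor_ge0 g : 0 <= sqnorm_hor g.
Proof. by apply: sumr_ge0 => i _; exact: sqr_ge0. Qed.

Lemma homN_ge0 g : 0 <= homN g.
Proof. by rewrite addr_ge0// sqr_ge0. Qed.

Lemma coord_le_sqnorm g i : g.1 ord0 i ^+ 2 <= sqnorm_hor g.
Proof.
rewrite /sqnorm_hor (bigD1 i)//= lerDl.
by apply: sumr_ge0 => j _; exact: sqr_ge0.
Qed.

Lemma pcoefD k (x y : 'rV[R]_(n + n)) : pcoef k (x + y) = pcoef k x + pcoef k y.
Proof. by rewrite /pcoef; case: fintype.split => j; rewrite !mxE// opprD. Qed.

Lemma pcoefZ k a (x : 'rV[R]_(n + n)) : pcoef k (a *: x) = a * pcoef k x.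
Proof. by rewrite /pcoef; case: fintype.split => j; rewrite !mxE// mulrN. Qed.

Lemma split_lshift j : fintype.split (lshift n j : 'I_(n + n)) = inl j.
Proof. by have := @unsplitK n n (inl j). Qed.

Lemma split_rshift j : fintype.split (rshift n j : 'I_(n + n)) = inr j.
Proof. by have := @unsplitK n n (inr j). Qed.

Lemma pcoefl j (x : 'rV[R]_(n + n)) : pcoef (lshift n j) x = x ord0 (rshift n j).
Proof. by rewrite /pcoef split_lshift. Qed.

Lemma pcoefr j (x : 'rV[R]_(n + n)) : pcoef (rshift n j) x = - x ord0 (lshift n j).
Proof. by rewrite /pcoef split_rshift. Qed.

Lemma pcoef_delta k : pcoef k (delta_mx ord0 k) = 0 :> R.
Proof.
rewrite -(splitK k); case: (fintype.split k) => j /=.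
  by rewrite pcoefl mxE eq_rlshift.
by rewrite pcoefr mxE eq_lrshift oppr0.
Qed.

(** [pcoef] turns x by a quarter in each plane (x_j, x_(n+j)). This is an isometry, and it makes the
    image orthogonal to x. *)
Lemma sum_pcoef2 (x : 'rV[R]_(n + n)) :
  \sum_k pcoef k x ^+ 2 = \sum_k x ord0 k ^+ 2.
Proof.
rewrite !big_split_ord/= addrC; congr (_ + _); apply: eq_bigr => i _.
  by rewrite pcoefr sqrrN.
by rewrite pcoefl.
Qed.

Lemma sum_coord_pcoef (x : 'rV[R]_(n + n)) : \sum_k x ord0 k * pcoef k x = 0.
Proof.
rewrite !big_split_ord/= -big_split/=; apply: big1 => i _.
by rewrite pcoefl pcoefr mulrN mulrC subrr.
Qed.

Lemma measurable_hor i : measurable_fun setT (fun g : H => g.1 ord0 i).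
Proof. exact: (measurableT_comp (measurable_coord i) measurable_fst). Qed.

Lemma measurable_pcoef k : measurable_fun setT (pcoef k).
Proof.
rewrite /pcoef; case: fintype.split => j; first exact: measurable_coord.
by apply: measurableT_comp => //; exact: measurable_coord.
Qed.

Lemma measurable_sqnorm : measurable_fun setT (@sqnorm_hor R n).
Proof. by apply: measurable_sum => i; apply: measurable_funX; exact: measurable_hor. Qed.

Lemma measurable_homN : measurable_fun setT homN.
Proof.
apply: measurable_funD; apply: measurable_funX; first exact: measurable_sqnorm.
exact: measurable_snd.
Qed.

Lemma measurable_powR_comp d (T : measurableType d) (f : T -> R) p :
  measurable_fun setT f -> measurable_fun setT (fun x => f x `^ p).
Proof. by move=> mf; apply: (measurableT_comp (measurable_powR p)). Qed.

Lemma ball_heisE g e h : 0 < e ->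
  ball g e h <-> (forall i, `|g.1 ord0 i - h.1 ord0 i| < e) /\ `|g.2 - h.2| < e.
Proof.
move=> e0; split.
  by move=> [[_ b1] b2]; split => // i; exact: b1.
move=> [b1 b2]; split => //; split => // i j; rewrite ord1; exact: b1.
Qed.

Lemma measurable_ball_heis g e : 0 < e -> measurable (ball g e : set H).
Proof.
move=> e0.
have -> : ball g e = (\bigcap_(i in [set: 'I_(n + n)])
    ((fun h : H => h.1 ord0 i) @^-1` ball (g.1 ord0 i) e)) `&`
    (snd @^-1` ball g.2 e).
  apply/seteqP; split => h.
    by move=> /(ball_heisE _ _ e0)[b1 b2]; split => // i _; exact: b1.
  move=> [b1 b2]; apply/(ball_heisE _ _ e0); split; last exact: b2.
  by move=> i; exact: (b1 i).
apply: measurableI.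
  apply: fin_bigcap_measurable => // i _.
  rewrite -[X in measurable X]setTI; apply: measurable_hor => //.
  exact: measurable_ball.
rewrite -[X in measurable X]setTI; apply: measurable_snd => //.
exact: measurable_ball.
Qed.

(** The sigma-algebra is generated by coordinates, so Borel sets need an argument: an open set is
    the union of those balls with rational centre and radius 1/(m+1) that it contains, and these are
    countably many. *)
Lemma open_measurable_heis (A : set H) : open A -> measurable A.
Proof.
move=> oA.
pose c (z : 'rV[rat]_(n + n) * rat * nat) : H := (map_mx ratr z.1.1, ratr z.1.2).
pose B z := [set h | (forall x, ball (c z) z.2.+1%:R^-1 x -> A x) /\ ball (c z) z.2.+1%:R^-1 h].
have -> : A = \bigcup_z B z.
  apply/seteqP; split => [g Ag|g [z _ [+ ]]]; last by move=> /[apply].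
  have /nbhs_ballP[e /= e0 eA] : nbhs g A by exact: open_nbhs_nbhs.
  have [N] : exists N, 0 + N.+1%:R^-1 < e / 2.
    by apply: ltr_add_invr; rewrite divr_gt0.
  rewrite add0r => N0.
  have k0 : 0 < N.+1%:R^-1 :> R by rewrite invr_gt0.
  have ex (x : R) : exists q : rat, `|ratr q - x| < N.+1%:R^-1.
    have /rat_in_itvoo[q] : x - N.+1%:R^-1 < x + N.+1%:R^-1.
      by rewrite ltrD2l (lt_trans _ k0)// oppr_lt0.
    by rewrite in_itv/= => hq; exists q; rewrite ltr_distl.
  have /choice[p Hp] : forall i, exists q : rat, `|ratr q - g.1 ord0 i| < N.+1%:R^-1.
    by move=> i; exact: ex.
  have [q Hq] := ex g.2.
  have bg : ball (c (\row_i p i, q, N)) N.+1%:R^-1 g.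
    by apply/ball_heisE => //; split => // i; rewrite !mxE.
  exists (\row_i p i, q, N) => //; split => // x bx; apply: eA.
  apply: (@le_ball _ _ _ (N.+1%:R^-1 + N.+1%:R^-1)).
    by rewrite ltW// (splitr e) ltrD.
  by apply: ball_triangle bx; exact: ball_sym.
apply: countable_bigcupT_measurable; first exact: countableP.
move=> z; have [h|nh] := pselect (forall x, ball (c z) z.2.+1%:R^-1 x -> A x).
  rewrite (_ : B z = ball (c z) z.2.+1%:R^-1); first exact: measurable_ball_heis.
  by apply/seteqP; split => [x []//|x].
rewrite (_ : B z = set0)//; by apply/seteqP; split => // x [].
Qed.

Lemma continuous_measurable_heis (f : H -> R) : continuous f -> measurable_fun setT f.
Proof.
move=> cf; apply: (measurability _ (RGenOpens.measurableE R)) => //.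
move=> _ [_ [a [b ->]] <-]; rewrite setTI; apply: open_measurable_heis.
by apply: open_comp => //; exact: interval_open.
Qed.

Lemma lebesgue_R_ball (r : R) : 0 < r -> lebesgue_R (ball 0 r) = (2 * r)%:E.
Proof.
by move=> r0; rewrite [LHS]lebesgue_measure_ball ?ltW// mulr_natl.
Qed.

Lemma lebesgue_rV_box m (r : R) : 0 < r ->
  measurable [set v : 'rV[R]_m | forall i, `|v ord0 i| < r] /\
  lebesgue_rV m [set v : 'rV[R]_m | forall i, `|v ord0 i| < r] = ((2 * r) ^+ m)%:E.
Proof.
move=> r0.
have mb k : measurable [set v : 'rV[R]_k | forall i, `|v ord0 i| < r].
  have -> : [set v : 'rV[R]_k | forall i, `|v ord0 i| < r] =
     \bigcap_(i in [set: 'I_k]) ((fun v : 'rV[R]_k => v ord0 i) @^-1` ball 0 r).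
    apply/seteqP; split => v /= Hv i; last by have := Hv i I; rewrite /ball /= sub0r normrN.
    by move=> _; rewrite /ball /= sub0r normrN.
  apply: fin_bigcap_measurable => // i _.
  by rewrite -[X in measurable X]setTI; apply: measurable_coord => //; exact: measurable_ball.
split => //; elim: m => [|m IH].
  by rewrite /= diracE mem_set//= => -[].
rewrite /= /lebesgue_rV_step /pushforward.
have -> : @cons_rV R m @^-1` [set v | forall i, `|v ord0 i| < r] =
    ball 0 r `*` [set v : 'rV[R]_m | forall i, `|v ord0 i| < r].
  apply/seteqP; split => [[x v] /= Hv|[x v] [/= Hx Hv] i].
    split => /=; last first.
      by move=> i; have := Hv (lift ord0 i); rewrite mxE liftK.
    by have := Hv ord0; rewrite mxE unlift_none /= /ball /= sub0r normrN.
  rewrite mxE; case: unliftP => [j _|_]; first exact: (Hv j).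
  by move: Hx; rewrite /ball /= sub0r normrN.
rewrite product_measure1E; [|exact: measurable_ball|exact: mb].
rewrite [X in (_ * X)%E]IH exprS EFinM; congr (_ * _)%E.
exact: lebesgue_R_ball.
Qed.

Definition hbox (r : R) : set H := [set g : H | (forall i, `|g.1 ord0 i| < r) /\ `|g.2| < r].

Lemma measurable_hbox r : 0 < r -> measurable (hbox r).
Proof.
move=> r0; have := measurable_ball_heis 0 r0; congr (measurable _).
have E h : ball (0 : H) r h <-> hbox r h.
  rewrite ball_heisE//; split => -[b1 b2]; split => [i|].
  - by have := b1 i; rewrite /= mxE sub0r normrN.
  - by move: b2; rewrite /= sub0r normrN.
  - by rewrite /= mxE sub0r normrN.
  - by rewrite /= sub0r normrN.
by apply/seteqP; split => h /E.
Qed.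

Lemma heis_leb_hbox r : 0 < r -> mu (hbox r) = ((2 * r) ^+ (n + n).+1)%:E.
Proof.
move=> r0; have [mb bE] := lebesgue_rV_box (n + n) r0.
have -> : hbox r = [set v : 'rV[R]_(n + n) | forall i, `|v ord0 i| < r] `*` ball 0 r.
  apply/seteqP; split => [[x v] [/= h1 h2]|[x v] [/= h1 h2]]; split => //=.
    by rewrite /ball /= sub0r normrN.
  by move: h2; rewrite /ball /= sub0r normrN.
have mB : measurable (ball (0 : R) r) by exact: measurable_ball.
rewrite [LHS](@product_measure1E _ _ _ _ R (lebesgue_rV (n + n)) (@lebesgue_R R) _ _ mb mB).
rewrite [X in (X * _)%E]bE exprSr EFinM; congr (_ * _)%E.
exact: lebesgue_R_ball.
Qed.

(** Measure preservation in terms of integrals of nonnegative functions, the form that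
    [ge0_integral_affine_heis] provides; [mpres_integral] extends it to signed functions, integrable
    or not. *)
Definition mpres (phi : H -> H) := measurable_fun setT phi /\
  forall f : H -> \bar R, measurable_fun setT f -> (forall g, (0 <= f g)%E) ->
    (\int[mu]_g f (phi g) = \int[mu]_g f g)%E.

Lemma measurable_shear (a : R) (b : 'rV[R]_(n + n)) (a' : R)
    (s : 'rV[R]_(n + n) -> R) : measurable_fun setT s ->
  measurable_fun setT (fun g : H => (a *: g.1 + b, a' * g.2 + s g.1)%R).
Proof.
move=> ms; apply/measurable_fun_pairP; split => /=.
  by apply: (measurableT_comp (measurable_affine_rV a b)); exact: measurable_fst.
apply: measurable_funD; first by apply: measurable_funM => //; exact: measurable_snd.
by apply: (measurableT_comp ms); exact: measurable_fst.
Qed.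

Lemma mpres_shear (a : R) (b : 'rV[R]_(n + n)) (s : 'rV[R]_(n + n) -> R) (phi : H -> H) :
  `|a| = 1 -> measurable_fun setT s ->
  (forall g, phi g = (a *: g.1 + b, g.2 + s g.1)) -> mpres phi.
Proof.
move=> a1 ms phiE.
have a0 : a != 0 by rewrite -normr_eq0 a1 oner_neq0.
have -> : phi = fun g => (a *: g.1 + b, 1 * g.2 + s g.1).
  by apply/funext => g; rewrite phiE mul1r.
split; first exact: measurable_shear.
move=> f mf f0; rewrite (@ge0_integral_affine_heis R n a b 1 s f)// ?oner_neq0//.
by rewrite a1 normr1 invr1 expr1n mulr1 mul1e.
Qed.

Lemma mpres_flow k s : mpres (flow k s).
Proof.
apply: (@mpres_shear 1 (s *: delta_mx ord0 k) (fun x => s * (2 * pcoef k x))).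
- by rewrite normr1.
- by apply: measurable_funM => //; apply: measurable_funM => //; exact: measurable_pcoef.
- by move=> g; rewrite scale1r.
Qed.

Lemma mpres_mul g : mpres (heis_mul g).
Proof.
apply: (@mpres_shear 1 g.1 (fun x => g.2 + 2 * \sum_(j < n)
   (g.1 ord0 (rshift n j) * x ord0 (lshift n j) - g.1 ord0 (lshift n j) * x ord0 (rshift n j)))).
- by rewrite normr1.
- apply: measurable_funD => //; apply: measurable_funM => //.
  apply: measurable_sum => j; apply: measurable_funB; apply: measurable_funM => //;
    exact: measurable_coord.
- by move=> h; rewrite /heis_mul scale1r addrC (addrC g.2 h.2) addrA.
Qed.

Definition refl_hor g : H := (- g.1, g.2).

Lemma mpres_refl : mpres refl_hor.
Proof.
apply: (@mpres_shear (-1) 0 (fun => 0)) => //.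
- by rewrite normrN1.
- by move=> g; rewrite scaleN1r !addr0.
Qed.

Definition dil (r : R) g : H := (r *: g.1, r ^+ 2 * g.2).

Lemma ge0_integral_dil r (f : H -> \bar R) : 0 < r ->
  measurable_fun setT f -> (forall g, (0 <= f g)%E) ->
  (\int[mu]_g f (dil r g) = (r ^- (2 * n + 2))%:E * \int[mu]_g f g)%E.
Proof.
move=> r0 mf f0.
have := @ge0_integral_affine_heis R n r 0 (r ^+ 2) (fun=> 0) f (lt0r_neq0 r0).
rewrite expf_neq0 ?gt_eqF// => /(_ isT (measurable_cst _) mf f0).
under eq_integral => g _ do rewrite !addr0.
move=> ->; congr (_%:E * _)%E.
by rewrite !gtr0_norm ?exprn_gt0// exprVn -invfM -exprD addnn mul2n.
Qed.

Lemma mpres_integral phi (f : H -> R) : mpres phi -> measurable_fun setT f ->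
  (\int[mu]_g (f (phi g))%:E = \int[mu]_g (f g)%:E)%E.
Proof.
move=> [mphi hphi] mf.
have mf' : measurable_fun setT (EFin \o f) by exact/measurable_EFinP.
rewrite [LHS]integralE [RHS]integralE.
congr (_ - _)%E.
  have H1 := hphi _ (measurable_funepos mf') (fun=> funepos_ge0 _ _).
  by rewrite -[RHS]H1; apply: eq_integral => g _; rewrite ?funeposE ?funenegE.
have H1 := hphi _ (measurable_funeneg mf') (fun=> funeneg_ge0 _ _).
by rewrite -[RHS]H1; apply: eq_integral => g _; rewrite ?funeposE ?funenegE.
Qed.

End heis_basics.

(** * Riesz representation for a semidefinite form *)

Lemma sq_cvg0 {R : realType} (a d : nat -> R) K : (forall i, a i ^+ 2 <= K * d i) ->
  d @ \oo --> 0 -> a @ \oo --> 0.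
Proof.
move=> h d0; apply/cvgr0Pnorm_lt => e e0.
have K1 : 0 < `|K| + 1 by rewrite ltr_wpDl.
have e2 : 0 < e ^+ 2 / (`|K| + 1) by rewrite divr_gt0// exprn_gt0.
move/cvgr0Pnorm_lt : d0 => /(_ _ e2) hd.
near=> i.
rewrite -(@ltr_pXn2r _ 2)// ?nnegrE ?ltW// real_normK ?num_real//.
apply: (le_lt_trans (h i)); apply: (le_lt_trans (ler_norm _)); rewrite normrM.
apply: (@le_lt_trans _ _ ((`|K| + 1) * `|d i|)); first by rewrite ler_wpM2r// lerDl.
rewrite mulrC -ltr_pdivlMr//; near: i; exact: hd.
Unshelve. all: end_near.
Qed.

Lemma const_sq0 {R : realType} (c : R) (d : nat -> R) K :
  (forall i, c ^+ 2 <= K * d i) -> d @ \oo --> 0 -> c = 0.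
Proof.
move=> h d0; have h1 := @sq_cvg0 _ (fun=> c) d K h d0.
by rewrite -(cvg_lim (@Rhausdorff R) h1) lim_cst.
Qed.

Section riesz_representation.
Context {R : realType} {E : lmodType R}.
Variables (D D' : set E) (B : E -> E -> R).
Hypothesis DD' : D `<=` D'.
Hypothesis D0 : D 0.
Hypothesis Dlin : forall a x y, D x -> D y -> D (a *: x + y).
Hypothesis D'lin : forall a x y, D' x -> D' y -> D' (a *: x + y).
Hypothesis Blin : forall a x y z, D' x -> D' y -> D' z ->
  B (a *: x + y) z = a * B x z + B y z.
Hypothesis Bsym : forall x y, D' x -> D' y -> B x y = B y x.
Hypothesis Bge0 : forall x, D' x -> 0 <= B x x.

Lemma sesqui_sub x y : D' x -> D' y -> D' (x - y).
Proof. by move=> Dx Dy; rewrite addrC -scaleN1r; exact: D'lin. Qed.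

Lemma sesqui_expand a x y : D' x -> D' y ->
  B (a *: x + y) (a *: x + y) = a ^+ 2 * B x x + 2 * a * B x y + B y y.
Proof.
move=> Dx Dy; have Dxy := D'lin a Dx Dy.
rewrite Blin// (Bsym Dx Dxy) (Bsym Dy Dxy) !Blin// (Bsym Dy Dx).
by ring.
Qed.

Lemma sesqui_subE x y z : D' x -> D' y -> D' z -> B (x - y) z = B x z - B y z.
Proof. by move=> Dx Dy Dz; rewrite addrC -scaleN1r Blin// mulN1r addrC. Qed.

Lemma sesqui_CS x y : D' x -> D' y -> B x y ^+ 2 <= B x x * B y y.
Proof.
move=> Dx Dy.
have H a : 0 <= a ^+ 2 * B x x + 2 * a * B x y + B y y.
  by rewrite -sesqui_expand//; apply: Bge0; exact: D'lin.
have x0 := Bge0 Dx; have y0 := Bge0 Dy.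
move: x0; rewrite le0r => /orP[/eqP Bx0|Bx0].
  have [->|Bxy] := eqVneq (B x y) 0; first by rewrite Bx0 mul0r expr0n.
  (* The form may be degenerate. If [B x x = 0], the quadratic is affine in a, and this a gives it
     the value -1. *)
  have := H (- (B y y + 1) / (2 * B x y)); rewrite Bx0 mulr0 add0r.
  have -> : 2 * (- (B y y + 1) / (2 * B x y)) * B x y = - (B y y + 1) by field.
  by lra.
have := H (- B x y / B x x).
have -> : (- B x y / B x x) ^+ 2 * B x x + 2 * (- B x y / B x x) * B x y + B y y =
  (B x x * B y y - B x y ^+ 2) / B x x by field; rewrite gt_eqF.
by rewrite pmulr_lge0 ?invr_gt0// subr_ge0.
Qed.

Variable l : E -> R.
Hypothesis llin : forall a x y, D x -> D y -> l (a *: x + y) = a * l x + l y.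
Variable C : R.
Hypothesis C0 : 0 <= C.
Hypothesis lC : forall x, D x -> l x ^+ 2 <= C * B x x.
Hypothesis compl : forall x : nat -> E, (forall i, D' (x i)) ->
  (forall e, 0 < e -> exists N, forall i j, (N <= i)%N -> (N <= j)%N ->
     B (x i - x j) (x i - x j) < e) ->
  exists2 z, D' z & B (x i - z) (x i - z) @[i --> \oo] --> 0.

Let J x := B x x - 2 * l x.

Let J_lb x : D x -> - C <= J x.
Proof.
move=> Dx; have := lC Dx; have := Bge0 (DD' Dx).
rewrite /J; set b := B x x; set t := l x => b0 h; have c0 : (0 : R) <= C := C0.
have [t0|t0] := leP t 0; first by lra.
have bC : 0 <= b + C by lra.
have h2 : (2 * t) ^+ 2 <= (b + C) ^+ 2.
  have := sqr_ge0 (b - C); nra.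
have : 2 * t <= b + C by rewrite -(@ler_pXn2r _ 2)// nnegrE; lra.
by lra.
Qed.

(** A minimizing sequence of J over D is Cauchy by the parallelogram identity. Only D' is complete,
    so z is found in D' while the equation is tested on D: in [L2_riesz] D may be the test functions
    and D' is L2. The form is only semidefinite because functions are not identified up to null
    sets. *)
Lemma riesz_representation : exists z, [/\ D' z, forall x, D x -> B z x = l x &
  B z z <= C].
Proof.
pose S := [set J x | x in D].
have S0 : S !=set0 by exists (J 0); exists 0.
have lS : has_inf S by split => //; exists (- C) => _ [x Dx <-]; exact: J_lb.
pose m := inf S.
have mJ x : D x -> m <= J x by move=> Dx; apply: ge_inf; [case: lS|exists x].
have /choice[x Hx] : forall i : nat, exists x, D x /\ J x < m + i.+1%:R^-1.
  move=> i; have i0 : 0 < i.+1%:R^-1 :> R by rewrite invr_gt0.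
  have [_ [x Dx <-] xm] := inf_adherent i0 lS.
  by exists x.
have Dx i : D (x i) by case: (Hx i).
have D'x i : D' (x i) by apply: DD'.
have Jx i : J (x i) < m + i.+1%:R^-1 by case: (Hx i).
(* Parallelogram identity for J. The midpoint lies in D, where J is at least m, so two
   almost-minimizers are close to each other. *)
have para u v : D u -> D v -> B (u - v) (u - v) = 2 * J u + 2 * J v - 4 * J (2^-1 *: u + 2^-1 *: v).
  move=> Du Dv; have D'u := DD' Du; have D'v := DD' Dv.
  have D2 : D (2^-1 *: v + 0) by apply: Dlin.
  have E1 : u - v = (-1) *: v + u by rewrite scaleN1r addrC.
  have E2 : 2^-1 *: u + 2^-1 *: v = 2^-1 *: u + (2^-1 *: v + 0) by rewrite addr0.
  have l0 : l 0 = 0.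
    by have := llin 1 D0 D0; rewrite scaler0 addr0 mul1r => h; lra.
  have B0 w : D' w -> B 0 w = 0.
    move=> Dw; have D'0 := DD' D0; have := Blin 1 D'0 D'0 Dw.
    by rewrite scaler0 addr0 mul1r => h; lra.
  rewrite /J E1 E2 !sesqui_expand//; [|exact: DD'..].
  rewrite !llin// l0 (Bsym D'u (DD' D2)) !Blin//; [|exact: DD'..].
  rewrite !B0// ; [|exact: DD'..].
  rewrite (Bsym D'v (DD' D0)) B0//.
  by field.
have cau e : 0 < e -> exists N, forall i j, (N <= i)%N -> (N <= j)%N ->
     B (x i - x j) (x i - x j) < e.
  move=> e0; have [N] := ltr_add_invr (divr_gt0 e0 (ltr0n _ 4)).
  rewrite add0r => hN; exists N => i j Ni Nj.
  rewrite para//.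
  have Dm : D (2^-1 *: x i + 2^-1 *: x j).
    by apply: Dlin => //; rewrite -[X in D X]addr0; exact: Dlin.
  have h1 := mJ _ Dm; have h2 := Jx i; have h3 := Jx j.
  have inv_le k : (N <= k)%N -> k.+1%:R^-1 <= N.+1%:R^-1 :> R.
    by move=> Nk; rewrite lef_pV2 ?posrE// ler_nat.
  have h4 := inv_le _ Ni; have h5 := inv_le _ Nj.
  move: h1 h2 h3 h4 h5 hN.
  set a := i.+1%:R^-1; set b := j.+1%:R^-1; set c := N.+1%:R^-1.
  by lra.
have [z Dz zlim] := compl D'x cau.
have key y : D y -> B z y = l y.
  move=> Dy; have D'y := DD' Dy.
  (* First variation: moving [x i] by t y changes J by a quadratic in t which is bounded below by
     -1/(i+1), and its discriminant bounds [B (x i) y - l y]. *)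
  have h1 i : (B (x i) y - l y) ^+ 2 <= i.+1%:R^-1 * B y y.
    have h t : 0 <= i.+1%:R^-1 + 2 * t * (B (x i) y - l y) + t ^+ 2 * B y y.
      have := mJ _ (Dlin t Dy (Dx i)); rewrite /J sesqui_expand// llin//.
      have := Jx i; rewrite /J (Bsym D'y (D'x i)).
      set a := i.+1%:R^-1; lra.
    have a0 : 0 < i.+1%:R^-1 :> R by rewrite invr_gt0.
    move: h a0; set a := i.+1%:R^-1; set b := B (x i) y - l y => h a0.
    have := Bge0 D'y; rewrite le0r => /orP[/eqP Bx0|Bx0].
      have [->|bn0] := eqVneq b 0; first by rewrite Bx0 mulr0 expr0n.
      have := h (- (a + 1) / (2 * b)); rewrite Bx0 mulr0 addr0.
      have -> : 2 * (- (a + 1) / (2 * b)) * b = - (a + 1) by field.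
      by lra.
    have := h (- b / B y y).
    have -> : a + 2 * (- b / B y y) * b + (- b / B y y) ^+ 2 * B y y =
      (a * B y y - b ^+ 2) / B y y by field; rewrite gt_eqF.
    by rewrite pmulr_lge0 ?invr_gt0// subr_ge0.
  have h2 i : (B z y - l y) ^+ 2 <= 2 * (B (x i - z) (x i - z) * B y y) + 2 * (i.+1%:R^-1 * B y y).
    have h3 := sesqui_CS (sesqui_sub (D'x i) Dz) D'y.
    have h4 := h1 i; rewrite sesqui_subE// in h3.
    apply: (@le_trans _ _ (2 * (B (x i) y - B z y) ^+ 2 + 2 * (B (x i) y - l y) ^+ 2)); last by rewrite lerD// ler_wpM2l.
    by have := sqr_ge0 ((B (x i) y - B z y) + (B (x i) y - l y)); nra.
  apply/eqP; rewrite -subr_eq0; apply/eqP.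
  apply: (@const_sq0 _ _ (fun i => B (x i - z) (x i - z) + i.+1%:R^-1) (2 * B y y)).
    by move=> i; apply: (le_trans (h2 i)); rewrite le_eqVlt; apply/orP; left; apply/eqP; ring.
  by rewrite -[X in _ --> X]addr0; apply: cvgD => //; exact: cvg_harmonic.
exists z; split => //.
(* Since z need not lie in D, the bound [lC] is applied to the [x i] and passed to the limit. *)
pose a i := B z (x i - z); pose d i := B (x i - z) (x i - z).
have a0 : a @ \oo --> 0.
  apply: (@sq_cvg0 _ a d (B z z)) => // i.
  by apply: sesqui_CS => //; exact: sesqui_sub.
have Bzx i : B z (x i) = B z z + a i.
  rewrite /a (Bsym Dz (sesqui_sub (D'x i) Dz)) sesqui_subE// (Bsym (D'x i) Dz).
  by ring.
have Bxx i : B (x i) (x i) = B z z + 2 * a i + d i.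
  rewrite {1}(_ : x i = 1 *: (x i - z) + z); last by rewrite scale1r subrK.
  rewrite {2}(_ : x i = 1 *: (x i - z) + z); last by rewrite scale1r subrK.
  rewrite sesqui_expand//; last exact: sesqui_sub.
  by rewrite (Bsym (sesqui_sub (D'x i) Dz) Dz) -/(a i) -/(d i); ring.
have h i : (B z z + a i) ^+ 2 <= C * (B z z + 2 * a i + d i).
  by rewrite -Bxx -Bzx key//; exact: lC.
have l1 : (B z z + a i) ^+ 2 @[i --> \oo] --> (B z z) ^+ 2.
  have h1 : (B z z + a i) @[i --> \oo] --> B z z.
    by rewrite -[X in _ --> X]addr0; apply: cvgD => //; exact: cvg_cst.
  by rewrite expr2; under eq_cvg do rewrite expr2; exact: cvgM.
have l2 : C * (B z z + 2 * a i + d i) @[i --> \oo] --> C * (B z z).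
  have h1 : (B z z + 2 * a i + d i) @[i --> \oo] --> B z z + 2 * 0 + 0.
    apply: cvgD => //; apply: cvgD; first exact: cvg_cst.
    by apply: cvgM => //; exact: cvg_cst.
  move: h1; rewrite mulr0 !addr0 => h1.
  by apply: cvgM => //; exact: cvg_cst.
have : B z z ^+ 2 <= C * B z z.
  by apply: (ler_cvg_to l1 l2); apply: nearW.
have := Bge0 Dz; rewrite le0r => /orP[/eqP ->|Bz]; first by [].
by rewrite expr2 ler_pM2r.
Qed.

End riesz_representation.

(** * The Hilbert space L^2 *)

Section L2_theory.
Context {R : realType} {n : nat}.
Local Notation H := (heis R n).
Local Notation mu := (@heis_leb R n).
Implicit Types (f g u v : H -> R).

Lemma L2P f : L2 f <-> measurable_fun setT f /\ (\int[mu]_x (f x ^+ 2)%:E < +oo)%E.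
Proof.
split.
  move=> Lf; split.
    by move: Lf; rewrite /L2 inE => /andP[/[!inE]].
  have /integrableP[_] := Lfun2_integrable_sqr Lf.
  by under eq_integral => x _ do rewrite /= ger0_norm ?sqr_ge0//.
move=> [mf fi]; rewrite /L2 inE; apply/andP; split; first by rewrite inE.
rewrite inE /finite_norm /= unlock; apply: poweR_lty.
under eq_integral => x _ do rewrite /= powR_mulrn// real_normK ?num_real//.
by [].
Qed.

Lemma L2_measurable f : L2 f -> measurable_fun setT f.
Proof. by move/L2P => []. Qed.

Lemma L2_mul f g : L2 f -> L2 g -> mu.-integrable setT (EFin \o (fun x => f x * g x)).
Proof. by move=> Lf Lg; apply/Lfun1_integrable; exact: Lfun2_mul_Lfun1. Qed.

Lemma L2_mulE f g : L2 f -> L2 g -> mu.-integrable setT (fun x => (f x * g x)%:E).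
Proof. exact: L2_mul. Qed.

Lemma L2_dom f g : measurable_fun setT f -> (forall x, `|f x| <= `|g x|) -> L2 g -> L2 f.
Proof.
move=> mf fg /L2P[mg gi]; apply/L2P; split => //; apply: le_lt_trans gi.
apply: ge0_le_integral => //.
- by move=> x _; rewrite lee_fin sqr_ge0.
- by apply/measurable_EFinP; exact: measurable_funX.
- by apply/measurable_EFinP; exact: measurable_funX.
- by move=> x _; rewrite lee_fin -(real_normK (num_real (f x))) -(real_normK (num_real (g x))) ler_pXn2r ?nnegrE.
Qed.

Lemma L2D f g : L2 f -> L2 g -> L2 (fun x => f x + g x).
Proof.
move=> /L2P[mf fi] /L2P[mg gi]; apply/L2P; split; first exact: measurable_funD.
apply: (@le_lt_trans _ _ (\int[mu]_x (2%:E * (f x ^+ 2)%:E + 2%:E * (g x ^+ 2)%:E))%E).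
  apply: ge0_le_integral => //.
  - by move=> x _; rewrite lee_fin sqr_ge0.
  - by apply/measurable_EFinP; apply: measurable_funX; exact: measurable_funD.
  - apply/measurable_EFinP; apply: measurable_funD; apply: measurable_funM => //; exact: measurable_funX.
  - by move=> x _; rewrite -!EFinM -EFinD lee_fin; have := sqr_ge0 (f x - g x); nra.
have m2 (h : H -> R) : measurable_fun setT h -> measurable_fun setT (fun x : H => (h x ^+ 2)%:E).
  by move=> mh; apply/measurable_EFinP; exact: measurable_funX.
rewrite ge0_integralD//; last 4 first.
- by move=> x _; rewrite -EFinM lee_fin mulr_ge0 ?sqr_ge0.
- by apply: measurable_funeM; exact: m2.
- by move=> x _; rewrite -EFinM lee_fin mulr_ge0 ?sqr_ge0.
- by apply: measurable_funeM; exact: m2.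
rewrite !ge0_integralZl_EFin//; last 4 first.
- by move=> x _; rewrite lee_fin sqr_ge0.
- exact: m2.
- by move=> x _; rewrite lee_fin sqr_ge0.
- exact: m2.
by rewrite lte_add_pinfty// lte_mul_pinfty.
Qed.

Lemma L2Z a f : L2 f -> L2 (fun x => a * f x).
Proof.
move=> /L2P[mf fi]; apply/L2P; split; first exact: measurable_funM.
under eq_integral => x _ do rewrite exprMn EFinM.
rewrite ge0_integralZl_EFin ?sqr_ge0//.
- by rewrite lte_mul_pinfty// lee_fin sqr_ge0.
- by move=> x _; rewrite lee_fin sqr_ge0.
- by apply/measurable_EFinP; exact: measurable_funX.
Qed.

Lemma L2N f : L2 f -> L2 (fun x => - f x).
Proof. by move=> Lf; have := L2Z (-1) Lf; under eq_fun do rewrite mulN1r. Qed.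

Lemma L2B f g : L2 f -> L2 g -> L2 (fun x => f x - g x).
Proof. by move=> Lf Lg; apply: L2D => //; exact: L2N. Qed.

Lemma L2_0 : L2 (fun _ : H => 0 : R).
Proof. by apply/L2P; split => //; under eq_integral do rewrite expr0n/=; rewrite integral0. Qed.

Lemma L2_bounded_mul f (m : H -> R) (M : R) : measurable_fun setT m -> (forall x, `|m x| <= M) -> L2 f ->
  L2 (fun x => m x * f x).
Proof.
move=> mm mM Lf; apply: (@L2_dom _ (fun x => M * f x)).
- by apply: measurable_funM => //; exact: L2_measurable.
- by move=> x; rewrite !normrM ler_wpM2r// (le_trans (mM x))// ler_norm.
- exact: L2Z.
Qed.

Lemma dotC f g : dot f g = dot g f.
Proof. by rewrite /dot; under eq_Rintegral do rewrite mulrC. Qed.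

Lemma dotDl f g u : L2 f -> L2 g -> L2 u -> dot (fun x => f x + g x) u = dot f u + dot g u.
Proof.
move=> Lf Lg Lu; rewrite /dot -RintegralD//; last 2 first.
- exact: L2_mul.
- exact: L2_mul.
by apply: eq_Rintegral => x _; rewrite mulrDl.
Qed.

Lemma dotZl a f u : L2 f -> L2 u -> dot (fun x => a * f x) u = a * dot f u.
Proof.
move=> Lf Lu; rewrite /dot -RintegralZl//; last exact: L2_mul.
by apply: eq_Rintegral => x _; rewrite mulrA.
Qed.

Lemma dotNl f u : L2 f -> L2 u -> dot (fun x => - f x) u = - dot f u.
Proof.
by move=> Lf Lu; rewrite -mulN1r -dotZl//; congr dot; apply/funext => x; rewrite mulN1r.
Qed.

Lemma dotBl f g u : L2 f -> L2 g -> L2 u -> dot (fun x => f x - g x) u = dot f u - dot g u.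
Proof. by move=> Lf Lg Lu; rewrite dotDl//; [rewrite dotNl|exact: L2N]. Qed.

Lemma dotDr f g u : L2 f -> L2 g -> L2 u -> dot u (fun x => f x + g x) = dot u f + dot u g.
Proof. by move=> *; rewrite dotC dotDl// !(dotC u). Qed.

Lemma dotZr a f u : L2 f -> L2 u -> dot u (fun x => a * f x) = a * dot u f.
Proof. by move=> *; rewrite dotC dotZl// dotC. Qed.

Lemma dotBr f g u : L2 f -> L2 g -> L2 u -> dot u (fun x => f x - g x) = dot u f - dot u g.
Proof. by move=> *; rewrite dotC dotBl// !(dotC u). Qed.

Lemma dot_ge0 f : 0 <= dot f f.
Proof. by apply: Rintegral_ge0 => x _; rewrite -expr2 sqr_ge0. Qed.

Lemma dotE f : L2 f -> (dot f f)%:E = (\int[mu]_x (f x ^+ 2)%:E)%E.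
Proof.
move=> Lf; rewrite /dot /Rintegral fineK; last first.
  by apply: integrable_fin_num => //; exact: L2_mulE.
by apply: eq_integral => x _; rewrite expr2.
Qed.

Lemma dot_CS f g : L2 f -> L2 g -> dot f g ^+ 2 <= dot f f * dot g g.
Proof.
move=> Lf Lg.
apply: (@sesqui_CS R (H -> R) (@L2 R n) (@dot R n)) => //.
- by move=> a x y Lx Ly; apply: L2D => //; exact: L2Z.
- by move=> a x y z Lx Ly Lz; rewrite -dotZl// -dotDl//; exact: L2Z.
- by move=> x y _ _; exact: dotC.
- by move=> x _; exact: dot_ge0.
Qed.

Lemma dot_le_norm f g : L2 f -> L2 g ->
  `|dot f g| <= Num.sqrt (dot f f) * Num.sqrt (dot g g).
Proof.
move=> Lf Lg; rewrite -sqrtrM ?dot_ge0// -sqrtr_sqr ler_sqrt ?dot_CS//.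
by rewrite mulr_ge0 ?dot_ge0.
Qed.

Lemma dot_eq0_ae f : L2 f -> dot f f = 0 -> {ae mu, forall x, f x = 0}.
Proof.
move=> Lf f0.
have mf := L2_measurable Lf.
have m2 : measurable_fun setT (fun x : H => (f x ^+ 2)%:E).
  by apply/measurable_EFinP; exact: measurable_funX.
have : (\int[mu]_x `|(f x ^+ 2)%:E| = 0)%E.
  under eq_integral => x _ do rewrite gee0_abs ?lee_fin ?sqr_ge0//.
  by rewrite -dotE// f0.
move/(ae_eq_integral_abs mu measurableT m2).1; apply: filterS => x /(_ I) [] /eqP.
by rewrite sqrf_eq0 => /eqP.
Qed.

Lemma L2_ae f g : {ae mu, forall x, f x = g x} -> measurable_fun setT g -> L2 f -> L2 g.
Proof.
move=> fg mg /L2P[mf fi]; apply/L2P; split => //.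
rewrite (@ge0_ae_eq_integral _ _ _ mu setT _ (fun x => (f x ^+ 2)%:E))//.
- by apply/measurable_EFinP; exact: measurable_funX.
- by apply/measurable_EFinP; exact: measurable_funX.
- by move=> x _; rewrite lee_fin sqr_ge0.
- by move=> x _; rewrite lee_fin sqr_ge0.
- by apply: filterS fg => x -> _.
Qed.

Lemma dot_ae f g u : {ae mu, forall x, f x = g x} ->
  measurable_fun setT f -> measurable_fun setT g -> measurable_fun setT u ->
  dot f u = dot g u.
Proof.
move=> fg mf mg mu'; rewrite /dot /Rintegral; congr fine.
apply: ae_eq_integral => //.
- by apply/measurable_EFinP; exact: measurable_funM.
- by apply/measurable_EFinP; exact: measurable_funM.
- by apply: filterS fg => x -> _.
Qed.

(** Riesz-Fischer: a subsequence with geometrically small increments converges almost everywhere,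
    and Fatou's lemma turns the Cauchy condition into convergence in norm. *)
Lemma L2_complete (u : nat -> H -> R) : (forall i, L2 (u i)) ->
  (forall e, 0 < e -> exists N, forall i j, (N <= i)%N -> (N <= j)%N ->
     dot (u i \- u j) (u i \- u j) < e) ->
  exists2 v, L2 v & dot (u i \- v) (u i \- v) @[i --> \oo] --> 0.
Proof.
move=> Lu cau.
have /choice[k Hk] : forall i : nat, exists k, forall a b, (k <= a)%N -> (k <= b)%N ->
    dot (u a \- u b) (u a \- u b) < 4^-1 ^+ i.
  by move=> i; apply: cau; rewrite exprn_gt0// invr_gt0.
pose K := fix K i := if i is i'.+1 then maxn (K i').+1 (k i'.+1) else k 0%N.
have Kk i : (k i <= K i)%N by case: i => //= i; rewrite leq_maxr.
have KS i : (K i < K i.+1)%N by rewrite /= leq_maxl.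
have Ki i : (i <= K i)%N by elim: i => // i IH; exact: leq_ltn_trans IH (KS i).
pose w i := u (K i).
have Lw i : L2 (w i) by exact: Lu.
pose d i := w i.+1 \- w i.
have Ld i : L2 (d i) by exact: L2B.
have dd i : dot (d i) (d i) < 4^-1 ^+ i.
  by apply: Hk; rewrite ?Kk// (leq_trans (Kk i) (ltnW (KS i))).
(* The weights 2^i are beaten by the increments, whose squared norms are below 4^-i, so S is
   integrable. Where S is finite, the increments are dominated by a geometric series of ratio
   2^(-1/2). *)
pose S x := (\sum_(i <oo) (2 ^+ i * d i x ^+ 2)%:E)%E.
have md i : measurable_fun setT (fun x => (2 ^+ i * d i x ^+ 2)%:E).
  apply/measurable_EFinP; apply: measurable_funM => //; apply: measurable_funX.
  exact: L2_measurable.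
have d0 i x : (0 <= (2 ^+ i * d i x ^+ 2)%:E)%E.
  by rewrite lee_fin mulr_ge0// ?sqr_ge0// exprn_ge0.
have S0 x : (0 <= S x)%E by apply: nneseries_ge0 => i _ _; exact: d0.
have mS : measurable_fun setT S.
  by apply: ge0_emeasurable_sum => // i x _ _; exact: d0.
have Sfin : (\int[mu]_x S x < +oo)%E.
  rewrite /S integral_nneseries//.
  apply: (@le_lt_trans _ _ (\sum_(i <oo) (1 / 2 ^+ i)%:E)%E).
    apply: lee_nneseries => [i _|i _].
      by move=> _; apply: integral_ge0 => x _; exact: d0.
    under eq_integral => x _ do rewrite EFinM.
    rewrite ge0_integralZl_EFin//; last 2 first.
    - by move=> x _; rewrite lee_fin sqr_ge0.
    - by apply/measurable_EFinP; apply: measurable_funX; exact: L2_measurable.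
    rewrite -dotE// -EFinM lee_fin.
    apply: (@le_trans _ _ (2 ^+ i * 4^-1 ^+ i)).
      by rewrite ler_pM2l ?exprn_gt0// ltW.
    rewrite div1r -exprVn -exprMn (_ : 2 * 4^-1 = 2^-1)//.
    by rewrite (_ : 4 = 2 * 2 :> R) ?invfM ?mulrA ?mulfV ?mul1r//; lra.
  have h := @cvg_geometric_eseries_half R 2 0.
  rewrite (_ : (\sum_(i <oo) _)%E = (2 / 2 ^+ 0)%:E) ?ltry//.
  apply/cvg_lim => //; move: h; apply: cvg_trans; apply: near_eq_cvg.
  apply: nearW => i; rewrite /eseries /=; apply: eq_bigr => j _; congr _%:E.
  by rewrite addn1 natrX exprS invfM mulrA mulfV// mul1r div1r.
have aeS : {ae mu, forall x, S x \is a fin_num}.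
  have /integrable_ae : mu.-integrable setT S.
    apply/integrableP; split => //.
    by under eq_integral => x _ do rewrite gee0_abs//.
  by move/(_ measurableT); apply: filterS => x /(_ I).
pose A := [set x | S x \is a fin_num].
have mA : measurable A.
  by have := emeasurable_fin_num measurableT mS; rewrite setTI.
(* Multiplying by the indicator of A makes the sequence converge at every point, so that its limit
   is measurable. *)
pose w' i x := w i x * \1_A x.
have mw' i : measurable_fun setT (w' i).
  by apply: measurable_funM; [exact: L2_measurable|exact: measurable_indic].
have cw x : cvgn (w' ^~ x).
  have [Ax|nAx] := pselect (A x); last first.
    rewrite /w' (_ : (fun i => w i x * \1_A x) = fun=> 0); first exact: is_cvg_cst.
    by apply/funext => i; rewrite indicE memNset// mulr0.
  rewrite /w' (_ : (fun i => w i x * \1_A x) = w ^~ x); last first.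
    by apply/funext => i; rewrite indicE mem_set// mulr1.
  pose s := fine (S x).
  have ds i : `|d i x| <= Num.sqrt s * (Num.sqrt 2^-1) ^+ i.
    have h : 2 ^+ i * d i x ^+ 2 <= s.
      rewrite -lee_fin /s fineK//; rewrite /S.
      have := @nneseries_lim_ge R (fun i => (2 ^+ i * d i x ^+ 2)%:E) xpredT 0%N i.+1
        (fun i _ _ => d0 i x).
      apply: le_trans; rewrite big_mkord big_ord_recr/= leeDr//.
      by apply: sume_ge0 => j _; exact: d0.
    rewrite -(@ler_pXn2r _ 2)// ?nnegrE ?mulr_ge0// ?exprn_ge0//.
    rewrite real_normK ?num_real// exprMn sqr_sqrtr; last first.
      by apply: le_trans h; rewrite mulr_ge0// ?sqr_ge0// exprn_ge0.
    by rewrite -exprM mulnC exprM sqr_sqrtr// exprVn ler_pdivlMr ?exprn_gt0// mulrC.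
  have q1 : `|Num.sqrt 2^-1| < 1 :> R.
    rewrite ger0_norm// -[X in _ < X]sqrtr1 ltr_sqrt// invf_lt1//.
    by rewrite ltr1n.
  have cs : cvgn (series (d ^~ x)).
    apply: normed_cvg; apply: (@series_le_cvg _ _ (geometric (Num.sqrt s) (Num.sqrt 2^-1))).
    - by move=> i; exact: normr_ge0.
    - by move=> i; rewrite /geometric /= mulr_ge0// exprn_ge0.
    - by move=> i; exact: ds.
    - exact: is_cvg_geometric_series.
  have -> : w ^~ x = (fun i => w 0%N x + series (d ^~ x) i).
    apply/funext => i; rewrite /series /= /d telescope_sumr//; ring.
  by apply: is_cvgD => //; exact: is_cvg_cst.
pose v x := limn (w' ^~ x).
have wv x : w' ^~ x @ \oo --> v x by exact: cw.
have mv : measurable_fun setT v by apply: (measurable_fun_cvg mw') => x _.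
have aew : {ae mu, forall x, forall i, w' i x = w i x}.
  apply: filterS aeS => x Sx i; rewrite /w' indicE mem_set ?mulr1//.
have est e N : 0 < e -> (forall i j, (N <= i)%N -> (N <= j)%N ->
     dot (u i \- u j) (u i \- u j) < e) -> forall i, (N <= i)%N ->
    (\int[mu]_x ((u i x - v x) ^+ 2)%:E <= e%:E)%E.
  move=> e0 HN i Ni.
  have mi j : measurable_fun setT (fun x => ((u i x - w' j x) ^+ 2)%:E).
    apply/measurable_EFinP; apply: measurable_funX; apply: measurable_funB => //.
    exact: L2_measurable.
  have := @fatou _ _ _ mu setT measurableT (fun j x => ((u i x - w' j x) ^+ 2)%:E)
    mi (fun j x _ => ltac:(by rewrite lee_fin sqr_ge0)).
  under eq_integral => x _.
    have cx : (fun j => ((u i x - w' j x) ^+ 2)%:E) @ \oo --> ((u i x - v x) ^+ 2)%:E.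
      apply: cvg_EFin; first exact: nearW.
      rewrite expr2; under eq_cvg do rewrite /= expr2.
      by apply: cvgM; apply: cvgB => //; exact: cvg_cst.
    rewrite (is_cvg_limn_einfE (cvgP _ cx)) (cvg_lim _ cx)//.
    over.
  move=> h; apply: (le_trans h).
  have hj j : (N <= j)%N -> (\int[mu]_x ((u i x - w' j x) ^+ 2)%:E <= e%:E)%E.
    move=> Nj.
    rewrite (@ge0_ae_eq_integral _ _ _ mu setT _ (fun x => ((u i x - w j x) ^+ 2)%:E))//.
    - have := HN i (K j) Ni (leq_trans Nj (Ki j)).
      by rewrite -lte_fin dotE; [move/ltW|exact: L2B].
    - apply/measurable_EFinP; apply: measurable_funX; apply: measurable_funB;
        exact: L2_measurable.
    - by move=> x _; rewrite lee_fin sqr_ge0.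
    - by move=> x _; rewrite lee_fin sqr_ge0.
    - by apply: filterS aew => x -> _.
  rewrite limn_einf_lim; apply: lime_le; first exact: is_cvg_einfs.
  near=> j; apply: (@le_trans _ _ (\int[mu]_x ((u i x - w' j x) ^+ 2)%:E)%E).
    by apply: ereal_inf_lbound; exists j => /=.
  apply: hj; near: j; exact: nbhs_infty_ge.
have Luv i : (exists e N, [/\ 0 < e, (N <= i)%N & forall i j, (N <= i)%N -> (N <= j)%N ->
     dot (u i \- u j) (u i \- u j) < e]) -> L2 (u i \- v).
  move=> [e [N [e0 Ni HN]]]; apply/L2P; split.
    by apply: measurable_funB => //; exact: L2_measurable.
  exact: (le_lt_trans (est e N e0 HN i Ni) (ltry _)).
have Lv : L2 v.
  have [N HN] := cau 1 ltr01.
  have L1 : L2 (u N \- v) by apply: Luv; exists 1, N.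
  have := L2B (Lu N) L1; congr L2; apply/funext => x /=; ring.
exists v => //.
apply/cvgr0Pnorm_lt => e e0; have e2 : 0 < e / 2 by rewrite divr_gt0.
have [N HN] := cau _ e2; near=> i.
rewrite ger0_norm ?dot_ge0// -lte_fin dotE; last exact: L2B.
apply: (@le_lt_trans _ _ (e / 2)%:E); last by rewrite lte_fin; lra.
by apply: (est _ N e2 HN); near: i; exact: nbhs_infty_ge.
Unshelve. all: end_near.
Qed.

End L2_theory.

(** * Directional derivatives *)

Section directional_derivatives.
Context {R : realType} {V : normedModType R}.
Implicit Types (f : V -> R) (g v : V).

Lemma is_derive_line f g v s df :
  is_derive (s *: v + g) v f df <-> is_derive s 1 (fun t : R => f (t *: v + g)) df.
Proof.
have E : (fun h : R => h^-1 *: (f (h *: v + (s *: v + g)) - f (s *: v + g))) =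
  (fun h : R => h^-1 *: (f ((h *: (1 : R) + s) *: v + g) - f (s *: v + g))).
  by apply/funext => h; rewrite scalerDl addrA scaler1.
split=> -[d1 d2]; split.
- by move: d1; rewrite /derivable E.
- by move: d2; rewrite /derive E.
- by move: d1; rewrite /derivable E.
- by move: d2; rewrite /derive E.
Qed.

Lemma is_derive_comp1 (h : R -> R) f g v dh df :
  is_derive g v f df -> is_derive (f g) 1 h dh -> is_derive g v (h \o f) (dh * df).
Proof.
move=> fd hd.
have fd' : is_derive (0 *: v + g) v f df by rewrite scale0r add0r.
have /is_derive_line fl := fd'.
have hd' : is_derive ((fun t : R => f (t *: v + g)) 0) 1 h dh.
  by rewrite scale0r add0r.
have : is_derive (0 *: v + g) v (h \o f) (dh * df).
  apply/is_derive_line.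
  case: fl => dl el; case: hd' => dd ed.
  split.
    apply/derivable1_diffP.
    by apply: (differentiable_comp (f := fun t : R => f (t *: v + g))); exact/derivable1_diffP.
  have e := @derive1_comp _ (fun t : R => f (t *: v + g)) h 0 dl dd.
  by rewrite -derive1E; apply: (etrans e); rewrite !derive1E ed el.
by rewrite scale0r add0r.
Qed.

End directional_derivatives.

Lemma is_derive_comp1_R {R : realType} (h f : R -> R) (x v dh df : R) :
  is_derive x v f df -> is_derive (f x) 1 h dh -> is_derive x v (h \o f) (dh * df).
Proof. exact: (@is_derive_comp1 R R^o). Qed.

Section directional_derivatives2.
Context {R : realType} {V : normedModType R}.
Implicit Types (f : V -> R) (g v : V).

Lemma is_derive_scaled f g v a df : is_derive g v f df -> is_derive g (a *: v) f (a * df).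
Proof.
move=> fd.
have /is_derive_line fl : is_derive (0 *: v + g) v f df by rewrite scale0r add0r.
have : is_derive (0 *: (a *: v) + g) (a *: v) f (a * df).
  apply/is_derive_line.
  have -> : (fun t : R => f (t *: (a *: v) + g)) = (fun t : R => f (t *: v + g)) \o (fun t => a * t).
    by apply/funext => t /=; rewrite scalerA mulrC.
  have h1 : is_derive (0 : R) 1 (fun t : R => a * t) a.
    have := @is_deriveZ R R^o R^o id a 0 1 1 (is_derive_id _ _).
    by move=> h; apply: (is_derive_eq h); rewrite [_ *: _]mulr1.
  have fl' : is_derive (a * (0 : R)) 1 (fun t : R => f (t *: v + g)) df by rewrite mulr0.
  have h2 := @is_derive_comp1_R _ (fun t : R => f (t *: v + g)) (fun t : R => a * t) 0 1 df a h1 fl'.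
  by rewrite mulrC.
by rewrite scale0r add0r.
Qed.

Lemma line_MVT f g v (df : V -> R) (a b : R) : (forall x, is_derive x v f (df x)) ->
  exists c, `|c - a| <= `|b - a| /\ f (b *: v + g) - f (a *: v + g) = df (c *: v + g) * (b - a).
Proof.
move=> fd.
pose F := fun t : R => f (t *: v + g).
have dF (t : R) : is_derive t 1 F (df (t *: v + g)).
  exact: (is_derive_line f g v t _).1 (fd _).
have cF (i : interval R) : {within [set` i], continuous F}.
  apply: derivable_within_continuous => t _; by case: (dF t).
have [ab|ba] := leP a b.
  have [c + E] := MVT_segment ab (fun x _ => dF x) (cF _).
  rewrite in_itv/= => /andP[ac cb]; exists c; split => //.
  by rewrite !ger0_norm ?subr_ge0// lerD2r.
have [c + E] := MVT_segment (ltW ba) (fun x _ => dF x) (cF _).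
rewrite in_itv/= => /andP[bc ca]; exists c; split.
  by rewrite (distrC c) (distrC b) !ger0_norm ?subr_ge0// ?(ltW ba)// lerD2l lerN2.
by rewrite -[LHS]opprB E; ring.
Qed.

(** Additivity in the direction without total differentiability: the increment along b starts from
    the moving point h a + g, where the mean value theorem applies, and continuity of the derivative
    along b at g gives the limit. *)
Lemma is_deriveDv f g a b (fb : V -> R) da :
  is_derive g a f da -> (forall x, is_derive x b f (fb x)) -> {for g, continuous fb} ->
  is_derive g (a + b) f (da + fb g).
Proof.
move=> fa hb cb.
suff h : (fun h : R => h^-1 *: (f (h *: (a + b) + g) - f g)) @ 0^' --> da + fb g.
  by split; [exact: cvgP h|exact: (cvg_lim (@Rhausdorff R))].
have [fa1 fa2] := fa.
have ca : (fun h : R => h^-1 *: (f (h *: a + g) - f g)) @ 0^' --> da.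
  by rewrite -fa2; exact: fa1.
have h2 : (fun h : R => h^-1 *: (f (h *: b + (h *: a + g)) - f (h *: a + g))) @ 0^' --> fb g.
  apply/cvgrPdist_lt => e e0.
  have /nbhs_ballP[d /= d0 dP] : \forall y \near g, `|fb g - fb y| < e.
    by move/cvgrPdist_lt : cb => /(_ _ e0).
  have q0 : 0 < d / (`|a| + `|b| + 1) by rewrite divr_gt0// ltr_wpDl// addr_ge0.
  near=> h.
  have hn : h != 0 by near: h; exact: nbhs_dnbhs_neq.
  have hs : `|h| < d / (`|a| + `|b| + 1).
    by near: h; apply: dnbhs0_lt.
  have [c [ch]] := @line_MVT f (h *: a + g) b fb 0 h hb.
  rewrite !subr0 in ch *; rewrite scale0r add0r => ->.
  rewrite [_ *: _]mulrC mulfK//; apply: dP.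
  rewrite -ball_normE /ball_ /=.
  have -> : g - (c *: b + (h *: a + g)) = - (c *: b) - h *: a.
    by rewrite addrA (addrC (_ + _) g) opprD addrA subrr add0r opprD.
  apply: (le_lt_trans (ler_normD _ _)); rewrite !normrN !normrZ.
  apply: (@le_lt_trans _ _ (`|h| * (`|a| + `|b| + 1))); last first.
    by rewrite -ltr_pdivlMr// ltr_wpDl// addr_ge0.
  rewrite mulrDr mulr1 mulrDr ler_wpDr// addrC lerD2l.
  exact: ler_wpM2r.
have -> : (fun h0 : R => h0^-1 *: (f (h0 *: (a + b) + g) - f g)) =
  (fun h => h^-1 *: (f (h *: a + g) - f g) + h^-1 *: (f (h *: b + (h *: a + g)) - f (h *: a + g))).
  apply/funext => h; rewrite -scalerDr; congr (_ *: _).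
  rewrite [RHS]addrC addrA subrK; congr (f _ - _).
  by rewrite scalerDr addrA; congr (_ + _); exact: addrC.
exact: cvgD.
Unshelve. all: end_near.
Qed.

End directional_derivatives2.

(** * Smooth functions and test functions *)

Section smooth_functions.
Context {R : realType} {n : nat}.
Local Notation H := (heis R n).
Implicit Types (f u v : H -> R) (g e : H).

(** Finite order of smoothness along arbitrary directions. Sums, products and compositions are
    handled by induction on k, which [smooth], quantified over all lists of directions, does not
    offer directly. *)
Fixpoint Ck (k : nat) f : Prop :=
  continuous f /\ (if k is k'.+1 then
    forall e, (forall g, derivable f g e) /\ Ck k' ('D_e f) else True).

Lemma Ck_continuous k f : Ck k f -> continuous f.
Proof. by case: k => [|k] []. Qed.

Lemma smoothP f : smooth f <-> forall k, Ck k f.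
Proof.
split=> [sf k|h vs].
  suff : forall vs, Ck k (iter_derive vs f) by move/(_ [::]).
  elim: k => [|k IH] vs; first by split => //; have [] := sf vs.
  split; first by have [] := sf vs.
  move=> e; split; first by move=> g; have [_] := sf vs; exact.
  exact: (IH (e :: vs)).
have {}h : forall k, Ck k (iter_derive vs f).
  elim: vs => [|e vs IH] k //=.
  by have [_ /(_ e)[]] := IH k.+1.
split; first exact: (Ck_continuous (h 0%N)).
by move=> g e; have [_ /(_ e)[+ _]] := h 1%N; exact.
Qed.

Lemma CkW k f : Ck k.+1 f -> Ck k f.
Proof.
elim: k f => [|k IH] f; first by case.
by move=> [cf h]; split => // e; have [d1 d2] := h e; split => //; exact: IH.
Qed.

Lemma Ck_ext k f u : f =1 u -> Ck k f -> Ck k u.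
Proof. by move=> /funext ->. Qed.

Lemma CkS_is_derive k f (df : H -> H -> R) : continuous f ->
  (forall g e, is_derive g e f (df e g)) -> (forall e, Ck k (df e)) -> Ck k.+1 f.
Proof.
move=> cf h hk; split => // e; split; first by move=> g; case: (h g e).
have -> // : 'D_e f = df e.
by apply/funext => g; case: (h g e).
Qed.

Lemma CkS_inv k f : Ck k.+1 f -> forall g e, is_derive g e f ('D_e f g).
Proof. by move=> [_ h] g e; apply: derivableP; have [] := h e. Qed.

Lemma CkS_D k f e : Ck k.+1 f -> Ck k ('D_e f).
Proof. by move=> [_ h]; have [] := h e. Qed.

Lemma Ck_cst k (c : R) : Ck k (fun=> c).
Proof.
elim: k c => [|k IH] c; first by split => // x; exact: cvg_cst.
have cc : continuous (fun _ : H => c) by move=> x; exact: cvg_cst.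
exact: (@CkS_is_derive k _ (fun _ _ : H => 0 : R) cc (fun g e => is_derive_cst c g e) (fun=> IH 0)).
Qed.

Lemma CkD k f u : Ck k f -> Ck k u -> Ck k (fun g => f g + u g).
Proof.
elim: k f u => [|k IH] f u hf hu.
  by split => // x; apply: cvgD; [exact: (Ck_continuous hf)|exact: (Ck_continuous hu)].
apply: (@CkS_is_derive k _ (fun e g => 'D_e f g + 'D_e u g)) => [x|g e|e].
- by apply: cvgD; [exact: (Ck_continuous hf)|exact: (Ck_continuous hu)].
- exact: (is_deriveD (CkS_inv hf g e) (CkS_inv hu g e)).
- by apply: IH; exact: CkS_D.
Qed.

Lemma CkM k f u : Ck k f -> Ck k u -> Ck k (fun g => f g * u g).
Proof.
elim: k f u => [|k IH] f u hf hu.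
  by split => // x; apply: cvgM; [exact: (Ck_continuous hf)|exact: (Ck_continuous hu)].
apply: (@CkS_is_derive k _ (fun e g => f g * 'D_e u g + u g * 'D_e f g)) => [x|g e|e].
- by apply: cvgM; [exact: (Ck_continuous hf)|exact: (Ck_continuous hu)].
- exact: (is_deriveM (CkS_inv hf g e) (CkS_inv hu g e)).
- by apply: CkD; apply: IH; by [exact: CkW|exact: CkS_D].
Qed.

Lemma Ck_linear k (L : H -> R) : continuous L ->
  (forall s e g, L (s *: e + g) = s * L e + L g) -> Ck k L.
Proof.
case: k => [|k] cL hL; first by split.
apply: (@CkS_is_derive k _ (fun e g => L e)) => //; last by move=> e; exact: Ck_cst.
move=> g e; have h : (fun h : R => h^-1 *: (L (h *: e + g) - L g)) @ 0^' --> L e.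
  apply: cvg_near_cst; near=> h.
  have hn : h != 0 by near: h; exact: nbhs_dnbhs_neq.
  by rewrite hL addrK [_ *: _]mulrA mulVf// mul1r.
by split; [exact: cvgP h|exact: (cvg_lim (@Rhausdorff R))].
Unshelve. all: end_near.
Qed.

(* [Sk k W h]: h is k times continuously differentiable on the open set W. *)
Fixpoint Sk (k : nat) (W : set R) (h : R -> R) : Prop :=
  (forall x, W x -> {for x, continuous h}) /\
  (if k is k'.+1 then
    exists2 h', (forall x, W x -> is_derive x 1 h (h' x)) & Sk k' W h' else True).

Lemma Sk_cont k W h : Sk k W h -> forall x, W x -> {for x, continuous h}.
Proof. by case: k => [|k] []. Qed.

Lemma Ck_comp k W h f : (forall j, Sk j W h) -> (forall g, W (f g)) -> Ck k f ->
  Ck k (fun g => h (f g)).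
Proof.
move=> /(_ k) sh Wf; elim: k h sh f Wf => [|k IH] h sh f Wf hf.
  split => // x; apply: continuous_comp; first exact: (Ck_continuous hf).
  exact: (Sk_cont sh).
case: (sh) => ch [h' hh' sh'].
apply: (@CkS_is_derive k _ (fun e g => h' (f g) * 'D_e f g)) => [x|g e|e].
- apply: continuous_comp; first exact: (Ck_continuous hf).
  exact: (Sk_cont sh).
- exact: (is_derive_comp1 (CkS_inv hf g e) (hh' _ (Wf g))).
- by apply: CkM; [apply: IH => //; exact: CkW|exact: CkS_D].
Qed.

Lemma Ck_affine k (A A' : H -> H) f : continuous A ->
  (forall s e g, A (s *: e + g) = s *: A' e + A g) -> Ck k f -> Ck k (fun g => f (A g)).
Proof.
move=> cA hA; elim: k f => [|k IH] f hf.
  by split => // x; apply: continuous_comp; [exact: cA|exact: (Ck_continuous hf)].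
apply: (@CkS_is_derive k _ (fun e g => 'D_(A' e) f (A g))) => [x|g e|e].
- by apply: continuous_comp; [exact: cA|exact: (Ck_continuous hf)].
- have := CkS_inv hf (A g) (A' e).
  have E : (fun h : R => h^-1 *: (f (h *: A' e + A g) - f (A g))) =
    (fun h : R => h^-1 *: (f (A (h *: e + g)) - f (A g))).
    by apply/funext => h; rewrite hA.
  move=> [d1 _]; split; first by move: d1; rewrite /derivable E.
  by rewrite /derive E.
- exact: (IH ('D_(A' e) f) (CkS_D (A' e) hf)).
Qed.

Lemma continuous_hor i : continuous (fun g : H => g.1 ord0 i).
Proof.
move=> g; apply: (@continuous_comp _ _ _ fst (fun x : 'rV[R]_(n + n) => x ord0 i)).
  exact: cvg_fst.
exact: coord_continuous.
Qed.

Lemma continuous_vert : continuous (fun g : H => g.2).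
Proof. by move=> g; exact: cvg_snd. Qed.

Lemma Ck_hor k i : Ck k (fun g : H => g.1 ord0 i).
Proof. by apply: Ck_linear; [exact: continuous_hor|move=> s e g; rewrite !mxE]. Qed.

Lemma Ck_vert k : Ck k (fun g : H => g.2).
Proof. by apply: Ck_linear; [exact: continuous_vert|]. Qed.

Lemma Ck_pcoef k i : Ck k (fun g : H => pcoef i g.1).
Proof.
rewrite /pcoef; case: fintype.split => j; first exact: Ck_hor.
apply: (@Ck_ext k (fun g => (-1) * g.1 ord0 (lshift n j))); first by move=> g; rewrite mulN1r.
by apply: CkM; [exact: Ck_cst|exact: Ck_hor].
Qed.

Lemma Ck_sum k I (r : seq I) (F : I -> H -> R) : (forall i, Ck k (F i)) ->
  Ck k (fun g => \sum_(i <- r) F i g).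
Proof.
move=> hF; elim: r => [|i r IH].
  by apply: (@Ck_ext k (fun=> 0)) => [g|]; [rewrite big_nil|exact: Ck_cst].
apply: (@Ck_ext k (fun g => F i g + \sum_(i <- r) F i g)) => [g|].
  by rewrite big_cons.
exact: CkD.
Qed.

Lemma Ck_homN k : Ck k (@homN R n).
Proof.
have hs : Ck k (@sqnorm_hor R n).
  apply: Ck_sum => i; apply: (@Ck_ext k (fun g => g.1 ord0 i * g.1 ord0 i)).
    by move=> g; rewrite expr2.
  by apply: CkM; exact: Ck_hor.
apply: (@Ck_ext k (fun g => sqnorm_hor g * sqnorm_hor g + g.2 * g.2)).
  by move=> g; rewrite /homN !expr2.
by apply: CkD; apply: CkM => //; exact: Ck_vert.
Qed.

Lemma heis_XE k f g : heis_X k f g = partial_x k f g + 2 * pcoef k g.1 * partial_t f g.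
Proof. by rewrite /heis_X /pcoef; case: fintype.split => j //; rewrite mulrN mulNr. Qed.

Lemma Ck_heis_X k i f : Ck k.+1 f -> Ck k (heis_X i f).
Proof.
move=> hf; apply: (@Ck_ext k (fun g => 'D_(delta_mx ord0 i, 0) f g + (2 * pcoef i g.1) * 'D_(0, 1) f g)).
  by move=> g; rewrite heis_XE.
apply: CkD; first exact: CkS_D.
apply: CkM; last exact: CkS_D.
by apply: CkM; [exact: Ck_cst|exact: Ck_pcoef].
Qed.

Definition Xdir (k : 'I_(n + n)) g : H := (delta_mx ord0 k, 2 * pcoef k g.1).

Lemma flowE k s g : flow k s g = s *: Xdir k g + g.
Proof. by rewrite /flow /Xdir; congr pair; rewrite /= addrC. Qed.

Lemma Xdir_flow k s g : Xdir k (flow k s g) = Xdir k g.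
Proof. by rewrite /Xdir /flow /= pcoefD pcoefZ pcoef_delta mulr0 addr0. Qed.

Lemma flow_add k s t g : flow k s (flow k t g) = flow k (s + t) g.
Proof. by rewrite flowE Xdir_flow !flowE scalerDl addrA. Qed.

Lemma flow0 k g : flow k 0 g = g.
Proof. by rewrite flowE scale0r add0r. Qed.

Lemma is_derive_Xdir k f g : Ck 1 f -> is_derive g (Xdir k g) f (heis_X k f g).
Proof.
move=> hf; have -> : Xdir k g = (delta_mx ord0 k, 0) + (2 * pcoef k g.1) *: (0, 1).
  by rewrite /Xdir; congr pair; rewrite /= ?scaler0 ?addr0// add0r [_ *: _]mulr1.
rewrite heis_XE.
have c2 : continuous ('D_(0, 1) f) by exact: (Ck_continuous (CkS_D (0, 1) hf)).
have h1 := CkS_inv hf g (delta_mx ord0 k, 0).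
have h2 x : is_derive x ((2 * pcoef k g.1) *: (0, 1) : H) f (2 * pcoef k g.1 * 'D_(0, 1) f x).
  exact: (is_derive_scaled (2 * pcoef k g.1) (CkS_inv hf x (0, 1))).
have h3 : {for g, continuous (fun x => 2 * pcoef k g.1 * 'D_(0, 1) f x)}.
  by apply: cvgM; [exact: cvg_cst|exact: c2].
exact: (@is_deriveDv R _ f g _ _ _ _ h1 h2 h3).
Qed.

Lemma is_derive_flow k f g (s : R) : Ck 1 f ->
  is_derive s 1 (fun t : R => f (flow k t g)) (heis_X k f (flow k s g)).
Proof.
move=> hf.
have -> : (fun t : R => f (flow k t g)) = (fun t : R => f (t *: Xdir k g + g)).
  by apply/funext => t; rewrite flowE.
apply: (is_derive_line f g (Xdir k g) s _).1.
by rewrite -flowE -(Xdir_flow k s g); exact: is_derive_Xdir.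
Qed.

Lemma Ck_flow j k s f : Ck j f -> Ck j (fun g => f (flow k s g)).
Proof.
apply: (@Ck_affine j (flow k s) (fun e => (e.1, e.2 + s * (2 * pcoef k e.1)))).
  move=> g.
  have c1 : {for g, continuous (fun g : H => g.1 + s *: delta_mx ord0 k)}.
    by apply: cvgD; [exact: cvg_fst|exact: cvg_cst].
  have c2 : {for g, continuous (fun g : H => g.2 + s * (2 * pcoef k g.1))}.
    apply: cvgD; first exact: cvg_snd.
    apply: cvgM; first exact: cvg_cst.
    by apply: cvgM; [exact: cvg_cst|exact: (Ck_continuous (Ck_pcoef 0 k))].
  exact: (cvg_pair c1 c2).
move=> t e g; rewrite /flow /= pcoefD pcoefZ; congr pair; first by rewrite addrA.
rewrite /= -[RHS]/(t * (e.2 + s * (2 * pcoef k e.1)) + (g.2 + s * (2 * pcoef k g.1))).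
by rewrite -[t *: e.2]/(t * e.2); ring.
Qed.

End smooth_functions.

Section test_functions.
Context {R : realType} {n : nat}.
Local Notation H := (heis R n).
Local Notation mu := (@heis_leb R n).
Implicit Types (f u v phi : H -> R) (g e : H).

Lemma hboxE (r : R) g : 0 < r -> hbox r g <-> `|g| < r.
Proof.
move=> r0.
have -> : `|g| = Num.max `|g.1| `|g.2| by [].
rewrite gt_max; split.
  move=> [h1 h2]; apply/andP; split => //.
  rewrite /Num.norm /= mx_normrE; apply/bigmax_ltP; split => // -[i j] _ /=.
  by rewrite ord1.
move=> /andP[h1 h2]; split => // i; apply: le_lt_trans h1.
rewrite [leRHS]/Num.norm /= mx_normrE.
exact: (le_bigmax _ (fun ij : 'I_1 * 'I_(n + n) => `|g.1 ij.1 ij.2|) (ord0, i)).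
Qed.

Definition vanish_off (r : R) f := forall g, r <= `|g| -> f g = 0.

Lemma closed_ball_compact_heis (r : R) : 0 < r -> compact [set g : H | `|g| <= r].
Proof.
move=> r0.
have -> : [set g : H | `|g| <= r] =
    [set x : 'rV[R]_(n + n) | forall i, `[- r, r]%classic (x ord0 i)] `*` `[- r, r]%classic.
  apply/seteqP; split => [g|g].
    rewrite /= [X in X <= _](_ : _ = Num.max `|g.1| `|g.2|)// ge_max => /andP[h1 h2].
    split => /=; last by rewrite in_itv/= -ler_norml.
    move=> i; rewrite in_itv/= -ler_norml; apply: le_trans h1.
    rewrite [leRHS]/Num.norm /= mx_normrE.
    exact: (le_bigmax _ (fun ij : 'I_1 * 'I_(n + n) => `|g.1 ij.1 ij.2|) (ord0, i)).
  move=> [/= h1 h2]; rewrite [X in X <= _](_ : _ = Num.max `|g.1| `|g.2|)// ge_max.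
  apply/andP; split; last by rewrite ler_norml; move: h2; rewrite in_itv.
  rewrite /Num.norm /= mx_normrE; apply/bigmax_leP; split; first exact: ltW.
  move=> -[i j] _ /=; rewrite ord1 ler_norml.
  by have := h1 j; rewrite in_itv.
apply: compact_setX; last exact: segment_compact.
exact: (@rV_compact R (n + n) (fun _ => `[- r, r]%classic) (fun _ => @segment_compact R (- r) r)).
Qed.

Lemma test_funP f : test_fun f <-> smooth f /\ exists2 r, 0 < r & vanish_off r f.
Proof.
split=> -[sf].
  move=> cf; split => //.
  have /compact_bounded[M [Mr MP]] := cf.
  have M1 : M < `|M| + 1 by rewrite (le_lt_trans (ler_norm M))// ltrDl.
  exists (`|M| + 2); first by rewrite ltr_wpDl.
  move=> g gM; apply: contrapT => /eqP fg.
  have := MP _ M1 g; rewrite /= => h.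
  have : `|g| <= `|M| + 1 by apply: h; exact: subset_closure.
  by move/(le_trans gM); rewrite lerD2l leNgt ltr1n.
move=> [r r0 hr]; split => //.
apply: (@subclosed_compact _ _ [set g : H | `|g| <= r]).
- exact: closed_closure.
- exact: closed_ball_compact_heis.
- have cl : closed [set g : H | `|g| <= r].
    apply: (@closed_comp _ _ (fun g : H => `|g|) [set x | x <= r]); last exact: closed_le.
    by move=> x _; exact: norm_continuous.
  move=> g cg; apply: cl; apply: closure_subset cg => h /=.
  by apply: contra_neqP => /negP; rewrite -ltNge => /ltW /hr ->.
Qed.

Lemma test_Ck k f : test_fun f -> Ck k f.
Proof. by move=> [/smoothP]. Qed.

Lemma test_measurable f : test_fun f -> measurable_fun setT f.
Proof.
by move=> /(test_Ck 0)/Ck_continuous; exact: continuous_measurable_heis.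
Qed.

Lemma vanish_bounded f r : 0 < r -> continuous f -> vanish_off r f ->
  exists2 M, 0 < M & forall g, `|f g| <= M.
Proof.
move=> r0 cf hf.
have [c _ cM] : exists2 c, c \in [set g : H | `|g| <= r] &
    forall t, t \in [set g : H | `|g| <= r] -> `|f t| <= `|f c|.
  apply: compact_EVT_max.
  - by exists 0; rewrite /= normr0 ltW.
  - exact: closed_ball_compact_heis.
  - apply: continuous_subspaceT => x; apply: continuous_comp; first exact: cf.
    exact: norm_continuous.
exists (`|f c| + 1); first by rewrite ltr_wpDl.
move=> g; have [gr|/ltW /hf ->] := leP `|g| r.
  by rewrite (@le_trans _ _ `|f c|) ?lerDl// cM// inE.
by rewrite normr0 addr_ge0.
Qed.

Lemma measurable_indic_hbox r : 0 < r -> measurable_fun setT (\1_(hbox r) : H -> R).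
Proof. by move=> r0; apply: measurable_indic; exact: measurable_hbox. Qed.

Lemma L2_indic_hbox r : 0 < r -> L2 (\1_(hbox r) : H -> R).
Proof.
move=> r0; apply/L2P; split; first exact: measurable_indic_hbox.
under eq_integral => x _ do rewrite indicE expr2 -natrM mulnb andbb -indicE.
by rewrite integral_indic ?setIT ?heis_leb_hbox ?ltry//; exact: measurable_hbox.
Qed.

Lemma vanish_L2 f r : 0 < r -> continuous f -> vanish_off r f -> L2 f.
Proof.
move=> r0 cf hf; have [M M0 hM] := vanish_bounded r0 cf hf.
apply: (@L2_dom _ _ f (fun g => M * \1_(hbox r) g)).
- exact: continuous_measurable_heis.
- move=> x; have [rx|xr] := leP r `|x|; first by rewrite hf// normr0.
  rewrite indicE mem_set; last exact/hboxE.
  by rewrite mulr1 (le_trans (hM x))// ler_norm.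
- by apply: L2Z; exact: L2_indic_hbox.
Qed.

Lemma test_L2 f : test_fun f -> L2 f.
Proof.
move=> tf; have [_ [r r0 hr]] := (test_funP f).1 tf.
by apply: (vanish_L2 r0) => //; exact: (Ck_continuous (test_Ck 0 tf)).
Qed.

Lemma vanish_D r f e : vanish_off r f -> vanish_off (r + 1) ('D_e f).
Proof.
move=> hf g rg; apply: (cvg_lim (@Rhausdorff R)); apply: cvg_near_cst; near=> h.
have hs : `|h| < (`|e| + 1)^-1.
  by near: h; apply: dnbhs0_lt; rewrite invr_gt0 ltr_wpDl.
have he : `|h *: e| <= 1.
  rewrite normrZ; apply: (@le_trans _ _ (`|h| * (`|e| + 1))).
    by rewrite ler_wpM2l// lerDl.
  by rewrite -ler_pdivlMr ?ltr_wpDl// div1r ltW.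
have fg : f g = 0 by apply: hf; apply: le_trans rg; rewrite lerDl.
rewrite /= fg hf ?subrr ?scaler0//.
rewrite addrC -[h *: e]opprK; apply: (le_trans _ (lerB_dist _ _)); rewrite normrN.
by rewrite lerBrDl addrC (le_trans _ rg)// lerD2l.
Unshelve. all: end_near.
Qed.

Lemma test_heis_X k f : test_fun f -> test_fun (heis_X k f).
Proof.
move=> tf; have [_ [r r0 hr]] := (test_funP f).1 tf.
apply/test_funP; split.
  by apply/smoothP => j; apply: Ck_heis_X; exact: test_Ck.
exists (r + 1); first by rewrite addr_gt0.
by move=> g rg; rewrite heis_XE /partial_x /partial_t !(vanish_D _ hr)// mulr0 addr0.
Qed.

Lemma test_lin a f u : test_fun f -> test_fun u -> test_fun (fun g => a * f g + u g).
Proof.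
move=> tf tu; have [_ [r r0 hr]] := (test_funP f).1 tf.
have [_ [s s0 hs]] := (test_funP u).1 tu.
apply/test_funP; split.
  apply/smoothP => j; apply: CkD; last exact: test_Ck.
  by apply: CkM; [exact: Ck_cst|exact: test_Ck].
exists (r + s); first exact: addr_gt0.
move=> g rg; rewrite hr ?hs ?mulr0 ?addr0//.
  by apply: le_trans rg; rewrite lerDr ltW.
by apply: le_trans rg; rewrite lerDl ltW.
Qed.

Lemma test0 : test_fun (fun _ : H => 0 : R).
Proof.
apply/test_funP; split; first by apply/smoothP => k; exact: Ck_cst.
by exists 1.
Qed.

Lemma heis_X_lin k a f u g : Ck 1 f -> Ck 1 u ->
  heis_X k (fun g => a * f g + u g) g = a * heis_X k f g + heis_X k u g.
Proof.
move=> hf hu.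
have h1 := is_derive_Xdir k g hf; have h2 := is_derive_Xdir k g hu.
have h3 : Ck 1 (fun g => a * f g + u g) := CkD (CkM (Ck_cst 1 a) hf) hu.
have h4 := is_derive_Xdir k g h3.
have h5 := is_deriveD (is_deriveZ a h1) h2.
case: h4 => _ <-; case: h5 => _ h5; exact: h5.
Qed.

Lemma norm_pcoef k (x : 'rV[R]_(n + n)) : `|pcoef k x| <= `|x|.
Proof.
have h i : `|x ord0 i| <= `|x|.
  rewrite [leRHS]/Num.norm /= mx_normrE.
  exact: (le_bigmax _ (fun ij : 'I_1 * 'I_(n + n) => `|x ij.1 ij.2|) (ord0, i)).
by rewrite /pcoef; case: fintype.split => j; rewrite ?normrN; exact: h.
Qed.

Lemma norm_flow k s g : `|s| <= 1 -> `|flow k s g| <= 3 * `|g| + 1.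
Proof.
move=> s1; rewrite flowE.
have g1 : `|g.1| <= `|g| by rewrite [leRHS](_ : _ = Num.max `|g.1| `|g.2|)// le_max lexx.
have hX : `|Xdir k g| <= 2 * `|g| + 1.
  rewrite [X in X <= _](_ : _ = Num.max `|delta_mx ord0 k : 'rV[R]_(n + n)| `|2 * pcoef k g.1|)// ge_max.
  apply/andP; split.
    apply: (@le_trans _ _ 1); last by rewrite lerDr mulr_ge0.
    rewrite /Num.norm /= mx_normrE; apply/bigmax_leP; split => // -[i j] _ /=.
    by rewrite mxE; case: (_ && _); rewrite ?normr1 ?normr0.
  rewrite normrM ger0_norm// ler_wpDr// ler_pM2l//.
  exact: (le_trans (norm_pcoef _ _) g1).
apply: (le_trans (ler_normD _ _)); rewrite normrZ.
apply: (@le_trans _ _ (1 * (2 * `|g| + 1) + `|g|)); last by lra.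
by rewrite lerD2r ler_pM.
Qed.

Lemma vanish_flow k s r f : `|s| <= 1 -> vanish_off r f ->
  vanish_off (3 * r + 1) (fun g => f (flow k s g)).
Proof.
move=> s1 hf g rg; apply: hf.
have := norm_flow k (flow k s g) (s := - s); rewrite normrN => /(_ s1).
rewrite flow_add addNr flow0 => h; lra.
Qed.

Lemma test_flow k s f : `|s| <= 1 -> test_fun f -> test_fun (fun g => f (flow k s g)).
Proof.
move=> s1 tf; have [_ [r r0 hr]] := (test_funP f).1 tf.
apply/test_funP; split.
  by apply/smoothP => j; apply: Ck_flow; exact: test_Ck.
exists (3 * r + 1); first by rewrite addr_gt0// mulr_gt0.
exact: vanish_flow.
Qed.

(** The mean value theorem is applied twice along a flow line. The remainder has an L2 majorant that
    is the same for all |s| <= 1, so it can be paired with any L2 function. *)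
Lemma flow_taylor k f : test_fun f -> exists C r, [/\ 0 < r, 0 <= C &
  forall s g, `|s| <= 1 ->
    `|f (flow k s g) - f g - s * heis_X k f g| <= s ^+ 2 * (C * \1_(hbox r) g)].
Proof.
move=> tf; have tX := test_heis_X k tf; have tXX := test_heis_X k tX.
have [_ [r r0 hr]] := (test_funP f).1 tf.
have [_ [r1 r10 hr1]] := (test_funP _).1 tXX.
have [C C0 hC] := vanish_bounded r10 (Ck_continuous (test_Ck 0 tXX)) hr1.
exists C, (3 * r + 1); split; [by rewrite addr_gt0// mulr_gt0|exact: ltW|].
move=> s g s1; have r30 : 0 < 3 * r + 1 by rewrite addr_gt0// mulr_gt0.
have [rg|gr] := leP (3 * r + 1) `|g|.
  have f0 t : `|t| <= 1 -> f (flow k t g) = 0 by move=> t1; exact: (vanish_flow k t1 hr).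
  have fg : f g = 0 by rewrite -(flow0 k g) f0// normr0.
  have Xg : heis_X k f g = 0.
    have [_ h] := is_derive_flow k g 0 (test_Ck 1 tf); rewrite flow0 in h.
    rewrite -h; apply: (cvg_lim (@Rhausdorff R)); apply: cvg_near_cst; near=> t.
    rewrite flow0 fg /=.
    have -> : t%:A + 0 = t by rewrite addr0 [_ *: _]mulr1.
    rewrite f0 ?subrr ?scaler0//.
    by apply: ltW; near: t; apply: dnbhs0_lt.
  rewrite f0// fg Xg mulr0 !subr0 normr0 mulr_ge0 ?sqr_ge0// mulr_ge0 ?(ltW C0)//.
rewrite indicE mem_set ?mulr1; last exact/hboxE.
have fl (u : H -> R) (t : R) : Ck 1 u -> is_derive t 1 (fun t => u (flow k t g)) (heis_X k u (flow k t g)).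
  exact: is_derive_flow.
have [c [c1 E1]] := @line_MVT R R^o (fun t => f (flow k t g)) 0 1
  (fun t => heis_X k f (flow k t g)) 0 s (fun t => fl f t (test_Ck 1 tf)).
have [d [d1 E2]] := @line_MVT R R^o (fun t => heis_X k f (flow k t g)) 0 1
  (fun t => heis_X k (heis_X k f) (flow k t g)) 0 c (fun t => fl _ t (test_Ck 1 tX)).
have sc (x : R) : (x *: (1 : R^o) + 0 : R^o) = x by rewrite addr0 [_ *: _]mulr1.
move: E1 E2; rewrite !sc !subr0 !flow0 => -> E2.
rewrite (mulrC _ s) -mulrBr E2 !normrM.
have -> : s ^+ 2 = `|s| * `|s| by rewrite -normrM -expr2 ger0_norm ?sqr_ge0.
rewrite -mulrA ler_wpM2l// mulrC ler_pM//.
by move: c1; rewrite !subr0.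
Unshelve. all: end_near.
Qed.

End test_functions.

(** * Smooth bump functions of one variable *)

Section bump.
Context {R : realType}.
Implicit Types (p : {poly R}) (x y : R).

(* The functions p(1/x) exp(-1/x) on x > 0, extended by 0; this family is stable
   under differentiation. *)
Definition pexp p x : R := if 0 < x then p.[x^-1] * expR (- x^-1) else 0.

Lemma poly_le_expR p : exists2 C, 0 <= C & forall y, 0 <= y -> `|p.[y]| <= C * expR y.
Proof.
suff mon k : exists2 C, 0 <= C & forall y, 0 <= y -> y ^+ k <= C * expR y.
  have -> : p = \sum_(i < size p) p`_i *: 'X^i by rewrite -[LHS]coefK poly_def.
  elim: (size p) => [|m [C C0 IH]].
    by exists 0 => // y _; rewrite big_ord0 horner0 normr0 mul0r.
  have [D D0 hD] := mon m.
  exists (C + `|p`_m| * D); first by rewrite addr_ge0// mulr_ge0.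
  move=> y y0; rewrite big_ord_recr /= hornerD hornerZ hornerXn mulrDl.
  apply: (le_trans (ler_normD _ _)); rewrite lerD ?IH//.
  by rewrite normrM (ger0_norm (exprn_ge0 _ y0)) -mulrA ler_wpM2l// hD.
case: k => [|k].
  by exists 1 => // y y0; rewrite expr0 mul1r -expR0 ler_expR.
exists (k.+1`!%:R) => // y y0.
have k0 : 0 < k.+1`!%:R :> R by rewrite ltr0n fact_gt0.
rewrite mulrC -ler_pdivrMr//.
by apply: le_trans (expR_ge1Dxn k y0); rewrite lerDr.
Qed.

(** The exponential beats every polynomial in 1/x, in particular ['X^2 * p]. The factor x^2 gained
    in this way gives the derivative 0 at the origin. *)
Lemma pexp_bound p : exists2 C, 0 <= C & forall x, `|pexp p x| <= C * x ^+ 2.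
Proof.
have [C C0 hC] := poly_le_expR ('X^2 * p).
exists C => // x; rewrite /pexp; case: ifPn => [x0|_]; last first.
  by rewrite normr0 mulr_ge0// sqr_ge0.
have y0 : 0 <= x^-1 by rewrite invr_ge0 ltW.
have := hC _ y0; rewrite hornerM hornerXn normrM (ger0_norm (exprn_ge0 2 y0)) => h.
rewrite normrM (gtr0_norm (expR_gt0 _)) expRN ler_pdivrMr ?expR_gt0//.
rewrite mulrAC -ler_pdivrMr ?exprn_gt0// mulrC -exprVn.
by [].
Qed.

Lemma pexp_is_derive p x : is_derive x 1 (pexp p) (pexp ('X^2 * (p - p^`())) x).
Proof.
have [x0|x0|x0] := ltgtP x 0.
- have -> : pexp ('X^2 * (p - p^`())) x = 0 by rewrite /pexp ltNge (ltW x0).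
  have h0 : is_derive x 1 (fun _ : R => 0 : R) 0 by exact: is_derive_cst.
  refine (near_eq_is_derive _ h0).
  near=> z; rewrite /pexp ltNge.
  have -> // : z <= 0.
  by near: z; apply: (filterS _ (lt_nbhsl x0)) => z /ltW.
- have h1 : is_derive x 1 (fun z : R => z^-1) (- x ^- 2).
    have h0 := is_derive1_powR (-1) x0.
    have h1 : is_derive x 1 (fun z : R => z `^ (-1)) (- x ^- 2).
      apply: (is_derive_eq h0); rewrite mulN1r (_ : -1 - 1 = - 2%:R); last by ring.
      by rewrite powR_invn ?ltW.
    refine (near_eq_is_derive _ h1); near=> z; rewrite powR_inv1//.
    by near: z; apply: (filterS _ (lt_nbhsr x0)) => z /ltW.
  have hp y : is_derive y 1 (fun z : R => p.[z]) (p^`().[y]).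
    exact: is_derive_poly.
  have h2 := is_derive_comp1_R h1 (hp x^-1).
  have h3 : is_derive x 1 (fun z : R => - z^-1) (x ^- 2).
    by have := is_deriveN h1; rewrite opprK.
  have h4 := is_derive_comp1_R h3 (is_derive_expR _).
  have h5 := is_deriveM h2 h4.
  have h6 : is_derive x 1 (fun z : R => p.[z^-1] * expR (- z^-1)) (pexp ('X^2 * (p - p^`())) x); last first.
    refine (near_eq_is_derive _ h6); near=> z; rewrite /pexp.
    by have -> : 0 < z by near: z; exact: lt_nbhsr.
  apply: (is_derive_eq h5).
  rewrite /pexp x0 hornerM hornerXn hornerD hornerN /= -!exprVn.
  rewrite -[LHS]/(p.[x^-1] * (expR (- x^-1) * x^-1 ^+ 2) + expR (- x^-1) * (p^`().[x^-1] * - x^-1 ^+ 2)).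
  by ring.
- subst x; have -> : pexp ('X^2 * (p - p^`())) 0 = 0 by rewrite /pexp ltxx.
  have [C C0 hC] := pexp_bound p.
  suff h : (fun h : R => h^-1 *: (pexp p (h *: (1 : R) + 0) - pexp p 0)) @ 0^' --> (0 : R).
    by split; [exact: cvgP h|exact: (cvg_lim (@Rhausdorff R))].
  apply/cvgr0Pnorm_lt => e e0.
  near=> h.
  have hn : h != 0 by near: h; exact: nbhs_dnbhs_neq.
  have hs : `|h| < e / (C + 1).
    by near: h; apply: dnbhs0_lt; rewrite divr_gt0// ltr_wpDl.
  have -> : h *: (1 : R) + 0 = h by rewrite addr0 [_ *: _]mulr1.
  rewrite [pexp p 0]/pexp ltxx subr0 normrM normfV.
  rewrite mulrC ltr_pdivrMr ?normr_gt0//.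
  apply: (le_lt_trans (hC h)); rewrite -(real_normK (num_real h)) expr2 mulrA ltr_pM2r ?normr_gt0//.
  apply: (@le_lt_trans _ _ ((C + 1) * `|h|)); first by rewrite ler_wpM2r// lerDl.
  by rewrite mulrC -ltr_pdivlMr// ltr_wpDl.
Unshelve. all: end_near.
Qed.

Lemma is_derive_cont (f : R -> R) x df : is_derive x 1 f df -> {for x, continuous f}.
Proof.
by move=> [d _]; apply: differentiable_continuous; exact/derivable1_diffP.
Qed.

Lemma Sk_pexp k p : Sk k setT (pexp p).
Proof.
elim: k p => [|k IH] p; split => [x _|]; try exact: (is_derive_cont (pexp_is_derive p x)).
- by [].
- by exists (pexp ('X^2 * (p - p^`()))) => // x _; exact: pexp_is_derive.
Qed.

Definition bump0 := pexp 1.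

Lemma bump0E x : bump0 x = if 0 < x then expR (- x^-1) else 0.
Proof. by rewrite /bump0 /pexp hornerC mul1r. Qed.

Lemma bump0_ge0 x : 0 <= bump0 x.
Proof. by rewrite bump0E; case: ifP => // _; exact: expR_ge0. Qed.

Lemma bump0_le1 x : bump0 x <= 1.
Proof.
rewrite bump0E; case: ifP => // x0; rewrite -expR0 ler_expR oppr_le0 invr_ge0; exact: ltW.
Qed.

Lemma bump0_le0 x : x <= 0 -> bump0 x = 0.
Proof. by move=> x0; rewrite bump0E ltNge x0. Qed.

Lemma bump0_gt0 x : 0 < x -> 0 < bump0 x.
Proof. by move=> x0; rewrite bump0E x0 expR_gt0. Qed.

Lemma bump0_cvg x : bump0 (i.+1%:R * x) @[i --> \oo] --> ((0 < x)%R%:R : R).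
Proof.
have [x0|x0] := ltP 0 x; last first.
  rewrite (_ : (fun i : nat => _) = (fun=> 0 : R)); first exact: cvg_cst.
  by apply/funext => i; rewrite bump0_le0// mulr_ge0_le0.
rewrite (_ : (fun i : nat => _) = (fun i : nat => expR (- (i.+1%:R^-1 * x^-1)))); last first.
  by apply/funext => i; rewrite bump0E mulr_gt0// invfM.
have h : (fun i : nat => - (i.+1%:R^-1 * x^-1) : R) @ \oo --> - (0 * x^-1).
  by apply: cvgN; apply: cvgM; [exact: cvg_harmonic|exact: cvg_cst].
have -> : (true%:R : R) = expR (- (0 * x^-1)) by rewrite mul0r oppr0 expR0.
by apply: (cvg_comp _ _ h); exact: continuous_expR.
Qed.

Lemma Sk_powR k (c s : R) : Sk k [set x | 0 < x] (fun x => c * x `^ s).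
Proof.
have hd d t x : 0 < x -> is_derive x 1 (fun x => d * x `^ t) (d * t * x `^ (t - 1)).
  move=> x0; have := @is_deriveZ R R^o R^o _ d _ _ _ (is_derive1_powR t x0).
  by move=> h; apply: (is_derive_eq h); rewrite -mulrA.
elim: k c s => [|k IH] c s; split => [x /= x0|]; try exact: (is_derive_cont (hd c s x x0)).
- by [].
- by exists (fun x => c * s * x `^ (s - 1)) => // x; exact: hd.
Qed.

End bump.

(** * Weak derivatives *)

Section dominated.
Context {R : realType} {n : nat}.
Local Notation H := (heis R n).
Local Notation mu := (@heis_leb R n).
Implicit Types (f u v phi : H -> R) (g e : H).

Lemma dot_dominated_cvg (f_ : nat -> H -> R) f F v :
  (forall i, measurable_fun setT (f_ i)) -> L2 F -> (forall i x, `|f_ i x| <= `|F x|) ->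
  (forall x, f_ ^~ x @ \oo --> f x) -> L2 v ->
  L2 f /\ dot (f_ i) v @[i --> \oo] --> dot f v.
Proof.
move=> mf LF fF cf Lv.
have mF : measurable_fun setT f by apply: (measurable_fun_cvg mf) => x _; exact: cf.
have Lf : L2 f.
  apply: (L2_dom mF) LF => x.
  have h : (fun i => `|f_ i x|) @ \oo --> `|f x| by apply: cvg_norm; exact: cf.
  by apply: (cvgr_to_le h); apply: nearW.
split => //.
have Lfi i : L2 (f_ i) by exact: (L2_dom (mf i)) LF.
have LnF : L2 (fun x => `|F x|).
  apply: (L2_dom _ _ LF); last by move=> x; rewrite normr_id.
  by apply: measurableT_comp => //; exact: L2_measurable.
have Lnv : L2 (fun x => `|v x|).
  apply: (L2_dom _ _ Lv); last by move=> x; rewrite normr_id.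
  by apply: measurableT_comp => //; exact: L2_measurable.
have cfx x : setT x -> (fun i => (f_ i x * v x)%:E) @ \oo --> (f x * v x)%:E.
  move=> _; apply: cvg_EFin; first exact: nearW.
  by apply: cvgM; [exact: cf|exact: cvg_cst].
have bd x i : setT x -> (`|(f_ i x * v x)%:E| <= (`|F x| * `|v x|)%:E)%E.
  by move=> _; rewrite lee_fin normrM ler_wpM2r.
have [_ _ h] := @dominated_convergence _ _ R mu setT measurableT
  (fun i x => (f_ i x * v x)%:E) (fun x => (f x * v x)%:E) (fun x => (`|F x| * `|v x|)%:E)
  (fun i => measurable_int _ (L2_mulE (Lfi i) Lv)) (measurable_int _ (L2_mulE Lf Lv))
  (aeW mu cfx) (L2_mulE LnF Lnv) (aeW mu bd).
have E w : L2 w -> (\int[mu]_x (w x * v x)%:E)%E = (dot w v)%:E.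
  by move=> Lw; rewrite /dot /Rintegral fineK//; apply: integrable_fin_num => //; exact: L2_mulE.
move: h; rewrite E// => h.
exact: (fine_cvg h).
Qed.

End dominated.

Section weak_derivatives.
Context {R : realType} {n : nat}.
Local Notation H := (heis R n).
Local Notation mu := (@heis_leb R n).
Implicit Types (f u v w phi : H -> R) (g e : H) (k : 'I_(n + n)).

Lemma dot_mpres (phi : H -> H) u v : mpres phi -> measurable_fun setT u -> measurable_fun setT v ->
  dot (fun g => u (phi g)) (fun g => v (phi g)) = dot u v.
Proof.
move=> mp mu' mv; rewrite /dot /Rintegral; congr fine.
exact: (mpres_integral mp (measurable_funM mu' mv)).
Qed.

Lemma L2_mpres (phi : H -> H) u : mpres phi -> L2 u -> L2 (fun g => u (phi g)).
Proof.
move=> [mp hp] /L2P[mu' ui]; apply/L2P; split; first exact: (measurableT_comp mu' mp).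
rewrite (hp (fun g => (u g ^+ 2)%:E))//.
  by apply/measurable_EFinP; exact: measurable_funX.
by move=> g; rewrite lee_fin sqr_ge0.
Qed.

Lemma dot_flow k s u v : measurable_fun setT u -> measurable_fun setT v ->
  dot (fun g => u (flow k s g)) v = dot u (fun g => v (flow k (- s) g)).
Proof.
move=> mu' mv; rewrite -(dot_mpres (mpres_flow k (- s))) //.
- by congr dot; apply/funext => g; rewrite flow_add subrr flow0.
- by apply: (measurableT_comp mu'); exact: (mpres_flow k s).1.
Qed.

Lemma L2_flow k s u : L2 u -> L2 (fun g => u (flow k s g)).
Proof. exact: L2_mpres (mpres_flow k s). Qed.

Lemma flow_dot_taylor k f u : test_fun f -> L2 u -> exists2 C, 0 <= C &
  forall s, `|s| <= 1 ->
  `|dot u (fun g => f (flow k s g)) - dot u f - s * dot u (heis_X k f)| <= s ^+ 2 * C.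
Proof.
move=> tf Lu; have [C [r [r0 C0 hC]]] := flow_taylor k tf.
have Lf := test_L2 tf; have LX := test_L2 (test_heis_X k tf).
have LB : L2 (fun g => C * \1_(hbox r) g : R) by apply: L2Z; exact: L2_indic_hbox.
have Lau : L2 (fun g => `|u g|).
  apply: (L2_dom _ _ Lu); last by move=> x; rewrite normr_id.
  by apply: measurableT_comp => //; exact: L2_measurable.
exists (dot (fun g => `|u g|) (fun g => C * \1_(hbox r) g : R)).
  by apply: Rintegral_ge0 => g _; rewrite !mulr_ge0// indicE.
move=> s s1; have Ls := L2_flow k s Lf.
rewrite -dotBr// -dotZr// -dotBr//; last 2 first.
- exact: L2B.
- exact: L2Z.
rewrite -dotZr// /dot; apply: (le_trans (le_normr_Rintegral measurableT _)).
  by apply: L2_mul => //; apply: L2B; [exact: L2B|exact: L2Z].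
apply: le_Rintegral => //.
- apply: (@integrable_norm _ _ R mu setT (fun g => u g * _)).
  by apply: L2_mul => //; apply: L2B; [exact: L2B|exact: L2Z].
- by apply: L2_mul => //; exact: L2Z.
- by move=> g _; rewrite normrM ler_wpM2l// hC.
Qed.

Lemma weak_XE k u w : weak_X k u w <-> forall phi, test_fun phi ->
  dot u (heis_X k phi) = - dot w phi.
Proof. by []. Qed.

Lemma weak_X_lin k a u w u' w' : L2 u -> L2 w -> L2 u' -> L2 w' ->
  weak_X k u w -> weak_X k u' w' ->
  weak_X k (fun g => a * u g + u' g) (fun g => a * w g + w' g).
Proof.
move=> Lu Lw Lu' Lw' h h'; apply/weak_XE => phi tphi.
have Lp := test_L2 tphi; have LX := test_L2 (test_heis_X k tphi).
rewrite !dotDl// ?dotZl//; last 2 first.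
- exact: L2Z.
- exact: L2Z.
by rewrite (weak_XE k u w).1// (weak_XE k u' w').1//; ring.
Qed.

(** Integration by parts from invariance of the measure: the flow for time s can be moved from psi
    to phi as the flow for time -s, and the first-order terms in s are compared. *)
Lemma weak_X_test k phi : test_fun phi -> weak_X k phi (heis_X k phi).
Proof.
move=> tphi; apply/weak_XE => psi tpsi.
have Lp := test_L2 tphi; have Lq := test_L2 tpsi.
have [C C0 h1] := flow_dot_taylor k tpsi Lp.
have [D D0 h2] := flow_dot_taylor k tphi Lq.
apply/eqP; rewrite -subr_eq0 opprK (dotC (heis_X k phi)); apply/eqP.
set a := _ + _.
have ha (s : R) : 0 < s <= 1 -> `|a| <= s * (C + D).
  move=> /andP[s0 s1].
  have s1' : `|s| <= 1 by rewrite gtr0_norm.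
  have := h1 s s1'; have := h2 (- s); rewrite normrN sqrrN => /(_ s1').
  rewrite dotC dot_flow ?opprK; last 2 first.
  - exact: L2_measurable.
  - exact: L2_measurable.
  rewrite (dotC psi phi).
  set X := dot phi _; set Y := dot phi psi; set A := dot psi _; set B := dot phi (heis_X k psi).
  move=> i1 i2.
  have : `|s * a| <= s * (s * (C + D)).
    rewrite (_ : s * a = (X - Y - - s * A) - (X - Y - s * B)).
      apply: (le_trans (ler_normB _ _)).
      have -> : s * (s * (C + D)) = s ^+ 2 * D + s ^+ 2 * C by ring.
      exact: lerD.
    by rewrite /a -/A -/B; ring.
  by rewrite normrM gtr0_norm// ler_pM2l.
apply/eqP; rewrite -normr_le0; apply/ler_addgt0Pr => e e0; rewrite add0r.
pose s := Num.min 1 (e / (C + D + 1)).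
have CD : 0 < C + D + 1 by rewrite ltr_wpDl// addr_ge0.
have s0 : 0 < s by rewrite lt_min ltr01 divr_gt0.
apply: (@le_trans _ _ (s * (C + D))); first by apply: ha; rewrite s0 ge_min lexx.
apply: (@le_trans _ _ (e / (C + D + 1) * (C + D + 1))).
  by rewrite ler_pM ?addr_ge0 ?(ltW s0) ?ge_min ?lexx ?orbT// lerDl.
by rewrite divfK// gt_eqF.
Qed.

(** The function [m t] has derivative [- dot w (phi o flow t)], because phi composed with a flow is
    again a test function; then the mean value theorem and Cauchy-Schwarz apply. *)
Lemma weak_X_flow_bound k u w phi s : L2 u -> L2 w -> weak_X k u w -> test_fun phi ->
  `|s| <= 1 ->
  (dot u (fun g => phi (flow k s g)) - dot u phi) ^+ 2 <= s ^+ 2 * (dot w w * dot phi phi).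
Proof.
move=> Lu Lw hw tphi s1.
pose m t := dot u (fun g => phi (flow k t g)).
have Lp := test_L2 tphi.
have mder (t : R) : `|t| <= 1 -> is_derive t 1 m (- dot w (fun g => phi (flow k t g))).
  move=> t1; have tt := test_flow k t1 tphi.
  have [C C0 hC] := flow_dot_taylor k tt Lu.
  suff h : (fun h : R => h^-1 *: (m (h *: (1 : R) + t) - m t)) @ 0^' --> - dot w (fun g => phi (flow k t g)).
    by split; [exact: cvgP h|exact: (cvg_lim (@Rhausdorff R))].
  apply/cvgrPdist_lt => e e0.
  near=> h.
  have hn : h != 0 by near: h; exact: nbhs_dnbhs_neq.
  have h1 : `|h| <= 1 by apply: ltW; near: h; apply: dnbhs0_lt.
  have he : `|h| < e / (C + 1).
    by near: h; apply: dnbhs0_lt; rewrite divr_gt0// ltr_wpDl.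
  rewrite -(hw _ tt) -/(dot u _) distrC.
  have -> : h *: (1 : R) + t = h + t by rewrite [_ *: _]mulr1.
  have := hC h h1.
  have -> : (fun g => phi (flow k t (flow k h g))) = (fun g => phi (flow k (h + t) g)).
    by apply/funext => g; rewrite flow_add addrC.
  rewrite -/(m t) -/(m (h + t)); set B := dot u _ => hb.
  have -> : h^-1 *: (m (h + t) - m t) - B = h^-1 * (m (h + t) - m t - h * B).
    by rewrite [_ *: _]/(_ * _) [in RHS]mulrBr mulrA mulVf// mul1r.
  rewrite normrM normfV mulrC ltr_pdivrMr ?normr_gt0//.
  apply: (le_lt_trans hb); rewrite -(real_normK (num_real h)) expr2 -mulrA (mulrC e) ltr_pM2l ?normr_gt0//.
  apply: (@le_lt_trans _ _ (`|h| * (C + 1))); first by rewrite ler_wpM2l// lerDl.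
  by rewrite -ltr_pdivlMr// ltr_wpDl.
have bnd t : dot w (fun g => phi (flow k t g)) ^+ 2 <= dot w w * dot phi phi.
  apply: (le_trans (dot_CS Lw (L2_flow k t Lp))).
  by rewrite (dot_mpres (mpres_flow k t)) //; exact: L2_measurable.
have cm (a b : R) : -1 <= a -> b <= 1 -> {within `[a, b], continuous m}.
  move=> a1 b1; apply: derivable_within_continuous => t.
  rewrite in_itv/= => /andP[ta tb]; have /mder[] // : `|t| <= 1.
  by rewrite ler_norml (le_trans a1 ta) (le_trans tb b1).
have s1' : -1 <= s <= 1 by rewrite -ler_norml.
have sl : -1 <= s by case/andP: s1'.
have sr : s <= 1 by case/andP: s1'.
have E : exists c, m s - m 0 = - dot w (fun g => phi (flow k c g)) * s.
  have [s0|s0] := leP 0 s.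
    have [|c _ h] := @MVT_segment R m (fun t => - dot w (fun g => phi (flow k t g))) 0 s s0 _ (cm _ _ (lerN10 _) sr).
    - move=> t; rewrite in_itv/= => /andP[t0 ts]; apply: mder.
      by rewrite gtr0_norm// (le_trans (ltW ts)).
    - by exists c; rewrite h subr0.
  have [|c _ h] := @MVT_segment R m (fun t => - dot w (fun g => phi (flow k t g))) s 0 (ltW s0) _ (cm _ _ sl ler01).
  - move=> t; rewrite in_itv/= => /andP[t0 ts]; apply: mder.
    by rewrite ltr0_norm// (le_trans _ s1)// ltr0_norm// lerN2 ltW.
  - by exists c; rewrite -opprB h; ring.
have [c hc] := E.
have -> : dot u phi = m 0 by rewrite /m; congr dot; apply/funext => g; rewrite flow0.
by rewrite -/(m s) hc exprMn sqrrN mulrC ler_wpM2l ?sqr_ge0.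
Unshelve. all: end_near.
Qed.

End weak_derivatives.

(** * Test functions separate L2 functions *)

Section fundamental_lemma.
Context {R : realType} {n : nat}.
Local Notation H := (heis R n).
Local Notation mu := (@heis_leb R n).
Implicit Types (f u v z phi : H -> R) (g lo hi : H).

Definition obox lo hi : set H :=
  [set g : H | (forall i, lo.1 ord0 i < g.1 ord0 i < hi.1 ord0 i) /\ lo.2 < g.2 < hi.2].

Definition oboxes : set (set H) := [set A | exists lo hi, A = obox lo hi].

Lemma oboxesI : setI_closed oboxes.
Proof.
move=> _ _ [l1 [h1 ->]] [l2 [h2 ->]].
exists (\row_i Num.max (l1.1 ord0 i) (l2.1 ord0 i), Num.max l1.2 l2.2),
       (\row_i Num.min (h1.1 ord0 i) (h2.1 ord0 i), Num.min h1.2 h2.2).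
apply/seteqP; split => g.
  move=> [[a1 b1] [a2 b2]]; split => /= [i|].
    rewrite !mxE gt_max lt_min.
    by have /andP[-> ->] := a1 i; have /andP[-> ->] := a2 i.
  by rewrite gt_max lt_min; move/andP: b1 => [-> ->]; move/andP: b2 => [-> ->].
move=> [a b]; split; split.
- by move=> i; have := a i; rewrite /= !mxE gt_max lt_min => /andP[/andP[-> _] /andP[-> _]].
- by move: b; rewrite /= gt_max lt_min => /andP[/andP[-> _] /andP[-> _]].
- by move=> i; have := a i; rewrite /= !mxE gt_max lt_min => /andP[/andP[_ ->] /andP[_ ->]].
- by move: b; rewrite /= gt_max lt_min => /andP[/andP[_ ->] /andP[_ ->]].
Qed.

Lemma bounded_coord_nat g : exists N : nat, (forall i, `|g.1 ord0 i| < N.+1%:R) /\ `|g.2| < N.+1%:R.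
Proof.
exists (Num.truncn `|g|).
have h : `|g| < (Num.truncn `|g|).+1%:R by exact: truncnS_gt.
by have [] := (hboxE g (le_lt_trans (normr_ge0 _) h)).2 h.
Qed.

(** The sigma-algebra comes from the coordinates, so it is enough to write each half-space on which
    a coordinate exceeds a as a countable union of bounded boxes. *)
Lemma measurable_oboxesE : @measurable _ H = <<s oboxes >>.
Proof.
apply/seteqP; split; last first.
  apply: smallest_sub; first exact: sigma_algebra_measurable.
  move=> _ [lo [hi ->]].
  have -> : obox lo hi = (\bigcap_(i in [set: 'I_(n + n)])
      ((fun g : H => g.1 ord0 i) @^-1` `]lo.1 ord0 i, hi.1 ord0 i[%classic)) `&`
      (snd @^-1` `]lo.2, hi.2[%classic).
    apply/seteqP; split => g.
      by move=> [a b]; split => [i _|]; rewrite /= in_itv /=; [exact: a|exact: b].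
    move=> [a b]; split => [i|]; last by move: b; rewrite /= in_itv.
    by have := a i I; rewrite /= in_itv.
  apply: measurableI.
    apply: fin_bigcap_measurable => // i _.
    by rewrite -[X in measurable X]setTI; apply: measurable_hor => //.
  by rewrite -[X in measurable X]setTI; apply: measurable_snd => //.
pose T' := g_sigma_algebraType oboxes.
have mray (c : H -> R) : (forall a, exists F : nat -> set H,
    (forall N, oboxes (F N)) /\ [set g | a < c g] = \bigcup_N F N) ->
    measurable_fun [set: T'] (c : T' -> R).
  move=> hc; apply: (measurability _ (RGenOInfty.measurableE R)) => //.
  move=> _ [_ [a ->] <-]; rewrite setTI.
  have [F [hF E]] := hc a.
  rewrite (_ : _ @^-1` _ = \bigcup_N F N); last first.
    by rewrite -E; apply/seteqP; split => g /=; rewrite in_itv/= andbT.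
  by apply: bigcupT_measurable => N; apply: sub_sigma_algebra; exact: hF.
have mid : measurable_fun [set: T'] (id : T' -> H).
  apply/measurable_fun_pairP; split.
    apply: measurable_fun_rV => i.
    apply: (mray (fun g : H => g.1 ord0 i)) => a.
    exists (fun N : nat => obox (\row_j (if j == i then a else - N.+1%:R), - N.+1%:R)
                         (\row_j N.+1%:R, N.+1%:R)); split; first by move=> N; do 2 eexists.
    apply/seteqP; split => g.
      move=> ag; have [N [h1 h2]] := bounded_coord_nat g.
      exists N => //; split => [j|] /=; last by rewrite -ltr_norml.
      rewrite !mxE; have := h1 j; rewrite ltr_norml => /andP[j1 j2].
      by case: eqP j1 j2 => [->|_] j1 j2; apply/andP.
    by move=> [N _ [/(_ i) + _]]; rewrite !mxE eqxx => /andP[].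
  apply: (mray (fun g : H => g.2)) => a.
  exists (fun N : nat => obox (\row_j (- N.+1%:R), a) (\row_j N.+1%:R, N.+1%:R)).
  split; first by move=> N; do 2 eexists.
  apply/seteqP; split => g.
    move=> ag; have [N [h1 h2]] := bounded_coord_nat g.
    exists N => //; split => [j|] /=.
      by rewrite !mxE -ltr_norml.
    by rewrite ag; move: h2; rewrite ltr_norml => /andP[].
  by move=> [N _ [_ /andP[]]].
by move=> A mA; have := mid measurableT A mA; rewrite setTI.
Qed.

(** Each face contributes [bump0] of m + 1 times the signed distance to it, so these test functions
    tend pointwise to the indicator of the open box. *)
Definition box_bump lo hi (m : nat) g : R :=
  \prod_i (bump0 (m.+1%:R * (g.1 ord0 i - lo.1 ord0 i)) *
           bump0 (m.+1%:R * (hi.1 ord0 i - g.1 ord0 i))) *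
  (bump0 (m.+1%:R * (g.2 - lo.2)) * bump0 (m.+1%:R * (hi.2 - g.2))).

Lemma Ck_prod k (I : Type) (r : seq I) (F : I -> H -> R) : (forall i, Ck k (F i)) ->
  Ck k (fun g => \prod_(i <- r) F i g).
Proof.
move=> hF; elim: r => [|i r IH].
  by apply: (@Ck_ext R n k (fun=> 1)) => [g|]; [rewrite big_nil|exact: Ck_cst].
apply: (@Ck_ext R n k (fun g => F i g * \prod_(i <- r) F i g)) => [g|].
  by rewrite big_cons.
exact: CkM.
Qed.

Lemma Ck_bump0 k (c d : R) (L : H -> R) : Ck k L -> Ck k (fun g => bump0 (c * (d + L g))).
Proof.
move=> hL; apply: (@Ck_comp R n k setT bump0 (fun g => c * (d + L g))) => //.
  by move=> j; exact: Sk_pexp.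
by apply: CkM; [exact: Ck_cst|apply: CkD => //; exact: Ck_cst].
Qed.

Lemma CkN k f : Ck k f -> Ck k (fun g => - f g).
Proof.
move=> hf; apply: (@Ck_ext R n k (fun g => (-1) * f g)); first by move=> g; rewrite mulN1r.
by apply: CkM => //; exact: Ck_cst.
Qed.

Lemma box_bump_out lo hi m g : ~ obox lo hi g -> box_bump lo hi m g = 0.
Proof.
move=> ng; have m0 : 0 <= m.+1%:R :> R by [].
have b0 (x : R) : x <= 0 -> bump0 (m.+1%:R * x) = 0.
  by move=> x0; rewrite bump0_le0// mulr_ge0_le0.
have [h2|h2] := boolP (lo.2 < g.2 < hi.2); last first.
  rewrite /box_bump [X in _ * X](_ : _ = 0) ?mulr0//.
  move: h2; rewrite negb_and -!leNgt => /orP[h|h].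
    by rewrite b0 ?mul0r// subr_le0.
  by rewrite [X in _ * X]b0 ?mulr0// subr_le0.
have [i hi'] : exists i, ~~ (lo.1 ord0 i < g.1 ord0 i < hi.1 ord0 i).
  apply: contrapT => h; apply: ng; split => // i; apply: contrapT => /negP hi'.
  by apply: h; exists i.
rewrite /box_bump (bigD1 i)//= [X in X * _ * _](_ : _ = 0) ?mul0r//.
move: hi'; rewrite negb_and -!leNgt => /orP[h|h].
  by rewrite b0 ?mul0r// subr_le0.
by rewrite [X in _ * X]b0 ?mulr0// subr_le0.
Qed.

Lemma box_bump_bound lo hi m g : 0 <= box_bump lo hi m g <= 1.
Proof.
have b2 (x y : R) : 0 <= bump0 x * bump0 y <= 1.
  by rewrite mulr_ge0 ?bump0_ge0//= mulr_ile1 ?bump0_ge0 ?bump0_le1.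
have /andP[h1 h2] : 0 <= \prod_i (bump0 (m.+1%:R * (g.1 ord0 i - lo.1 ord0 i)) *
           bump0 (m.+1%:R * (hi.1 ord0 i - g.1 ord0 i))) <= 1.
  rewrite prodr_ge0 => [|i _]; last by have /andP[] := b2 (m.+1%:R * (g.1 ord0 i - lo.1 ord0 i)) (m.+1%:R * (hi.1 ord0 i - g.1 ord0 i)).
  by apply: prodr_ile1 => i _.
have /andP[h3 h4] := b2 (m.+1%:R * (g.2 - lo.2)) (m.+1%:R * (hi.2 - g.2)).
by rewrite /box_bump mulr_ge0//= mulr_ile1.
Qed.

Lemma box_bump_cvg lo hi g : box_bump lo hi m g @[m --> \oo] --> (\1_(obox lo hi) g : R).
Proof.
have [og|ng] := pselect (obox lo hi g); last first.
  rewrite indicE memNset// (_ : (fun m => _) = fun=> 0); first exact: cvg_cst.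
  by apply/funext => m; rewrite box_bump_out.
rewrite indicE mem_set//=; have [h1 h2] := og.
have b1 (x y z : R) : x < y < z ->
    bump0 (m.+1%:R * (y - x)) * bump0 (m.+1%:R * (z - y)) @[m --> \oo] --> (1 : R).
  move=> /andP[xy yz]; rewrite -[X in _ --> X]mulr1; apply: cvgM.
    by have := @bump0_cvg R (y - x); rewrite subr_gt0 xy.
  by have := @bump0_cvg R (z - y); rewrite subr_gt0 yz.
rewrite -[X in _ --> X]mulr1; apply: cvgM; last exact: b1.
have : forall r : seq 'I_(n + n), \prod_(i <- r) (bump0 (m.+1%:R * (g.1 ord0 i - lo.1 ord0 i)) *
   bump0 (m.+1%:R * (hi.1 ord0 i - g.1 ord0 i))) @[m --> \oo] --> (1 : R).
  elim=> [|i r IH].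
    rewrite (_ : (fun m => _) = fun=> 1); first exact: cvg_cst.
    by apply/funext => m; rewrite big_nil.
  rewrite (_ : (fun m : nat => _) = (fun m : nat => (bump0 (m.+1%:R * (g.1 ord0 i - lo.1 ord0 i)) *
      bump0 (m.+1%:R * (hi.1 ord0 i - g.1 ord0 i))) * \prod_(i <- r) (bump0 (m.+1%:R * (g.1 ord0 i - lo.1 ord0 i)) *
   bump0 (m.+1%:R * (hi.1 ord0 i - g.1 ord0 i))))); last by apply/funext => m; rewrite big_cons.
  by rewrite -[X in _ --> X]mulr1; apply: cvgM => //; exact: b1.
exact.
Qed.

Lemma test_box_bump lo hi m : test_fun (box_bump lo hi m).
Proof.
apply/test_funP; split.
  apply/smoothP => k; apply: CkM.
    apply: Ck_prod => i; apply: CkM.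
      apply: (@Ck_ext R n k (fun g => bump0 (m.+1%:R * (- lo.1 ord0 i + g.1 ord0 i)))).
        by move=> g; rewrite addrC.
      by apply: Ck_bump0; exact: Ck_hor.
    by apply: (@Ck_bump0 k _ _ (fun g => - g.1 ord0 i)); apply: CkN; exact: Ck_hor.
  apply: CkM.
    apply: (@Ck_ext R n k (fun g => bump0 (m.+1%:R * (- lo.2 + g.2)))).
      by move=> g; rewrite addrC.
    by apply: Ck_bump0; exact: Ck_vert.
  by apply: (@Ck_bump0 k _ _ (fun g => - g.2)); apply: CkN; exact: Ck_vert.
exists (`|lo| + `|hi| + 1); first by rewrite ltr_wpDl// addr_ge0.
move=> g gr; apply: box_bump_out => og.
have h0 : 0 < `|lo| + `|hi| + 1 by rewrite ltr_wpDl// addr_ge0.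
have hn (x : H) (r : R) : `|x| < r -> (forall i, `|x.1 ord0 i| < r) /\ `|x.2| < r.
  by move=> xr; have [] := (hboxE x (le_lt_trans (normr_ge0 _) xr)).2 xr.
have [l1 l2] := hn lo (`|lo| + 1) (ltac:(by rewrite ltrDl)).
have [u1 u2] := hn hi (`|hi| + 1) (ltac:(by rewrite ltrDl)).
have : `|g| < `|lo| + `|hi| + 1.
  apply/hboxE => //; case: og => o1 o2; split.
    move=> i; have /andP[a b] := o1 i; have := l1 i; have := u1 i.
    rewrite !ltr_norml => /andP[c d] /andP[e f].
    have := normr_ge0 lo; have := normr_ge0 hi => p q; apply/andP; split; lra.
  move/andP: o2 => [a b]; move: l2 u2; rewrite !ltr_norml => /andP[c d] /andP[e f].
  have := normr_ge0 lo; have := normr_ge0 hi => p q; apply/andP; split; lra.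
by rewrite ltNge gr.
Qed.

Lemma L2_mul_indic z A : measurable A -> L2 z -> L2 (fun g => \1_A g * z g).
Proof.
move=> mA Lz; apply: (@L2_bounded_mul R n z (\1_A) 1) => //.
  by move=> x; rewrite indicE ger0_norm ?lern1 ?leq_b1.
Qed.

(** Smoothed indicators show that z is orthogonal to the indicator of every box, and Dynkin's
    theorem extends this to measurable subsets of a fixed bounded box, where z is integrable. A
    function with zero integral over all these subsets vanishes almost everywhere there. *)
Lemma L2_fundamental z : L2 z -> (forall phi, test_fun phi -> dot z phi = 0) ->
  {ae mu, forall g, z g = 0}.
Proof.
move=> Lz hz.
have box0 lo hi : dot z (\1_(obox lo hi) : H -> R) = 0.
  have r0 : 0 < `|lo| + `|hi| + 1 by rewrite ltr_wpDl// addr_ge0.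
  have hF i x : `|box_bump lo hi i x| <= `|(\1_(hbox (`|lo| + `|hi| + 1)) : H -> R) x|.
    have [og|ng] := pselect (hbox (`|lo| + `|hi| + 1) x).
      rewrite [X in _ <= `|X|]indicE mem_set//= normr1.
      by have /andP[b0 b1] := box_bump_bound lo hi i x; rewrite ger0_norm.
    rewrite box_bump_out ?normr0// => og; apply: ng; case: og => o1 o2.
    have hn (y : H) : (forall i, `|y.1 ord0 i| < `|y| + 1) /\ `|y.2| < `|y| + 1.
      by have [] := (hboxE y (ltr_wpDl (normr_ge0 y) ltr01)).2 (ltac:(by rewrite ltrDl)).
    have [l1 l2] := hn lo; have [u1 u2] := hn hi.
    have := normr_ge0 lo; have := normr_ge0 hi => p q; split.
      move=> j; have /andP[a b] := o1 j; have := l1 j; have := u1 j.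
      rewrite !ltr_norml => /andP[c d] /andP[e f]; apply/andP; split; lra.
    move/andP: o2 => [a b]; move: l2 u2; rewrite !ltr_norml => /andP[c d] /andP[e f].
    apply/andP; split; lra.
  have [_ h] := dot_dominated_cvg (fun i => test_measurable (test_box_bump lo hi i))
    (L2_indic_hbox r0) hF (@box_bump_cvg lo hi) Lz.
  rewrite dotC -(cvg_lim (@Rhausdorff R) h).
  rewrite (_ : (fun i => _) = fun=> 0 : R); first exact: lim_cst.
  by apply/funext => i; rewrite dotC hz//; exact: test_box_bump.
have Nall N : {ae mu, forall g, hbox N.+1%:R g -> z g = 0}.
  have N0 : 0 < N.+1%:R :> R by [].
  pose y g := \1_(hbox N.+1%:R) g * z g.
  have Ly : L2 y by apply: L2_mul_indic => //; exact: measurable_hbox.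
  have L1 A : measurable A -> L2 (fun g => \1_A g * \1_(hbox N.+1%:R) g : R).
    by move=> mA; apply: L2_mul_indic => //; exact: L2_indic_hbox.
  pose b A : H -> R := fun g => \1_A g * \1_(hbox N.+1%:R) g.
  have hb : forall A, <<s oboxes >> A -> dot z (b A) = 0.
    apply: (@dynkin_induction _ H oboxes (fun A => dot z (b A) = 0)).
    - exact: measurable_oboxesE.
    - exact: oboxesI.
    - have -> : b setT = \1_(obox (\row_i (- N.+1%:R), - N.+1%:R) (\row_i N.+1%:R, N.+1%:R)).
        apply/funext => g; rewrite /b indicT mul1r; congr (\1_ _ _).
        apply/seteqP; split => x [h1 h2]; split => [i|].
        + by rewrite !mxE -ltr_norml.
        + by rewrite /= -ltr_norml.
        + by have := h1 i; rewrite !mxE -ltr_norml.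
        + by move: h2; rewrite /= -ltr_norml.
      exact: box0.
    - move=> _ [lo [hi ->]].
      have [lo' [hi' E]] : oboxes (obox lo hi `&` obox (\row_i (- N.+1%:R), - N.+1%:R) (\row_i N.+1%:R, N.+1%:R)).
        by apply: oboxesI; do 2 eexists.
      have -> : b (obox lo hi) = \1_(obox lo' hi'); last exact: box0.
      rewrite -E indicI; apply/funext => g; rewrite /b /=; congr (_ * \1_ _ _).
      apply/seteqP; split => x [h1 h2]; split => [i|].
      + by rewrite !mxE -ltr_norml.
      + by rewrite /= -ltr_norml.
      + by have := h1 i; rewrite !mxE -ltr_norml.
      + by move: h2; rewrite /= -ltr_norml.
    - move=> A mA hA.
      have h1 : dot z (\1_(hbox N.+1%:R) : H -> R) = 0.
        have -> : (\1_(hbox N.+1%:R) : H -> R) = \1_(obox (\row_i (- N.+1%:R), - N.+1%:R) (\row_i N.+1%:R, N.+1%:R)).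
          congr (\1_ _); apply/seteqP; split => x [h1 h2]; split => [i|].
          + by rewrite !mxE -ltr_norml.
          + by rewrite /= -ltr_norml.
          + by have := h1 i; rewrite !mxE -ltr_norml.
          + by move: h2; rewrite /= -ltr_norml.
        exact: box0.
      have -> : b (~` A) = (fun g => (\1_(hbox N.+1%:R) : H -> R) g - b A g).
        apply/funext => g; rewrite /b !indicE in_setC.
        by case: (g \in A) => /=; ring.
      by rewrite dotBr// ?hA ?h1 ?subr0//; [exact: L2_indic_hbox|exact: L1].
    - move=> F mF tF hF.
      have mU : measurable (\bigcup_k F k) by exact: bigcupT_measurable.
      pose G m g := \sum_(k < m) b (F k) g.
      have LG m : L2 (G m).
        elim: m => [|m IH].
          rewrite (_ : G 0%N = fun=> 0); first exact: L2_0.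
          by apply/funext => g; rewrite /G big_ord0.
        rewrite (_ : G m.+1 = fun g => G m g + b (F m) g).
          by apply: L2D => //; exact: L1.
        by apply/funext => g; rewrite /G big_ord_recr.
      have GE m g : G m g = b (\big[setU/set0]_(k < m) F k) g.
        rewrite /G /b -mulr_suml; congr (_ * _).
        elim: m => [|m IH]; first by rewrite !big_ord0 indic0.
        rewrite !big_ord_recr /= IH !indicE in_setU.
        have [gm|] := boolP (g \in F m); last by rewrite orbF addr0.
        rewrite orbT; suff -> : (g \in \big[setU/set0]_(k < m) F k) = false by rewrite add0r.
        apply/negP; rewrite inE -bigcup_mkord => -[k /= km gk].
        move/trivIsetP : tF => /(_ k m I I); rewrite ltn_eqF// => /(_ isT).
        by apply/eqP/set0P; exists g; split => //; exact: set_mem.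
      have cG g : G m g @[m --> \oo] --> b (\bigcup_k F k) g.
        have [gU|ngU] := pselect ((\bigcup_k F k) g).
          have [k _ gk] := gU.
          apply: cvg_near_cst; near=> m; rewrite GE /b !indicE; congr (_%:R * _).
          rewrite (mem_set gU) mem_set// -bigcup_mkord; exists k => //=.
          by near: m; exact: nbhs_infty_gt.
        rewrite (_ : (fun m => _) = fun=> b (\bigcup_k F k) g); first exact: cvg_cst.
        apply/funext => m; rewrite GE /b !indicE (memNset ngU) memNset//.
        by rewrite -bigcup_mkord => -[k _ gk]; apply: ngU; exists k.
      have GF m g : `|G m g| <= `|(\1_(hbox N.+1%:R) : H -> R) g|.
        rewrite GE /b normrM ger0_norm ?indicE// ler_piMl//.
        by rewrite lern1 leq_b1.
      have [_ h] := dot_dominated_cvg (fun m => L2_measurable (LG m)) (L2_indic_hbox N0) GF cG Lz.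
      rewrite dotC -(cvg_lim (@Rhausdorff R) h).
      rewrite (_ : (fun i => _) = fun=> 0 : R); first exact: lim_cst.
      apply/funext => m; elim: m => [|m IH].
        rewrite (_ : G 0%N = fun=> 0) /dot; last by apply/funext => g; rewrite /G big_ord0.
        by under eq_Rintegral do rewrite mul0r; rewrite /Rintegral integral0.
      rewrite (_ : G m.+1 = fun g => G m g + b (F m) g).
        by rewrite dotDl//; [rewrite IH add0r dotC hF|exact: L1].
      by apply/funext => g; rewrite /G big_ord_recr.
  have hA A : measurable A -> dot z (b A) = 0.
    by move=> mA; apply: hb; rewrite -measurable_oboxesE.
  have iy : mu.-integrable setT (fun g => (y g)%:E).
    by apply: L2_mulE => //; exact: L2_indic_hbox.
  have := @integral_ae_eq _ H R mu setT measurableT (cst 0%E) _ iy (measurable_cst _).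
  have hE E : E `<=` setT -> measurable E -> (\int[mu]_(x in E) (y x)%:E = \int[mu]_(x in E) (cst 0 x))%E.
    move=> _ mE; rewrite [RHS]integral0 integral_mkcond.
    have := hA E mE; rewrite /dot /Rintegral.
    rewrite (_ : (fun x => (z x * b E x)%:E) = (fun x => (y x)%:E) \_ E); last first.
      apply/funext => x; rewrite patchE /b /y indicE.
      by case: (x \in E); rewrite ?mul1r ?mul0r ?mulr0// mulrC.
    move=> h; rewrite -[LHS]fineK ?h//.
    apply: integrable_fin_num => //.
    by apply/(integrable_mkcond (fun x => (y x)%:E) mE).1; exact: integrableS iy.
  move=> /(_ hE); apply: filterS => g /(_ I) [] + gN.
  by rewrite /y indicE mem_set// mul1r.
have /ae_foralln : forall N : nat, {ae mu, forall g, hbox N.+1%:R g -> z g = 0} by exact: Nall.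
apply: filterS => g hg; have [N Nb] := bounded_coord_nat g.
exact: (hg N Nb).
Unshelve. all: end_near.
Qed.

End fundamental_lemma.

(** * Contractions of weakly differentiable functions *)

Section contraction.
Context {R : realType} {n : nat}.
Local Notation H := (heis R n).
Local Notation mu := (@heis_leb R n).
Implicit Types (u v w z phi : H -> R) (k : 'I_(n + n)).

Lemma L2_riesz (D : set (H -> R)) (l : (H -> R) -> R) (C : R) :
  D `<=` (@L2 R n) -> D 0 -> (forall a x y, D x -> D y -> D (a *: x + y)) ->
  (forall a x y, D x -> D y -> l (a *: x + y) = a * l x + l y) -> 0 <= C ->
  (forall x, D x -> l x ^+ 2 <= C * dot x x) ->
  exists z, [/\ L2 z, forall x, D x -> dot z x = l x & dot z z <= C].
Proof.
move=> DL D0 Dlin llin C0 lC.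
apply: (@riesz_representation R (H -> R) D (@L2 R n) (@dot R n)) => //.
- by move=> a x y Lx Ly; apply: L2D => //; exact: L2Z.
- by move=> a x y z Lx Ly Lz; rewrite -dotZl// -dotDl//; exact: L2Z.
- by move=> x y _ _; exact: dotC.
- by move=> x _; exact: dot_ge0.
- by move=> x Lx cau; exact: L2_complete.
Qed.

Lemma test_submod a (x y : H -> R) : test_fun x -> test_fun y -> test_fun (a *: x + y).
Proof. exact: test_lin. Qed.

(** Riesz representation on the test functions gives z with [dot z z <= C] and the same pairings as
    v, and [L2_fundamental] identifies z with v. No approximation of v is constructed. *)
Lemma L2_test_dense v (C : R) : L2 v -> 0 <= C ->
  (forall phi, test_fun phi -> dot v phi ^+ 2 <= C * dot phi phi) -> dot v v <= C.
Proof.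
move=> Lv C0 hC.
have [||||z [Lz hz zC]] := @L2_riesz (@test_fun R n) (dot v) C _ _ _ _ C0 hC.
- exact: test_L2.
- exact: test0.
- exact: test_submod.
- move=> a x y tx ty; have Lx := test_L2 tx; have Ly := test_L2 ty.
  by rewrite -dotZr// -dotDr//; exact: L2Z.
have Lvz := L2B Lv Lz.
have h := L2_fundamental Lvz.
have {}h : {ae mu, forall g, v g - z g = 0}.
  by apply: h => phi tphi; rewrite dotBl ?hz ?subrr//; exact: test_L2.
have hE : {ae mu, forall g, v g = z g} by apply: filterS h => g /subr0_eq.
have mv := L2_measurable Lv; have mz := L2_measurable Lz.
by rewrite (dot_ae hE)// dotC (dot_ae hE).
Qed.

(** The dual form of [weak_X_flow_bound]: the flow is moved from the test function to u. *)
Lemma weak_X_translation k u w s : L2 u -> L2 w -> weak_X k u w -> `|s| <= 1 ->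
  dot (fun g => u (flow k s g) - u g) (fun g => u (flow k s g) - u g) <= s ^+ 2 * dot w w.
Proof.
move=> Lu Lw hw s1.
have Ls := L2_flow k s Lu.
apply: L2_test_dense; first exact: L2B.
  by rewrite mulr_ge0 ?sqr_ge0 ?dot_ge0.
move=> phi tphi; have Lp := test_L2 tphi.
rewrite dotBl// dot_flow; [|exact: L2_measurable..].
have := @weak_X_flow_bound R n k u w phi (- s) Lu Lw hw tphi.
by rewrite normrN sqrrN -mulrA => /(_ s1).
Qed.

Lemma ler_addgt0_sqr (a b K : R) : (forall s : R, 0 < s <= 1 -> `|a| <= b + s * K) -> `|a| <= b.
Proof.
move=> h; apply/ler_addgt0Pr => e e0.
have K1 : 0 < `|K| + 1 by rewrite ltr_wpDl.
pose s := Num.min 1 (e / (`|K| + 1)).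
have s0 : 0 < s by rewrite lt_min ltr01 divr_gt0.
apply: (@le_trans _ _ (b + s * K)); first by apply: h; rewrite s0 ge_min lexx.
rewrite lerD2l; apply: (@le_trans _ _ (s * (`|K| + 1))).
  by rewrite ler_pM2l// (le_trans (ler_norm _))// lerDl.
apply: (@le_trans _ _ (e / (`|K| + 1) * (`|K| + 1))).
  by rewrite ler_pM2r// ge_min lexx orbT.
by rewrite divfK// gt_eqF.
Qed.

(** A chain rule for Lipschitz T is avoided. A weak derivative controls the differences of u along
    the flow in L2, composition with T decreases these differences pointwise, and Riesz
    representation recovers a weak derivative from the resulting bound. *)
Lemma weak_X_contraction k u w (T : R -> R) : L2 u -> L2 w -> weak_X k u w ->
  measurable_fun setT T -> T 0 = 0 -> (forall x y, `|T x - T y| <= `|x - y|) ->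
  exists w', [/\ L2 w', weak_X k (T \o u) w' & dot w' w' <= dot w w].
Proof.
move=> Lu Lw hw mT T0 hT.
have mu' := L2_measurable Lu.
have LT : L2 (T \o u).
  apply: (L2_dom _ _ Lu); first exact: (measurableT_comp mT).
  by move=> x; have := hT (u x) 0; rewrite T0 !subr0.
have bound phi : test_fun phi -> `|dot (T \o u) (heis_X k phi)| <= Num.sqrt (dot w w * dot phi phi).
  move=> tphi; have Lp := test_L2 tphi.
  have [C C0 hC] := flow_dot_taylor k tphi LT.
  apply: (@ler_addgt0_sqr _ _ C) => s /andP[s0 s1].
  have sn : `|s| <= 1 by rewrite gtr0_norm.
  have := hC s sn; set A := dot _ (heis_X k phi); set B := _ - dot (T \o u) phi => h1.
  have h2 : `|B| <= s * Num.sqrt (dot w w * dot phi phi).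
    have LTs := L2_flow k (- s) LT.
    have -> : B = dot (fun g => (T \o u) (flow k (- s) g) - (T \o u) g) phi.
      rewrite dotBl// /B; congr (_ - _).
      by rewrite dot_flow ?opprK//; exact: L2_measurable.
    apply: (le_trans (dot_le_norm _ Lp)); first exact: L2B.
    rewrite sqrtrM ?dot_ge0// mulrA ler_wpM2r ?sqrtr_ge0//.
    have -> : s * Num.sqrt (dot w w) = Num.sqrt (s ^+ 2 * dot w w).
      by rewrite sqrtrM ?sqr_ge0// sqrtr_sqr gtr0_norm.
    rewrite ler_sqrt; last by rewrite mulr_ge0 ?sqr_ge0 ?dot_ge0.
    have sn' : `|- s| <= 1 by rewrite normrN.
    have := weak_X_translation Lu Lw hw sn'; rewrite sqrrN; apply: le_trans.
    have Lus := L2_flow k (- s) Lu.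
    rewrite -lee_fin !dotE; [|exact: L2B..].
    apply: ge0_le_integral => //.
    - by move=> x _; rewrite lee_fin sqr_ge0.
    - by apply/measurable_EFinP; apply: measurable_funX; apply: L2_measurable; exact: L2B.
    - by apply/measurable_EFinP; apply: measurable_funX; apply: L2_measurable; exact: L2B.
    - move=> x _; rewrite lee_fin -real_normK ?num_real// -[leRHS]real_normK ?num_real//.
      by rewrite ler_pXn2r ?nnegrE//; exact: hT.
  rewrite -(ler_pM2l s0) -{1}(gtr0_norm s0) -normrM.
  have -> : s * A = B - (B - s * A) by ring.
  apply: (le_trans (ler_normB _ _)).
  have -> : s * (Num.sqrt (dot w w * dot phi phi) + s * C) =
    s * Num.sqrt (dot w w * dot phi phi) + s ^+ 2 * C by ring.
  exact: lerD.
have [||||||w' [Lw' hw' w'w]] := @L2_riesz (@test_fun R n) (fun phi => - dot (T \o u) (heis_X k phi)) (dot w w).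
- exact: test_L2.
- exact: test0.
- exact: test_submod.
- move=> a x y tx ty.
  have Lx := test_L2 (test_heis_X k tx); have Ly := test_L2 (test_heis_X k ty).
  have -> : heis_X k (a *: x + y) = (fun g => a * heis_X k x g + heis_X k y g).
    apply/funext => g; exact: (heis_X_lin k a g (test_Ck 1 tx) (test_Ck 1 ty)).
  rewrite dotDr ?dotZr//; [by rewrite opprD mulrN|exact: L2Z].
- exact: dot_ge0.
- move=> phi tphi; rewrite sqrrN -real_normK ?num_real//.
  rewrite -[leRHS]sqr_sqrtr ?mulr_ge0 ?dot_ge0//.
  by rewrite ler_pXn2r ?nnegrE ?sqrtr_ge0// bound.
exists w'; split => //; apply/weak_XE => phi tphi.
by rewrite hw'// opprK.
Qed.

Lemma dot_cvg (u_ : nat -> H -> R) u v : (forall i, L2 (u_ i)) -> L2 u -> L2 v ->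
  dot (u_ i \- u) (u_ i \- u) @[i --> \oo] --> 0 -> dot (u_ i) v @[i --> \oo] --> dot u v.
Proof.
move=> Lu_ Lu Lv h.
have h0 : (fun i => dot (u_ i \- u) v) @ \oo --> 0.
  apply: (@sq_cvg0 _ _ (fun i => dot (u_ i \- u) (u_ i \- u)) (dot v v)) => // i.
  by rewrite mulrC; apply: dot_CS => //; exact: L2B.
have -> : (fun i => dot (u_ i) v) = (fun i => dot u v + dot (u_ i \- u) v).
  by apply/funext => i; rewrite dotBl//; ring.
by rewrite -[X in _ --> X]addr0; apply: cvgD => //; exact: cvg_cst.
Qed.

Lemma weak_X_closed k (u_ w_ : nat -> H -> R) u w :
  (forall i, L2 (u_ i)) -> L2 u -> (forall i, L2 (w_ i)) -> L2 w ->
  (forall i, weak_X k (u_ i) (w_ i)) ->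
  (forall v, L2 v -> dot (u_ i) v @[i --> \oo] --> dot u v) ->
  (forall v, L2 v -> dot (w_ i) v @[i --> \oo] --> dot w v) ->
  weak_X k u w.
Proof.
move=> Lu_ Lu Lw_ Lw hw cu cw; apply/weak_XE => phi tphi.
have h1 := cu _ (test_L2 (test_heis_X k tphi)).
have h2 := cw _ (test_L2 tphi).
have h3 : (fun i => dot (u_ i) (heis_X k phi)) @ \oo --> - dot w phi.
  have -> : (fun i => dot (u_ i) (heis_X k phi)) = (fun i => - dot (w_ i) phi).
    by apply/funext => i; exact: (hw i phi tphi).
  exact: cvgN.
by rewrite -(cvg_lim (@Rhausdorff R) h1) -(cvg_lim (@Rhausdorff R) h3).
Qed.

End contraction.

(** * The quadratic form and the resolvent *)

Section form_domain.
Context {R : realType} {n : nat}.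
Local Notation H := (heis R n).
Local Notation mu := (@heis_leb R n).
Variable V : H -> R.
Hypothesis V0 : forall g, 0 <= V g.
Hypothesis mV : measurable_fun setT V.
Implicit Types (u v w z f : H -> R) (k : 'I_(n + n)).

(** Multiplication by V^(1/2) makes the potential part of the form an L2 inner product. *)
Definition sV u g := Num.sqrt (V g) * u g.

Lemma measurable_sqrtV : measurable_fun setT (fun g => Num.sqrt (V g)).
Proof.
rewrite (_ : (fun g => _) = (fun g => V g `^ 2^-1)); first exact: measurable_powR_comp.
by apply/funext => g; rewrite powR12_sqrt.
Qed.

Lemma measurable_sV u : measurable_fun setT u -> measurable_fun setT (sV u).
Proof. by move=> mu'; apply: measurable_funM => //; exact: measurable_sqrtV. Qed.

Lemma sV_sqr u v g : sV u g * sV v g = V g * u g * v g.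
Proof. by rewrite /sV mulrACA -expr2 sqr_sqrtr// mulrA. Qed.

Lemma formVE u v : \int[mu]_g (V g * u g * v g) = dot (sV u) (sV v).
Proof. by rewrite /dot; under [RHS]eq_Rintegral do rewrite sV_sqr. Qed.

Lemma form_domP u U : form_dom V u U <->
  [/\ L2 u, forall k, L2 (U k) /\ weak_X k u (U k) & L2 (sV u)].
Proof.
split=> -[Lu hU h]; split => //.
  apply/L2P; split; first by apply: measurable_sV; exact: L2_measurable.
  by under eq_integral => g _ do rewrite expr2 sV_sqr -mulrA -expr2.
have [_] := (L2P _).1 h.
by under eq_integral => g _ do rewrite expr2 sV_sqr -mulrA -expr2.
Qed.

Local Notation E := ((H -> R) * ('I_(n + n) -> H -> R))%type.
Implicit Types p q r : E.

(** A gradient is determined only up to null sets. Carrying it as a second component gives a linear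
    space on which the form is bilinear, with no choice of gradient. *)
Definition formD : set E := [set p | form_dom V p.1 p.2].

Definition formB (lam : R) p q : R :=
  \sum_k dot (p.2 k) (q.2 k) + dot (sV p.1) (sV q.1) + lam * dot p.1 q.1.

Lemma formD_L2 p : formD p -> L2 p.1. Proof. by case. Qed.

Lemma formD_L2V p : formD p -> L2 (sV p.1). Proof. by move/form_domP => []. Qed.

Lemma formD_L2X p k : formD p -> L2 (p.2 k). Proof. by move=> [_ /(_ k)[]]. Qed.

Lemma sV_lin a u v : sV (fun g => a * u g + v g) = (fun g => a * sV u g + sV v g).
Proof. by apply/funext => g; rewrite /sV mulrDr mulrCA. Qed.

Lemma formD_lin a p q : formD p -> formD q -> formD (a *: p + q).
Proof.
move=> /form_domP[Lp hp Vp] /form_domP[Lq hq Vq]; apply/form_domP; split => /=.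
- by apply: L2D => //; exact: L2Z.
- move=> k; have [Lpk Xp] := hp k; have [Lqk Xq] := hq k; split.
    by apply: L2D => //; exact: L2Z.
  exact: weak_X_lin.
- by rewrite (sV_lin a p.1 q.1); apply: L2D => //; exact: L2Z.
Qed.

Lemma formD0 : formD 0.
Proof.
apply/form_domP; split => /=.
- exact: L2_0.
- move=> k; split; first exact: L2_0.
  apply/weak_XE => phi tphi; rewrite /dot.
  under eq_Rintegral do rewrite mul0r.
  under [in RHS]eq_Rintegral do rewrite mul0r.
  by rewrite /Rintegral integral0 oppr0.
- rewrite (_ : sV 0 = fun=> 0); first exact: L2_0.
  by apply/funext => g; rewrite /sV mulr0.
Qed.

Lemma dotlinl a u v w : L2 u -> L2 v -> L2 w ->
  dot (fun g => a * u g + v g) w = a * dot u w + dot v w.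
Proof. by move=> Lu Lv Lw; rewrite dotDl ?dotZl//; exact: L2Z. Qed.

Lemma formB_lin lam a p q r : formD p -> formD q -> formD r ->
  formB lam (a *: p + q) r = a * formB lam p r + formB lam q r.
Proof.
move=> Dp Dq Dr; rewrite /formB.
have -> : \sum_k dot ((a *: p + q).2 k) (r.2 k) =
    a * \sum_k dot (p.2 k) (r.2 k) + \sum_k dot (q.2 k) (r.2 k).
  rewrite mulr_sumr -big_split/=; apply: eq_bigr => k _.
  by rewrite -(dotlinl a (formD_L2X k Dp) (formD_L2X k Dq) (formD_L2X k Dr)).
have -> : dot (sV (a *: p + q).1) (sV r.1) = a * dot (sV p.1) (sV r.1) + dot (sV q.1) (sV r.1).
  rewrite -(dotlinl a (formD_L2V Dp) (formD_L2V Dq) (formD_L2V Dr)).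
  by rewrite -(sV_lin a p.1 q.1).
have -> : dot (a *: p + q).1 r.1 = a * dot p.1 r.1 + dot q.1 r.1.
  by rewrite -(dotlinl a (formD_L2 Dp) (formD_L2 Dq) (formD_L2 Dr)).
move: (\sum_k _) (\sum_k _) (dot _ _) (dot _ _) (dot _ _) (dot _ _) => x1 x2 x3 x4 x5 x6.
by ring.
Qed.

Lemma formB_sym lam p q : formB lam p q = formB lam q p.
Proof.
rewrite /formB (dotC (sV p.1)) (dotC p.1); congr (_ + _ + _).
by apply: eq_bigr => k _; rewrite dotC.
Qed.

Lemma formB_ge0 lam p : 0 <= lam -> 0 <= formB lam p p.
Proof.
move=> l0; rewrite !addr_ge0 ?dot_ge0// ?mulr_ge0 ?dot_ge0//.
by apply: sumr_ge0 => k _; exact: dot_ge0.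
Qed.

Lemma formB_addlam lam p q : formB lam p q = formB 0 p q + lam * dot p.1 q.1.
Proof. by rewrite /formB mul0r addr0. Qed.

Lemma formB_ge_X lam p k : 0 <= lam -> dot (p.2 k) (p.2 k) <= formB lam p p.
Proof.
move=> l0; rewrite /formB (bigD1 k)//= -!addrA lerDl !addr_ge0 ?dot_ge0// ?mulr_ge0 ?dot_ge0//.
by apply: sumr_ge0 => j _; exact: dot_ge0.
Qed.

Lemma formB_ge_V lam p : 0 <= lam -> dot (sV p.1) (sV p.1) <= formB lam p p.
Proof.
move=> l0; rewrite /formB addrAC lerDr addr_ge0 ?mulr_ge0 ?dot_ge0//.
by apply: sumr_ge0 => j _; exact: dot_ge0.
Qed.

Lemma formB_ge_L2 lam p : lam * dot p.1 p.1 <= formB lam p p.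
Proof.
rewrite /formB lerDr addr_ge0 ?dot_ge0//.
by apply: sumr_ge0 => j _; exact: dot_ge0.
Qed.

(** Multiplication by the unbounded function V^(1/2) is a closed operator: on the set where V^(1/2)
    <= K it is bounded, so both limits can be tested there against the same L2 function, and K is
    arbitrary. *)
Lemma sV_closed (u_ : nat -> H -> R) u y : (forall i, L2 (u_ i)) -> L2 u -> L2 y ->
  (forall i, L2 (sV (u_ i))) ->
  dot (u_ i \- u) (u_ i \- u) @[i --> \oo] --> 0 ->
  dot (sV (u_ i) \- y) (sV (u_ i) \- y) @[i --> \oo] --> 0 ->
  {ae mu, forall g, y g = sV u g}.
Proof.
move=> Lu_ Lu Ly LV cu cy.
pose m (K : nat) : H -> R := \1_[set g | Num.sqrt (V g) <= K%:R].
have mm K : measurable_fun setT (m K).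
  apply: measurable_indic.
  rewrite (_ : [set g | _] = (fun g => Num.sqrt (V g)) @^-1` `]-oo, K%:R]%classic).
    by rewrite -[X in measurable X]setTI; exact: measurable_sqrtV.
  by apply/seteqP; split => g /=; rewrite in_itv.
have m1 K g : `|m K g| <= 1 by rewrite /m indicE ger0_norm// lern1 leq_b1.
have mK K g : `|m K g * Num.sqrt (V g)| <= K%:R.
  rewrite /m indicE; have [|] := boolP (g \in _); rewrite ?mul0r ?normr0 ?mul1r// inE /=.
  by rewrite ger0_norm ?sqrtr_ge0.
have LK K v : L2 v -> L2 (fun g => m K g * v g) by exact: L2_bounded_mul (mm K) (m1 K).
have LKV K v : L2 v -> L2 (fun g => m K g * Num.sqrt (V g) * v g).
  apply: L2_bounded_mul (mK K); apply: measurable_funM => //; exact: measurable_sqrtV.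
have key K : {ae mu, forall g, m K g * y g - m K g * Num.sqrt (V g) * u g = 0}.
  have Lt : L2 (fun g => m K g * y g - m K g * Num.sqrt (V g) * u g).
    by apply: L2B; [exact: LK|exact: LKV].
  apply: dot_eq0_ae => //.
  set t := (fun g => _ - _); have Lt' : L2 t by [].
  have e1 : dot (fun g => m K g * y g) t = dot y (fun g => m K g * t g).
    by rewrite /dot; apply: eq_Rintegral => g _; rewrite -mulrA mulrCA.
  have e2 : dot (fun g => m K g * Num.sqrt (V g) * u g) t = dot u (fun g => m K g * Num.sqrt (V g) * t g).
    by rewrite /dot; apply: eq_Rintegral => g _; rewrite -mulrA mulrCA.
  have -> : dot t t = dot y (fun g => m K g * t g) - dot u (fun g => m K g * Num.sqrt (V g) * t g).
    by rewrite -e1 -e2 {1}/t dotBl//; [exact: LK|exact: LKV].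
  have c1 := dot_cvg LV Ly (LK K _ Lt') cy.
  have c2 := dot_cvg Lu_ Lu (LKV K _ Lt') cu.
  have E3 : (fun i => dot (sV (u_ i)) (fun g => m K g * t g)) =
      (fun i => dot (u_ i) (fun g => m K g * Num.sqrt (V g) * t g)).
    apply/funext => i; rewrite /dot; apply: eq_Rintegral => g _.
    rewrite /sV; move: (Num.sqrt _) (u_ i g) (m K g) (t g) => a1 a2 a3 a4; ring.
  rewrite E3 in c1.
  by rewrite -(cvg_lim (@Rhausdorff R) c1) -(cvg_lim (@Rhausdorff R) c2) subrr.
have /ae_foralln : forall K : nat, {ae mu, forall g, m K g * y g - m K g * Num.sqrt (V g) * u g = 0}.
  exact: key.
apply: filterS => g hg; have [K hK] : exists K : nat, Num.sqrt (V g) <= K%:R.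
  by exists (Num.truncn (Num.sqrt (V g))).+1; apply: ltW; exact: truncnS_gt.
have := hg K; rewrite /m indicE mem_set//= !mul1r => /subr0_eq.
exact.
Qed.

Lemma form_complete lam (x : nat -> E) : 0 < lam -> (forall i, formD (x i)) ->
  (forall e, 0 < e -> exists N, forall i j, (N <= i)%N -> (N <= j)%N ->
     formB lam (x i - x j) (x i - x j) < e) ->
  exists2 z, formD z & formB lam (x i - z) (x i - z) @[i --> \oo] --> 0.
Proof.
move=> l0 Dx cau; have l0' := ltW l0.
have [u Lu cu] : exists2 u, L2 u & dot ((x i).1 \- u) ((x i).1 \- u) @[i --> \oo] --> 0.
  apply: L2_complete => [i|e e0]; first exact: formD_L2.
  have [N hN] := cau (lam * e) (mulr_gt0 l0 e0); exists N => i j Ni Nj.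
  rewrite -(ltr_pM2l l0); apply: le_lt_trans (hN i j Ni Nj).
  exact: (formB_ge_L2 lam (x i - x j)).
have [y Ly cy] : exists2 y, L2 y & dot (sV (x i).1 \- y) (sV (x i).1 \- y) @[i --> \oo] --> 0.
  apply: L2_complete => [i|e e0]; first exact: formD_L2V.
  have [N hN] := cau e e0; exists N => i j Ni Nj.
  apply: le_lt_trans (hN i j Ni Nj).
  have -> : sV (x i).1 \- sV (x j).1 = sV (x i - x j).1.
    by apply/funext => g; rewrite /sV /= -mulrBr.
  exact: formB_ge_V.
have /choice[U hU] : forall k, exists w, L2 w /\ dot ((x i).2 k \- w) ((x i).2 k \- w) @[i --> \oo] --> 0.
  move=> k; have [w Lw cw] : exists2 w, L2 w & dot ((x i).2 k \- w) ((x i).2 k \- w) @[i --> \oo] --> 0.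
    apply: L2_complete => [i|e e0]; first exact: formD_L2X.
    have [N hN] := cau e e0; exists N => i j Ni Nj.
    apply: le_lt_trans (hN i j Ni Nj); exact: (formB_ge_X (x i - x j) k l0').
  by exists w.
have yV := sV_closed (fun i => formD_L2 (Dx i)) Lu Ly (fun i => formD_L2V (Dx i)) cu cy.
have mVu : measurable_fun setT (sV u) by apply: measurable_sV; exact: L2_measurable.
have LVu : L2 (sV u) by exact: L2_ae yV mVu Ly.
exists (u, U).
  apply/form_domP; split => //= k; have [LU cU] := hU k; split => //.
  apply: (@weak_X_closed R n k (fun i => (x i).1) (fun i => (x i).2 k)) => //.
  - by move=> i; exact: formD_L2.
  - by move=> i; exact: formD_L2X.
  - by move=> i; case: (Dx i) => _ /(_ k)[].
  - by move=> v Lv; apply: dot_cvg => // i; exact: formD_L2.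
  - by move=> v Lv; apply: dot_cvg => // i; exact: formD_L2X.
have -> : (fun i => formB lam (x i - (u, U)) (x i - (u, U))) =
   (fun i => \sum_k dot ((x i).2 k \- U k) ((x i).2 k \- U k) +
      dot (sV (x i).1 \- y) (sV (x i).1 \- y) + lam * dot ((x i).1 \- u) ((x i).1 \- u)).
  apply/funext => i; rewrite /formB /=; congr (_ + _ + _).
  have -> : sV ((x i).1 - u) = sV (x i).1 \- sV u.
    by apply/funext => g; rewrite /sV /= -mulrBr.
  (* The convergence is known for the limit y of the [sV (x i).1], while the form contains [sV u];
     the two agree almost everywhere. *)
  have ae1 : {ae mu, forall g, (sV (x i).1 \- sV u) g = (sV (x i).1 \- y) g}.
    by apply: filterS yV => g /= ->.
  have mx := L2_measurable (formD_L2V (Dx i)).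
  have m1 : measurable_fun setT (sV (x i).1 \- sV u) by exact: measurable_funB.
  have m2 : measurable_fun setT (sV (x i).1 \- y).
    by apply: measurable_funB => //; exact: L2_measurable.
  by rewrite (dot_ae ae1 m1 m2 m1) dotC (dot_ae ae1 m1 m2 m2).
rewrite -[X in _ --> X]addr0; apply: cvgD; last first.
  by rewrite -(mulr0 lam); apply: cvgM => //; exact: cvg_cst.
rewrite -[X in _ --> X]addr0; apply: cvgD => //.
have : forall r : seq 'I_(n + n), \sum_(k <- r) dot ((x i).2 k \- U k) ((x i).2 k \- U k) @[i --> \oo] --> (0 : R).
  elim=> [|k r IH].
    by rewrite (_ : (fun i => _) = fun=> 0); [exact: cvg_cst|apply/funext => i; rewrite big_nil].
  rewrite (_ : (fun i => _) = fun i => dot ((x i).2 k \- U k) ((x i).2 k \- U k) +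
     \sum_(k <- r) dot ((x i).2 k \- U k) ((x i).2 k \- U k)).
    by rewrite -[X in _ --> X]addr0; apply: cvgD => //; have [] := hU k.
  by apply/funext => i; rewrite big_cons.
exact.
Qed.

Lemma resolvent_exists lam f : 0 < lam -> L2 f ->
  exists p, formD p /\ forall q, formD q -> formB lam p q = dot f q.1.
Proof.
move=> l0 Lf.
have [|||||||z [Dz hz _]] := @riesz_representation R E formD formD (formB lam) (fun _ => id)
  formD0 formD_lin formD_lin _ _ _ (fun p => dot f p.1) _ (dot f f / lam).
- by move=> *; exact: formB_lin.
- by move=> *; exact: formB_sym.
- by move=> p _; apply: formB_ge0; exact: ltW.
- move=> a p q Dp Dq /=; rewrite dotC (dotC f) (dotC f).
  by rewrite -(dotlinl a (formD_L2 Dp) (formD_L2 Dq) Lf).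
- by rewrite divr_ge0 ?dot_ge0// ltW.
- move=> p Dp /=; apply: (le_trans (dot_CS Lf (formD_L2 Dp))).
  rewrite -mulrA ler_wpM2l ?dot_ge0// mulrC ler_pdivlMr// mulrC.
  exact: formB_ge_L2.
- by move=> x Dx cau; exact: form_complete.
by exists z.
Qed.

End form_domain.

Section dot_expansions.
Context {R : realType} {n : nat}.
Implicit Types (u v : heis R n -> R).

Lemma dot_lin_sq a u v : L2 u -> L2 v ->
  dot (fun g => a * u g + v g) (fun g => a * u g + v g) =
  a ^+ 2 * dot u u + 2 * a * dot u v + dot v v.
Proof.
move=> Lu Lv; apply: (@sesqui_expand R (heis R n -> R) (@L2 R n) (@dot R n)) => //.
- by move=> b x y Lx Ly; apply: L2D => //; exact: L2Z.
- by move=> b x y z Lx Ly Lz; rewrite -dotZl// -dotDl//; exact: L2Z.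
- by move=> x y _ _; exact: dotC.
Qed.

Lemma dot_sub_sq u v : L2 u -> L2 v ->
  dot (fun g => u g - v g) (fun g => u g - v g) = dot u u - 2 * dot u v + dot v v.
Proof.
move=> Lu Lv; have L1 := L2B Lu Lv.
rewrite dotBl// !dotBr// (dotC v u).
by move: (dot _ _) (dot _ _) (dot _ _) => a b c; ring.
Qed.

Lemma lip_max (R' : realDomainType) (a x y : R') : `|Num.max a x - Num.max a y| <= `|x - y|.
Proof.
rewrite !maxEle; case: (leP a x) => h1; case: (leP a y) => h2 //.
- by rewrite !ger0_norm ?subr_ge0 ?(le_trans (ltW h2))// lerD2l lerN2 ltW.
- by rewrite !ler0_norm ?subr_le0 ?(le_trans (ltW h1))// lerN2 lerD2r ltW.
- by rewrite subrr normr0.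
Qed.

Lemma lip_min (R' : realDomainType) (a x y : R') : `|Num.min a x - Num.min a y| <= `|x - y|.
Proof.
rewrite !minEle; case: (leP a x) => h1; case: (leP a y) => h2 //.
- by rewrite subrr normr0.
- by rewrite !ger0_norm ?subr_ge0 ?(ltW h2) ?(le_trans (ltW h2))// lerD2r.
- by rewrite !ler0_norm ?subr_le0 ?(ltW h1) ?(le_trans (ltW h1))// lerN2 lerD2l lerN2.
Qed.

End dot_expansions.

Section resolvent.
Context {R : realType} {n : nat}.
Local Notation H := (heis R n).
Local Notation mu := (@heis_leb R n).
Variable V : H -> R.
Hypothesis V0 : forall g, 0 <= V g.
Hypothesis mV : measurable_fun setT V.
Implicit Types (u v w z f : H -> R) (k : 'I_(n + n)) (lam : R).

Local Notation E := ((H -> R) * ('I_(n + n) -> H -> R))%type.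

(** (L + lam)^-1 f with its gradient, chosen among solutions that agree only up to null sets. Facts
    about it are therefore stated for pairings or almost everywhere. *)
Definition resp lam f : E :=
  xget 0 [set p : E | formD V p /\ forall q, formD V q -> formB V lam p q = dot f q.1].

Definition res lam f : H -> R := (resp lam f).1.

Lemma respP lam f : 0 < lam -> L2 f ->
  formD V (resp lam f) /\ forall q, formD V q -> formB V lam (resp lam f) q = dot f q.1.
Proof.
move=> l0 Lf; have [p hp] := resolvent_exists V0 mV l0 Lf.
exact: (@xgetPex E 0 [set p : E | formD V p /\ forall q, formD V q -> formB V lam p q = dot f q.1] (ex_intro _ p hp)).
Qed.

Lemma resp_form lam f : 0 < lam -> L2 f -> formD V (resp lam f).
Proof. by move=> l0 /(respP l0)[]. Qed.

Lemma resp_eq lam f q : 0 < lam -> L2 f -> formD V q -> formB V lam (resp lam f) q = dot f q.1.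
Proof. by move=> l0 /(respP l0)[_]; exact. Qed.

Lemma res_L2 lam f : 0 < lam -> L2 f -> L2 (res lam f).
Proof. by move=> l0 Lf; exact: formD_L2 (resp_form l0 Lf). Qed.

Lemma resolvent_res lam f : 0 < lam -> L2 f -> resolvent V lam f (res lam f).
Proof.
move=> l0 Lf; have Lr := res_L2 l0 Lf; split => //; split.
  by apply: L2B => //; exact: L2Z.
exists (resp lam f).2; first exact: resp_form.
move=> v W Dv; have := resp_eq l0 Lf (q := (v, W)) Dv.
rewrite formVE// dotBl ?dotZl//; last 3 first.
- by case: Dv.
- exact: L2Z.
- by case: Dv.
by rewrite /formB /= => <-; rewrite addrK.
Qed.

Lemma res_sym lam f v : 0 < lam -> L2 f -> L2 v -> dot (res lam f) v = dot f (res lam v).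
Proof.
move=> l0 Lf Lv; rewrite -(resp_eq l0 Lf (resp_form l0 Lv)) dotC.
by rewrite -(resp_eq l0 Lv (resp_form l0 Lf)) formB_sym.
Qed.

(** The equation for [resp m f] is tested with [resp lam v] and conversely; the two differ only in
    the coefficient of the L2 term. *)
Lemma res_identity lam m f v : 0 < lam -> 0 < m -> L2 f -> L2 v ->
  dot (res lam f) v - dot (res m f) v = (m - lam) * dot (res m f) (res lam v).
Proof.
move=> l0 m0 Lf Lv.
have h1 := resp_eq m0 Lf (resp_form l0 Lv).
have h2 := resp_eq l0 Lv (resp_form m0 Lf).
rewrite formB_addlam in h1; rewrite formB_addlam formB_sym in h2.
rewrite res_sym// (dotC (res m f) v).
rewrite -[dot f (res lam v)]h1 -[dot v (res m f)]h2 (dotC (resp lam v).1).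
rewrite -/(res m f) -/(res lam v).
by move: (formB V 0 _ _) (dot _ _) => a b; ring.
Qed.

Lemma res_energy lam f : 0 < lam -> L2 f ->
  formB V 0 (resp lam f) (resp lam f) + lam * dot (res lam f) (res lam f) = dot (res lam f) f.
Proof.
move=> l0 Lf; have h := resp_eq l0 Lf (resp_form l0 Lf).
by rewrite [RHS]dotC -[RHS]h [RHS]formB_addlam.
Qed.

Lemma res_ge0 lam f : 0 < lam -> L2 f -> 0 <= dot (res lam f) f.
Proof.
move=> l0 Lf; rewrite -res_energy// addr_ge0 ?formB_ge0//.
by rewrite mulr_ge0 ?dot_ge0// ltW.
Qed.

Lemma res_norm lam f : 0 < lam -> L2 f ->
  lam ^+ 2 * dot (res lam f) (res lam f) <= dot f f.
Proof.
move=> l0 Lf; have Lr := res_L2 l0 Lf.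
have h1 : lam * dot (res lam f) (res lam f) <= dot (res lam f) f.
  by rewrite -res_energy// lerDr formB_ge0.
have h2 := dot_CS Lr Lf.
move: h1 h2 (dot_ge0 (res lam f)) (dot_ge0 f) (res_ge0 l0 Lf).
move: (dot (res lam f) (res lam f)) (dot (res lam f) f) (dot f f) => a b c h1 h2 a0 c0 b0.
move: a0; rewrite le0r => /orP[/eqP ->|a0]; first by rewrite mulr0.
rewrite -(ler_pM2r a0) (mulrC c); apply: le_trans h2.
have -> : lam ^+ 2 * a * a = (lam * a) ^+ 2 by ring.
by rewrite ler_pXn2r ?nnegrE ?mulr_ge0// ltW.
Qed.

Lemma res_norm_sqrt lam f : 0 < lam -> L2 f ->
  Num.sqrt (dot (res lam f) (res lam f)) <= lam^-1 * Num.sqrt (dot f f).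
Proof.
move=> l0 Lf; rewrite ler_pdivlMl// -[X in X * _ <= _]gtr0_norm// -sqrtr_sqr -sqrtrM ?sqr_ge0//.
by rewrite ler_sqrt ?dot_ge0// res_norm.
Qed.

(* <L (L + lam)^-1 z, z>, written without applying L. *)
Definition Lres lam z : R := dot z z - lam * dot (res lam z) z.

(* The right-hand side is minimal at p = lam (L + lam)^-1 z. *)
Lemma Lres_le lam z p : 0 < lam -> L2 z -> formD V p ->
  Lres lam z <= formB V 0 p p / lam + dot (fun g => p.1 g - z g) (fun g => p.1 g - z g).
Proof.
move=> l0 Lz Dp; have Dr := resp_form l0 Lz; have Lr := res_L2 l0 Lz.
have Lp := formD_L2 Dp.
have Dq : formD V ((- lam) *: resp lam z + p) by exact: formD_lin.
have h := resp_eq l0 Lz Dp; rewrite formB_addlam in h.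
have he := res_energy l0 Lz.
have hq : 0 <= formB V 0 ((- lam) *: resp lam z + p) ((- lam) *: resp lam z + p) / lam
    + dot (fun g => - lam * res lam z g + p.1 g) (fun g => - lam * res lam z g + p.1 g).
  by rewrite addr_ge0 ?dot_ge0// divr_ge0 ?formB_ge0// ltW.
have eB : formB V 0 ((- lam) *: resp lam z + p) ((- lam) *: resp lam z + p) =
    lam ^+ 2 * formB V 0 (resp lam z) (resp lam z) - 2 * lam * formB V 0 (resp lam z) p + formB V 0 p p.
  rewrite formB_lin// formB_sym formB_lin// (formB_sym V 0 p ((- lam) *: resp lam z + p)) formB_lin//.
  rewrite (formB_sym V 0 p (resp lam z)).
  by move: (formB V 0 _ _) (formB V 0 _ _) (formB V 0 _ _) => a b c; ring.
have ed : dot (fun g => - lam * res lam z g + p.1 g) (fun g => - lam * res lam z g + p.1 g) =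
   lam ^+ 2 * dot (res lam z) (res lam z) - 2 * lam * dot (res lam z) p.1 + dot p.1 p.1.
  rewrite dot_lin_sq//.
  by move: (dot _ _) (dot _ _) (dot _ _) => a b c; ring.
have ez : dot (fun g => p.1 g - z g) (fun g => p.1 g - z g) = dot p.1 p.1 - 2 * dot z p.1 + dot z z.
  by rewrite dot_sub_sq// (dotC p.1 z).
rewrite eB ed in hq; rewrite ez /Lres; rewrite -/(res lam z) in h.
move: h he hq.
move: (formB V 0 (resp lam z) (resp lam z)) (formB V 0 (resp lam z) p) (formB V 0 p p)
  (dot (res lam z) (res lam z)) (dot (res lam z) p.1) (dot p.1 p.1) (dot z p.1) (dot z z) (dot (res lam z) z).
move=> a b c d e f0 s t y h he hq.
rewrite -subr_ge0; apply: (le_trans hq); rewrite le_eqVlt; apply/orP; left; apply/eqP.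
by rewrite -h -he; field; rewrite gt_eqF.
Qed.

Lemma Lres_eq lam z : 0 < lam -> L2 z ->
  Lres lam z = formB V 0 (lam *: resp lam z) (lam *: resp lam z) / lam +
    dot (fun g => lam * res lam z g - z g) (fun g => lam * res lam z g - z g).
Proof.
move=> l0 Lz; have Dr := resp_form l0 Lz; have Lr := res_L2 l0 Lz.
have he := res_energy l0 Lz.
have L1 : L2 (fun g => lam * res lam z g) by exact: L2Z.
have eB : formB V 0 (lam *: resp lam z) (lam *: resp lam z) = lam ^+ 2 * formB V 0 (resp lam z) (resp lam z).
  have D0 := formD0 V0 mV; have B0 q : formD V q -> formB V 0 0 q = 0.
    by move=> Dq; have := formB_lin V0 mV 0 1 D0 D0 Dq; rewrite scaler0 addr0 mul1r => h; lra.
  have Dl : formD V (lam *: resp lam z) by rewrite -[X in formD V X]addr0; exact: formD_lin.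
  rewrite -{1}[lam *: resp lam z]addr0 formB_lin// B0// addr0 formB_sym.
  rewrite -{1}[lam *: resp lam z]addr0 formB_lin// B0// addr0.
  by rewrite mulrA.
have ez : dot (fun g => lam * res lam z g - z g) (fun g => lam * res lam z g - z g) =
    lam ^+ 2 * dot (res lam z) (res lam z) - 2 * lam * dot (res lam z) z + dot z z.
  rewrite dot_sub_sq// dotZl// dotZl// dotZr//.
  by move: (dot _ _) (dot _ _) (dot _ _) => a b c; ring.
rewrite eB ez /Lres; move: he.
move: (formB V 0 _ _) (dot (res lam z) (res lam z)) (dot (res lam z) z) (dot z z) => a b c d <-.
by field; rewrite gt_eqF.
Qed.

Lemma Lres_ge0 lam z : 0 < lam -> L2 z -> 0 <= Lres lam z.
Proof.
by move=> l0 Lz; rewrite Lres_eq// addr_ge0 ?dot_ge0// divr_ge0 ?formB_ge0// ltW.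
Qed.

Lemma Lres_bound lam z : 0 < lam -> L2 z -> Lres lam z <= dot z z.
Proof. by move=> l0 Lz; rewrite /Lres gerBl mulr_ge0 ?res_ge0// ltW. Qed.

(** The minimizer for lam is a competitor for m in [Lres_le], with its energy weighted by the
    smaller factor 1/m. This monotonicity does the work of a spectral measure. *)
Lemma Lres_nonincr lam m z : 0 < lam -> lam <= m -> L2 z -> Lres m z <= Lres lam z.
Proof.
move=> l0 lm Lz; have m0 := lt_le_trans l0 lm.
have Dr := resp_form l0 Lz.
have Dl : formD V (lam *: resp lam z).
  by rewrite -[X in formD V X]addr0; apply: formD_lin => //; exact: formD0.
apply: (le_trans (Lres_le m0 Lz Dl)); rewrite Lres_eq// lerD2r.
by rewrite ler_wpM2l ?formB_ge0// lef_pV2.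
Qed.

(** The weak form of (L + lam)^-1 L = 1 - lam (L + lam)^-1; it gives control of (L + lam)^-1 f for
    small lam. *)
Lemma schrodinger_res lam u f v : 0 < lam -> L2 u -> L2 v -> schrodinger V u f ->
  dot (res lam f) v = dot u v - lam * dot (res lam u) v.
Proof.
move=> l0 Lu Lv [Lf [U DU hU]].
have h1 := hU _ _ (resp_form l0 Lv).
have h2 := resp_eq l0 Lv (q := (u, U)) DU.
rewrite formVE// in h1; rewrite formB_addlam formB_sym in h2.
rewrite res_sym// -[dot f (res lam v)]h1 (res_sym l0 Lu Lv) (dotC u v) -h2 /formB /= mul0r addr0.
rewrite -/(res lam v) (dotC (res lam v) u).
by rewrite addrK.
Qed.

(* L is injective because V > 0 almost everywhere. *)
Lemma res_small z v (l_ : nat -> R) : (forall i, 0 < l_ i) -> l_ @ \oo --> 0 ->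
  {ae mu, forall g, 0 < V g} -> L2 z -> L2 v ->
  l_ i * dot (res (l_ i) z) v @[i --> \oo] --> 0.
Proof.
move=> l0 lc aeV Lz Lv.
pose w i g := l_ i * res (l_ i) z g.
have Lw i : L2 (w i) by apply: L2Z; exact: res_L2.
have wE i v' : L2 v' -> l_ i * dot (res (l_ i) z) v' = dot (w i) v'.
  by move=> Lv'; rewrite dotZl//; exact: res_L2.
have wn i : dot (w i) (w i) <= dot z z.
  apply: le_trans (res_norm (l0 i) Lz); rewrite /w dotZl//; [|exact: res_L2|exact: Lw].
  by rewrite dotC dotZl ?mulrA -?expr2//; exact: res_L2.
(* By the energy identity V^(1/2) w tends to 0 in norm, whereas w itself is only bounded. *)
have wV i : dot (sV V (w i)) (sV V (w i)) <= l_ i * dot z z.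
  have LVr := formD_L2V V0 mV (resp_form (l0 i) Lz).
  have -> : sV V (w i) = fun g => l_ i * sV V (res (l_ i) z) g.
    by apply/funext => g; rewrite /sV mulrCA.
  rewrite dotZl//; last exact: L2Z.
  rewrite dotC dotZl// ler_pM2l//.
  have h1 : l_ i * dot (sV V (res (l_ i) z)) (sV V (res (l_ i) z)) <= dot (w i) z.
    rewrite /w dotZl//; last exact: res_L2.
    rewrite ler_pM2l//; rewrite -res_energy//.
    apply: ler_wpDr; first by rewrite mulr_ge0 ?dot_ge0// ltW.
    exact: (@formB_ge_V _ _ V 0 (resp (l_ i) z)).
  apply: (le_trans h1).
  have h2 := dot_CS (Lw i) Lz; have h3 := wn i; have := dot_ge0 z => z0.
  have [wz|wz] := leP (dot (w i) z) 0; first exact: (le_trans wz).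
  rewrite -(@ler_pXn2r _ 2)// ?nnegrE ?(ltW wz)//; apply: (le_trans h2).
  by rewrite expr2 ler_wpM2r.
apply/cvgr0Pnorm_lt => e e0.
(* The function v is split at the set where V^(1/2) < 1/(K+1). The part of v on it is small for
   large K since V > 0 almost everywhere; off it v is V^(1/2) y with y in L2. *)
pose B (K : nat) : set H := [set g | Num.sqrt (V g) < K.+1%:R^-1].
have mB K : measurable (B K).
  rewrite (_ : B K = (fun g => Num.sqrt (V g)) @^-1` `]-oo, K.+1%:R^-1[%classic).
    by rewrite -[X in measurable X]setTI; exact: measurable_sqrtV.
  by apply/seteqP; split => g /=; rewrite in_itv.
pose rK K g := \1_(B K) g * v g.
have LrK K : L2 (rK K) by exact: L2_mul_indic.
have rKc : dot (rK K) v @[K --> \oo] --> (0 : R).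
  have cv g : rK K g @[K --> \oo] --> (\1_[set g | V g <= 0] g * v g).
    have [Vg|Vg] := leP (V g) 0.
      rewrite (_ : (fun K => _) = fun=> \1_[set g | V g <= 0] g * v g); first exact: cvg_cst.
      apply/funext => K; rewrite /rK !indicE !mem_set//= /B /=.
      by rewrite ler0_sqrtr.
    apply: cvg_near_cst.
    have s0 : 0 < Num.sqrt (V g) by rewrite sqrtr_gt0.
    have := @cvg_harmonic R; move/cvgr0Pnorm_lt => /(_ _ s0); apply: filterS => K.
    rewrite /= ger0_norm// => h; rewrite /rK !indicE !memNset//=.
      by apply/negP; rewrite -ltNge.
    by rewrite /B /= ; apply/negP; rewrite -leNgt ltW.
  have [Ll h] := dot_dominated_cvg (fun K => L2_measurable (LrK K)) Lv
    (fun K g => (ltac:(by rewrite /rK normrM indicE ler_piMl// ger0_norm// lern1 leq_b1) : `|rK K g| <= `|v g|)) cv Lv.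
  suff <- : dot (fun g => \1_[set g | V g <= 0] g * v g) v = 0 by [].
  rewrite (@dot_ae _ _ _ (fun=> 0)).
  - by rewrite /dot; under eq_Rintegral do rewrite mul0r; rewrite /Rintegral integral0.
  - by apply: filterS aeV => g Vg; rewrite indicE memNset ?mul0r//=; apply/negP; rewrite -ltNge.
  - exact: L2_measurable.
  - by [].
  - exact: L2_measurable.
have rK0 K : dot (rK K) (rK K) = dot (rK K) v.
  rewrite /dot; apply: eq_Rintegral => g _; rewrite /rK indicE.
  by case: (g \in B K) => /=; rewrite ?mul1r ?mul0r ?mulr0.
pose d := (e / 2) ^+ 2 / (dot z z + 1).
have z1 : 0 < dot z z + 1 by rewrite ltr_wpDl// dot_ge0.
have d0 : 0 < d by rewrite divr_gt0// exprn_gt0// divr_gt0.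
have [K hK] : exists K, dot (rK K) (rK K) < d.
  move/cvgr0Pnorm_lt : rKc => /(_ _ d0) [K _ hK]; exists K.
  by rewrite rK0; apply: le_lt_trans (hK K (leqnn K)); exact: ler_norm.
pose y g := \1_(~` B K) g * (Num.sqrt (V g))^-1 * v g.
have My g : `|(\1_(~` B K) : H -> R) g * (Num.sqrt (V g))^-1| <= K.+1%:R.
  rewrite indicE; have [|] := boolP (g \in ~` B K); last by rewrite mul0r normr0.
  rewrite inE /B /= => /negP; rewrite -leNgt => h.
  have s0 : 0 < Num.sqrt (V g) by rewrite (lt_le_trans _ h)// invr_gt0.
  by rewrite mul1r gtr0_norm ?invr_gt0// -[leRHS]invrK lef_pV2 ?posrE// invr_gt0.
have Ly : L2 y.
  apply: (L2_bounded_mul _ My) => //; apply: measurable_funM.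
    by apply: measurable_indic; exact: measurableC.
  rewrite (_ : (fun g => _) = (fun g => (V g `^ 2^-1) `^ (-1))).
    by apply: measurable_powR_comp; exact: measurable_powR_comp.
  by apply/funext => g; rewrite powR12_sqrt// powR_inv1// sqrtr_ge0.
have vE i : dot (w i) v = dot (w i) (rK K) + dot (sV V (w i)) y.
  have -> : dot (sV V (w i)) y = dot (w i) (fun g => \1_(~` B K) g * v g).
    rewrite /dot; apply: eq_Rintegral => g _; rewrite /sV /y indicE.
    have [|] := boolP (g \in ~` B K); last by rewrite !mul0r !mulr0.
    rewrite inE /B /= => /negP; rewrite -leNgt => h.
    have s0 : 0 < Num.sqrt (V g) by rewrite (lt_le_trans _ h)// invr_gt0.
    by rewrite !mul1r mulrACA mulfV ?mul1r ?gt_eqF.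
  rewrite -dotDr//; last by apply: L2_mul_indic => //; exact: measurableC.
  congr dot; apply/funext => g; rewrite /rK !indicE in_setC.
  by case: (g \in B K) => /=; rewrite ?mul1r ?mul0r ?addr0 ?add0r.
have LVw i : L2 (sV V (w i)).
  have LVr := formD_L2V V0 mV (resp_form (l0 i) Lz).
  have -> : sV V (w i) = fun g => l_ i * sV V (res (l_ i) z) g.
    by apply/funext => g; rewrite /sV mulrCA.
  exact: L2Z.
have c2 : dot (sV V (w i)) y @[i --> \oo] --> (0 : R).
  apply: (@sq_cvg0 _ _ l_ (dot z z * dot y y)) => // i.
  apply: (le_trans (dot_CS (LVw i) Ly)).
  by rewrite mulrAC ler_wpM2r ?dot_ge0// mulrC.
have e2 : 0 < e / 2 by rewrite divr_gt0.
move/cvgr0Pnorm_lt : c2 => /(_ _ e2); apply: filterS => i hi.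
rewrite wE// vE (splitr e); apply: (le_lt_trans (ler_normD _ _)); rewrite ltrD//.
rewrite -(@ltr_pXn2r _ 2)// ?nnegrE ?(ltW e2)// real_normK ?num_real//.
apply: (le_lt_trans (dot_CS (Lw i) (LrK K))).
apply: (@le_lt_trans _ _ (dot z z * dot (rK K) (rK K))); first by rewrite ler_wpM2r ?dot_ge0.
apply: (@le_lt_trans _ _ ((dot z z + 1) * dot (rK K) (rK K))).
  by rewrite ler_wpM2r ?dot_ge0// lerDl.
by rewrite mulrC -ltr_pdivlMr.
Qed.

(* Truncation at height M / lam does not increase the energy, so the minimizer
   is equal to its truncation. *)
Lemma res_bounded lam f M : 0 < lam -> L2 f -> 0 <= M -> (forall g, `|f g| <= M) ->
  {ae mu, forall g, `|res lam f g| <= M / lam}.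
Proof.
move=> l0 Lf M0 hf.
have Dr := resp_form l0 Lf; have Lr := res_L2 l0 Lf.
have ml0 : 0 <= M / lam by rewrite divr_ge0// ltW.
pose T (x : R) := Num.max (- (M / lam)) (Num.min (M / lam) x).
have mT : measurable_fun setT T by apply: measurable_maxr => //; exact: measurable_minr.
have T0 : T 0 = 0 by rewrite /T minEle; case: ltgtP ml0 => //= h _; rewrite maxEle; case: ltgtP => //; lra.
have Tid x : `|x| <= M / lam -> T x = x.
  by rewrite ler_norml => /andP[h1 h2]; rewrite /T (min_idPr h2) (max_idPr h1).
have TL x y : `|T x - T y| <= `|x - y|.
  exact: (le_trans (lip_max _ _ _) (lip_min _ _ _)).
have /choice[W hW] : forall k, exists w', [/\ L2 w', weak_X k (T \o res lam f) w' &
    dot w' w' <= dot ((resp lam f).2 k) ((resp lam f).2 k)].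
  move=> k; have [_ /(_ k)[LU wU] _] := Dr.
  exact: weak_X_contraction.
have Tle x : `|T x| <= `|x| by have := TL x 0; rewrite T0 !subr0.
have LVr := formD_L2V V0 mV Dr.
have mTr : measurable_fun setT (T \o res lam f).
  by apply: (measurableT_comp mT); exact: L2_measurable.
have sVle g : `|sV V (T \o res lam f) g| <= `|sV V (res lam f) g|.
  by rewrite /sV !normrM ler_wpM2l//; exact: Tle.
have DT : formD V (T \o res lam f, W).
  apply/(form_domP V0 mV); split => /=.
  - exact: (L2_dom mTr (fun g => Tle (res lam f g)) Lr).
  - by move=> k; have [] := hW k.
  - apply: (L2_dom _ sVle LVr); exact: measurable_sV.
have LT := formD_L2 DT.
have dot_le u v : L2 u -> L2 v -> (forall g, `|u g| <= `|v g|) -> dot u u <= dot v v.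
  move=> Lu Lv uv; rewrite -lee_fin !dotE//.
  apply: ge0_le_integral => //.
  - by move=> x _; rewrite lee_fin sqr_ge0.
  - by apply/measurable_EFinP; apply: measurable_funX; exact: L2_measurable.
  - by apply/measurable_EFinP; apply: measurable_funX; exact: L2_measurable.
  - move=> x _; rewrite lee_fin -real_normK ?num_real// -[leRHS]real_normK ?num_real//.
    by rewrite ler_pXn2r ?nnegrE.
(* Up to a constant the resolvent minimizes the energy plus lam times the squared distance to f /
   lam. As |f / lam| <= M / lam, the contraction T fixes f / lam, so it increases neither term. *)
pose f' g := lam^-1 * f g.
have Lf' : L2 f' by exact: L2Z.
have f'M g : `|f' g| <= M / lam by rewrite /f' normrM gtr0_norm ?invr_gt0// mulrC ler_wpM2r// invr_ge0 ltW.
pose p := resp lam f; pose q : E := (T \o res lam f, W).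
have Dd : formD V ((-1) *: p + q) by exact: formD_lin.
have hpp := resp_eq l0 Lf Dr; have hpq := resp_eq l0 Lf DT.
rewrite -/p formB_addlam in hpp; rewrite -/p formB_addlam in hpq.
have eB : formB V 0 ((-1) *: p + q) ((-1) *: p + q) = formB V 0 p p - 2 * formB V 0 p q + formB V 0 q q.
  rewrite formB_lin// formB_sym formB_lin// (formB_sym V 0 q ((-1) *: p + q)) formB_lin//.
  rewrite (formB_sym V 0 q p).
  by move: (formB V 0 _ _) (formB V 0 _ _) (formB V 0 _ _) => a b c; ring.
have B0 : 0 <= formB V 0 ((-1) *: p + q) ((-1) *: p + q) by exact: formB_ge0.
have Bqp : formB V 0 q q <= formB V 0 p p.
  rewrite /formB !mul0r !addr0 lerD//.
    by apply: ler_sum => k _; have [] := hW k.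
  by apply: dot_le => //; exact: formD_L2V DT.
have dqp : dot (fun g => q.1 g - f' g) (fun g => q.1 g - f' g) <= dot (fun g => p.1 g - f' g) (fun g => p.1 g - f' g).
  apply: dot_le; [exact: L2B|exact: L2B|].
  by move=> g; rewrite -{1}(Tid (f' g) (f'M g)); exact: TL.
have f'E u : L2 u -> lam * dot u f' = dot f u.
  by move=> Lu; rewrite dotC dotZl// mulrA mulfV ?mul1r// gt_eqF.
have z0 : dot (fun g => res lam f g - T (res lam f g)) (fun g => res lam f g - T (res lam f g)) = 0.
  apply/eqP; rewrite eq_le dot_ge0 andbT.
  rewrite (dot_sub_sq Lr LT).
  have i1 : dot (T \o res lam f) (T \o res lam f) - 2 * dot (T \o res lam f) f' + dot f' f' <=
      dot (res lam f) (res lam f) - 2 * dot (res lam f) f' + dot f' f'.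
    by rewrite -!dot_sub_sq.
  have e1 := f'E _ Lr; have e2 := f'E _ LT.
  rewrite eB in B0.
  have i2 : formB V 0 p p + lam * dot (res lam f) (res lam f) = dot f (res lam f) := hpp.
  have i3 : formB V 0 p q + lam * dot (res lam f) (T \o res lam f) = dot f (T \o res lam f) := hpq.
  move: i1 e1 e2 B0 Bqp i2 i3.
  move: (formB V 0 p p) (formB V 0 p q) (formB V 0 q q) => a b c.
  move: (dot f (res lam f)) (dot f (T \o res lam f)) (dot f' f') (dot (res lam f) (res lam f))
    (dot (T \o res lam f) (T \o res lam f)) (dot (res lam f) (T \o res lam f))
    (dot (res lam f) f') (dot (T \o res lam f) f').
  move=> d1 d2 ff rr tt rt rf tf i1 e1 e2 i4 i5 i2 i3.
  rewrite -(ler_pM2l l0) mulr0.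
  have i6 : lam * (tt - 2 * tf) <= lam * (rr - 2 * rf) by rewrite ler_pM2l//; lra.
  move: i6 i2 i3; rewrite -e1 -e2 !mulrDr !mulrN !(mulrCA lam 2).
  move: (lam * rr) (lam * tt) (lam * rt) (lam * rf) (lam * tf) => y1 y2 y3 y4 y5.
  by lra.
have LrT : L2 (fun g => res lam f g - T (res lam f g)) by exact: L2B.
have := dot_eq0_ae LrT z0; apply: filterS => g /subr0_eq ->.
rewrite ler_norml /T le_max lexx /= ge_max ge_min lexx /= andbT.
by rewrite (le_trans _ ml0)// oppr_le0.
Qed.

End resolvent.

(** * Frullani integrals *)

Section HalfLine.
Context {R : realType}.
Local Open Scope ereal_scope.
Local Notation leb := (@lebesgue_R R).
Local Notation D := (`]0%R, +oo[%classic : set R).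
Implicit Types (a b c d : R) (S : set R).

(** Kernels are written with |x|^-1 rather than x^-1 to be nonnegative on the whole line, as the
    changes of variables require. *)
Lemma measurable_inv_norm : measurable_fun setT (fun x : R => `|x|^-1)%R.
Proof.
have -> : (fun x : R => `|x|^-1)%R = (fun x => powR `|x| (-1)).
  by apply/funext => x; rewrite powRN powRr1.
apply: (measurableT_comp (f := (@powR R)^~ (-1)%R)); first exact: measurable_powR.
exact: normr_measurable.
Qed.

Lemma ge0_integral_scale a S (f : R -> \bar R) : (0 < a)%R -> measurable S ->
  measurable_fun setT f -> (forall x, 0 <= f x) ->
  \int[leb]_(x in [set x | S (a * x)%R]) f (a * x)%R = (a^-1)%:E * \int[leb]_(x in S) f x.
Proof.
move=> a0 mS mf f0; rewrite integral_mkcond [in RHS]integral_mkcond.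
have := @ge0_integral_affine_R R a 0 (f \_ S) (lt0r_neq0 a0).
rewrite gtr0_norm// => <-.
- apply: eq_integral => x _; rewrite !patchE addr0.
  by congr (if _ then _ else _); apply/idP/idP; rewrite !inE.
- exact/(measurable_restrictT f mS)/measurable_funTS.
- exact: erestrict_ge0.
Qed.

Lemma scale_itv a c d : (0 < a)%R ->
  [set x : R | (a * x)%R \in `[a * c, a * d[%R] = `[c, d[%classic.
Proof.
move=> a0; apply/seteqP; split => x /=; rewrite !in_itv/=.
  by rewrite ler_pM2l// ltr_pM2l.
by rewrite ler_pM2l// ltr_pM2l.
Qed.

Lemma ge0_integral_scale_itv a c d (f : R -> \bar R) : (0 < a)%R ->
  measurable_fun setT f -> (forall x, 0 <= f x) ->
  \int[leb]_(x in `[c, d[) f (a * x)%R = (a^-1)%:E * \int[leb]_(x in `[(a * c)%R, (a * d)%R[) f x.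
Proof.
move=> a0 mf f0; rewrite -ge0_integral_scale//.
by congr integral; rewrite -(scale_itv c d a0).
Qed.

Lemma ge0_integral_scale_pos a (f : R -> \bar R) : (0 < a)%R ->
  measurable_fun setT f -> (forall x, 0 <= f x) ->
  \int[leb]_(x in D) f (a * x)%R = (a^-1)%:E * \int[leb]_(x in D) f x.
Proof.
move=> a0 mf f0; rewrite -ge0_integral_scale//.
by congr integral; apply/seteqP; split => x /=; rewrite !in_itv/= !andbT pmulr_rgt0.
Qed.

Lemma itv_split (f : R -> \bar R) a b c : (a <= b)%R -> (b <= c)%R -> measurable_fun setT f ->
  (forall x, 0 <= f x) ->
  \int[leb]_(x in `[a, c[) f x = \int[leb]_(x in `[a, b[) f x + \int[leb]_(x in `[b, c[) f x.
Proof.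
move=> ab bc mf f0; rewrite -ge0_integral_setU//=.
- by congr integral; rewrite -itv_bndbnd_setU// bnd_simp.
- exact: measurable_funTS.
- apply/disj_setPS => x [] /=; rewrite !in_itv/= => /andP[_ h1] /andP[h2 _].
  by move: (lt_le_trans h1 h2); rewrite ltxx.
Qed.

(** This is log a for a >= 1. It stays an integral, since only invariance under scaling, finiteness
    and positivity are used. *)
Definition logk a : \bar R := \int[leb]_(x in `[1%R, a[) (`|x|^-1)%:E.

Lemma logk_ge0 a : 0 <= logk a.
Proof. by apply: integral_ge0 => x _; rewrite lee_fin invr_ge0. Qed.

Lemma leb_itv a b : (a <= b)%R -> leb `[a, b[%classic = (b - a)%:E.
Proof.
move=> ab; rewrite /lebesgue_R (@lebesgue_measure_itv R `[a, b[) /= lte_fin.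
by move: ab; rewrite le_eqVlt => /predU1P[->|->]//; rewrite ltxx subrr.
Qed.

Lemma measurable_einv_norm : measurable_fun setT (fun x : R => (`|x|^-1)%:E).
Proof. by apply/measurable_EFinP; exact: measurable_inv_norm. Qed.

Lemma logk_le a : (1 <= a)%R -> logk a <= (a - 1)%:E.
Proof.
move=> a1; rewrite /logk -leb_itv// -[leRHS]mul1e -integral_cst//.
apply: ge0_le_integral => //=.
- exact: measurable_funTS measurable_einv_norm.
- move=> x; rewrite in_itv/= => /andP[x1 _]; rewrite lee_fin.
  by rewrite invf_le1 ger0_norm ?(le_trans _ x1)// (lt_le_trans _ x1).
Qed.

Lemma logk_fin a : (1 <= a)%R -> logk a \is a fin_num.
Proof.
move=> a1; rewrite ge0_fin_numE ?logk_ge0//.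
by apply: le_lt_trans (logk_le a1) _; rewrite ltry.
Qed.

Lemma logk_scale a c : (0 < c)%R ->
  \int[leb]_(x in `[(c)%R, (c * a)%R[) (`|x|^-1)%:E = logk a.
Proof.
move=> c0.
have h := ge0_integral_scale_itv 1%R a c0 measurable_einv_norm (fun x => _).
rewrite mulr1 in h.
rewrite -[LHS]mul1e -(mulfV (lt0r_neq0 c0)) EFinM -muleA -h; last first.
  by move=> x; rewrite lee_fin invr_ge0.
rewrite -ge0_integralZl//.
- apply: eq_integral => x _; rewrite -EFinM normrM invfM gtr0_norm//.
  by rewrite mulrA mulfV ?mul1r// gt_eqF.
- apply: measurable_funTS; apply: (measurableT_comp (f := fun x : R => (`|x|^-1)%:E)).
    exact: measurable_einv_norm.
  exact: measurable_funM.
- by rewrite lee_fin ltW.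
Qed.

Section frullani.
Variables (F : R -> R) (A B : R).
Hypotheses (Fni : nonincreasing_fun F) (F0 : forall x, (0 <= F x)%R).
Hypotheses (FA : F x @[x --> 0%R^'+] --> A) (FB : F x @[x --> +oo%R] --> B).

Let mF : measurable_fun setT F.
Proof. exact: nonincreasing_measurable. Qed.

Let mFx a : measurable_fun setT (fun x : R => (F (a * x) * `|x|^-1)%:E).
Proof.
apply/measurable_EFinP/measurable_funM; last exact: measurable_inv_norm.
by apply: (measurableT_comp mF); exact: measurable_funM.
Qed.

Let mF1 : measurable_fun setT (fun x : R => (F x * `|x|^-1)%:E).
Proof. by have := mFx 1; under eq_fun do rewrite mul1r. Qed.

Let Fx0 a (x : R) : 0 <= (F (a * x) * `|x|^-1)%:E.
Proof. by rewrite lee_fin mulr_ge0// invr_ge0. Qed.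

Let F10 (x : R) : 0 <= (F x * `|x|^-1)%:E.
Proof. by rewrite lee_fin mulr_ge0// invr_ge0. Qed.

Let al a c := \int[leb]_(x in `[(c)%R, (c * a)%R[) (F x * `|x|^-1)%:E.

Let al_bound a c : (0 < c)%R -> (1 <= a)%R ->
  (F (c * a))%:E * logk a <= al a c <= (F c)%:E * logk a.
Proof.
move=> c0 a1; rewrite -(logk_scale a c0) /al -!ge0_integralZl ?lee_fin//; first last.
- exact: measurable_funTS measurable_einv_norm.
- exact: measurable_funTS measurable_einv_norm.
apply/andP; split; apply: ge0_le_integral => //=.
- by move=> x _; rewrite -EFinM lee_fin mulr_ge0// invr_ge0.
- by apply: emeasurable_funM => //; exact: measurable_funTS measurable_einv_norm.
- exact: measurable_funTS.
- move=> x; rewrite in_itv/= => /andP[x1 x2]; rewrite -EFinM lee_fin.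
  by rewrite ler_wpM2r ?invr_ge0// Fni// ltW.
- exact: measurable_funTS.
- by apply: emeasurable_funM => //; exact: measurable_funTS measurable_einv_norm.
- move=> x; rewrite in_itv/= => /andP[x1 x2]; rewrite -EFinM lee_fin.
  by rewrite ler_wpM2r ?invr_ge0// Fni// ltW.
Qed.

Let al_fin a c : (0 < c)%R -> (1 <= a)%R -> al a c \is a fin_num.
Proof.
move=> c0 a1; have /andP[_ h] := al_bound c0 a1.
rewrite ge0_fin_numE; last by apply: integral_ge0.
apply: le_lt_trans h _; rewrite -(fineK (logk_fin a1)) -EFinM ltry.
by [].
Qed.

Let al_cvg a (c_ : nat -> R) (l : R) : (1 <= a)%R -> (forall m, 0 < c_ m)%R ->
  F (c_ m) @[m --> \oo] --> l -> F (c_ m * a)%R @[m --> \oo] --> l ->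
  fine (al a (c_ m)) @[m --> \oo] --> (l * fine (logk a))%R.
Proof.
move=> a1 c0 h1 h2.
have hb m : (F (c_ m * a) * fine (logk a) <= fine (al a (c_ m)) <= F (c_ m) * fine (logk a))%R.
  have := al_bound (c0 m) a1.
  rewrite -(fineK (logk_fin a1)) -(fineK (al_fin (c0 m) a1)) -!EFinM !lee_fin.
  by [].
apply: (@squeeze_cvgr _ _ _ _ (fun m => (F (c_ m * a) * fine (logk a))%R)
   (fun m => (F (c_ m) * fine (logk a))%R)).
- by apply: nearW => m; exact: hb.
- by apply: cvgMl.
- by apply: cvgMl.
Qed.

Let I a := \int[leb]_(x in D) ((F x - F (a * x)) * `|x|^-1)%:E.

(** Rescaling turns the second part into an integral over [c a, d a[, so only the end pieces [c, c
    a[ and [d, d a[ remain. Stating this as a sum avoids a subtraction of possibly infinite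
    values. *)
Let split_al a c d : (1 <= a)%R -> (0 < c)%R -> (c <= d)%R ->
  \int[leb]_(x in `[(c)%R, (d)%R[) ((F x - F (a * x)) * `|x|^-1)%:E + al a d = al a c.
Proof.
move=> a1 c0 cd; have a0 : (0 < a)%R by apply: lt_le_trans a1.
have d0 : (0 < d)%R by apply: lt_le_trans cd.
have e1 : \int[leb]_(x in `[(c)%R, (d)%R[) (F x * `|x|^-1)%:E =
  \int[leb]_(x in `[(c)%R, (d)%R[) ((F x - F (a * x)) * `|x|^-1)%:E +
  \int[leb]_(x in `[(c)%R, (d)%R[) (F (a * x) * `|x|^-1)%:E.
  rewrite -ge0_integralD//=.
  - by apply: eq_integral => x _; rewrite -EFinD -mulrDl subrK.
  - move=> x; rewrite in_itv/= => /andP[x1 x2]; rewrite lee_fin mulr_ge0 ?invr_ge0//.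
    by rewrite subr_ge0 Fni// ler_peMl// (le_trans (ltW c0)).
  - apply: measurable_funTS; apply/measurable_EFinP/measurable_funM; last exact: measurable_inv_norm.
    apply: measurable_funB => //.
    by apply: (measurableT_comp mF); exact: measurable_funM.
  - exact: measurable_funTS.
have e2 : \int[leb]_(x in `[(c)%R, (d)%R[) (F (a * x) * `|x|^-1)%:E =
   \int[leb]_(x in `[(c * a)%R, (d * a)%R[) (F x * `|x|^-1)%:E.
  transitivity (\int[leb]_(x in `[(c)%R, (d)%R[) (a%:E * ((F (a * x) * `|(a * x)%R|^-1)%:E))).
    apply: eq_integral => x _; rewrite -EFinM; congr EFin.
    by rewrite normrM invfM (gtr0_norm a0) [RHS]mulrCA mulVKf// gt_eqF.
  rewrite ge0_integralZl//=.
  - rewrite (ge0_integral_scale_itv c d a0 mF1 F10).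
    by rewrite muleA -EFinM mulfV ?mul1e ?gt_eqF// ![(_ * a)%R]mulrC.
  - by apply: measurable_funTS; apply: (measurableT_comp mF1); exact: measurable_funM.
  - by rewrite lee_fin ltW.
have cc : (c <= c * a)%R by rewrite ler_peMr// ltW.
have dd : (d <= d * a)%R by rewrite ler_peMr// ltW.
have cd' : (c * a <= d * a)%R by rewrite ler_pM2r.
have e3 := itv_split cd dd mF1 F10.
have e4 := itv_split cc cd' mF1 F10.
have fin : \int[leb]_(x in `[(c * a)%R, (d * a)%R[) (F x * `|x|^-1)%:E \is a fin_num.
  have [m hm] : exists m : R, (1 <= m)%R /\ (d * a = c * m)%R.
    exists (d * a / c)%R; split; last by rewrite [RHS]mulrC mulfVK ?gt_eqF.
    by rewrite ler_pdivlMr// mul1r (le_trans cd).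
  have [m1 em] := hm; have := al_fin c0 m1.
  rewrite /al -em e4 => h; rewrite ge0_fin_numE; last exact: integral_ge0.
  apply: (@le_lt_trans _ _ (\int[leb]_(x in `[c, (c * a)%R[) (F x / `|x|)%:E +
    \int[leb]_(x in `[(c * a)%R, (d * a)%R[) (F x / `|x|)%:E)).
    by rewrite leeDr//; exact: integral_ge0.
  by rewrite -ge0_fin_numE//; apply: adde_ge0; exact: integral_ge0.
rewrite -[in LHS]/(al a d) -[in RHS]/(al a c) in e3 e4 *.
move: e3; rewrite e1 e2 e4 -/(al a c) -/(al a d) => e3.
by move: e3; rewrite addeAC => e3; rewrite -[LHS](addeK _ fin) -e3 addeK.
Qed.

(** The half-line is exhausted by [1/(m+1), m+1[. By [split_al] each integral is the difference of
    the end pieces, and [al a c] is squeezed between F (c a) log a and F c log a. *)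
Let I_gt1 a : (1 <= a)%R -> I a = ((A - B)%:E * logk a).
Proof.
move=> a1; have a0 : (0 < a)%R by apply: lt_le_trans a1.
pose c_ (m : nat) : R := (m.+1%:R^-1)%R; pose d_ (m : nat) : R := m.+1%:R%R.
have c0 m : (0 < c_ m)%R by rewrite invr_gt0.
have d0 m : (0 < d_ m)%R by [].
have cd m : (c_ m <= d_ m)%R.
  by apply: (@le_trans _ _ 1%R); rewrite ?invf_le1 ?ler1n.
have cc : c_ @ \oo --> 0%R by exact: cvg_harmonic.
have dd : d_ @ \oo --> +oo%R.
  by apply/cvgryPge => r; apply: filterS (nbhs_infty_ger r) => m h; rewrite (le_trans h)// ler_nat.
have hA (b : R) : (0 < b)%R -> F (c_ m * b)%R @[m --> \oo] --> A.
  move=> b0; apply: ((cvg_at_rightP F 0%R A).1 FA (fun m => c_ m * b)%R); split.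
    by move=> m; rewrite mulr_gt0.
  by rewrite -[X in _ --> X](mul0r b); apply: cvgMl.
have hB (b : R) : (0 < b)%R -> F (d_ m * b)%R @[m --> \oo] --> B.
  move=> b0; apply: ((cvg_pinftyP F B).1 FB (fun m => d_ m * b)%R).
  by apply/cvgryPge => r; move/cvgryPge : dd => /(_ (r / b)%R); apply: filterS => m; rewrite ler_pdivrMr.
have h1 := al_cvg a1 c0 _ (hA _ a0).
have h2 := al_cvg a1 d0 _ (hB _ a0).
have {}h1 : fine (al a (c_ m)) @[m --> \oo] --> (A * fine (logk a))%R.
  by apply: h1; under eq_fun do rewrite -[c_ _]mulr1; exact: hA.
have {}h2 : fine (al a (d_ m)) @[m --> \oo] --> (B * fine (logk a))%R.
  by apply: h2; under eq_fun do rewrite -[d_ _]mulr1; exact: hB.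
pose E_ (m : nat) : set R := `[c_ m, d_ m[%classic.
have mI : measurable_fun setT (fun x : R => ((F x - F (a * x)) * `|x|^-1)%:E).
  apply/measurable_EFinP/measurable_funM; last exact: measurable_inv_norm.
  apply: measurable_funB => //.
  by apply: (measurableT_comp mF); exact: measurable_funM.
have EU : \bigcup_m E_ m = D.
  apply/seteqP; split => x /=.
    by move=> [m _]; rewrite /E_/= !in_itv/= andbT => /andP[h _]; exact: lt_le_trans h.
  rewrite in_itv/= andbT => x0.
  have [m hm] : exists m, (c_ m <= x /\ x < d_ m)%R.
    near \oo => m; exists m; split; near: m.
      by near do apply: ltW; move/cvgrPdist_lt : cc => /(_ x x0); apply: filterS => m; rewrite sub0r normrN gtr0_norm.
    by move/cvgryPgt : dd; exact.
  by exists m => //; rewrite /E_/= in_itv/=; case: hm => -> ->.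
have hI := @ge0_nondecreasing_set_cvg_integral _ R R E_ (fun x => ((F x - F (a * x)) * `|x|^-1)%:E) leb.
rewrite EU in hI.
have {}hI : \int[leb]_(x in E_ m) ((F x - F (a * x)) * `|x|^-1)%:E @[m --> \oo] --> I a.
  apply: hI.
  - apply/nondecreasing_seqP => m; rewrite subsetEset => x; rewrite /E_/= !in_itv/= => /andP[h3 h4].
    apply/andP; split.
      by apply: le_trans h3; rewrite /c_ lef_pV2 ?posrE// ler_nat.
    by apply: lt_le_trans h4 _; rewrite ler_nat.
  - by move=> m; exact: measurable_itv.
  - by move=> m; exact: measurable_funTS.
  - move=> m x; rewrite /E_/= in_itv/= => /andP[h3 h4].
    rewrite lee_fin mulr_ge0 ?invr_ge0// subr_ge0 Fni// ler_peMl//.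
    by apply: ltW; exact: lt_le_trans h3.
have hE m : \int[leb]_(x in E_ m) ((F x - F (a * x)) * `|x|^-1)%:E
   = (fine (al a (c_ m)) - fine (al a (d_ m)))%:E.
  rewrite EFinB !fineK ?al_fin// -(split_al a1 (c0 m) (cd m)) addeK// al_fin//.
have hl : \int[leb]_(x in E_ m) ((F x - F (a * x)) * `|x|^-1)%:E @[m --> \oo] -->
    (A * fine (logk a) - B * fine (logk a))%:E.
  under eq_fun do rewrite hE.
  by apply: cvg_EFin; [exact: nearW|exact: cvgB].
rewrite (cvg_unique (@ereal_hausdorff R) hI hl).
by rewrite -mulrBl EFinM fineK ?logk_fin.
Unshelve. all: by end_near.
Qed.

(** Monotonicity of F gives the integrand a constant sign for each a. The case a < 1 reduces to a^-1
    by the substitution of x / a for x. *)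
Lemma frullani a : (0 < a)%R ->
  \int[leb]_(x in D) (`|F x - F (a * x)| * `|x|^-1)%:E =
  (A - B)%:E * logk (Num.max a a^-1)%R.
Proof.
move=> a0; have [a1|a1] := leP 1%R a.
  have -> : (Num.max a a^-1 = a)%R.
    by apply/max_idPl; apply: (@le_trans _ _ 1%R) => //; rewrite invf_le1.
  rewrite -I_gt1//; apply: eq_integral => x; rewrite inE/= in_itv/= andbT => x0.
  by rewrite ger0_norm// subr_ge0 Fni// ler_peMl// ltW.
have a1' : (1 <= a^-1)%R by rewrite invf_ge1// ltW.
have -> : (Num.max a a^-1 = a^-1)%R.
  by apply/max_idPr; apply: (@le_trans _ _ 1%R) => //; exact: ltW.
have ai0 : (0 < a^-1)%R by rewrite invr_gt0.
rewrite -I_gt1//.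
have mG : measurable_fun setT (fun x : R => (`|F x - F (a * x)| * `|x|^-1)%:E).
  apply/measurable_EFinP/measurable_funM; last exact: measurable_inv_norm.
  apply: (measurableT_comp (@normr_measurable _ _)); apply: measurable_funB => //.
  by apply: (measurableT_comp mF); exact: measurable_funM.
have G0 (x : R) : 0 <= (`|F x - F (a * x)| * `|x|^-1)%:E.
  by rewrite lee_fin mulr_ge0// invr_ge0.
have := ge0_integral_scale_pos ai0 mG G0; rewrite invrK => e.
rewrite -[LHS]mul1e -(mulVf (lt0r_neq0 a0)) EFinM -muleA -e -ge0_integralZl//.
- apply: eq_integral => x; rewrite inE/= in_itv/= andbT => x0.
  rewrite -EFinM; congr EFin.
  rewrite mulrA divff ?gt_eqF// mul1r normrM invfM (gtr0_norm ai0) invrK.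
  rewrite [X in (_ * X)%R = _]mulrCA mulKf ?gt_eqF// distrC.
  by congr (_ * _)%R; rewrite ger0_norm// subr_ge0 Fni// ler_peMl// ltW.
- by apply: measurable_funTS; apply: (measurableT_comp mG); exact: measurable_funM.
- by rewrite lee_fin ltW.
Qed.

End frullani.
End HalfLine.

(** * The double Frullani integral *)

Section DoubleIntegral.
Context {R : realType}.
Local Open Scope ereal_scope.
Local Notation leb := (@lebesgue_R R).
Local Notation D := (`]0%R, +oo[%classic : set R).
Local Notation hh x := (x `^ (- 2^-1))%R.

(** The maximum with 1 makes the logarithm finite and monotone on the whole line, hence
    measurable. *)
Definition logr (a : R) : R := fine (logk (Num.max 1 a)%R).

Lemma max1_ge1 (a : R) : (1 <= Num.max 1 a)%R.
Proof. by rewrite le_max lexx. Qed.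

Lemma logrE (a : R) : (1 <= a)%R -> logk a = (logr a)%:E.
Proof. by move=> a1; rewrite /logr (max_idPr a1) fineK// logk_fin. Qed.

Lemma logr_ge0 (a : R) : (0 <= logr a)%R.
Proof. by rewrite fine_ge0// logk_ge0. Qed.

Lemma logr_le : nondecreasing_fun logr.
Proof.
move=> a b ab; rewrite fine_le ?logk_fin ?max1_ge1//.
apply: ge0_subset_integral => //=.
- exact: measurable_funTS measurable_einv_norm.
- move=> x; rewrite /= !in_itv/= => /andP[-> h] /=; apply: lt_le_trans h _.
  by rewrite ge_max max1_ge1/= le_max ab orbT.
Qed.

Lemma measurable_logr : measurable_fun setT logr.
Proof. by apply: nondecreasing_measurable => //; exact: logr_le. Qed.

Lemma measurable_hh : measurable_fun setT (fun x : R => hh x).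
Proof. exact: measurable_powR. Qed.

(** In the variable s = y / x, the kernel (x y)^(-1/2) |y - x|^-1 dy becomes [kern s] ds / x. *)
Definition kern (s : R) : R := (hh s * `|s - 1|^-1)%R.

Lemma measurable_inv_norm_comp d (T : measurableType d) (f : T -> R) :
  measurable_fun setT f -> measurable_fun setT (fun x => `|f x|^-1)%R.
Proof. by move=> mf; apply: (measurableT_comp measurable_inv_norm). Qed.

Lemma measurable_kern : measurable_fun setT kern.
Proof.
apply: measurable_funM; first exact: measurable_hh.
by apply: measurable_inv_norm_comp; exact: measurable_funB.
Qed.

Lemma kern_ge0 s : (0 <= kern s)%R.
Proof. by rewrite mulr_ge0 ?powR_ge0// invr_ge0. Qed.

Lemma measurable_inv : measurable_fun setT (fun x : R => x^-1)%R.
Proof.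
have -> : (fun x : R => x^-1)%R = (fun x => Num.sg x * `|x|^-1)%R.
  apply/funext => x; have [->|x0] := eqVneq x 0%R; first by rewrite normr0 invr0 mulr0.
  by apply: (mulfI x0); rewrite mulfV// mulrA [(x * _)%R]mulrC -normrEsg mulfV ?normr_eq0.
apply: measurable_funM; last exact: measurable_inv_norm.
apply: nondecreasing_measurable => // x y xy.
case: (sgrP x) => hx; case: (sgrP y) => hy //; try lra.
Qed.

(* This integral is pi^2, which makes the constant of [inv_sqrt_half] equal
   to 1; only 0 < kern_int < +oo matters. *)
Definition kern_int : \bar R :=
  \int[leb]_(s in D) (kern s * logr (Num.max s s^-1))%:E.

Lemma tonelli_pos (G : R * R -> \bar R) : measurable_fun setT G -> (forall z, 0 <= G z) ->
  \int[leb]_(x in D) \int[leb]_(y in D) G (x, y) =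
  \int[leb]_(y in D) \int[leb]_(x in D) G (x, y).
Proof.
move=> mG G0.
have mD : measurable D by exact: measurable_itv.
pose G1 := G \_ (D `*` D).
have mG1 : measurable_fun setT G1.
  apply/(measurable_restrictT G); first exact: measurableX.
  exact: measurable_funTS.
have G10 z : 0 <= G1 z by apply: erestrict_ge0.
have e1 x : x \in D -> \int[leb]_(y in D) G (x, y) = \int[leb]_y G1 (x, y).
  move=> xD; rewrite integral_mkcond; apply: eq_integral => y _.
  by rewrite /G1 !patchE in_setX/= xD.
have e2 y : y \in D -> \int[leb]_(x in D) G (x, y) = \int[leb]_x G1 (x, y).
  move=> yD; rewrite integral_mkcond; apply: eq_integral => x _.
  by rewrite /G1 !patchE in_setX/= yD andbT.
transitivity (\int[leb]_x \int[leb]_y G1 (x, y)).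
  rewrite integral_mkcond; apply: eq_integral => x _; rewrite patchE; case: ifPn => xD.
    exact: e1.
  rewrite integral0_eq// => y _; rewrite /G1 patchE in_setX/=.
  by rewrite (negbTE xD).
rewrite (@fubini_tonelli _ _ _ _ R leb leb G1 mG1 G10).
rewrite [RHS]integral_mkcond; apply: eq_integral => y _; rewrite patchE; case: ifPn => yD.
  by rewrite e2.
rewrite integral0_eq// => x _; rewrite /G1 patchE in_setX/=.
by rewrite (negbTE yD) andbF.
Qed.

Lemma measurable_int_pos (G : R * R -> \bar R) : measurable_fun setT G -> (forall z, 0 <= G z) ->
  measurable_fun setT (fun x => \int[leb]_(y in D) G (x, y)).
Proof.
move=> mG G0.
have mD : measurable D by exact: measurable_itv.
pose G1 := G \_ (setT `*` D).
have mG1 : measurable_fun setT G1.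
  apply/(measurable_restrictT G); first exact: measurableX.
  exact: measurable_funTS.
have G10 z : 0 <= G1 z by apply: erestrict_ge0.
have := @measurable_fun_fubini_tonelli_F _ _ _ _ R leb G1 mG1 G10.
congr (measurable_fun setT _); apply/funext => x; rewrite [RHS]integral_mkcond.
apply: eq_integral => y _; rewrite /G1 !patchE in_setX/=.
by rewrite in_setT.
Qed.

Definition W (F : R -> R) (x y : R) : \bar R :=
  (hh x * hh y * (`|F x - F y| * `|y - x|^-1))%:E.

Lemma W_ge0 F x y : 0 <= W F x y.
Proof. by rewrite lee_fin !mulr_ge0 ?powR_ge0// invr_ge0. Qed.

Lemma measurable_W F : measurable_fun setT F -> measurable_fun setT (fun z : R * R => W F z.1 z.2).
Proof.
move=> mF; apply/measurable_EFinP/measurable_funM.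
  by apply: measurable_funM; apply: (measurableT_comp measurable_hh).
apply: measurable_funM.
  apply: (measurableT_comp (@normr_measurable _ _)).
  by apply: measurable_funB; apply: (measurableT_comp mF).
by apply: measurable_inv_norm_comp; exact: measurable_funB.
Qed.

Section frullani_double.
Variables (F : R -> R) (A B : R).
Hypotheses (Fni : nonincreasing_fun F) (F0 : forall x, (0 <= F x)%R).
Hypotheses (FA : F x @[x --> 0%R^'+] --> A) (FB : F x @[x --> +oo%R] --> B).

(* Substituting y = s x and exchanging the integrals leaves, for each s, a
   Frullani integral in x with value (A - B) |log s|. *)
Lemma double_frullani :
  \int[leb]_(x in D) \int[leb]_(y in D) W F x y = (A - B)%:E * kern_int.
Proof.
have mF : measurable_fun setT F by exact: nonincreasing_measurable.
pose G (z : R * R) : \bar R := (kern z.2 * (`|F z.1 - F (z.2 * z.1)| * `|z.1|^-1))%:E.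
have G0 z : 0 <= G z by rewrite lee_fin mulr_ge0 ?kern_ge0// mulr_ge0// invr_ge0.
have mG : measurable_fun setT G.
  apply/measurable_EFinP/measurable_funM; first exact: (measurableT_comp measurable_kern).
  apply: measurable_funM; last exact: measurable_inv_norm_comp.
  apply: (measurableT_comp (@normr_measurable _ _)).
  apply: measurable_funB; first exact: (measurableT_comp mF).
  by apply: (measurableT_comp mF); exact: measurable_funM.
transitivity (\int[leb]_(x in D) \int[leb]_(y in D) G (x, y)).
  apply: eq_integral => x; rewrite inE/= in_itv/= andbT => x0.
  have mW : measurable_fun setT (W F x).
    exact: (measurableT_comp (measurable_W mF) (measurable_pair1 x)).
  have := @ge0_integral_scale_pos R x (W F x) x0 mW (W_ge0 F x).
  move=> e; rewrite -[LHS]mul1e -(mulfV (lt0r_neq0 x0)) EFinM -muleA -e -ge0_integralZl//.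
  - apply: eq_integral => y; rewrite inE/= in_itv/= andbT => y0.
    rewrite /W /G -EFinM /= /kern; congr EFin.
    rewrite powRM ?ltW// [(y * x)%R]mulrC.
    have -> : (x * y - x = x * (y - 1))%R by ring.
    rewrite normrM invfM (gtr0_norm x0).
    have h : (hh x * hh x * x = 1)%R.
      rewrite -powRD; last by rewrite [in X in _ ==> X]gt_eqF ?implybT.
      have -> : (- 2^-1 - 2^-1 = -1 :> R)%R by field.
      by rewrite powR_inv1 ?ltW// mulVf// gt_eqF.
    transitivity ((hh x * hh x * x) * (hh y * `|(y - 1)%R|^-1 * (`|(F x - F (x * y))%R| * x^-1)))%R.
      have aux (a b c d e' z : R) : (z * (a * (a * b) * (c * (e' * d))) = a * a * z * (b * d * (c * e')))%R by ring.
      exact: aux.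
    by rewrite h mul1r.
  - by apply: measurable_funTS; apply: (measurableT_comp mW); exact: measurable_funM.
  - by move=> y _; exact: W_ge0.
  - by rewrite lee_fin ltW.
rewrite tonelli_pos// -ge0_integralZl//=.
- apply: eq_integral => s; rewrite inE/= in_itv/= andbT => s0.
  rewrite EFinM muleCA -logrE.
    rewrite -(frullani Fni F0 FA FB s0) -ge0_integralZl//.
    - by apply: measurable_funTS; apply/measurable_EFinP/measurable_funM; last exact: measurable_inv_norm;
      apply: (measurableT_comp (@normr_measurable _ _)); apply: measurable_funB => //;
      apply: (measurableT_comp mF); exact: measurable_funM.
    - by rewrite lee_fin kern_ge0.
  rewrite le_max; case: (leP 1%R s) => //= h.
  by rewrite invf_ge1// ltW.
- apply: measurable_funTS; apply/measurable_EFinP/measurable_funM; first exact: measurable_kern.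
  apply: (measurableT_comp measurable_logr); apply: measurable_maxr => //.
  exact: measurable_inv.
- by move=> s _; rewrite lee_fin mulr_ge0 ?kern_ge0 ?logr_ge0.
- rewrite lee_fin subr_ge0.
  apply: (@le_trans _ _ (F 1)).
    rewrite -(cvg_lim _ FB)//; apply: limr_le; first by apply/cvg_ex; exists B.
    by near=> b; apply: Fni; near: b; exact: nbhs_pinfty_ge.
  rewrite -(cvg_lim _ FA)//; apply: limr_ge; first by apply/cvg_ex; exists A.
  by near=> b; apply: Fni; near: b; exact: nbhs_right_le.
Unshelve. all: by end_near.
Qed.

End frullani_double.

(** The common integrable majorant for the integrals over lam of lam^(-1/2) times a pairing with the
    resolvent: the pairing is bounded at 0 and O(1/lam) at infinity. *)
Definition phi (x : R) : R := (hh x * (1 + `|x|)^-1)%R.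

Lemma phi_ge0 x : (0 <= phi x)%R.
Proof. by rewrite mulr_ge0 ?powR_ge0// invr_ge0. Qed.

Lemma measurable_phi : measurable_fun setT phi.
Proof.
apply: measurable_funM; first exact: measurable_hh.
apply: (measurableT_comp measurable_inv); exact: measurable_funD.
Qed.

Section inv1.
Variable f : R -> R.
Hypotheses (fnd : nondecreasing_fun f) (f0 : forall x, (0 <= f x)%R).
Let F x := (1 + f x)^-1%R.

Let F_ni : nonincreasing_fun F.
Proof.
move=> x y xy; rewrite /F lef_pV2 ?posrE ?ltr_pwDl//.
by rewrite lerD2l fnd.
Qed.

Let F_ge0 x : (0 <= F x)%R.
Proof. by rewrite invr_ge0 addr_ge0. Qed.

Lemma double_frullani_inv :
  f x @[x --> 0%R^'+] --> (0 : R)%R -> f x @[x --> +oo%R] --> +oo%R ->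
  [/\ nonincreasing_fun F, forall x, (0 <= F x)%R,
     F x @[x --> 0%R^'+] --> (1 : R)%R & F x @[x --> +oo%R] --> (0 : R)%R].
Proof.
move=> h1 h2; split => //.
  have h3 : (1 + f x)%R @[x --> 0%R^'+] --> (1 : R)%R.
    by rewrite -[X in _ --> X](addr0 1%R); apply: cvgD => //; exact: cvg_cst.
  have e1 : (1 = 1^-1 :> R)%R by rewrite invr1.
  by rewrite [X in _ --> X]e1; apply: cvgV => //; exact: oner_neq0.
apply/cvgr0Pnorm_lt => e e0; move/cvgryPge : h2 => /(_ e^-1%R); apply: filterS => x hx.
rewrite gtr0_norm ?invr_gt0 ?ltr_pwDl//.
rewrite invf_plt ?posrE ?ltr_pwDl//.
Qed.

End inv1.

(** Comparison with the Frullani integral of F x = 1 / (1 + sqrt x) for a = 4. With y = sqrt x its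
    integrand is 1 / (y (1 + y) (1 + 2 y)), and (1 + y) (1 + 2 y) <= 6 (1 + y^2). *)
Lemma int_phi_fin : \int[leb]_(x in D) (phi x)%:E < +oo.
Proof.
have [||||F1 F2 F3 F4] := @double_frullani_inv (fun x => Num.sqrt x).
- by move=> x y xy; exact: ler_wsqrtr.
- by move=> x; exact: sqrtr_ge0.
- rewrite -[X in _ --> X]sqrtr0; apply: cvg_at_right_filter; exact: sqrt_continuous.
- apply/cvgryPge => r; near=> x.
  have hr : (r <= Num.sqrt (Num.max r 0 ^+ 2))%R.
    by rewrite sqrtr_sqr ger0_norm le_max lexx ?orbT.
  apply: le_trans hr _; apply: ler_wsqrtr; near: x.
  exact: nbhs_pinfty_ge (num_real _).
have h := frullani F1 F2 F3 F4 (ltr0n R 4).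
have : \int[leb]_(x in D) (phi x)%:E <= 6%:E * \int[leb]_(x in D)
   (`|(1 + Num.sqrt x)^-1 - (1 + Num.sqrt (4 * x))^-1| / `|x|)%:E.
  rewrite -ge0_integralZl//.
  - apply: ge0_le_integral => //.
    + by move=> x _; rewrite lee_fin phi_ge0.
    + by apply: measurable_funTS; apply/measurable_EFinP; exact: measurable_phi.
    + apply: measurable_funTS; apply/measurable_EFinP/measurable_funM => //.
      apply: measurable_funM; last exact: measurable_inv_norm.
      have mF := nonincreasing_measurable measurableT F1.
      apply: (measurableT_comp (@normr_measurable _ _)); apply: measurable_funB => //.
      by apply: (measurableT_comp mF); exact: measurable_funM.
    + move=> x; rewrite /= in_itv/= andbT => x0; rewrite -EFinM lee_fin /phi.
      have := sqr_sqrtr (ltW x0); have := sqrtr_gt0 x; rewrite x0.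
      rewrite (sqrtrM _ (ler0n R 4)).
      have -> : Num.sqrt (4 : R) = 2%R.
        by rewrite (_ : 4 = 2 ^+ 2)%R ?sqrtr_sqr ?ger0_norm// -natrX.
      have -> : hh x = (Num.sqrt x)^-1%R by rewrite powRN powR12_sqrt// ltW.
      set y := Num.sqrt x => y0 yx; rewrite -yx.
      have d1 : (0 < 1 + y)%R by rewrite ltr_pwDl// ltW.
      have d2 : (0 < 1 + 2 * y)%R by rewrite ltr_pwDl// mulr_ge0// ltW.
      have d3 : (0 < 1 + y ^+ 2)%R by rewrite ltr_pwDl// sqr_ge0.
      have -> : ((1 + y)^-1 - (1 + 2 * y)^-1 = y / ((1 + y) * (1 + 2 * y)))%R.
        by field; rewrite !gt_eqF.
      have y20 : (0 < y ^+ 2)%R by rewrite exprn_gt0.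
      rewrite (gtr0_norm y20) gtr0_norm ?divr_gt0 ?mulr_gt0//.
      have -> : (6 * (y / ((1 + y) * (1 + 2 * y)) / y ^+ 2) = y^-1 * (6 / ((1 + y) * (1 + 2 * y))))%R.
        by field; rewrite !gt_eqF.
      rewrite ler_pM2l ?invr_gt0// ler_pdivlMr ?mulr_gt0// mulrC ler_pdivrMr//.
      nra.
  - apply: measurable_funTS; apply/measurable_EFinP/measurable_funM; last exact: measurable_inv_norm.
      have mF := nonincreasing_measurable measurableT F1.
      apply: (measurableT_comp (@normr_measurable _ _)); apply: measurable_funB => //.
      by apply: (measurableT_comp mF); exact: measurable_funM.
move=> h2; apply: le_lt_trans h2 _; rewrite h subr0 mul1e.
rewrite -(@fineK _ (logk _)); first by rewrite -EFinM ltry.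
by apply: logk_fin; rewrite le_max ler1n.
Unshelve. all: by end_near.
Qed.

(** [double_frullani] is read backwards with F x = 1 / (1 + x) for x > 0: there |F x - F y| / |y -
    x| factors into 1 / ((1 + x) (1 + y)), so the double integral is at most the square of the
    integral of [phi]. *)
Lemma kern_int_fin : kern_int < +oo.
Proof.
have [||||F1 F2 F3 F4] := @double_frullani_inv (fun x : R => Num.max 0 x)%R.
- by move=> x y xy; rewrite ge_max !le_max lexx xy /= orbT.
- by move=> x; rewrite le_max lexx.
- apply/cvgr0Pnorm_lt => e e0; near=> x.
  have x0 : (0 < x)%R by near: x; exact: nbhs_right_gt.
  by rewrite (max_idPr (ltW x0)) gtr0_norm//; near: x; exact: nbhs_right_lt.
- apply/cvgryPge => r; near=> x; rewrite le_max; apply/orP; right; near: x.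
  exact: nbhs_pinfty_ge (num_real _).
have := double_frullani F1 F2 F3 F4; rewrite subr0 mul1e => <-.
have phif := int_phi_fin.
apply: (@le_lt_trans _ _ (\int[leb]_(x in D) ((phi x)%:E * \int[leb]_(y in D) (phi y)%:E))).
  apply: ge0_le_integral => //=.
  - by move=> x _; apply: integral_ge0 => y _; exact: W_ge0.
  - apply: measurable_funTS; apply: (measurable_int_pos (G := fun z => W _ z.1 z.2)).
      by apply: measurable_W; exact: nonincreasing_measurable.
    by move=> z; exact: W_ge0.
  - apply: emeasurable_funM => //.
    by apply: measurable_funTS; apply/measurable_EFinP; exact: measurable_phi.
  move=> x; rewrite in_itv/= andbT => x0.
  rewrite -ge0_integralZl//.
  - apply: ge0_le_integral => //=.
    + by move=> y _; exact: W_ge0.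
    + apply: measurable_funTS.
      apply: (measurableT_comp (measurable_W _) (measurable_pair1 x)).
      exact: nonincreasing_measurable.
    + apply: emeasurable_funM => //.
      by apply: measurable_funTS; apply/measurable_EFinP; exact: measurable_phi.
    move=> y; rewrite in_itv/= andbT => y0.
    rewrite /W -EFinM lee_fin /phi.
    rewrite [leRHS]mulrACA ler_wpM2l ?mulr_ge0 ?powR_ge0//.
    rewrite (max_idPr (ltW x0)) (max_idPr (ltW y0)) (gtr0_norm x0) (gtr0_norm y0).
    have d1 : (0 < 1 + x)%R by rewrite ltr_pwDl// ltW.
    have d2 : (0 < 1 + y)%R by rewrite ltr_pwDl// ltW.
    have -> : ((1 + x)^-1 - (1 + y)^-1 = (y - x) * ((1 + x)^-1 * (1 + y)^-1))%R.
      by field; rewrite !gt_eqF.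
    rewrite normrM mulrAC.
    rewrite (@gtr0_norm _ (_ * _)%R) ?mulr_gt0 ?invr_gt0//.
    rewrite ler_piMl ?mulr_ge0 ?invr_ge0 ?(ltW d1) ?(ltW d2)//.
    have [->|ne] := eqVneq (y - x)%R 0%R; first by rewrite normr0 mul0r.
    by rewrite mulfV ?normr_eq0.
  - by apply: measurable_funTS; apply/measurable_EFinP; exact: measurable_phi.
  - by move=> y _; rewrite lee_fin phi_ge0.
  - by rewrite lee_fin phi_ge0.
have fin : \int[leb]_(y in D) (phi y)%:E \is a fin_num.
  by rewrite ge0_fin_numE// integral_ge0// => y _; rewrite lee_fin phi_ge0.
rewrite -(fineK fin) ge0_integralZr//.
- by rewrite -{1}(fineK fin) -EFinM ltry.
- by apply: measurable_funTS; apply/measurable_EFinP; exact: measurable_phi.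
- by move=> y _; rewrite lee_fin phi_ge0.
- by rewrite lee_fin fine_ge0// integral_ge0// => y _; rewrite lee_fin phi_ge0.
Unshelve. all: by end_near.
Qed.

Lemma logr2_gt0 : (0 < logr 2)%R.
Proof.
rewrite -lte_fin -logrE ?ler1n//.
apply: (@lt_le_trans _ _ (\int[leb]_(x in `[1%R, 2%R[) (2^-1)%:E)).
  rewrite integral_cst//= -[X in _ * X]/(leb `[1%R, 2%R[%classic) leb_itv ?ler1n//.
  by rewrite -EFinM lte_fin mulr_gt0// ?invr_gt0// subr_gt0 ltr1n.
apply: ge0_le_integral => //=.
- exact: measurable_funTS measurable_einv_norm.
- move=> x; rewrite in_itv/= => /andP[x1 x2]; rewrite lee_fin.
  have x0 : (0 < x)%R by apply: lt_le_trans x1.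
  by rewrite gtr0_norm// lef_pV2 ?posrE// ltW.
Qed.

Lemma kern_int_gt0 : 0 < kern_int.
Proof.
pose c := (hh 3 * 2^-1 * logr 2)%R.
apply: (@lt_le_trans _ _ (\int[leb]_(x in `[2%R, 3%R[) c%:E)).
  rewrite integral_cst//= -[X in _ * X]/(leb `[2%R, 3%R[%classic) leb_itv ?ler_nat//.
  rewrite -EFinM lte_fin mulr_gt0// ?subr_gt0 ?ltr_nat//.
  by rewrite !mulr_gt0 ?powR_gt0 ?logr2_gt0 ?invr_gt0.
have mk : measurable_fun setT (fun s => (kern s * logr (Num.max s s^-1))%:E).
  apply/measurable_EFinP/measurable_funM; first exact: measurable_kern.
  apply: (measurableT_comp measurable_logr); apply: measurable_maxr => //.
  exact: measurable_inv.
apply: (@le_trans _ _ (\int[leb]_(s in `[2%R, 3%R[) (kern s * logr (Num.max s s^-1))%:E)).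
  apply: ge0_le_integral => //=.
  - by move=> x _; rewrite lee_fin !mulr_ge0 ?powR_ge0 ?logr_ge0// invr_ge0.
  - exact: measurable_funTS.
  - move=> s; rewrite in_itv/= => /andP[s2 s3]; rewrite lee_fin.
    have s0 : (0 < s)%R by apply: lt_le_trans s2.
    apply: ler_pM; rewrite ?mulr_ge0 ?powR_ge0 ?invr_ge0 ?logr_ge0//.
      apply: ler_pM; rewrite ?mulr_ge0 ?powR_ge0 ?invr_ge0//.
        rewrite !powRN lef_pV2 ?posrE ?powR_gt0//.
        by apply: ge0_ler_powR; rewrite ?nnegrE ?invr_ge0 ?ltW.
      rewrite lef_pV2 ?posrE ?normr_gt0 ?subr_eq0//; last by rewrite gt_eqF// (lt_le_trans _ s2)// ltr1n.
      by rewrite gtr0_norm; lra.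
    by apply: logr_le; rewrite le_max s2.
apply: ge0_subset_integral => //=.
- exact: measurable_funTS.
- by move=> s _; rewrite lee_fin mulr_ge0 ?kern_ge0 ?logr_ge0.
- by move=> s /=; rewrite !in_itv/= andbT => /andP[h _]; exact: lt_le_trans h.
Qed.

End DoubleIntegral.

Section SignedDouble.
Context {R : realType}.
Local Open Scope ereal_scope.
Local Notation leb := (@lebesgue_R R).
Local Notation D := (`]0%R, +oo[%classic : set R).
Local Notation hh x := (x `^ (- 2^-1))%R.

Let mD : measurable D. Proof. exact: measurable_itv. Qed.

Lemma ae_neq (a : R) : {ae leb, forall y, y != a}.
Proof.
exists [set a]; split => //; first exact: lebesgue_measure_set1.
by move=> y /= /negP; rewrite negbK => /eqP.
Qed.

Record admissible (F : R -> R) (A B : R) : Prop := Admissible {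
  adm_ni : nonincreasing_fun F;
  adm_ge0 : forall x, (0 <= F x)%R;
  adm_0 : F x @[x --> 0%R^'+] --> A;
  adm_oo : F x @[x --> +oo%R] --> B }.

Lemma adm_meas F A B : admissible F A B -> measurable_fun setT F.
Proof. by case=> h _ _ _; exact: nonincreasing_measurable. Qed.

Lemma adm_cvg (F : R -> R) : nonincreasing_fun F -> (forall x, 0 <= F x)%R ->
  (exists M, forall x, F x <= M)%R -> exists A B, admissible F A B.
Proof.
move=> h1 h2 [M hM].
have c1 : cvg (F x @[x --> 0%R^'+]).
  apply: nonincreasing_at_right_is_cvgr.
  - by near=> b => x y _ _; exact: h1.
  - by near=> b; exists M => _ [y _ <-].
have c2 : cvg (F x @[x --> +oo%R]).
  have h := @nondecreasing_cvgr R (fun x => - F x)%R.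
  apply/cvg_ex; eexists.
  have {1}-> : F = (fun x => - (- F x))%R by apply/funext => x; rewrite opprK.
  apply: cvgN; apply: h; first by move=> x y xy; rewrite lerN2 h1.
  by exists 0%R => _ [y _ <-]; rewrite oppr_le0.
by exists (lim (F x @[x --> 0%R^'+])), (lim (F x @[x --> +oo%R])); split.
Unshelve. all: by end_near.
Qed.

Lemma W_int_integrable F A B : admissible F A B ->
  leb.-integrable D (fun x => \int[leb]_(y in D) W F x y).
Proof.
move=> adF; have mF := adm_meas adF; case: adF => h1 h2 h3 h4; apply/integrableP; split.
  apply: measurable_funTS; apply: (measurable_int_pos (G := fun z => W F z.1 z.2)).
    exact: measurable_W.
  by move=> z; exact: W_ge0.
rewrite (_ : \int[leb]_(x in D) _ = \int[leb]_(x in D) \int[leb]_(y in D) W F x y); last first.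
  apply: eq_integral => x _; rewrite gee0_abs// integral_ge0// => y _; exact: W_ge0.
rewrite (double_frullani h1 h2 h3 h4).
have fk : @kern_int R \is a fin_num.
  by rewrite ge0_fin_numE ?kern_int_fin// ltW// kern_int_gt0.
by rewrite -(fineK fk) -EFinM ltry.
Qed.

Section two.
Variables (F1 F2 : R -> R) (A1 B1 A2 B2 : R).
Hypotheses (ad1 : admissible F1 A1 B1) (ad2 : admissible F2 A2 B2).
(* In the application q x y = <(L + y)^-1 f, (L + x)^-1 v>, and polarization
   makes it a divided difference of the monotone functions F1 and F2, which
   gives the absolute convergence required to exchange the integrals. *)
Variables (q : R -> R -> R) (Psi : R -> R).
Hypothesis hq : forall x y : R, (0 < x -> 0 < y -> x != y ->
  q x y * (y - x) = (F1 x - F1 y) - (F2 x - F2 y))%R.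
Hypothesis qi : forall x : R, (0 < x)%R ->
  leb.-integrable D (fun y => (hh y * q x y)%:E).
Hypothesis PsiE : forall x : R, (0 < x)%R ->
  (Psi x = hh x * Rintegral leb D (fun y => hh y * q x y))%R.
Hypothesis mPsi : measurable_fun D Psi.

Let I1 x := \int[leb]_(y in D) W F1 x y.
Let I2 x := \int[leb]_(y in D) W F2 x y.

Let mW1 x : measurable_fun D (W F1 x).
Proof.
apply: measurable_funTS.
exact: (measurableT_comp (measurable_W (adm_meas ad1)) (measurable_pair1 x)).
Qed.

Let mW2 x : measurable_fun D (W F2 x).
Proof.
apply: measurable_funTS.
exact: (measurableT_comp (measurable_W (adm_meas ad2)) (measurable_pair1 x)).
Qed.

Let WE F (x y : R) : nonincreasing_fun F -> (0 < x -> 0 < y -> x != y ->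
  hh x * hh y * (`|F x - F y| * `|y - x|^-1) = hh x * (hh y * ((F x - F y) / (y - x))))%R.
Proof.
move=> Fni x0 y0 xy; rewrite -mulrA; congr (_ * (_ * _))%R.
have [h|h] := leP x y.
  have h' : (0 < y - x)%R by rewrite subr_gt0 lt_neqAle xy.
  by rewrite (gtr0_norm h') ger0_norm// subr_ge0 Fni.
have h' : (y - x < 0)%R by rewrite subr_lt0.
rewrite (ltr0_norm h') ler0_norm ?invrN ?mulrNN// subr_le0.
by apply: Fni; exact: ltW.
Qed.

(** The exceptional set is the point y = x, about which [hq] says nothing. *)
Let qE x : (0 < x)%R -> {ae leb, forall y, D y ->
  (hh x * (hh y * q x y))%:E = W F1 x y - W F2 x y}.
Proof.
move=> x0; apply: filterS (ae_neq x) => y yx; rewrite /= in_itv/= andbT => y0.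
rewrite eq_sym in yx.
rewrite /W -EFinB; congr EFin; case: ad1 => n1 _ _ _; case: ad2 => n2 _ _ _.
rewrite !WE// -!mulrBr; congr (_ * (_ * _))%R.
have h' : (y - x)%R != 0%R by rewrite subr_eq0 eq_sym.
by apply: (mulIf h'); rewrite hq// mulrBl !mulfVK.
Qed.

Let PsiE' x : (0 < x)%R -> (Psi x)%:E = \int[leb]_(y in D) (hh x * (hh y * q x y))%:E.
Proof.
move=> x0; rewrite PsiE// EFinM /Rintegral fineK; last by apply: integrable_fin_num => //; exact: qi.
by rewrite -integralZl//; exact: qi.
Qed.

Let mq x : (0 < x)%R -> measurable_fun D (fun y => (hh x * (hh y * q x y))%:E).
Proof.
move=> x0; apply/measurable_EFinP/measurable_funM => //.
by apply/measurable_EFinP; exact: measurable_int (qi x0).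
Qed.

Let Psi_le x : D x -> `|(Psi x)%:E| <= `|I1 x + I2 x|.
Proof.
move=> Dx; have x0 : (0 < x)%R by move: Dx; rewrite /= in_itv/= andbT.
rewrite PsiE'//.
have i1 : 0 <= I1 x by apply: integral_ge0 => y _; exact: W_ge0.
have i2 : 0 <= I2 x by apply: integral_ge0 => y _; exact: W_ge0.
rewrite (gee0_abs (adde_ge0 i1 i2)).
apply: (le_trans (le_abse_integral _ mD (mq x0))).
rewrite -ge0_integralD//; last 2 first.
- by move=> y _; exact: W_ge0.
- by move=> y _; exact: W_ge0.
apply: ae_ge0_le_integral => //.
- by apply: measurableT_comp => //; exact: mq.
- by move=> y _; apply: adde_ge0; exact: W_ge0.
- exact: emeasurable_funD.
apply: filterS (qE x0) => y h Dy; rewrite h// (le_trans (lee_abs_sub _ _))//.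
by rewrite !gee0_abs// W_ge0.
Qed.

Lemma signed_integrable : leb.-integrable D (fun x => (Psi x)%:E).
Proof.
apply: (le_integrable mD _ Psi_le); first exact/measurable_EFinP.
by apply: integrableD => //; [exact: W_int_integrable ad1|exact: W_int_integrable ad2].
Qed.

(** The inner integrals of [W F1 x] and [W F2 x] are finite for almost every x. There the signed
    inner integral is their difference, and [double_frullani] evaluates both iterated integrals. *)
Lemma signed_double :
  Rintegral leb D Psi = ((A1 - B1 - (A2 - B2)) * fine (@kern_int R))%R.
Proof.
have j1 := W_int_integrable ad1; have j2 := W_int_integrable ad2.
have e : \int[leb]_(x in D) (Psi x)%:E = \int[leb]_(x in D) (I1 x - I2 x).
  apply: ae_eq_integral => //.
  - exact/measurable_EFinP.
  - by apply: emeasurable_funB; [exact: measurable_int j1|exact: measurable_int j2].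
  have f1 := integrable_ae mD j1; have f2 := integrable_ae mD j2.
  apply: filterS2 f1 f2 => x f1 f2 Dx; move: (f1 Dx) (f2 Dx) => {}f1 {}f2.
  have x0 : (0 < x)%R by move: Dx; rewrite /= in_itv/= andbT.
  have w1 : leb.-integrable D (W F1 x).
    apply/integrableP; split => //.
    rewrite (eq_integral (W F1 x)); last by move=> y _; rewrite gee0_abs// W_ge0.
    by rewrite -ge0_fin_numE// integral_ge0// => y _; exact: W_ge0.
  have w2 : leb.-integrable D (W F2 x).
    apply/integrableP; split => //.
    rewrite (eq_integral (W F2 x)); last by move=> y _; rewrite gee0_abs// W_ge0.
    by rewrite -ge0_fin_numE// integral_ge0// => y _; exact: W_ge0.
  rewrite PsiE'// /I1 /I2 -integralB//.
  apply: ae_eq_integral => //; first exact: mq.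
    exact: emeasurable_funB.
  exact: qE.
rewrite /Rintegral e integralB//.
have [h1 h2 h3 h4] := ad1; have [k1 k2 k3 k4] := ad2.
rewrite /I1 /I2 (double_frullani h1 h2 h3 h4) (double_frullani k1 k2 k3 k4).
have fk : @kern_int R \is a fin_num.
  by rewrite ge0_fin_numE ?kern_int_fin// ltW// kern_int_gt0.
by rewrite -(fineK fk) -!EFinM -EFinB /= -mulrBl.
Qed.

End two.

End SignedDouble.

(** * The square root of L *)

Section SquareRoot.
Context {R : realType} {n : nat}.
Local Notation H := (heis R n).
Local Notation mu := (@heis_leb R n).
Local Notation leb := (@lebesgue_R R).
Local Notation D := (`]0, +oo[%classic : set R).
Local Notation hh x := (x `^ (- 2^-1)).
Implicit Types (u v w z f : H -> R) (lam m : R).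

Lemma dot_ge0_ae u v : L2 u -> L2 v -> {ae mu, forall g, 0 <= u g * v g} -> 0 <= dot u v.
Proof.
move=> Lu Lv uv; have i1 := L2_mulE Lu Lv.
rewrite /dot /Rintegral.
rewrite (@ae_eq_integral _ _ _ mu setT (fun g => (`|u g * v g|)%:E))//.
- by rewrite fine_ge0// integral_ge0// => g _; rewrite lee_fin.
- exact: measurable_int i1.
- by apply/measurable_EFinP; apply: (measurableT_comp (@normr_measurable _ _));
    apply: measurable_funM; exact: L2_measurable.
- by apply: filterS uv => g h _; rewrite ger0_norm.
Qed.

(** Hoelder's inequality between L1 and L-infinity. A nonnegative v supported in a box is
    integrable, and its integral is expressed as a pairing with the indicator of the box. *)
Lemma dot_le_box w v M r : 0 < r -> L2 w -> {ae mu, forall g, `|w g| <= M} ->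
  L2 v -> (forall g, 0 <= v g) -> (forall g, v g = v g * \1_(hbox r) g) ->
  `|dot w v| <= M * dot v (\1_(hbox r)).
Proof.
move=> r0 Lw wM Lv v0 vb; have Lb := @L2_indic_hbox R n _ r0.
rewrite -dotZr// dotC.
rewrite ler_norml; apply/andP; split.
  rewrite -subr_ge0 opprK -dotDr//; last exact: L2Z.
  apply: dot_ge0_ae => //; first by apply: L2D => //; exact: L2Z.
  apply: filterS wM => g; rewrite ler_norml => /andP[h1 h2].
  rewrite vb -mulrA; have [hg|hg] := pselect (hbox r g); last first.
    by rewrite indicE memNset// mul0r mulr0.
  by rewrite indicE mem_set//= !mulr1 mul1r mulr_ge0//; lra.
rewrite -subr_ge0 -dotBr//; last exact: L2Z.
apply: dot_ge0_ae => //; first by apply: L2B => //; exact: L2Z.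
apply: filterS wM => g; rewrite ler_norml => /andP[h1 h2].
rewrite vb -mulrA; have [hg|hg] := pselect (hbox r g); last first.
  by rewrite indicE memNset// mul0r mulr0.
by rewrite indicE mem_set//= !mulr1 mul1r mulr_ge0//; lra.
Qed.

(** Test with v the positive part of z - K on a box: then [dot z v] equals [dot v v] plus K times
    the integral of v, which forces [dot v v = 0]. The same is done for - z. *)
Lemma bounded_of_dot_box z K : L2 z -> 0 <= K ->
  (forall r v, 0 < r -> L2 v -> (forall g, 0 <= v g) -> (forall g, v g = v g * \1_(hbox r) g) ->
     `|dot z v| <= K * dot v (\1_(hbox r))) ->
  {ae mu, forall g, `|z g| <= K}.
Proof.
move=> Lz K0 hK.
have one y : L2 y -> (forall r v, 0 < r -> L2 v -> (forall g, 0 <= v g) -> (forall g, v g = v g * \1_(hbox r) g) ->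
     `|dot y v| <= K * dot v (\1_(hbox r))) -> forall N, {ae mu, forall g, hbox N.+1%:R g -> y g <= K}.
  move=> Ly hy N; have N0 : 0 < N.+1%:R :> R by [].
  have Lb := @L2_indic_hbox R n _ N0.
  pose v g := \1_(hbox N.+1%:R) g * Num.max (y g - K) 0.
  have my := L2_measurable Ly.
  have Lm : L2 (fun g => Num.max (y g - K) 0).
    apply: (@L2_dom _ _ _ y) => //.
      by apply: measurable_maxr => //; exact: measurable_funB.
    move=> g; rewrite ger0_norm ?le_max ?lexx ?orbT// ge_max normr_ge0 andbT.
    by rewrite (le_trans _ (ler_norm _))// gerBl.
  have Lv : L2 v by apply: L2_mul_indic => //; exact: measurable_hbox.
  have v0 g : 0 <= v g by rewrite mulr_ge0// ?le_max ?lexx ?orbT// indicE.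
  have bb (g : H) : \1_(hbox N.+1%:R) g * \1_(hbox N.+1%:R) g = \1_(hbox N.+1%:R) g :> R.
    by rewrite indicE -natrM mulnb andbb.
  have vb g : v g = v g * \1_(hbox N.+1%:R) g by rewrite mulrAC bb.
  have e : dot y v = dot v v + K * dot v (\1_(hbox N.+1%:R)).
    rewrite -dotZr// -dotDr//; last exact: L2Z.
    rewrite [RHS]dotC /dot; apply: eq_Rintegral => g _.
    rewrite /v; move: (\1_(hbox N.+1%:R) g : R) (bb g) => b hb.
    rewrite maxEle; case: (leP (y g - K) 0) => h; first by rewrite !mulr0.
    have -> : (b * (y g - K) + K * b) * (b * (y g - K)) = (b * b) * ((y g - K) * (y g - K) + K * (y g - K)) by ring.
    by rewrite hb; ring.
  have := hy _ _ N0 Lv v0 vb; rewrite e => h.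
  have : dot v v = 0.
    apply/eqP; rewrite eq_le dot_ge0 andbT.
    by move: (le_trans (ler_norm _) h); rewrite gerDr.
  move/(dot_eq0_ae Lv); apply: filterS => g + hg; rewrite /v indicE mem_set//= mul1r => h1.
  by rewrite -subr_le0 -h1 le_max lexx.
have h1 := one _ Lz hK.
have h2 : forall N, {ae mu, forall g, hbox N.+1%:R g -> - z g <= K}.
  apply: one; first exact: L2N.
  by move=> r v r0 Lv v0 vb; rewrite dotNl// normrN; exact: hK.
have h3 := ae_foralln h1; have h4 := ae_foralln h2.
apply: filterS2 h3 h4 => g h3 h4.
have [N hN] : exists N, hbox N.+1%:R g.
  near \oo => N; exists N; apply/hboxE => //; near: N.
  by apply: filterS (nbhs_infty_gtr `|g|) => N h; rewrite (lt_le_trans h)// ler_nat.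
by rewrite ler_norml (h3 N)// andbT lerNl (h4 N).
Unshelve. all: by end_near.
Qed.

Variable V : H -> R.
Hypothesis V0 : forall g, 0 <= V g.
Hypothesis mV : measurable_fun setT V.

(** The factor 1/4 is that of polarization. For x <= 0 the value is the upper bound of [Lres_bound],
    which keeps the function nonincreasing on the whole line. *)
Definition Fz z (x : R) : R := if 0 < x then Lres V x z / 4 else dot z z / 4.

Lemma Fz_adm z : L2 z -> exists A B, admissible (Fz z) A B.
Proof.
move=> Lz; apply: adm_cvg.
- move=> x y xy; rewrite /Fz; case: ifPn => y0; case: ifPn => x0 //.
  + by rewrite ler_pM2r ?invr_gt0//; exact: (Lres_nonincr V0 mV).
  + by rewrite ler_pM2r ?invr_gt0//; exact: (Lres_bound V0 mV).
  + by rewrite (lt_le_trans x0 xy) in y0.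
- move=> x; rewrite /Fz; case: ifPn => x0; rewrite divr_ge0 ?dot_ge0//.
  exact: (Lres_ge0 V0 mV).
- exists (dot z z / 4) => x; rewrite /Fz; case: ifPn => x0 //.
  by rewrite ler_pM2r ?invr_gt0//; exact: (Lres_bound V0 mV).
Qed.

Lemma Fz_polar x u v : 0 < x -> L2 u -> L2 v ->
  Fz (fun g => u g + v g) x - Fz (fun g => u g - v g) x = dot u v - x * dot (res V x u) v.
Proof.
move=> x0 Lu Lv; rewrite /Fz x0 /Lres.
have L1 := L2D Lu Lv; have L3 := L2B Lu Lv.
rewrite !(res_sym V0 mV x0) //.
have rl w : L2 w -> dot w (res V x (fun g => u g + v g)) = dot w (res V x u) + dot w (res V x v).
  move=> Lw; rewrite -!(res_sym V0 mV x0)// dotDr//; exact: (res_L2 V0 mV).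
have rb w : L2 w -> dot w (res V x (fun g => u g - v g)) = dot w (res V x u) - dot w (res V x v).
  move=> Lw; rewrite -!(res_sym V0 mV x0)// dotBr//; exact: (res_L2 V0 mV).
rewrite rl// rb//.
have Lru := res_L2 V0 mV x0 Lu; have Lrv := res_L2 V0 mV x0 Lv.
rewrite !dotBl// !dotDl// !dotBr// !dotDr// (dotC v u).
rewrite -(res_sym V0 mV x0 Lv Lu) (dotC (res V x v)).
move: (dot u u) (dot u v) (dot v v) (dot u (res V x u)) (dot u (res V x v)) (dot v (res V x v)) => a b c d e h.
by field.
Qed.

(** Measurability in lam comes from monotonicity: by polarization x times the pairing is a constant
    minus a difference of two monotone functions. *)
Lemma measurable_res u v : L2 u -> L2 v -> measurable_fun D (fun x => dot (res V x u) v).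
Proof.
move=> Lu Lv.
have [A1 [B1 a1]] := Fz_adm (L2D Lu Lv); have [A2 [B2 a2]] := Fz_adm (L2B Lu Lv).
apply: (@eq_measurable_fun _ _ _ _ _ (fun x => (dot u v - (Fz (fun g => u g + v g) x - Fz (fun g => u g - v g) x)) * `|x|^-1)).
  move=> x; rewrite inE/= in_itv/= andbT => x0; rewrite Fz_polar// gtr0_norm//.
  by rewrite subKr mulrAC mulfV ?mul1r// gt_eqF.
apply: measurable_funTS; apply: measurable_funM; last exact: measurable_inv_norm.
by apply: measurable_funB => //; apply: measurable_funB; [exact: adm_meas a1|exact: adm_meas a2].
Qed.

Lemma measurable_hh_res u v : L2 u -> L2 v -> measurable_fun D (fun x => hh x * dot (res V x u) v).
Proof.
move=> Lu Lv; apply: measurable_funM; last exact: measurable_res.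
exact: measurable_funTS (@measurable_hh R).
Qed.

End SquareRoot.

Section InverseSquareRoot.
Context {R : realType} {n : nat}.
Local Notation H := (heis R n).
Local Notation mu := (@heis_leb R n).
Local Notation leb := (@lebesgue_R R).
Local Notation D := (`]0, +oo[%classic : set R).
Local Notation hh x := (x `^ (- 2^-1)).
Implicit Types (u v w z f : H -> R) (lam m : R).
Variable V : H -> R.
Hypothesis V0 : forall g, 0 <= V g.
Hypothesis mV : measurable_fun setT V.

Section root.
Variables (u0 f : H -> R).
Hypotheses (Lu0 : L2 u0) (sf : schrodinger V u0 f).

Let Lf : L2 f. Proof. by case: sf. Qed.

Let C0 := Num.sqrt (dot f f) + 2 * Num.sqrt (dot u0 u0).

Let C0_ge0 : 0 <= C0. Proof. by rewrite addr_ge0 ?mulr_ge0 ?sqrtr_ge0. Qed.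

(** Two bounds are added. The resolvent estimate for f gives decay 1/x at infinity, and
    [schrodinger_res] gives boundedness by twice the norm of u0 near 0. *)
Let G_bound x v : 0 < x -> L2 v ->
  `|dot (res V x f) v| <= C0 * Num.sqrt (dot v v) * (1 + `|x|)^-1.
Proof.
move=> x0 Lv; rewrite (gtr0_norm x0) ler_pdivlMr ?(ltr_pwDl ltr01 (ltW x0))//.
have h1 : `|dot (res V x f) v| * x <= Num.sqrt (dot f f) * Num.sqrt (dot v v).
  rewrite -ler_pdivlMr//; apply: (le_trans (dot_le_norm (res_L2 V0 mV x0 Lf) Lv)).
  by rewrite mulrAC ler_wpM2r ?sqrtr_ge0// mulrC; exact: (res_norm_sqrt V0 mV).
have h2 : `|dot (res V x f) v| <= 2 * Num.sqrt (dot u0 u0) * Num.sqrt (dot v v).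
  rewrite (schrodinger_res V0 mV x0 Lu0 Lv sf) (le_trans (ler_normB _ _))//.
  rewrite normrM gtr0_norm//.
  have a1 := dot_le_norm Lu0 Lv.
  have a2 : x * `|dot (res V x u0) v| <= Num.sqrt (dot u0 u0) * Num.sqrt (dot v v).
    rewrite -ler_pdivlMl//; apply: (le_trans (dot_le_norm (res_L2 V0 mV x0 Lu0) Lv)).
    by rewrite mulrA ler_wpM2r ?sqrtr_ge0//; exact: (res_norm_sqrt V0 mV).
  by apply: le_trans (lerD a1 a2) _; rewrite -!mulrA [2 * _]mulr_natl mulr2n.
by rewrite mulrDr mulr1 /C0 mulrDl [X in X <= _]addrC lerD.
Qed.

Let hhG_bound x v : D x -> L2 v ->
  `|hh x * dot (res V x f) v| <= C0 * Num.sqrt (dot v v) * phi x.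
Proof.
move=> Dx Lv; have x0 : 0 < x by move: Dx; rewrite /= in_itv/= andbT.
rewrite normrM ger0_norm ?powR_ge0// /phi mulrCA ler_wpM2l ?powR_ge0//.
exact: G_bound.
Qed.

Let phi_int : leb.-integrable D (fun x => (phi x)%:E).
Proof.
apply/integrableP; split.
  by apply: measurable_funTS; apply/measurable_EFinP; exact: measurable_phi.
under eq_integral => x _ do rewrite gee0_abs ?lee_fin ?phi_ge0//.
exact: int_phi_fin.
Qed.

Let mD : measurable D. Proof. exact: measurable_itv. Qed.

Let G_int v : L2 v -> leb.-integrable D (fun x => (hh x * dot (res V x f) v)%:E).
Proof.
move=> Lv; apply: (@le_integrable _ _ _ leb D mD _ (fun x => ((C0 * Num.sqrt (dot v v))%:E * (phi x)%:E)%E)).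
- by apply/measurable_EFinP; exact: measurable_hh_res.
- move=> x Dx; rewrite -EFinM /= lee_fin (le_trans (hhG_bound Dx Lv))// ler_norm//.
- exact: integrableZl.
Qed.

(* v |-> <L^(1/2) u0, v>, where f = L u0. *)
Definition half v : R := pi^-1 * Rintegral leb D (fun x => hh x * dot (res V x f) v).

Let Cphi := fine (\int[leb]_(x in D) (phi x)%:E)%E.

Let Cphi_ge0 : 0 <= Cphi.
Proof. by apply: fine_ge0; apply: integral_ge0 => x _; rewrite lee_fin phi_ge0. Qed.

Let Rint_bound v C : L2 v -> 0 <= C ->
  (forall x, 0 < x -> `|dot (res V x f) v| <= C * (1 + `|x|)^-1) ->
  `|half v| <= pi^-1 * (C * Cphi).
Proof.
move=> Lv C_ge0 hC; rewrite /half normrM ger0_norm ?invr_ge0 ?pi_ge0//.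
rewrite ler_wpM2l ?invr_ge0 ?pi_ge0// -lee_fin.
have Gi := G_int Lv.
rewrite -abse_EFin /Rintegral fineK; last exact: integrable_fin_num.
apply: (le_trans (le_abse_integral _ mD _)); first exact: measurable_int Gi.
rewrite EFinM /Cphi fineK; last exact: integrable_fin_num.
rewrite -integralZl//.
apply: ge0_le_integral => //.
- by apply: measurableT_comp => //; exact: measurable_int Gi.
- by apply: emeasurable_funM => //; exact: measurable_int phi_int.
move=> x Dx; have x0 : 0 < x by move: Dx; rewrite /= in_itv/= andbT.
rewrite -EFinM /= lee_fin normrM ger0_norm ?powR_ge0// /phi mulrCA ler_wpM2l ?powR_ge0//.
exact: hC.
Qed.

Lemma half_exists : exists2 h, L2 h & forall v, L2 v -> dot h v = half v.
Proof.
have [||||||z [Lz hz _]] := @L2_riesz R n (@L2 R n) half ((pi^-1 * (C0 * Cphi)) ^+ 2).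
- by [].
- exact: L2_0.
- by move=> a x y Lx Ly; apply: L2D => //; exact: L2Z.
- move=> a x y Lx Ly; rewrite /half mulrCA -mulrDr; congr (_ * _).
  rewrite -RintegralZl//; last exact: G_int.
  rewrite -RintegralD//; last 2 first.
  + by have := integrableZl mD a (G_int Lx); apply: eq_integrable => // t _; rewrite /= EFinM.
  + exact: G_int.
  apply: eq_Rintegral => t; rewrite inE/= in_itv/= andbT => t0.
  have Lr := res_L2 V0 mV t0 Lf.
  rewrite dotDr//; last exact: L2Z.
  by rewrite dotZr// mulrDr mulrCA.
- by rewrite exprn_ge0// !mulr_ge0 ?invr_ge0 ?pi_ge0.
- move=> v Lv.
  have h := @Rint_bound v (C0 * Num.sqrt (dot v v)) Lv _ (fun x x0 => G_bound x0 Lv).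
  rewrite -(sqr_sqrtr (dot_ge0 v)) -exprMn -[half v ^+ 2]real_normK ?num_real//.
  rewrite ler_pXn2r ?nnegrE ?mulr_ge0 ?invr_ge0 ?pi_ge0 ?sqrtr_ge0//.
  apply: le_trans (h _) _; first by rewrite mulr_ge0 ?sqrtr_ge0.
  by rewrite le_eqVlt; apply/orP; left; apply/eqP; ring.
by exists z.
Qed.

Section bounded.
Variables (Mu Mf : R).
Hypotheses (Mu0 : 0 <= Mu) (Mf0 : 0 <= Mf).
Hypotheses (hu : forall g, `|u0 g| <= Mu) (hf : forall g, `|f g| <= Mf).

(** The two bounds of [G_bound] hold in the sup norm as well: [res_bounded] is applied to f for
    large x and to u0, through [schrodinger_res], for small x. *)
Lemma half_bounded h : L2 h -> (forall v, L2 v -> dot h v = half v) ->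
  {ae mu, forall g, `|h g| <= pi^-1 * ((Mf + 2 * Mu) * Cphi)}.
Proof.
move=> Lh hh'; apply: bounded_of_dot_box => //.
  by rewrite !mulr_ge0 ?invr_ge0 ?pi_ge0// addr_ge0// mulr_ge0.
move=> r v r0 Lv v0 vb; rewrite hh'//.
have Lb := @L2_indic_hbox R n _ r0.
set J := dot v _.
have J0 : 0 <= J.
  by apply: dot_ge0_ae => //; apply: nearW => g; rewrite mulr_ge0// indicE.
apply: (@le_trans _ _ (pi^-1 * ((Mf + 2 * Mu) * J * Cphi))); last first.
  by rewrite le_eqVlt; apply/orP; left; apply/eqP; ring.
apply: Rint_bound => //; first by rewrite mulr_ge0// addr_ge0// mulr_ge0.
move=> x x0; rewrite (gtr0_norm x0) ler_pdivlMr ?(ltr_pwDl ltr01 (ltW x0))//.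
have h1 : `|dot (res V x f) v| <= Mf / x * J.
  by apply: dot_le_box => //; [exact: (res_L2 V0 mV)|exact: (res_bounded V0 mV)].
have h2 : `|dot (res V x f) v| <= 2 * Mu * J.
  rewrite (schrodinger_res V0 mV x0 Lu0 Lv sf) (le_trans (ler_normB _ _))//.
  rewrite normrM gtr0_norm//.
  have a1 : `|dot u0 v| <= Mu * J by apply: dot_le_box => //; exact: nearW.
  have a2 : `|dot (res V x u0) v| <= Mu / x * J.
    by apply: dot_le_box => //; [exact: (res_L2 V0 mV)|exact: (res_bounded V0 mV)].
  have a3 : x * `|dot (res V x u0) v| <= Mu * J.
    by rewrite -ler_pdivlMl// mulrCA mulrA.
  by apply: le_trans (lerD a1 a3) _; rewrite -!mulrA [2 * _]mulr_natl mulr2n.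
have h3 : `|dot (res V x f) v| * x <= Mf * J.
  by rewrite -ler_pdivlMr// mulrAC.
by rewrite mulrDr mulr1 mulrDl [X in X <= _]addrC lerD.
Qed.

End bounded.

Hypothesis aeV : {ae mu, forall g, 0 < V g}.

(** Inserting the integral for h into that for L^(-1/2) h gives the pairing [q x y]. By the
    resolvent identity it is a divided difference of F x = <(L + x)^-1 f, v>, so the result is F(0+)
    - F(+oo) times [kern_int]. F(0+) is <u0, v> by [res_small], which expresses injectivity of L,
    and F(+oo) = 0 by [G_bound]. Each of the two integrals contributes one factor 1/pi. *)
Lemma inv_sqrt_half h : L2 h -> (forall v, L2 v -> dot h v = half v) ->
  inv_sqrt V h (fun g => fine (@kern_int R) / pi ^+ 2 * u0 g).
Proof.
move=> Lh hh'; split; first exact: L2Z.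
exists (fun lam => res V lam h); first by move=> lam l0; exact: (resolvent_res V0 mV).
move=> v Lv.
have [A1 [B1 a1]] := Fz_adm V0 mV (L2D Lu0 Lv); have [A2 [B2 a2]] := Fz_adm V0 mV (L2B Lu0 Lv).
set F1 := Fz _ _ in a1; set F2 := Fz _ _ in a2.
have FE x : 0 < x -> F1 x - F2 x = dot (res V x f) v.
  by move=> x0; rewrite (Fz_polar V0 mV)// (schrodinger_res V0 mV x0 Lu0 Lv sf).
pose q x y := dot (res V y f) (res V x v).
(* The factor pi cancels the one in [half], so that Psi is the bare inner integral required by
   [signed_double]. *)
pose Psi x := pi * (hh x * dot (res V x h) v).
have hq x y : 0 < x -> 0 < y -> x != y -> q x y * (y - x) = (F1 x - F1 y) - (F2 x - F2 y).
  move=> x0 y0 _; rewrite mulrC -(res_identity V0 mV x0 y0 Lf Lv) -!FE//; ring.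
have qi x : 0 < x -> leb.-integrable D (fun y => (hh y * q x y)%:E).
  by move=> x0; apply: G_int; exact: (res_L2 V0 mV).
have PsiE x : 0 < x -> Psi x = hh x * Rintegral leb D (fun y => hh y * q x y).
  move=> x0; rewrite /Psi (res_sym V0 mV x0 Lh Lv) hh'; last exact: (res_L2 V0 mV).
  by rewrite /half mulrCA mulVKf// gt_eqF// pi_gt0.
have mPsi : measurable_fun D Psi.
  by apply: measurable_funM => //; exact: measurable_hh_res.
have i1 := signed_integrable a1 a2 hq qi PsiE mPsi.
have e1 := signed_double a1 a2 hq qi PsiE mPsi.
have pi0 : pi != 0 :> R by rewrite gt_eqF// pi_gt0.
have i2 : leb.-integrable D (fun x => (hh x * dot (res V x h) v)%:E).
  have := integrableZl mD pi^-1 i1; apply: eq_integrable => // x _ /=.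
  by rewrite /Psi -EFinM mulKf.
split => //.
have eA : A1 - A2 = dot u0 v.
  have c1 : F1 x - F2 x @[x --> 0^'+] --> A1 - A2 by apply: cvgB; [exact: adm_0 a1|exact: adm_0 a2].
  pose l_ (i : nat) : R := i.+1%:R^-1.
  have l0 i : 0 < l_ i by rewrite invr_gt0.
  have lc : l_ @ \oo --> 0 by exact: cvg_harmonic.
  have c2 : F1 (l_ i) - F2 (l_ i) @[i --> \oo] --> A1 - A2.
    by apply: ((cvg_at_rightP (fun x => F1 x - F2 x) 0 (A1 - A2)).1 c1 l_); split.
  have c3 : F1 (l_ i) - F2 (l_ i) @[i --> \oo] --> dot u0 v - 0.
    under eq_fun do rewrite (Fz_polar V0 mV)//.
    by apply: cvgB; [exact: cvg_cst|exact: (res_small V0 mV)].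
  by rewrite subr0 in c3; exact: (cvg_unique (@Rhausdorff R) c2 c3).
have eB : B1 - B2 = 0.
  have c1 : F1 x - F2 x @[x --> +oo] --> B1 - B2 by apply: cvgB; [exact: adm_oo a1|exact: adm_oo a2].
  suff c2 : F1 x - F2 x @[x --> +oo] --> (0 : R) by exact: (cvg_unique (@Rhausdorff R) c1 c2).
  apply/cvgr0Pnorm_le => e e0; near=> x.
  have x0 : 0 < x by near: x; exact: nbhs_pinfty_gt.
  rewrite FE//; apply: le_trans (G_bound x0 Lv) _.
  rewrite gtr0_norm// ler_pdivrMr ?(ltr_pwDl ltr01 (ltW x0))// mulrDr mulr1.
  apply: (@le_trans _ _ (e * x)); last by rewrite lerDr ltW.
  rewrite [X in _ <= X]mulrC -ler_pdivrMr//; near: x; exact: nbhs_pinfty_ge (num_real _).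
have e2 : A1 - B1 - (A2 - B2) = dot u0 v.
  by rewrite -eA -[RHS]subr0 -eB; ring.
rewrite e2 in e1.
have e3 : Rintegral leb D Psi = pi * Rintegral leb D (fun x => hh x * dot (res V x h) v).
  by rewrite -RintegralZl.
rewrite dotZl//.
have -> : Rintegral leb D (fun x => hh x * dot (res V x h) v) = pi^-1 * (dot u0 v * fine (@kern_int R)).
  by rewrite -e1 e3 mulKf.
by rewrite expr2 invfM; move: (dot u0 v) (fine _) pi^-1 => a b c; ring.
Unshelve. all: by end_near.
Qed.

End root.

End InverseSquareRoot.

(** * Homogeneous balls *)

Section HomogeneousBalls.
Context {R : realType} {n : nat}.
Local Notation H := (heis R n).
Local Notation mu := (@heis_leb R n).
Local Notation Q := (2 * n + 2)%N.
Implicit Types (g h : H) (r s : R).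

Lemma sqnorm_dil r g : sqnorm_hor (dil r g) = r ^+ 2 * sqnorm_hor g.
Proof.
by rewrite /sqnorm_hor mulr_sumr; apply: eq_bigr => i _; rewrite /= mxE exprMn.
Qed.

Lemma homN_dil r g : homN (dil r g) = r ^+ 4 * homN g.
Proof.
by rewrite /homN sqnorm_dil /=; ring.
Qed.

Lemma sqnorm_le_homN g : sqnorm_hor g ^+ 2 <= homN g.
Proof. by rewrite lerDl sqr_ge0. Qed.

Lemma homN_eq0_sqnorm g : homN g = 0 -> sqnorm_hor g = 0 /\ g.2 = 0.
Proof.
move/eqP; rewrite paddr_eq0 ?sqr_ge0// => /andP[/eqP h1 /eqP h2].
by split; apply/eqP; rewrite -sqrf_eq0 ?h1 ?h2.
Qed.

(** The index is the fourth power of the radius, which avoids roots: for r > 0, [dil r] maps [NB s]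
    onto [NB (r ^+ 4 * s)]. *)
Definition NB r : set H := [set g | homN g < r].

Lemma measurable_NB r : measurable (NB r).
Proof.
have := @measurable_homN R n; rewrite -[NB r]setTI => /(_ measurableT `]-oo, r[%classic (measurable_itv _)).
by congr (measurable (_ `&` _)); apply/seteqP; split => g; rewrite /NB /= in_itv.
Qed.

Lemma ge0_integral_dil_set r (S : set H) (f : H -> \bar R) : 0 < r -> measurable S ->
  measurable_fun setT f -> (forall g, (0 <= f g)%E) ->
  (\int[mu]_(g in [set g | S (dil r g)]) f (dil r g) =
   (r ^- Q)%:E * \int[mu]_(g in S) f g)%E.
Proof.
move=> r0 mS mf f0; rewrite integral_mkcond [in RHS]integral_mkcond.
rewrite -(@ge0_integral_dil R n r (f \_ S)) //; last 2 first.
- exact/(measurable_restrictT f mS)/measurable_funTS.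
- exact: erestrict_ge0.
Qed.

Lemma dil_NB r s : 0 < r -> [set g | NB (r ^+ 4 * s) (dil r g)] = NB s.
Proof.
move=> r0; apply/seteqP; split => g; rewrite /NB /= homN_dil ltr_pM2l// exprn_gt0//.
Qed.

Lemma NB_hbox r : 0 < r -> NB r `<=` hbox (r + 1).
Proof.
move=> r0 g; rewrite /NB /= => hN.
have h1 (x : R) : x ^+ 2 < r -> `|x| < r + 1.
  move=> hx; rewrite ltNge; apply/negP => h.
  have : (r + 1) ^+ 2 <= x ^+ 2.
    by rewrite -[x ^+ 2]real_normK ?num_real// ler_pXn2r ?nnegrE// addr_ge0// ltW.
  by nra.
have h2 : sqnorm_hor g ^+ 2 < r by apply: le_lt_trans hN; exact: sqnorm_le_homN.
split => [i|]; last first.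
  by apply: h1; apply: le_lt_trans hN; rewrite lerDr sqr_ge0.
rewrite ltNge; apply/negP => h.
have h3 : (r + 1) ^+ 2 <= sqnorm_hor g.
  apply: le_trans (coord_le_sqnorm g i).
  by rewrite -[_ ^+ 2 in X in _ <= X]real_normK ?num_real// ler_pXn2r ?nnegrE// addr_ge0// ltW.
have h4 : ((r + 1) ^+ 2) ^+ 2 <= sqnorm_hor g ^+ 2.
  by rewrite ler_pXn2r ?nnegrE ?sqr_ge0// sqnorm_hor_ge0.
by have := sqr_ge0 r; nra.
Qed.

Lemma mu_NB_fin r : 0 < r -> (mu (NB r) < +oo)%E.
Proof.
move=> r0; have r1 : 0 < r + 1 by rewrite addr_gt0.
apply: (@le_lt_trans _ _ (mu (hbox (r + 1)))).
  by apply: le_measure; rewrite ?inE; [exact: measurable_NB|exact: measurable_hbox|exact: NB_hbox].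
by rewrite heis_leb_hbox// ltry.
Qed.

Lemma hbox_NB r : 0 < r -> exists2 d, 0 < d & hbox d `<=` NB r.
Proof.
(* On the box of size d <= 1, [homN] is below (2n)^2 d^4 + d^2, which is at most c d. *)
move=> r0; pose c : R := (n + n)%:R ^+ 2 + 1.
have c0 : 0 < c by rewrite ltr_wpDl ?sqr_ge0.
pose d := Num.min 1 (r / c).
have d0 : 0 < d by rewrite lt_min ltr01 divr_gt0.
have d1 : d <= 1 by rewrite ge_min lexx.
have dc : d * c <= r by rewrite -ler_pdivlMr// ge_min lexx orbT.
exists d => // g [h1 h2]; rewrite /NB /=.
have sq (x : R) : `|x| < d -> x ^+ 2 < d ^+ 2.
  by move=> h; rewrite -[x ^+ 2]real_normK ?num_real// ltr_pXn2r ?nnegrE// ltW.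
have a1 : sqnorm_hor g <= (n + n)%:R * d ^+ 2.
  have -> : (n + n)%:R * d ^+ 2 = \sum_(i < n + n) d ^+ 2.
    by rewrite sumr_const card_ord mulr_natl.
  by apply: ler_sum => i _; rewrite ltW// sq.
have a2 := sq _ h2.
have a3 : sqnorm_hor g ^+ 2 <= ((n + n)%:R * d ^+ 2) ^+ 2.
  by rewrite ler_pXn2r ?nnegrE ?sqnorm_hor_ge0// mulr_ge0// sqr_ge0.
rewrite /homN; apply: (@lt_le_trans _ _ (((n + n)%:R * d ^+ 2) ^+ 2 + d ^+ 2)).
  exact: ler_ltD.
apply: le_trans dc; rewrite /c exprMn -exprM; move: ((n + n)%:R ^+ 2) (sqr_ge0 ((n + n)%:R : R)) => m m0.
have e1 : d ^+ 2 <= d by rewrite expr2 ler_piMr// ltW.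
have e2 : d ^+ 4 <= d by rewrite exprS ler_piMr ?exprn_ile1// ltW.
by rewrite mulrDr mulr1 [d * m]mulrC lerD// ler_wpM2l.
Qed.

Lemma mu_NB_gt0 r : 0 < r -> (0 < mu (NB r))%E.
Proof.
move=> r0; have [d d0 hd] := hbox_NB r0.
apply: (@lt_le_trans _ _ (mu (hbox d))).
  by rewrite heis_leb_hbox// lte_fin exprn_gt0// mulr_gt0.
by apply: le_measure; rewrite ?inE; [exact: measurable_hbox|exact: measurable_NB|].
Qed.

Lemma mu_NB_scale r s : 0 < r ->
  (mu (NB s) = (r ^- Q)%:E * mu (NB (r ^+ 4 * s)))%E.
Proof.
move=> r0.
have := @ge0_integral_dil_set r (NB (r ^+ 4 * s)) (cst 1%E) r0 (measurable_NB _).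
rewrite dil_NB// !integral_cst ?mul1e; try exact: measurable_NB.
by apply => //.
Qed.

(** The map (x, t) to (2 x, t) preserves the axis x = 0 and any piece of it bounded in t, but
    multiplies volumes by 2^(2n), which exceeds 1 as n > 0. Such a piece has finite measure, so it
    is null. *)
Lemma sqnorm_gt0_ae : (0 < n)%N -> {ae mu, forall g, 0 < sqnorm_hor g}.
Proof.
move=> n0.
pose A (N : nat) : set H := [set g | sqnorm_hor g = 0 /\ `|g.2| < N.+1%:R].
have A0 : measurable [set g : H | sqnorm_hor g = 0].
  have := @measurable_sqnorm R n; rewrite -[X in measurable X]setTI => /(_ measurableT [set 0] (measurable_set1 _)).
  by [].
have mA N : measurable (A N).
  apply: measurableI => //.
  have m2 : measurable_fun setT (fun g : H => `|g.2|).
    by apply: (measurableT_comp (@normr_measurable _ _)); exact: measurable_snd.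
  have := m2 measurableT `]-oo, N.+1%:R[%classic (measurable_itv _).
  rewrite setTI; congr measurable; apply/seteqP; split => g /=; rewrite in_itv//=.
have AN N : mu (A N) = 0%E.
  have hx g : sqnorm_hor g = 0 -> forall i, g.1 ord0 i = 0.
    move=> h i; apply/eqP; rewrite -sqrf_eq0 eq_le sqr_ge0 andbT -h.
    exact: coord_le_sqnorm.
  have Afin : (mu (A N) < +oo)%E.
    have r1 : 0 < N.+1%:R + 1 :> R by [].
    apply: (@le_lt_trans _ _ (mu (hbox N.+1%:R))).
      apply: le_measure; rewrite ?inE; [exact: mA|exact: measurable_hbox|].
      by move=> g [h1 h2]; split => // i; rewrite hx// normr0.
    by rewrite heis_leb_hbox// ltry.
  have two0 : 2 != 0 :> R by rewrite pnatr_eq0.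
  have := @ge0_integral_affine_heis R n 2 0 1 (fun=> 0) (fun g => (\1_(A N) g)%:E)
    two0 (oner_neq0 _) (measurable_cst _).
  have -> : (\int[mu]_g (\1_(A N) g)%:E = mu (A N))%E by rewrite integral_indic// setIT.
  have -> : (\int[mu]_g (\1_(A N) (2 *: g.1 + 0, 1 * g.2 + 0))%:E = mu (A N))%E.
    have Ai : (\int[mu]_g (\1_(A N) g)%:E = mu (A N))%E by rewrite integral_indic// setIT.
    rewrite -[RHS]Ai; apply: eq_integral => g _.
    congr (_%:E); rewrite !indicE; congr ((_ : bool)%:R); apply/idP/idP; rewrite !inE /A /= mul1r !addr0 => -[h1 h2]; split => //.
    - move: h1; rewrite -[(2 *: _, _)]/(2 *: g.1, g.2).
      have -> : sqnorm_hor ((2 *: g.1, g.2) : H) = 2 ^+ 2 * sqnorm_hor g.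
        by rewrite /sqnorm_hor mulr_sumr; apply: eq_bigr => i _; rewrite /= mxE exprMn.
      by move/eqP; rewrite mulf_eq0 => /orP[/eqP|/eqP//]; lra.
    - have -> : sqnorm_hor ((2 *: g.1, g.2) : H) = 2 ^+ 2 * sqnorm_hor g.
        by rewrite /sqnorm_hor mulr_sumr; apply: eq_bigr => i _; rewrite /= mxE exprMn.
      by rewrite h1 mulr0.
  have m1 : measurable_fun setT (fun g : H => (\1_(A N) g : R)%:E).
    by apply/measurable_EFinP; exact: measurable_indic.
  move=> /(_ m1 (fun g => _)) => h.
  have {}h := h (fun g => ltac:(by rewrite lee_fin indicE)).
  have Af : mu (A N) \is a fin_num by rewrite ge0_fin_numE.
  move: h; rewrite -(fineK Af) -EFinM => -[]; rewrite normr1 invr1 mulr1.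
  rewrite ger0_norm// => h; congr (_%:E).
  have c1 : (2^-1 : R) ^+ (n + n) < 1.
    by rewrite exprn_ilt1 ?invr_ge0// ?invf_lt1// ?ltr1n// -lt0n addn_gt0 n0.
  apply/eqP; apply: contraLR c1 => hne; rewrite -leNgt.
  have : fine (mu (A N)) * ((2^-1 : R) ^+ (n + n) - 1) = 0 by rewrite mulrBr mulr1 mulrC -h subrr.
  by move/eqP; rewrite mulf_eq0 (negbTE hne)/= subr_eq0 => /eqP ->.
have cov : ~` [set g : H | 0 < sqnorm_hor g] `<=` \bigcup_N A N.
  move=> g /= /negP; rewrite -leNgt => h.
  have h0 : sqnorm_hor g = 0 by apply/eqP; rewrite eq_le h sqnorm_hor_ge0.
  near \oo => N; exists N => //; split => //.
  near: N; apply: filterS (nbhs_infty_gtr `|g.2|) => N hN; by rewrite (lt_le_trans hN)// ler_nat leqnSn.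
apply: (negligibleS cov); apply: negligible_bigcup => N.
by exists (A N); split.
Unshelve. all: by end_near.
Qed.

(** Self-similarity replaces polar coordinates. Dilation by 1/2 carries the part with homN < 1/16
    into the unit ball, so the integral I over a <= homN < 1 satisfies I <= a1 + th I with th = 2^(4
    s - Q) < 1. This bounds I independently of a. *)
Lemma int_homN_pow s : 0 < s -> 4 * s < Q%:R ->
  (\int[mu]_(g in NB 1) (homN g `^ (- s))%:E < +oo)%E.
Proof.
move=> s0 sQ.
pose f g : \bar R := (homN g `^ (- s))%:E.
have mf : measurable_fun setT f.
  by apply/measurable_EFinP; apply: measurable_powR_comp; exact: measurable_homN.
have f0 g : (0 <= f g)%E by rewrite lee_fin powR_ge0.
pose th : R := 2 `^ (4 * s - Q%:R).
have th1 : th < 1.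
  rewrite /th -opprB powRN invf_lt1 ?powR_gt0// -[X in X < _](congr1 (fun f => f (Q%:R - 4 * s)) (powR1 R)).
  by apply: gt0_ltr_powR; rewrite ?subr_gt0 ?nnegrE ?ltr1n.
have th0 : 0 <= th by exact: powR_ge0.
pose S (a : R) : set H := [set g | a <= homN g] `&` NB 1.
have mS0 a : measurable [set g : H | a <= homN g].
  have := @measurable_homN R n; rewrite -[X in measurable X]setTI => /(_ measurableT `[a, +oo[%classic (measurable_itv _)).
  by congr (measurable (_ `&` _)); apply/seteqP; split => g; rewrite /= in_itv/= andbT.
have mS a : measurable (S a) by apply: measurableI => //; exact: measurable_NB.
have Sfin a : 0 < a -> (\int[mu]_(g in S a) f g < +oo)%E.
  move=> a0; apply: (@le_lt_trans _ _ (\int[mu]_(g in S a) (a `^ (- s))%:E)%E).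
    apply: ge0_le_integral => //; first exact: measurable_funTS.
    move=> g [h1 h2]; rewrite lee_fin !powRN lef_pV2 ?posrE ?powR_gt0//; last exact: lt_le_trans h1.
    by apply: ge0_ler_powR; rewrite ?nnegrE ?homN_ge0// ltW.
  rewrite integral_cst//; apply: (@le_lt_trans _ _ ((a `^ (- s))%:E * mu (NB 1))%E).
    apply: lee_pmul => //.
    + by rewrite lee_fin powR_ge0.
    + by apply: le_measure; rewrite ?inE//; [exact: measurable_NB|move=> g []].
  have F := mu_NB_fin (@ltr01 R); rewrite -ge0_fin_numE// in F.
  by rewrite -(fineK F) -EFinM ltry.
have i16 : 0 < (16^-1 : R) by rewrite invr_gt0.
pose a1 := fine (\int[mu]_(g in S 16^-1) f g).
have rec a : 0 < a -> a <= 16^-1 -> (\int[mu]_(g in S a) f g <= a1%:E + th%:E * \int[mu]_(g in S a) f g)%E.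
  move=> a0 a16; rewrite fineK; last by rewrite ge0_fin_numE ?Sfin// integral_ge0.
  pose T : set H := [set g | a <= homN g] `&` NB 16^-1.
  have mT : measurable T by apply: measurableI => //; exact: measurable_NB.
  have -> : S a = S 16^-1 `|` T.
    apply/seteqP; split => g.
      move=> [h1 h2]; have [h|h] := leP 16^-1 (homN g); [by left|by right].
    move=> [[h1 h2]|[h1 h2]]; split => //; first exact: le_trans h1.
    by apply: (lt_trans h2); rewrite invf_lt1// ltr1n.
  rewrite {1}ge0_integral_setU//; last 2 first.
  - exact: measurable_funTS.
  - apply/disj_setPS => g [[h1 _] [_ h2]].
    by move: (le_lt_trans h1 h2); rewrite ltxx.
  rewrite leeD2l//.
  have h2 : (0 < 2^-1 :> R) by rewrite invr_gt0.
  have := @ge0_integral_dil_set 2^-1 T f h2 mT mf f0.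
  have -> : [set g | T (dil 2^-1 g)] = [set g | 16 * a <= homN g] `&` NB 1.
    have e16 : (2^-1 : R) ^+ 4 = 16^-1 by rewrite exprVn -natrX.
    apply/seteqP; split => g [h3 h4]; split.
    + by move: h3; rewrite /= homN_dil e16 ler_pdivlMl.
    + by move: h4; rewrite /NB /= homN_dil e16 ltr_pdivrMl// mulfV ?gt_eqF.
    + by rewrite /= homN_dil e16 ler_pdivlMl.
    + by rewrite /NB /= homN_dil e16 ltr_pdivrMl// mulfV ?gt_eqF.
  have e1 g : (f (dil 2^-1 g) = (16 `^ s)%:E * f g)%E.
    rewrite /f homN_dil powRM ?homN_ge0 ?exprn_ge0 ?invr_ge0// EFinM; congr (_ * _)%E.
    by rewrite exprVn -natrX -powR_inv1 ?powRrM ?mulN1r ?opprK// -powRrM mulN1r opprK.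
  have -> : (\int[mu]_(g in [set g | (16 * a <= homN g)%R] `&` NB 1) f (dil 2^-1 g) =
    \int[mu]_(g in [set g | (16 * a <= homN g)%R] `&` NB 1) ((16 `^ s)%:E * f g))%E.
    by apply: eq_integral => g _; exact: e1.
  rewrite ge0_integralZl//; last 2 first.
  - by apply: measurableI => //; exact: measurable_NB.
  - exact: measurable_funTS.
  rewrite exprVn invrK => e.
  have hth : th = 16 `^ s / 2 ^+ Q.
    have two0 : (2 : R) != 0 by rewrite pnatr_eq0.
    have e4 : (2 : R) `^ 4 = 16 by rewrite powR_mulrn// -natrX.
    by rewrite /th powRB ?two0 ?implybT// powRrM e4 powR_mulrn.
  have -> : (\int[mu]_(g in T) f g = th%:E * \int[mu]_(g in ([set g | (16 * a <= homN g)%R] `&` NB 1)) f g)%E.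
    rewrite hth mulrC EFinM -muleA e muleA -EFinM mulVf ?mul1e//.
  apply: lee_pmul => //; first by apply: integral_ge0.
  apply: ge0_subset_integral => //.
  - by apply: measurableI => //; exact: measurable_NB.
  - by rewrite -/(S 16^-1); exact: measurableU.
  - exact: measurable_funTS.
  - move=> g [h3 h4]; have h5 : a <= homN g.
      by apply: le_trans h3; rewrite ler_peMl ?ler1n// (ltW a0).
    by have [h|h] := leP 16^-1 (homN g); [left|right].
have bnd a : 0 < a -> a <= 16^-1 -> (\int[mu]_(g in S a) f g <= (a1 / (1 - th))%:E)%E.
  move=> a0 a16; have := rec _ a0 a16.
  have F : (\int[mu]_(g in S a) f g)%E \is a fin_num by rewrite ge0_fin_numE ?Sfin// integral_ge0.
  rewrite -(fineK F) -EFinM -EFinD !lee_fin => h.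
  by rewrite ler_pdivlMr ?subr_gt0// mulrBr mulr1 lerBlDr [X in _ <= _ + X]mulrC.
pose E (j : nat) := S (16^-1 / j.+1%:R).
have cE := @ge0_nondecreasing_set_cvg_integral _ H R E f mu.
have EU : \bigcup_j E j = [set g | 0 < homN g] `&` NB 1.
  apply/seteqP; split => g.
    move=> [j _ [h1 h2]]; split => //; apply: lt_le_trans h1.
    by rewrite divr_gt0.
  move=> [/= h1 h2]; near \oo => j; exists j => //; split => //=.
  rewrite ler_pdivrMr// mulrC -ler_pdivrMr//.
  near: j; apply: filterS (nbhs_infty_ger (16^-1 / homN g)) => j hj.
  by rewrite (le_trans hj)// ler_nat.
have -> : (\int[mu]_(g in NB 1) f g = \int[mu]_(g in \bigcup_j E j) f g)%E.
  rewrite EU integral_mkcond [RHS]integral_mkcond; apply: eq_integral => g _.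
  rewrite !patchE in_setI; have [h|h] := ltP 0 (homN g).
    by rewrite (mem_set (h : [set g : H | 0 < homN g] g)).
  rewrite (memNset (A := [set g | 0 < homN g])) /=; last by apply/negP; rewrite -leNgt.
  (* At the origin the integrand is 0, since [powR] of 0 is 0 for a nonzero exponent; the origin
     therefore contributes nothing. *)
  have -> : f g = 0%E; last by case: ifP.
  have h0 : homN g = 0 by apply/eqP; rewrite eq_le h homN_ge0.
  by rewrite /f h0 powR0// oppr_eq0 gt_eqF.
have {}cE : (\int[mu]_(g in E j) f g @[j --> \oo] --> \int[mu]_(g in \bigcup_j E j) f g)%E.
  apply: cE => //.
  - apply/nondecreasing_seqP => j; rewrite subsetEset => g [h1 h2]; split => //.
    apply: le_trans h1; rewrite ler_pM2l// lef_pV2 ?posrE// ler_nat//.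
  - by move=> j; exact: mS.
  - by move=> j; exact: measurable_funTS.
apply: (@le_lt_trans _ _ (a1 / (1 - th))%:E); last by rewrite ltry.
rewrite -(cvg_lim _ cE)//; apply: lime_le; first by apply/cvg_ex; eexists; exact: cE.
apply: nearW => j; apply: bnd; first by rewrite divr_gt0.
by rewrite ler_pdivrMr// ler_peMr// ?ler1n// ltW.
Unshelve. all: by end_near.
Qed.

End HomogeneousBalls.

(** * The counterexample *)

Section Profile.
Context {R : realType}.
Variables (b : R) (nu : R).
Hypotheses (b0 : 0 < b) (b4 : b < 4^-1) (nu0 : 0 <= nu).
Implicit Types (a : nat -> R) (e y : R) (m i : nat) (p : {poly R}).

Definition pwr a e m y : R := \sum_(i < m) a i * y `^ (i%:R * b + e).

Lemma pwr_is_derive a e m y : 0 < y ->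
  is_derive y 1 (pwr a e m) (pwr (fun i => a i * (i%:R * b + e)) (e - 1) m y).
Proof.
move=> y0; elim: m => [|m IH].
  have -> : pwr a e 0 = fun=> 0 by apply/funext => z; rewrite /pwr big_ord0.
  by rewrite /pwr big_ord0; exact: is_derive_cst.
have -> : pwr a e m.+1 = pwr a e m \+ (fun z => a m * z `^ (m%:R * b + e)).
  by apply/funext => z; rewrite /pwr big_ord_recr.
rewrite /pwr big_ord_recr /= -/(pwr _ _ _ _); apply: is_deriveD.
have := @is_deriveZ R R^o R^o _ (a m) _ _ _ (is_derive1_powR (m%:R * b + e) y0).
by move=> h; apply: (is_derive_eq h); rewrite -[LHS]/(a m * _) mulrA addrA.
Qed.

Lemma pwr_bound a e e' m y : 0 < y -> y <= 1 ->
  (forall i, a i != 0 -> e' <= i%:R * b + e) ->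
  `|pwr a e m y| <= (\sum_(i < m) `|a i|) * y `^ e'.
Proof.
move=> y0 y1 h; rewrite /pwr mulr_suml; apply: le_trans (ler_norm_sum _ _ _) _.
apply: ler_sum => i _; rewrite normrM (ger0_norm (powR_ge0 _ _)).
have [->|ai] := eqVneq (a i) 0; first by rewrite normr0 !mul0r.
by rewrite ler_wpM2l// ger_powR ?y0 ?h.
Qed.

Lemma Ck_pwr k a e m n (f : heis R n -> R) : Ck k f -> (forall g, 0 < f g) ->
  Ck k (fun g => pwr a e m (f g)).
Proof.
move=> hf f0; apply: Ck_sum => i.
by apply: (@Ck_comp R n k [set x | 0 < x] (fun x => a i * x `^ (i%:R * b + e))) => // j; exact: Sk_powR.
Qed.

(** Continuity at 0 uses that [powR] of 0 with exponent 0 is 1 for the constant term; all other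
    exponents are positive. *)
Lemma pwr_cvg0 a m (l : nat -> R) : (forall j, 0 < l j) -> l @ \oo --> 0 ->
  pwr a 0 m (l j) @[j --> \oo] --> pwr a 0 m 0.
Proof.
move=> l0 lc; elim: m => [|m IH].
  have -> : (fun j => pwr a 0 0 (l j)) = fun=> 0 by apply/funext => z; rewrite /pwr big_ord0.
  by rewrite /pwr big_ord0; exact: cvg_cst.
have -> : (fun j => pwr a 0 m.+1 (l j)) = (fun j => pwr a 0 m (l j) + a m * l j `^ (m%:R * b + 0)).
  by apply/funext => z; rewrite /pwr big_ord_recr.
rewrite {2}/pwr big_ord_recr /= -/(pwr _ _ _ _); apply: cvgD => //; apply: cvgMr.
rewrite addr0; case: m {IH} => [|m].
  by rewrite mul0r powRr0; under eq_fun do rewrite powRr0; exact: cvg_cst.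
have s0 : 0 < m.+1%:R * b by rewrite mulr_gt0.
rewrite powR0 ?gt_eqF//.
by apply: ((cvg_at_rightP (fun x => x `^ (m.+1%:R * b)) 0 0).1 (powR_cvg0 s0) l); split.
Qed.

(** For p = 1 this is the cutoff at y = 1. It is not constant near 0, but in the differential
    equation its derivatives multiply bounded terms only. *)
Definition gp p y : R := pexp p (1 - y).
Definition dp p : {poly R} := 'X^2 * (p - p^`()).

Lemma gp_is_derive p y : is_derive y 1 (gp p) (- gp (dp p) y).
Proof.
have h1 : is_derive y 1 (fun z : R => 1 - z) (-1).
  have := @is_deriveB R R^o R^o (fun=> 1) id y 1 0 1 _ _.
  by move=> h; apply: (is_derive_eq (h _ _)); rewrite sub0r.
have := is_derive_comp1_R h1 (pexp_is_derive p (1 - y)).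
by move=> h; apply: (is_derive_eq h); rewrite mulrN1.
Qed.

Lemma gp_bound p : exists2 C, 0 <= C & forall y, 0 <= y -> `|gp p y| <= C.
Proof.
have [C C0 hC] := pexp_bound p; exists C => // y y0.
have [y1|y1] := leP 1 y; first by rewrite /gp /pexp ltNge subr_le0 y1 normr0.
apply: le_trans (hC _) _; rewrite ler_piMr// exprn_ile1// ?subr_ge0 ?(ltW y1)//.
by rewrite gerBl.
Qed.

Lemma gp_ge1 p y : 1 <= y -> gp p y = 0.
Proof. by move=> y1; rewrite /gp /pexp ltNge subr_le0 y1. Qed.

Lemma Ck_gp k p n (f : heis R n -> R) : Ck k f -> Ck k (fun g => gp p (f g)).
Proof.
move=> hf; apply: (@Ck_comp R n k setT (pexp p) (fun g => 1 - f g)) => //.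
  by move=> j; exact: Sk_pexp.
by apply: CkD; [exact: Ck_cst|exact: CkN].
Qed.

(** The recursion of a Frobenius series: 16 y H'' + 8 (nu + 2) H' takes y^e to 16 e (e + nu / 2)
    y^(e - 1), and for e = (i + 1) b this has to match the coefficient of y^(i b) multiplied by y^(b
    - 1). *)
Fixpoint cc i : R := if i is j.+1 then
  cc j / (16 * (j.+1%:R * b) * (j.+1%:R * b + nu / 2)) else 1.

Lemma cc_gt0 i : 0 < cc i.
Proof.
elim: i => //= i IH; rewrite divr_gt0// mulr_gt0//.
  by rewrite !mulr_gt0.
by rewrite ltr_pwDl ?mulr_gt0// divr_ge0.
Qed.

(** Enough terms for mm b >= 1, so that the one uncancelled power y^(mm b - 1) is bounded on ]0,
    1]. *)
Definition mm : nat := (Num.truncn b^-1).+1.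

Lemma mm_b : 1 <= mm%:R * b.
Proof. by rewrite -ler_pdivrMr// mul1r ltW// truncnS_gt. Qed.

Lemma mm_gt1 : (1 < mm)%N.
Proof.
rewrite -(ltr_nat R); have h : 4 < b^-1 by rewrite -[4]invrK ltf_pV2 ?posrE ?invr_gt0.
apply: (@lt_trans _ _ b^-1); first by apply: lt_trans h; rewrite ltr1n.
by rewrite truncnS_gt.
Qed.

(* A partial sum in powers of y^b of a solution of
   16 y H'' + 8 (nu + 2) H' = y^(b - 1) H, cut off at y = 1; for nu = n this is
   the equation L u = 0 for u = H(|g|^4). *)
Definition H0 y := pwr cc 0 mm y * gp 1 y.
Definition cc1 i := cc i * (i%:R * b).
Definition cc2 i := cc1 i * (i%:R * b - 1).
Definition H1 y := pwr cc1 (-1) mm y * gp 1 y - pwr cc 0 mm y * gp (dp 1) y.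
Definition H2 y := pwr cc2 (-2) mm y * gp 1 y - 2 * (pwr cc1 (-1) mm y * gp (dp 1) y)
   + pwr cc 0 mm y * gp (dp (dp 1)) y.

Lemma pwr0_is_derive y : 0 < y -> is_derive y 1 (pwr cc 0 mm) (pwr cc1 (-1) mm y).
Proof.
move=> y0; apply: (is_derive_eq (pwr_is_derive cc 0 mm y0)).
by rewrite sub0r /pwr; apply: eq_bigr => i _; rewrite addr0.
Qed.

Lemma pwr1_is_derive y : 0 < y -> is_derive y 1 (pwr cc1 (-1) mm) (pwr cc2 (-2) mm y).
Proof.
move=> y0; apply: (is_derive_eq (pwr_is_derive cc1 (-1) mm y0)).
by have -> : -1 - 1 = -2 :> R by ring.
Qed.

Lemma H0_is_derive y : 0 < y -> is_derive y 1 H0 (H1 y).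
Proof.
move=> y0; have h := is_deriveM (pwr0_is_derive y0) (gp_is_derive 1 y).
apply: (is_derive_eq h).
rewrite -[LHS]/(pwr cc 0 mm y * (- gp (dp 1) y) + gp 1 y * pwr cc1 (-1) mm y) /H1.
by ring.
Qed.

Lemma H1_is_derive y : 0 < y -> is_derive y 1 H1 (H2 y).
Proof.
move=> y0; have h1 := is_deriveM (pwr1_is_derive y0) (gp_is_derive 1 y).
have h2 := is_deriveM (pwr0_is_derive y0) (gp_is_derive (dp 1) y).
have h := is_deriveB h1 h2; apply: (is_derive_eq h).
rewrite -[LHS]/(pwr cc1 (-1) mm y * (- gp (dp 1) y) + gp 1 y * pwr cc2 (-2) mm y
  - (pwr cc 0 mm y * (- gp (dp (dp 1)) y) + gp (dp 1) y * pwr cc1 (-1) mm y)) /H2.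
by ring.
Qed.

Lemma H_ge1 y : 1 <= y -> [/\ H0 y = 0, H1 y = 0 & H2 y = 0].
Proof. by move=> y1; rewrite /H0 /H1 /H2 !gp_ge1// !mulr0 subr0 ?mulr0 ?subr0 ?addr0. Qed.

Lemma cc1_ne0 i : cc1 i != 0 -> (0 < i)%N.
Proof. by case: i => //; rewrite /cc1 mul0r mulr0 eqxx. Qed.

Lemma cc1_ge0 i : 0 <= cc1 i.
Proof. by rewrite mulr_ge0 ?(ltW (cc_gt0 i))// mulr_ge0// ltW. Qed.

(** Differentiation kills the constant term of the series, so the leading singularities of H' and
    H'' are y^(b - 1) and y^(b - 2) rather than y^-1 and y^-2. *)
Lemma H_bound : exists2 C, 0 <= C & forall y, 0 < y ->
  [/\ `|H0 y| <= C, `|H1 y| <= C * y `^ (b - 1) & `|H2 y| <= C * y `^ (b - 2)].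
Proof.
have [G0 G00 hG0] := gp_bound 1; have [G1 G10 hG1] := gp_bound (dp 1).
have [G2 G20 hG2] := gp_bound (dp (dp 1)).
pose S0 := \sum_(i < mm) `|cc i|; pose S1 := \sum_(i < mm) `|cc1 i|.
pose S2 := \sum_(i < mm) `|cc2 i|.
have S00 : 0 <= S0 by exact: sumr_ge0.
have S10 : 0 <= S1 by exact: sumr_ge0.
have S20 : 0 <= S2 by exact: sumr_ge0.
pose C := S0 * G0 + (S1 * G0 + S0 * G1) + (S2 * G0 + 2 * (S1 * G1) + S0 * G2).
have D0 : 0 <= S0 * G0 by rewrite mulr_ge0.
have D1 : 0 <= S1 * G0 + S0 * G1 by rewrite addr_ge0// mulr_ge0.
have D2 : 0 <= S2 * G0 + 2 * (S1 * G1) + S0 * G2 by rewrite !addr_ge0// !mulr_ge0.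
have C0 : 0 <= C := addr_ge0 (addr_ge0 D0 D1) D2.
exists C => // y y0; have [y1|y1] := leP 1 y.
  by have [-> -> ->] := H_ge1 y1; rewrite normr0 C0 !mulr_ge0 ?powR_ge0.
have g0 := hG0 _ (ltW y0); have g1 := hG1 _ (ltW y0); have g2 := hG2 _ (ltW y0).
have p0 : `|pwr cc 0 mm y| <= S0.
  have := @pwr_bound cc 0 0 mm y y0 (ltW y1); rewrite powRr0 mulr1; apply => i _.
  by rewrite addr0 mulr_ge0// ltW.
have p1 : `|pwr cc1 (-1) mm y| <= S1 * y `^ (b - 1).
  apply: pwr_bound => // [|i /cc1_ne0 i0]; first exact: ltW.
  by rewrite lerD2r ler_peMl ?ler1n// ltW.
have p2 : `|pwr cc2 (-2) mm y| <= S2 * y `^ (b - 2).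
  apply: pwr_bound => // [|i i0]; first exact: ltW.
  have {}i0 : (0 < i)%N by apply: cc1_ne0; apply: contraNneq i0 => h; rewrite /cc2 h mul0r.
  by rewrite lerD2r ler_peMl ?ler1n// ltW.
have w1 : 1 <= y `^ (b - 1).
  rewrite -[leLHS](powRr0 y); apply: ger_powR; first by rewrite y0 ltW.
  by rewrite subr_le0 ltW// (lt_trans b4)// invf_lt1// ltr1n.
have w2 : y `^ (b - 1) <= y `^ (b - 2).
  apply: ger_powR; first by rewrite y0 ltW.
  by rewrite lerD2l lerN2 ler1n.
have v1 := powR_ge0 y (b - 1); have v2 := powR_ge0 y (b - 2).
have mb (u v s t : R) : `|u| <= s -> `|v| <= t -> `|u * v| <= s * t.
  by move=> h1 h2; rewrite normrM ler_pM.
have a0 := mb _ _ _ _ p0 g0.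
have a1 : `|pwr cc1 (-1) mm y * gp 1 y| <= S1 * G0 * y `^ (b - 1).
  by rewrite mulrAC; exact: mb.
have a2 : `|pwr cc1 (-1) mm y * gp (dp 1) y| <= S1 * G1 * y `^ (b - 1).
  by rewrite mulrAC; exact: mb.
have a3 := mb _ _ _ _ p0 g1; have a4 := mb _ _ _ _ p0 g2.
have a5 : `|pwr cc2 (-2) mm y * gp 1 y| <= S2 * G0 * y `^ (b - 2).
  by rewrite mulrAC; exact: mb.
split.
- by apply: le_trans a0 _; rewrite /C -addrA lerDl addr_ge0.
- apply: (@le_trans _ _ ((S1 * G0 + S0 * G1) * y `^ (b - 1))).
    apply: le_trans (ler_normB _ _) _; rewrite mulrDl lerD//.
    by apply: le_trans a3 _; rewrite ler_peMr// mulr_ge0.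
  by rewrite ler_wpM2r// /C addrAC lerDr addr_ge0.
- apply: (@le_trans _ _ ((S2 * G0 + 2 * (S1 * G1) + S0 * G2) * y `^ (b - 2))).
    rewrite /H2; apply: le_trans (ler_normD _ _) _; rewrite [leRHS]mulrDl; apply: lerD.
      apply: le_trans (ler_normB _ _) _; rewrite [leRHS]mulrDl; apply: lerD => //.
      rewrite normrM gtr0_norm// -mulrA ler_pM2l//.
      by apply: le_trans a2 _; rewrite ler_wpM2l// mulr_ge0.
    by apply: le_trans a4 _; rewrite ler_peMr ?mulr_ge0// (le_trans w1).
  by rewrite ler_wpM2r// /C lerDr addr_ge0.
Qed.

(* The coefficients [cc] make all but the last term of the power series part
   cancel. *)
Lemma pwr_ode y : 0 < y ->
  y `^ (b - 1) * pwr cc 0 mm y - 16 * (y * pwr cc2 (-2) mm y)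
     - 8 * (nu + 2) * pwr cc1 (-1) mm y = cc mm.-1 * y `^ (mm%:R * b - 1).
Proof.
move=> y0; have yn : y != 0 by rewrite gt_eqF.
have e2 : y * pwr cc2 (-2) mm y = \sum_(i < mm) cc2 i * y `^ (i%:R * b - 1).
  rewrite /pwr mulr_sumr; apply: eq_bigr => i _.
  have -> : y `^ (i%:R * b - 1) = y * y `^ (i%:R * b - 2).
    rewrite -{2}(powRr1 (ltW y0)) -powRD ?yn ?implybT//; congr powR; ring.
  by ring.
have e0 : y `^ (b - 1) * pwr cc 0 mm y = \sum_(i < mm) cc i * y `^ (i.+1%:R * b - 1).
  rewrite /pwr mulr_sumr; apply: eq_bigr => i _.
  have -> : y `^ (i.+1%:R * b - 1) = y `^ (b - 1) * y `^ (i%:R * b + 0).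
    rewrite -powRD ?yn ?implybT//; congr powR; rewrite -natr1; ring.
  by ring.
have e3 : 16 * (\sum_(i < mm) cc2 i * y `^ (i%:R * b - 1)) + 8 * (nu + 2) * pwr cc1 (-1) mm y
   = \sum_(i < mm) cc i * (16 * (i%:R * b) * (i%:R * b + nu / 2)) * y `^ (i%:R * b - 1).
  rewrite /pwr !mulr_sumr -big_split; apply: eq_bigr => i _ /=.
  by rewrite /cc2 /cc1; move: (cc i) (i%:R * b) => c d; field.
have e4 : \sum_(i < mm) cc i * (16 * (i%:R * b) * (i%:R * b + nu / 2)) * y `^ (i%:R * b - 1) =
  \sum_(i < mm.-1) cc i * y `^ (i.+1%:R * b - 1).
  rewrite /mm big_ord_recl /= !mul0r mulr0 mul0r mulr0 mul0r add0r; apply: eq_bigr => i _.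
  rewrite /bump /= add1n mulfVK//.
  rewrite gt_eqF// mulr_gt0//; first by rewrite !mulr_gt0.
  by rewrite ltr_pwDl ?mulr_gt0// divr_ge0.
by rewrite e2 e0 -addrA -opprD e3 e4 {1}/mm big_ord_recr /= addrAC subrr add0r.
Qed.

(** Besides the remainder of [pwr_ode] there are only terms in which the cutoff is differentiated.
    There the derivative of the power sum appears multiplied by y, which is bounded. *)
Lemma H_ode_bound : exists2 C, 0 <= C & forall y, 0 < y ->
  `|y `^ (b - 1) * H0 y - (16 * y * H2 y + 8 * (nu + 2) * H1 y)| <= C.
Proof.
have [G0 G00 hG0] := gp_bound 1; have [G1 G10 hG1] := gp_bound (dp 1).
have [G2 G20 hG2] := gp_bound (dp (dp 1)).
pose S0 := \sum_(i < mm) `|cc i|; pose S1 := \sum_(i < mm) `|cc1 i|.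
have S00 : 0 <= S0 by exact: sumr_ge0.
have S10 : 0 <= S1 by exact: sumr_ge0.
pose C := cc mm.-1 * G0 + 32 * (S1 * G1) + S0 * (16 * G2 + 8 * (nu + 2) * G1).
have c0 := cc_gt0 mm.-1.
have C0 : 0 <= C.
  by rewrite /C !addr_ge0 ?mulr_ge0 ?addr_ge0 ?mulr_ge0 ?addr_ge0// ltW.
exists C => // y y0; have [y1|y1] := leP 1 y.
  by have [-> -> ->] := H_ge1 y1; rewrite !mulr0 addr0 subr0 normr0.
have g0 := hG0 _ (ltW y0); have g1 := hG1 _ (ltW y0); have g2 := hG2 _ (ltW y0).
have p0 : `|pwr cc 0 mm y| <= S0.
  have := @pwr_bound cc 0 0 mm y y0 (ltW y1); rewrite powRr0 mulr1; apply => i _.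
  by rewrite addr0 mulr_ge0// ltW.
have p1 : `|y * pwr cc1 (-1) mm y| <= S1.
  have h : `|pwr cc1 (-1) mm y| <= S1 * y `^ (-1).
    apply: pwr_bound => // [|i _]; first exact: ltW.
    by rewrite lerDr mulr_ge0// ltW.
  rewrite normrM gtr0_norm// -ler_pdivlMl// mulrC.
  by rewrite -(powR_inv1 (ltW y0)).
have e : y `^ (b - 1) * H0 y - (16 * y * H2 y + 8 * (nu + 2) * H1 y) =
   cc mm.-1 * y `^ (mm%:R * b - 1) * gp 1 y + 32 * (y * pwr cc1 (-1) mm y * gp (dp 1) y)
   + pwr cc 0 mm y * (8 * (nu + 2) * gp (dp 1) y - 16 * y * gp (dp (dp 1)) y).
  rewrite -pwr_ode// /H0 /H1 /H2.
  move: (y `^ (b - 1)) (pwr cc 0 mm y) (pwr cc1 (-1) mm y) (pwr cc2 (-2) mm y) (gp 1 y) (gp (dp 1) y) (gp (dp (dp 1)) y) => z p q r s t u.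
  by ring.
have mb (u v s t : R) : `|u| <= s -> `|v| <= t -> `|u * v| <= s * t.
  by move=> h1 h2; rewrite normrM ler_pM.
rewrite e; apply: le_trans (ler_normD _ _) _; apply: lerD.
  apply: le_trans (ler_normD _ _) _; apply: lerD.
    apply: mb => //; rewrite normrM (gtr0_norm c0) ler_piMr ?(ltW c0)//.
    rewrite ger0_norm ?powR_ge0// -[leRHS](powRr0 y); apply: ger_powR; first by rewrite y0 ltW.
    by rewrite subr_ge0 mm_b.
  by rewrite normrM gtr0_norm// ler_pM2l//; exact: mb.
apply: mb => //; apply: le_trans (ler_normB _ _) _; rewrite addrC; apply: lerD.
  rewrite -mulrA normrM gtr0_norm// ler_pM2l// normrM gtr0_norm//.
  by apply: le_trans (ler_pM _ _ (ltW y1) g2) _; rewrite ?mul1r// ltW.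
by rewrite normrM ger0_norm ?ler_wpM2l// mulr_ge0// addr_ge0.
Qed.

(** All coefficients [cc1] are nonnegative, so the power sum is at least its first nonzero term, and
    that term dominates the differentiated cutoff near 0. This is the source of the singular
    gradient. *)
Lemma H1_lower : exists2 C, 0 < C & exists2 d, 0 < d & forall y, 0 < y -> y < d ->
  C * y `^ (b - 1) <= H1 y.
Proof.
have [G1 G10 hG1] := gp_bound (dp 1).
pose S0 := \sum_(i < mm) `|cc i|.
have S00 : 0 <= S0 by exact: sumr_ge0.
pose c := cc1 1 * pexp 1 2^-1.
have c1 : 0 < cc1 1 by rewrite mulr_gt0 ?cc_gt0// mulr_gt0.
have c0 : 0 < c by rewrite mulr_gt0// bump0_gt0 ?invr_gt0.
have b1 : b < 1 by rewrite (lt_trans b4)// invf_lt1// ltr1n.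
(* Once y^(b - 1) >= M, half of the leading term absorbs the bounded cutoff term [S0 * G1]. As b <
   1, this holds for y below M^(1/(b - 1)). *)
pose M := 2 * (S0 * G1) / c + 1.
have M0 : 0 < M.
  exact: (ltr_wpDl (divr_ge0 (mulr_ge0 (ler0n _ 2) (mulr_ge0 S00 G10)) (ltW c0)) ltr01).
pose d1 := Num.min 2^-1 (M `^ (b - 1)^-1).
have d10 : 0 < d1 by rewrite /d1 lt_min invr_gt0 powR_gt0// ltr0n.
exists (c / 2); first by rewrite divr_gt0.
exists d1 => // y y0; rewrite lt_min => /andP[y2 yM].
have y1 : y < 1 by apply: lt_trans y2 _; rewrite invf_lt1// ltr1n.
have p0 : `|pwr cc 0 mm y| <= S0.
  have := @pwr_bound cc 0 0 mm y y0 (ltW y1); rewrite powRr0 mulr1; apply => i _.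
  by rewrite addr0 mulr_ge0// ltW.
have w : M <= y `^ (b - 1).
  have e : M = (M `^ (b - 1)^-1) `^ (b - 1).
    by rewrite -powRrM mulVf ?powRr1 ?ltW// subr_eq0 lt_eqF.
  have z0 : 0 < M `^ (b - 1)^-1 by exact: powR_gt0.
  rewrite e; move: yM z0 {e}; move: (M `^ _) => z yM z0.
  rewrite -[b - 1]opprB !powRN lef_pV2 ?posrE ?powR_gt0//.
  by apply: ge0_ler_powR; rewrite ?nnegrE ?subr_ge0 ?(ltW b1) ?(ltW y0) ?(ltW z0) ?(ltW yM).
have q : cc1 1 * y `^ (b - 1) <= pwr cc1 (-1) mm y.
  have [k ek] : exists k, mm = k.+2 by move: mm_gt1; case: mm => [|[|k]] // _; exists k.
  have z0 : cc1 0 = 0 by rewrite /cc1 mul0r mulr0.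
  rewrite /pwr ek big_ord_recl /= z0 mul0r add0r big_ord_recl /=.
  rewrite /bump /= add1n mul1r lerDl sumr_ge0// => i _.
  by rewrite mulr_ge0 ?powR_ge0// cc1_ge0.
have g : pexp 1 2^-1 <= gp 1 y.
  rewrite /gp -/bump0 !bump0E invr_gt0 ltr0n /=.
  have h : 2^-1 < 1 - y by lra.
  have h0 : 0 < 1 - y by apply: lt_trans h; rewrite invr_gt0.
  rewrite h0 ler_expR lerN2 lef_pV2 ?posrE ?invr_gt0// ltW//.
rewrite /H1.
have a1 : c * y `^ (b - 1) <= pwr cc1 (-1) mm y * gp 1 y.
  rewrite /c mulrAC; apply: ler_pM => //.
    by rewrite mulr_ge0 ?powR_ge0// ltW.
  by rewrite ltW// bump0_gt0// invr_gt0.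
have a2 : pwr cc 0 mm y * gp (dp 1) y <= S0 * G1.
  apply: le_trans (ler_norm _) _; rewrite normrM ler_pM//.
  exact: hG1 (ltW y0).
have a3 : S0 * G1 <= c / 2 * y `^ (b - 1).
  apply: (@le_trans _ _ (c / 2 * M)); last by rewrite ler_pM2l// divr_gt0.
  rewrite /M mulrDr mulr1.
  have -> : c / 2 * (2 * (S0 * G1) / c) = S0 * G1 by field; rewrite gt_eqF.
  by rewrite lerDl divr_ge0// ltW.
have -> : c / 2 * y `^ (b - 1) = c * y `^ (b - 1) - c / 2 * y `^ (b - 1) by field.
apply: lerB => //; exact: le_trans a2 a3.
Qed.

End Profile.

(** * Horizontal gradient and sublaplacian of radial functions *)

Section RadialFunctions.
Context {R : realType} {n : nat}.
Local Notation H := (heis R n).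
Local Notation mu := (@heis_leb R n).
Local Notation Q := (2 * n + 2)%N.
Implicit Types (g : H) (k : 'I_(n + n)).

Lemma powRD_gt0 (x r s : R) : 0 < x -> x `^ (r + s) = x `^ r * x `^ s.
Proof. by move=> x0; rewrite powRD// (gt_eqF x0) implybT. Qed.

(** Along a flow line [homN] and [XN] are polynomials of degree at most 4 in s, so a derivative is
    read off as the linear coefficient. *)
Lemma is_derive0_quartic (f : R -> R) (a b c d e : R) :
  (forall s, f s = a + b * s + c * s ^+ 2 + d * s ^+ 3 + e * s ^+ 4) ->
  is_derive (0 : R) 1 f b.
Proof.
move=> hf.
pose p : {poly R} := a%:P + b *: 'X + c *: 'X^2 + d *: 'X^3 + e *: 'X^4.
have -> : f = fun s => p.[s].
  by apply/funext => s; rewrite hf /p !hornerE.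
have hp : is_derive (0 : R) 1 (fun z : R => p.[z]) (p^`().[0]) by exact: is_derive_poly.
apply: (is_derive_eq hp).
rewrite horner_coef0 coef_deriv mulr1n /p !coefE /=.
by rewrite !mulr0 mulr1 !addr0 add0r.
Qed.

Lemma sqnorm_flow k s g :
  sqnorm_hor (flow k s g) = sqnorm_hor g + 2 * s * g.1 ord0 k + s ^+ 2.
Proof.
rewrite /sqnorm_hor /= (bigD1 k)//= [in RHS](bigD1 k)//=.
rewrite !mxE !eqxx /= mulr1 (eq_bigr (fun i => g.1 ord0 i ^+ 2)); first by ring.
by move=> i ik; rewrite !mxE eqxx /= (negbTE ik) mulr0 addr0.
Qed.

Lemma pcoef_flow k s g : pcoef k (flow k s g).1 = pcoef k g.1.
Proof. by rewrite /= pcoefD pcoefZ pcoef_delta mulr0 addr0. Qed.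

Lemma coord_flow k s g : (flow k s g).1 ord0 k = g.1 ord0 k + s.
Proof. by rewrite !mxE !eqxx mulr1. Qed.

Definition XN k g : R := 4 * (sqnorm_hor g * g.1 ord0 k + g.2 * pcoef k g.1).

Lemma Ck_sqnorm j : Ck j (@sqnorm_hor R n).
Proof.
apply: Ck_sum => i; apply: (@Ck_ext _ _ j (fun g => g.1 ord0 i * g.1 ord0 i)).
  by move=> g; rewrite expr2.
by apply: CkM; exact: Ck_hor.
Qed.

Lemma Ck_XN j k : Ck j (XN k).
Proof.
apply: CkM; first exact: Ck_cst.
apply: CkD; apply: CkM; [exact: Ck_sqnorm|exact: Ck_hor|exact: Ck_vert|exact: Ck_pcoef].
Qed.

Lemma heis_X_homN k g : heis_X k (@homN R n) g = XN k g.
Proof.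
have h1 := is_derive_flow k g 0 (@Ck_homN R n 1); rewrite flow0 in h1.
set r := sqnorm_hor g; set x := g.1 ord0 k; set c := pcoef k g.1; set t := g.2.
have h2 : is_derive (0 : R) 1 (fun s : R => homN (flow k s g)) (XN k g).
  apply: (@is_derive0_quartic _ (r ^+ 2 + t ^+ 2) _ (4 * x ^+ 2 + 2 * r + 4 * c ^+ 2) (4 * x) 1) => s.
  rewrite /homN sqnorm_flow /XN /= -/r -/x -/c -/t.
  by ring.
by case: h1 => _ <-; case: h2.
Qed.

Lemma heis_X_XN k g :
  heis_X k (XN k) g = 4 * (2 * g.1 ord0 k ^+ 2 + sqnorm_hor g + 2 * pcoef k g.1 ^+ 2).
Proof.
have h1 := is_derive_flow k g 0 (Ck_XN 1 k); rewrite flow0 in h1.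
set r := sqnorm_hor g; set x := g.1 ord0 k; set c := pcoef k g.1; set t := g.2.
have h2 : is_derive (0 : R) 1 (fun s : R => XN k (flow k s g)) (4 * (2 * x ^+ 2 + r + 2 * c ^+ 2)).
  apply: (@is_derive0_quartic _ (4 * (r * x + t * c)) _ (12 * x) 4 0) => s.
  rewrite /XN sqnorm_flow coord_flow pcoef_flow /= -/r -/x -/c -/t.
  by ring.
by case: h1 => _ <-; case: h2.
Qed.

(** The vectors (x_k) and (pcoef k x) are orthogonal and both have length |x|, so there is no cross
    term. *)
Lemma sum_XN2 g : \sum_k XN k g ^+ 2 = 16 * sqnorm_hor g * homN g.
Proof.
rewrite (eq_bigr (fun k => 16 * sqnorm_hor g ^+ 2 * g.1 ord0 k ^+ 2 +
   (16 * g.2 ^+ 2 * pcoef k g.1 ^+ 2 + 32 * sqnorm_hor g * g.2 * (g.1 ord0 k * pcoef k g.1)))); last first.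
  by move=> k _; rewrite /XN; ring.
rewrite !big_split /= -!mulr_sumr sum_coord_pcoef sum_pcoef2 -/(sqnorm_hor g) /homN.
by ring.
Qed.

Lemma sum_X_XN g : \sum_k heis_X k (XN k) g = 8 * (n%:R + 2) * sqnorm_hor g.
Proof.
under eq_bigr do rewrite heis_X_XN.
rewrite (eq_bigr (fun k => 8 * g.1 ord0 k ^+ 2 +
   (8 * pcoef k g.1 ^+ 2 + 4 * sqnorm_hor g))); last by move=> k _; ring.
rewrite !big_split /= -!mulr_sumr sum_pcoef2 -/(sqnorm_hor g) sumr_const card_ord.
by rewrite -[_ *+ (n + n)]mulr_natl natrD; ring.
Qed.

Lemma heis_X_comp k (f : H -> R) (h : R -> R) (dh : R) g : Ck 1 f -> Ck 1 (fun x => h (f x)) ->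
  is_derive (f g) 1 h dh -> heis_X k (fun x => h (f x)) g = dh * heis_X k f g.
Proof.
move=> cf chf dhf; have h1 := is_derive_Xdir k g chf.
have h2 := is_derive_comp1 (is_derive_Xdir k g cf) dhf.
by case: h1 => _ <-; case: h2.
Qed.

Lemma heis_X_mul k (f u : H -> R) g : Ck 1 f -> Ck 1 u ->
  heis_X k (fun x => f x * u x) g = heis_X k f g * u g + f g * heis_X k u g.
Proof.
move=> cf cu; have h1 := is_derive_Xdir k g (CkM cf cu).
have h2 := is_deriveM (is_derive_Xdir k g cf) (is_derive_Xdir k g cu).
case: h1 => _ <-; case: h2 => _ h2.
rewrite -[LHS]/('D_(Xdir k g) (f * u) g) h2.
by rewrite -[LHS]/(f g * heis_X k u g + u g * heis_X k f g); ring.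
Qed.

Lemma dot_sum I (r : seq I) (F : I -> H -> R) v : (forall i, L2 (F i)) -> L2 v ->
  L2 (fun g => \sum_(i <- r) F i g) /\
  dot v (fun g => \sum_(i <- r) F i g) = \sum_(i <- r) dot v (F i).
Proof.
move=> LF Lv; elim: r => [|i r [L1 IH]].
  have -> : (fun g => \sum_(i <- [::]) F i g) = fun=> 0 by apply/funext => g; rewrite big_nil.
  rewrite big_nil; split; first exact: L2_0.
  by rewrite /dot; under eq_Rintegral do rewrite mulr0; rewrite Rintegral_cst// mul0r.
have -> : (fun g => \sum_(j <- i :: r) F j g) = (fun g => F i g + \sum_(j <- r) F j g).
  by apply/funext => g; rewrite big_cons.
by split; [exact: L2D|rewrite big_cons dotDr// IH].
Qed.

Lemma sqnorm_le_sqrtN g : sqnorm_hor g <= homN g `^ 2^-1.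
Proof.
rewrite powR12_sqrt ?homN_ge0// -[leLHS]ger0_norm ?sqnorm_hor_ge0// -sqrtr_sqr.
by rewrite ler_sqrt ?homN_ge0// sqnorm_le_homN.
Qed.

Lemma XN_bound k g : 0 < homN g -> `|XN k g| <= 4 * homN g `^ (3 / 4).
Proof.
move=> N0; rewrite -(@ler_pXn2r _ 2)// ?nnegrE ?mulr_ge0 ?powR_ge0// real_normK ?num_real//.
apply: (@le_trans _ _ (\sum_i XN i g ^+ 2)).
  by rewrite (bigD1 k)//= lerDl sumr_ge0// => i _; exact: sqr_ge0.
rewrite sum_XN2 exprMn -natrX -mulrA ler_pM2l//.
have -> : (homN g `^ (3 / 4)) ^+ 2 = homN g `^ 2^-1 * homN g.
  rewrite -{3}(powRr1 (homN_ge0 g)) -powRD; last by rewrite gt_eqF ?implybT.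
  by rewrite -powR_mulrn ?powR_ge0// -powRrM; congr powR; field.
by rewrite ler_wpM2r ?homN_ge0// sqnorm_le_sqrtN.
Qed.

Lemma L2_pow s : 0 < s -> 8 * s < Q%:R ->
  L2 (fun g : H => \1_(NB 1) g * homN g `^ (- s)).
Proof.
move=> s0 sQ; apply/L2P; split.
  apply: measurable_funM; first by apply: measurable_indic; exact: measurable_NB.
  by apply: measurable_powR_comp; exact: measurable_homN.
have h : (\int[mu]_(g in NB 1) (homN g `^ (- (2 * s)))%:E < +oo)%E.
  by apply: int_homN_pow; [rewrite mulr_gt0|rewrite mulrA -natrM].
rewrite integral_mkcond in h; congr (_ < _)%E: h; apply: eq_integral => g _.
rewrite patchE indicE; case: ifPn => [|_]; last by rewrite mul0r expr0n.
rewrite mul1r -powR_mulrn ?powR_ge0// -powRrM => _; congr (_ `^ _)%:E; ring.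
Qed.

Lemma vanish_off_NB (f : H -> R) : (forall g, 1 <= homN g -> f g = 0) -> vanish_off 2 f.
Proof.
move=> hf g hg; apply: hf; rewrite leNgt; apply/negP => h.
have /hboxE : hbox (1 + 1) g by apply: NB_hbox.
by move=> /(_ (addr_gt0 ltr01 ltr01)); rewrite ltNge hg.
Qed.

End RadialFunctions.

Section CounterexampleFunction.
Context {R : realType} {n : nat}.
Local Notation H := (heis R n).
Local Notation mu := (@heis_leb R n).
Local Notation Q := (2 * n + 2)%N.
Variable b : R.
Hypotheses (n0 : (0 < n)%N) (b0 : 0 < b) (b4 : b < 4^-1).
Implicit Types (g : H) (k : 'I_(n + n)) (e : R).

Local Notation nu := (n%:R : R).
Let nu0 : 0 <= nu. Proof. by []. Qed.
Local Notation h0 := (H0 b nu).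
Local Notation h1 := (H1 b nu).
Local Notation h2 := (H2 b nu).

Definition Vb g : R := sqnorm_hor g * homN g `^ (b - 1).
Definition u0 g : R := h0 (homN g).
Definition U0 k g : R := h1 (homN g) * XN k g.
(* [lap e] is the sublaplacian of H0 (|g|^4 + e). *)
Definition lap (e : R) g : R :=
  sqnorm_hor g * (16 * homN g * h2 (homN g + e) + 8 * (nu + 2) * h1 (homN g + e)).
Definition f0 g : R := Vb g * u0 g - lap 0 g.

(** Replacing N by N + e makes u a test function. The weak gradient of u and the equation L u = f
    are obtained from these as e tends to 0, with majorants uniform in e. *)
Let ue e g : R := h0 (homN g + e).

Let Ne e j : Ck j (fun g : H => homN g + e).
Proof. by apply: CkD; [exact: Ck_homN|exact: Ck_cst]. Qed.

Let Ne_gt0 e g : 0 < e -> 0 < homN g + e.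
Proof. by move=> e0; rewrite ltr_wpDl// homN_ge0. Qed.

Let Ck_ue e j : 0 < e -> Ck j (ue e).
Proof.
move=> e0; apply: CkM; last exact: Ck_gp.
by apply: Ck_pwr => // g; exact: Ne_gt0.
Qed.

Let Ck_h1e e j : 0 < e -> Ck j (fun g : H => h1 (homN g + e)).
Proof.
move=> e0; apply: CkD; last apply: CkN; apply: CkM; try exact: Ck_gp.
  by apply: Ck_pwr => // g; exact: Ne_gt0.
by apply: Ck_pwr => // g; exact: Ne_gt0.
Qed.

Let test_ue e : 0 < e -> test_fun (ue e).
Proof.
move=> e0; apply/test_funP; split; first by apply/smoothP => j; exact: Ck_ue.
exists 2 => //; apply: vanish_off_NB => g Ng.
by have [] := H_ge1 b nu (_ : 1 <= homN g + e); rewrite // (le_trans Ng)// lerDl ltW.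
Qed.

Let X_Ne e k g : heis_X k (fun g : H => homN g + e) g = XN k g.
Proof.
have h := heis_X_lin k 1 g (@Ck_homN R n 1) (Ck_cst 1 e).
have E : (fun g : H => 1 * homN g + e) = (fun g => homN g + e).
  by apply/funext => x; rewrite mul1r.
rewrite E mul1r heis_X_homN in h; rewrite h.
have -> : heis_X k (fun _ : H => e) g = 0; last by rewrite addr0.
by rewrite heis_XE /partial_x /partial_t !derive_cst mulr0 addr0.
Qed.

Let X_ue e k g : 0 < e -> heis_X k (ue e) g = h1 (homN g + e) * XN k g.
Proof.
move=> e0; rewrite -(X_Ne e).
exact: (@heis_X_comp _ _ k (fun g => homN g + e) h0 _ g (Ne e 1) (Ck_ue 1 e0)
  (H0_is_derive b nu (Ne_gt0 g e0))).
Qed.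

Let XX_ue e k g : 0 < e -> heis_X k (heis_X k (ue e)) g =
  h2 (homN g + e) * XN k g ^+ 2 + h1 (homN g + e) * heis_X k (XN k) g.
Proof.
move=> e0; have -> : heis_X k (ue e) = fun g => h1 (homN g + e) * XN k g.
  by apply/funext => x; exact: X_ue.
rewrite heis_X_mul; [|exact: Ck_h1e|exact: Ck_XN].
have h := @heis_X_comp _ _ k (fun g => homN g + e) h1 _ g (Ne e 1) (Ck_h1e 1 e0)
  (H1_is_derive b nu (Ne_gt0 g e0)).
by rewrite X_Ne in h; rewrite h expr2 mulrA.
Qed.

Let lap_ue e g : 0 < e -> \sum_k heis_X k (heis_X k (ue e)) g = lap e g.
Proof.
move=> e0; under eq_bigr do rewrite XX_ue//.
by rewrite big_split /= -!mulr_sumr sum_XN2 sum_X_XN /lap; ring.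
Qed.

Lemma measurable_Vb : measurable_fun setT Vb.
Proof.
apply: measurable_funM; first exact: measurable_sqnorm.
by apply: measurable_powR_comp; exact: measurable_homN.
Qed.

Lemma Vb_ge0 g : 0 <= Vb g.
Proof. by rewrite mulr_ge0 ?sqnorm_hor_ge0 ?powR_ge0. Qed.

Let homN0_XN k g : homN g = 0 -> XN k g = 0.
Proof. by move=> /homN_eq0_sqnorm[e1 e2]; rewrite /XN e1 e2 !mul0r addr0 mulr0. Qed.


Let bnd := H_bound nu b0 b4.

Let e_ (i : nat) : R := i.+1%:R^-1.
Let e_gt0 i : 0 < e_ i. Proof. by rewrite invr_gt0. Qed.
Let e_cvg : e_ @ \oo --> 0. Proof. exact: cvg_harmonic. Qed.

Let Q4 : 4 <= Q%:R :> R.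
Proof. by rewrite ler_nat -[4%N]/(2 * 1 + 2)%N leq_add2r leq_mul2l n0. Qed.

Let Fd s (g : H) : R := \1_(NB 1) g * homN g `^ (- s).

Let NB1E g : homN g < 1 -> \1_(NB 1) g = 1 :> R.
Proof. by move=> h; rewrite indicE mem_set. Qed.

Let powNe e g c : c < 0 -> 0 <= e -> 0 < homN g -> (homN g + e) `^ c <= homN g `^ c.
Proof.
move=> c0 e0 N0; have Ne0 : 0 < homN g + e by rewrite ltr_pwDl.
rewrite -[c]opprK !(powRN _ (- c)) lef_pV2 ?posrE ?powR_gt0//.
by apply: ge0_ler_powR; rewrite ?nnegrE ?oppr_ge0 ?(ltW c0) ?(ltW Ne0) ?(ltW N0)// lerDl.
Qed.

Let h_ge1 e g : 0 <= e -> 1 <= homN g ->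
  [/\ h0 (homN g + e) = 0, h1 (homN g + e) = 0 & h2 (homN g + e) = 0].
Proof. by move=> e0 N1; apply: H_ge1; rewrite (le_trans N1)// lerDl. Qed.

Let h0_dom : exists2 C, 0 <= C & forall e g, 0 <= e -> 0 < homN g -> `|h0 (homN g + e)| <= C * \1_(NB 1) g.
Proof.
have [C C0 hC] := bnd; exists C => // e g e0 N0.
have [N1|N1] := leP 1 (homN g).
  have [-> _ _] := h_ge1 e0 N1.
  by rewrite normr0 mulr_ge0// indicE.
by rewrite NB1E// mulr1; have [] := hC _ (ltr_pwDl N0 e0).
Qed.

(** The bound is N^(b-1) from H' times N^(3/4) from [XN]. It is uniform in e because a negative
    power only decreases when N is replaced by N + e. *)
Let X_dom : exists2 C, 0 <= C & forall e k g, 0 <= e ->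
  `|h1 (homN g + e) * XN k g| <= C * Fd (4^-1 - b) g.
Proof.
have [C C0 hC] := bnd; exists (C * 4) => [|e k g e0]; first by rewrite mulr_ge0.
have F0 : 0 <= C * 4 * Fd (4^-1 - b) g by rewrite !mulr_ge0 ?powR_ge0// indicE.
have := homN_ge0 g; rewrite le_eqVlt => /predU1P[N0|N0].
  by rewrite homN0_XN// mulr0 normr0.
have [N1|N1] := leP 1 (homN g).
  have [_ -> _] := h_ge1 e0 N1.
  by rewrite mul0r normr0.
rewrite /Fd NB1E// mul1r; have [_ c1 _] := hC _ (ltr_pwDl N0 e0).
have -> : homN g `^ (- (4^-1 - b)) = homN g `^ (b - 1) * homN g `^ (3 / 4).
  by rewrite -powRD_gt0//; congr (_ `^ _); field.
rewrite normrM mulrACA; apply: ler_pM => //; last exact: XN_bound.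
apply: le_trans c1 _; rewrite ler_wpM2l//; apply: powNe => //.
by rewrite subr_lt0 (lt_trans b4)// invf_lt1// ltr1n.
Qed.

(** Each term is at most a multiple of rho N^(b-1) <= N^(b - 1/2), which is square integrable near 0
    because 4 - 8 b < 4 <= Q. *)
Let lap_dom : exists2 C, 0 <= C & forall e g, 0 <= e -> `|lap e g| <= C * Fd (2^-1 - b) g.
Proof.
have [C C0 hC] := bnd; exists (C * (16 + 8 * (nu + 2))) => [|e g e0].
  by rewrite mulr_ge0// addr_ge0// mulr_ge0// addr_ge0.
have F0 : 0 <= C * (16 + 8 * (nu + 2)) * Fd (2^-1 - b) g.
  by rewrite mulr_ge0 ?mulr_ge0 ?addr_ge0 ?mulr_ge0 ?addr_ge0 ?powR_ge0// indicE.
have := homN_ge0 g; rewrite le_eqVlt => /predU1P[N0|N0].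
  by have [r0 _] := homN_eq0_sqnorm (esym N0); rewrite /lap r0 mul0r normr0.
have [N1|N1] := leP 1 (homN g).
  have [_ e1 e2] := h_ge1 e0 N1.
  by rewrite /lap e1 e2 !mulr0 addr0 mulr0 normr0.
rewrite /Fd NB1E// mul1r; have [_ c1 c2] := hC _ (ltr_pwDl N0 e0).
have -> : homN g `^ (- (2^-1 - b)) = homN g `^ 2^-1 * homN g `^ (b - 1).
  by rewrite -powRD_gt0//; congr (_ `^ _); field.
have b1 : b < 1 by rewrite (lt_trans b4)// invf_lt1// ltr1n.
have d1 : `|h1 (homN g + e)| <= C * homN g `^ (b - 1).
  by apply: le_trans c1 _; rewrite ler_wpM2l//; apply: powNe => //; rewrite subr_lt0.
have d2 : homN g * `|h2 (homN g + e)| <= C * homN g `^ (b - 1).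
  have -> : homN g `^ (b - 1) = homN g * homN g `^ (b - 2).
    by rewrite -{2}(powRr1 (homN_ge0 g)) -powRD_gt0//; congr (_ `^ _); ring.
  rewrite mulrCA ler_pM2l//; apply: le_trans c2 _; rewrite ler_wpM2l//; apply: powNe => //.
  by rewrite subr_lt0 (lt_trans b1)// ltr1n.
rewrite /lap normrM (ger0_norm (sqnorm_hor_ge0 g)) mulrCA; apply: ler_pM => //.
- exact: sqnorm_hor_ge0.
- exact: sqnorm_le_sqrtN.
apply: le_trans (ler_normD _ _) _.
rewrite [leRHS]mulrAC [leRHS]mulrDr; apply: lerD.
  rewrite -mulrA normrM (gtr0_norm (_ : 0 < 16))// mulrC ler_pM2r//.
  by rewrite normrM (gtr0_norm N0).
rewrite normrM ger0_norm; last by rewrite mulr_ge0// addr_ge0.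
by rewrite mulrC ler_wpM2r// mulr_ge0// addr_ge0.
Qed.

Let L2_Fd s : 0 < s -> 8 * s < 4 -> L2 (Fd s).
Proof. by move=> s0 s4; apply: L2_pow => //; apply: lt_le_trans Q4. Qed.

Let L2_Fdx C : L2 (fun g => C * Fd (4^-1 - b) g).
Proof. by have b0' := b0; have b4' := b4; apply: L2Z; apply: L2_Fd; lra. Qed.

Let L2_Fdl C : L2 (fun g => C * Fd (2^-1 - b) g).
Proof. by have b0' := b0; have b4' := b4; apply: L2Z; apply: L2_Fd; lra. Qed.

Let L2_Fd0 C : L2 (fun g => C * \1_(NB 1) g : R).
Proof.
apply: L2Z; apply/L2P; split; first by apply: measurable_indic; exact: measurable_NB.
have -> : (fun x : H => (\1_(NB 1) x ^+ 2 : R)%:E) = (fun x => (\1_(NB 1) x : R)%:E).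
  by apply/funext => g; rewrite indicE expr2 -natrM mulnb andbb.
rewrite integral_indic//; last exact: measurable_NB.
by rewrite setIT; exact: mu_NB_fin.
Qed.

Let pwr_cont a c m y : 0 < y -> {for y, continuous (pwr b a c m)}.
Proof. by move=> y0; exact: is_derive_cont (pwr_is_derive b a c m y0). Qed.

Let gp_cont p y : {for y, continuous (gp p : R -> R)}.
Proof. exact: is_derive_cont (gp_is_derive p y). Qed.

Let Ne_cvg g : homN g + e_ i @[i --> \oo] --> homN g.
Proof. by rewrite -[X in _ --> X]addr0; apply: cvgD; [exact: cvg_cst|exact: e_cvg]. Qed.

Let h0_cvg g : h0 (homN g + e_ i) @[i --> \oo] --> h0 (homN g).
Proof.
apply: cvgM; last by apply: continuous_cvg; [exact: gp_cont|exact: Ne_cvg].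
have := homN_ge0 g; rewrite le_eqVlt => /predU1P[N0|N0].
  rewrite -N0; apply: (pwr_cvg0 b0) => //; first by move=> j; rewrite add0r.
  by under eq_fun do rewrite add0r; exact: e_cvg.
by apply: continuous_cvg; [exact: pwr_cont|exact: Ne_cvg].
Qed.

Let h1_cvg g : 0 < homN g -> h1 (homN g + e_ i) @[i --> \oo] --> h1 (homN g).
Proof.
move=> N0; apply: continuous_cvg; last exact: Ne_cvg.
exact: is_derive_cont (H1_is_derive b nu N0).
Qed.

Let h2_cvg g : 0 < homN g -> h2 (homN g + e_ i) @[i --> \oo] --> h2 (homN g).
Proof.
move=> N0; have c : homN g + e_ i @[i --> \oo] --> homN g := @Ne_cvg g.
apply: cvgD; first apply: cvgB.
- by apply: cvgM; apply: continuous_cvg; [exact: pwr_cont|exact: c|exact: gp_cont|exact: c].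
- apply: cvgMr.
  by apply: cvgM; apply: continuous_cvg; [exact: pwr_cont|exact: c|exact: gp_cont|exact: c].
- by apply: cvgM; apply: continuous_cvg; [exact: pwr_cont|exact: c|exact: gp_cont|exact: c].
Qed.

Let X_cvg k g : h1 (homN g + e_ i) * XN k g @[i --> \oo] --> U0 k g.
Proof.
have := homN_ge0 g; rewrite le_eqVlt => /predU1P[N0|N0].
  by rewrite /U0 homN0_XN// mulr0; under eq_fun do rewrite mulr0; exact: cvg_cst.
by apply: cvgMl; exact: h1_cvg.
Qed.

Let lap_cvg g : lap (e_ i) g @[i --> \oo] --> lap 0 g.
Proof.
have := homN_ge0 g; rewrite le_eqVlt => /predU1P[N0|N0].
  have [r0 _] := homN_eq0_sqnorm (esym N0); rewrite /lap r0 mul0r.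
  by under eq_fun do rewrite mul0r; exact: cvg_cst.
rewrite /lap addr0; apply: cvgMr; apply: cvgD; apply: cvgMr.
  exact: h2_cvg.
exact: h1_cvg.
Qed.

Let u_lim v : L2 v -> L2 u0 /\ dot (ue (e_ i)) v @[i --> \oo] --> dot u0 v.
Proof.
move=> Lv; have [C C0 hC] := bnd.
apply: (@dot_dominated_cvg _ _ (fun i => ue (e_ i)) u0 (fun g => C * \1_(NB 1) g)) => //.
- by move=> i; exact: test_measurable (test_ue (e_gt0 i)).
move=> i g; rewrite (ger0_norm (_ : 0 <= C * \1_(NB 1) g)); last by rewrite mulr_ge0// indicE.
have [N1|N1] := leP 1 (homN g).
  rewrite /ue; have [-> _ _] := h_ge1 (ltW (e_gt0 i)) N1.
  by rewrite normr0 mulr_ge0// indicE.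
by rewrite NB1E// mulr1; have [] := hC _ (Ne_gt0 g (e_gt0 i)).
Qed.

Lemma u0_bound : exists2 C, 0 <= C & forall g, `|u0 g| <= C.
Proof.
have [C C0 hC] := bnd.
have [C1 h] : exists C1, forall g, homN g = 0 -> `|u0 g| <= C1.
  by exists `|h0 0| => g N0; rewrite /u0 N0.
exists (C + `|C1|) => [|g]; first by rewrite addr_ge0.
have := homN_ge0 g; rewrite le_eqVlt => /predU1P[N0|N0].
  by apply: le_trans (h _ (esym N0)) _; rewrite (le_trans (ler_norm C1))// lerDr.
by have [c _ _] := hC _ N0; rewrite (le_trans c)// lerDl.
Qed.

Lemma L2_u0 : L2 u0. Proof. by have [] := u_lim (@L2_0 R n). Qed.

Let U_lim k v : L2 v -> L2 (U0 k) /\ dot (heis_X k (ue (e_ i))) v @[i --> \oo] --> dot (U0 k) v.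
Proof.
move=> Lv; have [C C0 hC] := X_dom.
apply: (@dot_dominated_cvg _ _ (fun i => heis_X k (ue (e_ i))) (U0 k) (fun g => C * Fd (4^-1 - b) g)) => //.
- by move=> i; apply: test_measurable; apply: test_heis_X; exact: test_ue.
- by move=> i g; rewrite X_ue// (le_trans (hC _ _ _ (ltW (e_gt0 i))))// ler_norm.
- by move=> g; under eq_fun do rewrite X_ue//; exact: X_cvg.
Qed.

Lemma L2_U0 k : L2 (U0 k). Proof. by have [] := U_lim k (@L2_0 R n). Qed.

Let lap_lim v : L2 v -> L2 (lap 0) /\ dot (lap (e_ i)) v @[i --> \oo] --> dot (lap 0) v.
Proof.
move=> Lv; have [C C0 hC] := lap_dom.
apply: (@dot_dominated_cvg _ _ (fun i => lap (e_ i)) (lap 0) (fun g => C * Fd (2^-1 - b) g)) => //.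
- move=> i; have -> : lap (e_ i) = fun g => \sum_k heis_X k (heis_X k (ue (e_ i))) g.
    by apply/funext => g; rewrite lap_ue.
  by apply: measurable_sum => k; apply: test_measurable; do 2 apply: test_heis_X; exact: test_ue.
- by move=> i g; rewrite (le_trans (hC _ _ (ltW (e_gt0 i))))// ler_norm.
Qed.

Lemma weak_X_u0 k : weak_X k u0 (U0 k).
Proof.
apply: (@weak_X_closed _ _ k (fun i => ue (e_ i)) (fun i => heis_X k (ue (e_ i)))).
- by move=> i; apply: test_L2; exact: test_ue.
- exact: L2_u0.
- by move=> i; apply: test_L2; apply: test_heis_X; exact: test_ue.
- exact: L2_U0.
- by move=> i; apply: weak_X_test; exact: test_ue.
- by move=> v Lv; have [] := u_lim Lv.
- by move=> v Lv; have [] := U_lim k Lv.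
Qed.

Let Vu0_L2 : L2 (fun g => Vb g * u0 g).
Proof.
have [C C0 hC] := bnd.
apply: (L2_dom _ _ (L2_Fdl C)).
  by apply: measurable_funM; [exact: measurable_Vb|exact: L2_measurable L2_u0].
move=> g; have F0 : 0 <= C * Fd (2^-1 - b) g by rewrite !mulr_ge0 ?powR_ge0// indicE.
rewrite [leRHS]ger0_norm//.
have := homN_ge0 g; rewrite le_eqVlt => /predU1P[N0|N0].
  by have [r0 _] := homN_eq0_sqnorm (esym N0); rewrite /Vb r0 !mul0r normr0.
have [N1|N1] := leP 1 (homN g).
  by rewrite /u0; have [-> _ _] := H_ge1 b nu N1; rewrite mulr0 normr0.
rewrite /Fd NB1E// mul1r; have [c _ _] := hC _ N0.
have -> : homN g `^ (- (2^-1 - b)) = homN g `^ 2^-1 * homN g `^ (b - 1).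
  by rewrite -powRD_gt0//; congr (_ `^ _); field.
rewrite normrM (ger0_norm (Vb_ge0 g)) mulrC; apply: ler_pM => //; first exact: Vb_ge0.
by rewrite ler_wpM2r ?powR_ge0// sqnorm_le_sqrtN.
Qed.

Lemma L2_f0 : L2 f0.
Proof. by apply: L2B => //; have [] := lap_lim (@L2_0 R n). Qed.

Lemma form_dom_u0 : form_dom Vb u0 U0.
Proof.
split; first exact: L2_u0.
  by move=> k; split; [exact: L2_U0|exact: weak_X_u0].
have /integrableP[_ h] := L2_mulE Vu0_L2 L2_u0.
rewrite (eq_integral (fun g => `|(Vb g * u0 g * u0 g)%:E|%E))// => g _.
by rewrite /= ger0_norm -mulrA -expr2// mulr_ge0 ?sqr_ge0// Vb_ge0.
Qed.

(** The gradient of [ue e] consists of test functions, so the definition of the weak gradient of v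
    performs the integration by parts, and no smoothness of v is required. Both sides converge as e
    tends to 0. *)
Lemma schrodinger_u0 : schrodinger Vb u0 f0.
Proof.
split; first exact: L2_f0.
exists U0; first exact: form_dom_u0.
move=> v W [Lv hW _].
have Llap : L2 (lap 0) by have [] := lap_lim (@L2_0 R n).
have -> : \int[mu]_g (Vb g * u0 g * v g) = dot (fun g => Vb g * u0 g) v by [].
rewrite /f0 dotBl//.
suff -> : \sum_k dot (U0 k) (W k) = - dot (lap 0) v by rewrite addrC.
have e i : \sum_k dot (heis_X k (ue (e_ i))) (W k) = - dot (lap (e_ i)) v.
  have te := test_ue (e_gt0 i).
  have LXX k : L2 (heis_X k (heis_X k (ue (e_ i)))).
    by apply: test_L2; do 2 apply: test_heis_X.
  have [_ h] := dot_sum (index_enum 'I_(n + n)) LXX Lv.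
  have -> : lap (e_ i) = fun g => \sum_k heis_X k (heis_X k (ue (e_ i))) g.
    by apply/funext => g; rewrite lap_ue.
  rewrite dotC h -sumrN; apply: eq_bigr => k _.
  have [_ /weak_XE wk] := hW k.
  by rewrite wk ?opprK 1?dotC//; exact: test_heis_X.
have c1 : \sum_k dot (heis_X k (ue (e_ i))) (W k) @[i --> \oo] --> \sum_k dot (U0 k) (W k).
  apply: cvg_big => [|k _]; first exact: add_continuous.
  have [Lk _] := hW k.
  by have [] := U_lim k Lk.
have c2 : \sum_k dot (heis_X k (ue (e_ i))) (W k) @[i --> \oo] --> - dot (lap 0) v.
  by under eq_fun do rewrite e; apply: cvgN; have [] := lap_lim Lv.
exact: (cvg_unique (@Rhausdorff R) c1 c2).
Qed.

(** This is |x|^2, at most 1 on the support, times the defect bounded in [H_ode_bound], evaluated at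
    y = [homN g]. *)
Lemma f0_bound : exists2 C, 0 <= C & forall g, `|f0 g| <= C.
Proof.
have [C C0 hC] := H_ode_bound b0 nu0.
exists C => // g.
have e : f0 g = sqnorm_hor g * (homN g `^ (b - 1) * h0 (homN g) -
   (16 * homN g * h2 (homN g) + 8 * (nu + 2) * h1 (homN g))).
  by rewrite /f0 /Vb /u0 /lap addr0 [RHS]mulrBr [in RHS]mulrA.
have := homN_ge0 g; rewrite le_eqVlt => /predU1P[N0|N0].
  by have [r0 _] := homN_eq0_sqnorm (esym N0); rewrite e r0 mul0r normr0.
have [N1|N1] := leP 1 (homN g).
  by have [z0 z1 z2] := H_ge1 b nu N1; rewrite e z0 z1 z2 !mulr0 addr0 subr0 mulr0 normr0.
rewrite e normrM ger0_norm ?sqnorm_hor_ge0//.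
have r1 : sqnorm_hor g <= 1.
  apply: le_trans (sqnorm_le_sqrtN g) _.
  rewrite -[leRHS](powRr0 (homN g)); apply: ger_powR; first by rewrite N0 ltW.
  by rewrite invr_ge0.
by apply: le_trans (ler_pM (sqnorm_hor_ge0 g) (normr_ge0 _) r1 (hC _ N0)) _; rewrite mul1r.
Qed.

Lemma U0_lower : exists2 C, 0 < C & exists2 d, 0 < d & forall g, homN g < d ->
  C * (sqnorm_hor g * homN g `^ (2 * b - 1)) <= \sum_k U0 k g ^+ 2.
Proof.
have [C C0 [d d0 hC]] := H1_lower b0 b4 nu0.
exists (16 * C ^+ 2); first by rewrite mulr_gt0// exprn_gt0.
exists d => // g Nd.
have := homN_ge0 g; rewrite le_eqVlt => /predU1P[N0|N0].
  have [r0 _] := homN_eq0_sqnorm (esym N0); rewrite r0 mul0r mulr0.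
  by apply: sumr_ge0 => k _; exact: sqr_ge0.
have h := hC _ N0 Nd.
rewrite (eq_bigr (fun k => h1 (homN g) ^+ 2 * XN k g ^+ 2)); last by move=> k _; rewrite exprMn.
rewrite -mulr_sumr sum_XN2.
have -> : homN g `^ (2 * b - 1) = (homN g `^ (b - 1)) ^+ 2 * homN g.
  rewrite -{3}(powRr1 (homN_ge0 g)) -powR_mulrn ?powR_ge0// -powRrM -powRD_gt0//.
  by congr (_ `^ _); ring.
have h' : (C * homN g `^ (b - 1)) ^+ 2 <= h1 (homN g) ^+ 2.
  by rewrite ler_pXn2r ?nnegrE ?mulr_ge0 ?powR_ge0 ?(ltW C0)// (le_trans _ h)// mulr_ge0 ?powR_ge0// ltW.
have := ler_wpM2r (mulr_ge0 (mulr_ge0 (ler0n _ 16) (sqnorm_hor_ge0 g)) (homN_ge0 g)) h'.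
apply: le_trans; rewrite exprMn le_eqVlt; apply/orP; left; apply/eqP.
by move: (homN g `^ (b - 1)) (sqnorm_hor g) (homN g) => x y z; ring.
Qed.

End CounterexampleFunction.

(** * Non-integrability of the gradient at the critical exponent *)

Section NonIntegrability.
Context {R : realType} {n : nat}.
Local Notation H := (heis R n).
Local Notation mu := (@heis_leb R n).
Local Notation Q := (2 * n + 2)%N.
Variables (b p : R).
Hypotheses (n0 : (0 < n)%N) (b0 : 0 < b) (b4 : b < 4^-1) (p0 : 0 < p).
(* This makes [sing] homogeneous of the critical degree -Q. *)
Hypothesis pb : p * (1 - 4 * b) = Q%:R.
Implicit Types (g : H) (k : 'I_(n + n)).

Definition sing g : R := (sqnorm_hor g * homN g `^ (2 * b - 1)) `^ (p / 2).

Lemma measurable_sing : measurable_fun setT sing.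
Proof.
apply: measurable_powR_comp; apply: measurable_funM; first exact: measurable_sqnorm.
by apply: measurable_powR_comp; exact: measurable_homN.
Qed.

Lemma sing_dil g : sing (dil 2 g) = 2 ^- Q * sing g.
Proof.
have N0 := homN_ge0 g; have r0 := sqnorm_hor_ge0 g.
have e4 : 0 <= (2 : R) ^+ 4 by rewrite exprn_ge0.
have e2 : 0 <= (2 : R) ^+ 2 by rewrite exprn_ge0.
rewrite /sing sqnorm_dil homN_dil [(2 ^+ 4 * _) `^ _]powRM// mulrACA.
rewrite [LHS]powRM; [|by rewrite mulr_ge0 ?powR_ge0|by rewrite mulr_ge0 ?powR_ge0].
apply: (congr1 (fun x => x * _)).
rewrite -(powR_invn Q (ler0n R 2)) -(powR_mulrn 2 (ler0n R 2)) -(powR_mulrn 4 (ler0n R 2)).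
rewrite -powRrM -powRD_gt0// -powRrM -pb; congr (_ `^ _).
by field.
Qed.

(** The critical degree enters here: the same factor c describes the scaling of [sing] and that of
    the measure. *)
Lemma dil2_factor : exists c : R, [/\ 0 < c, c < 1, forall g, sing (dil 2 g) = c * sing g,
  forall s, mu (NB s) = (c%:E * mu (NB (2 ^+ 4 * s)))%E &
  forall (S : set H) (f : H -> \bar R), measurable S ->
    measurable_fun setT f -> (forall g, (0 <= f g)%E) ->
    (\int[mu]_(g in [set g | S (dil 2 g)]) f (dil 2 g) = c%:E * \int[mu]_(g in S) f g)%E].
Proof.
exists (2 ^- Q); split => //.
- by rewrite invf_lt1 ?exprn_gt0// exprn_egt1 ?ltr1n// addn2.
- exact: sing_dil.
- by move=> s; exact: mu_NB_scale.
- by move=> S f; exact: ge0_integral_dil_set.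
Qed.

(** If the integral over [NB d] were finite, critical homogeneity would give the same value over
    [NB (d / 16)], so [sing] would vanish almost everywhere on the shell between them. As [sing] is
    positive almost everywhere, the shell would be null, and the two balls would have equal measure,
    contrary to scaling. *)
Lemma sing_not_integrable d : 0 < d -> (\int[mu]_(g in NB d) (sing g)%:E = +oo)%E.
Proof.
move=> d0; apply/eqP; apply/negPn/negP => hne.
have [c [c0 c1 sd mus ints]] := dil2_factor.
pose f g : \bar R := (sing g)%:E.
have mf : measurable_fun setT f by apply/measurable_EFinP; exact: measurable_sing.
have f0' g : (0 <= f g)%E by rewrite lee_fin powR_ge0.
have fin : (\int[mu]_(g in NB d) f g)%E \is a fin_num.
  by rewrite ge0_fin_numE ?integral_ge0// ltey.
have h16 : 2 ^+ 4 * (d / 16) = d.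
  by rewrite -natrX mulrC mulfVK// pnatr_eq0.
have d16 : d / 16 <= d by rewrite ler_pdivrMr// ler_peMr ?ler1n// ltW.
have e1 : (\int[mu]_(g in NB (d / 16)) f g = \int[mu]_(g in NB d) f g)%E.
  have h := ints (NB (2 ^+ 4 * (d / 16))) f (measurable_NB _) mf f0'.
  rewrite dil_NB// h16 in h.
  have e3 : (\int[mu]_(g in NB (d / 16)) f (dil 2 g) =
     c%:E * \int[mu]_(g in NB (d / 16)) f g)%E.
    rewrite -ge0_integralZl//; last 3 first.
    - exact: measurable_NB.
    - exact: measurable_funTS.
    - by rewrite lee_fin ltW.
    by apply: eq_integral => g _; rewrite /f sd EFinM.
  have {}h := etrans (esym e3) h.
  have e4 : (1 = c^-1%:E * c%:E :> \bar R)%E by rewrite -EFinM mulVf// gt_eqF.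
  have mulc (x : \bar R) : x = (c^-1%:E * (c%:E * x))%E by rewrite muleA -e4 mul1e.
  by rewrite [LHS]mulc h -mulc.
pose A : set H := NB d `\` NB (d / 16).
have mA : measurable A by apply: measurableD; exact: measurable_NB.
have NBsub : (NB (d / 16) : set H) `<=` NB d by move=> g h; exact: lt_le_trans h d16.
have UA : NB d = NB (d / 16) `|` A.
  apply/seteqP; split => g; last by move=> [/NBsub|[]].
  by move=> h; have [h1|h1] := pselect (NB (d / 16) g); [left|right].
have dAB : [disjoint NB (d / 16) & A].
  by apply/disj_setPS => g [h1 [_ h2]].
have fA : (\int[mu]_(g in A) f g = 0)%E.
  have := @ge0_integral_setU _ _ _ mu (NB (d / 16)) A (measurable_NB _) mA f.
  rewrite -UA => /(_ (measurable_funTS mf) (fun g _ => f0' g) dAB).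
  rewrite e1 => h.
  have := @addeK R (\int[mu]_(g in A) f g)%E (\int[mu]_(g in NB d) f g)%E.
  have Afin : (\int[mu]_(g in A) f g)%E \is a fin_num.
    rewrite ge0_fin_numE ?integral_ge0//.
    apply: (@le_lt_trans _ _ (\int[mu]_(g in NB d) f g)%E); last by rewrite -ge0_fin_numE// integral_ge0.
    apply: ge0_subset_integral => //; first exact: measurable_NB.
      exact: measurable_funTS.
    by move=> g [].
  move=> /(_ Afin); rewrite -h -(fineK fin) -(fineK Afin) -EFinB => -[] h3.
  by congr (_%:E); lra.
have A0 : mu A = 0%E.
  have /ae_eq_integral_abs h : measurable_fun A f by exact: measurable_funTS.
  have fabs : (\int[mu]_(g in A) `|f g| = 0)%E.
    by rewrite -[RHS]fA; apply: eq_integral => g _; rewrite gee0_abs.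
  have {h}h : ae_eq mu A f (cst 0%E) by apply/h.
  have hr := sqnorm_gt0_ae n0 : {ae mu, forall g : H, 0 < sqnorm_hor g}.
  apply/negligibleP => //.
  have [N [mN N0 hN]] := filterI h hr.
  exists N; split => // g Ag; apply: hN => /= -[h1 h2].
  have N0' : 0 < homN g.
    by apply: lt_le_trans (sqnorm_le_homN g); rewrite exprn_gt0.
  by have [] := h1 Ag; apply/eqP; rewrite gt_eqF// !powR_gt0// mulr_gt0// powR_gt0.
have eN : mu (NB d) = mu (NB (d / 16)).
  rewrite UA measureU//; [|exact: measurable_NB|by apply/seteqP; split => g // [h1 [_ h2]]].
  by rewrite -[RHS]adde0; congr (_ + _)%E.
have d16' : 0 < d / 16 by rewrite divr_gt0.
have := mus (d / 16); rewrite h16 -eN.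
have Nf : mu (NB d) \is a fin_num by rewrite ge0_fin_numE ?mu_NB_fin.
have := mu_NB_gt0 (n := n) d0.
rewrite -(fineK Nf) lte_fin -EFinM => N0 [] /eqP.
rewrite -[X in X == _]mul1r -subr_eq0 -mulrBl mulf_eq0 (gt_eqF N0) orbF subr_eq0.
by rewrite gt_eqF.
Qed.

Lemma U0_not_Lp : ~ forall k, (\int[mu]_g (`|U0 b k g| `^ p)%:E < +oo)%E.
Proof.
move=> hk.
have [C C0 [d d0 hC]] := @U0_lower R n b b0 b4.
have n2 : 0 < (n + n)%:R :> R by rewrite ltr0n addn_gt0 n0.
pose C1 := (C / (n + n)%:R) `^ (p / 2).
have C10 : 0 < C1 by rewrite powR_gt0// divr_gt0.
have mU k : measurable_fun setT (fun g => (`|U0 b k g| `^ p)%:E).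
  apply/measurable_EFinP; apply: measurable_powR_comp.
  by apply: (measurableT_comp (@normr_measurable _ _)); exact: L2_measurable (L2_U0 n0 b0 b4 k).
have le1 g : homN g < d -> C1 * sing g <= \sum_k `|U0 b k g| `^ p.
  move=> Ng; have h := hC _ Ng.
  (* Some component carries at least the fraction 1/(2n) of the squared gradient. This k depends on
     g, hence the comparison below with the sum over all k. *)
  have [k hkk] : exists k, C / (n + n)%:R * (sqnorm_hor g * homN g `^ (2 * b - 1)) <= U0 b k g ^+ 2.
    apply: contrapT => hne.
    have lt k : U0 b k g ^+ 2 < C / (n + n)%:R * (sqnorm_hor g * homN g `^ (2 * b - 1)).
      by rewrite ltNge; apply/negP => h1; apply: hne; exists k.
    have : \sum_k U0 b k g ^+ 2 < \sum_(k < n + n) C / (n + n)%:R * (sqnorm_hor g * homN g `^ (2 * b - 1)).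
      apply: ltr_sum => [|k _]; last exact: lt.
      by apply/hasP; exists (Ordinal (ltn_addl n n0 : (0 < n + n)%N)); rewrite ?mem_index_enum.
    have -> : \sum_(k < n + n) C / (n + n)%:R * (sqnorm_hor g * homN g `^ (2 * b - 1)) =
        C * (sqnorm_hor g * homN g `^ (2 * b - 1)).
      rewrite sumr_const card_ord -[LHS]mulr_natl mulrA [_ * (C / _)]mulrCA.
      by rewrite mulfV ?gt_eqF// mulr1.
    by rewrite ltNge h.
  apply: (@le_trans _ _ (`|U0 b k g| `^ p)); last first.
    by rewrite (bigD1 k)//= lerDl sumr_ge0// => i _; exact: powR_ge0.
  have T0 : 0 <= sqnorm_hor g * homN g `^ (2 * b - 1) by rewrite mulr_ge0 ?sqnorm_hor_ge0 ?powR_ge0.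
  rewrite /C1 /sing -powRM ?divr_ge0 ?(ltW C0)//.
  have -> : `|U0 b k g| `^ p = (U0 b k g ^+ 2) `^ (p / 2).
    rewrite -real_normK ?num_real// -powR_mulrn// -powRrM; congr (_ `^ _); by field.
  apply: ge0_ler_powR => //; rewrite ?nnegrE ?sqr_ge0 ?divr_ge0 ?(ltW p0)//.
  by rewrite mulr_ge0// divr_ge0// ltW.
have : (C1%:E * \int[mu]_(g in NB d) (sing g)%:E < +oo)%E.
  rewrite -ge0_integralZl//; last 4 first.
  - exact: measurable_NB.
  - by apply: measurable_funTS; apply/measurable_EFinP; exact: measurable_sing.
  - by move=> g _; rewrite lee_fin powR_ge0.
  - by rewrite lee_fin ltW.
  apply: (@le_lt_trans _ _ (\int[mu]_(g in NB d) \sum_k (`|U0 b k g| `^ p)%:E)%E).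
    apply: ge0_le_integral => //=.
    - exact: measurable_NB.
    - by move=> g _; rewrite -EFinM lee_fin mulr_ge0 ?powR_ge0// ltW.
    - apply: emeasurable_funM => //; apply: measurable_funTS.
      by apply/measurable_EFinP; exact: measurable_sing.
    - by apply: emeasurable_sum => k; exact: measurable_funTS.
    - by move=> g Ng; rewrite -EFinM sumEFin lee_fin; exact: le1.
  rewrite ge0_integral_sum//; last 2 first.
  - exact: measurable_NB.
  - by move=> k; exact: measurable_funTS.
  apply: lte_sum_pinfty => k _; apply: le_lt_trans (hk k).
  apply: ge0_subset_integral => //; exact: measurable_NB.
by rewrite sing_not_integrable// gt0_muley ?lte_fin.
Qed.

End NonIntegrability.

(** * The reverse Hoelder inequality *)

Section ReverseHolder.
Context {R : realType} {n : nat}.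
Local Notation H := (heis R n).
Local Notation mu := (@heis_leb R n).
Local Notation Q := (2 * n + 2)%N.
Variable b : R.
Hypothesis b4 : b < 4^-1.
Implicit Types (g h k : H) (r : R).
Local Notation V := (@Vb R n b).

Lemma heis_mulK g k : heis_mul (heis_inv g) (heis_mul g k) = k.
Proof.
rewrite [RHS]surjective_pairing /heis_mul /heis_inv /=.
apply: (congr2 pair); first by rewrite addrA addNr add0r.
set S1 := \sum_(j < n) _; set S2 := \sum_(j < n) _.
have -> : S2 = - S1.
  rewrite /S1 /S2 -sumrN; apply: eq_bigr => j _; rewrite !mxE; ring.
by ring.
Qed.

Lemma sqrD_le (x y : R) : (x + y) ^+ 2 <= 2 * (x ^+ 2 + y ^+ 2).
Proof.
rewrite -subr_ge0 (_ : _ - _ = (x - y) ^+ 2) ?sqr_ge0//; ring.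
Qed.

Lemma symplectic_bound g k : `|2 * \sum_(j < n) (g.1 ord0 (rshift n j) * k.1 ord0 (lshift n j)
   - g.1 ord0 (lshift n j) * k.1 ord0 (rshift n j))| <= sqnorm_hor g + sqnorm_hor k.
Proof.
rewrite mulr_sumr; apply: le_trans (ler_norm_sum _ _ _) _.
rewrite /sqnorm_hor !big_split_ord /= -!big_split /=; apply: ler_sum => j _.
move: (g.1 ord0 (rshift n j)) (k.1 ord0 (lshift n j)) (g.1 ord0 (lshift n j)) (k.1 ord0 (rshift n j)) => a c d e.
rewrite ler_norml; apply/andP; split; rewrite -subr_ge0.
  have -> : 2 * (a * c - d * e) - - (d ^+ 2 + a ^+ 2 + (c ^+ 2 + e ^+ 2)) = (a + c) ^+ 2 + (d - e) ^+ 2 by ring.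
  by rewrite addr_ge0// sqr_ge0.
have -> : d ^+ 2 + a ^+ 2 + (c ^+ 2 + e ^+ 2) - 2 * (a * c - d * e) = (a - c) ^+ 2 + (d + e) ^+ 2 by ring.
by rewrite addr_ge0// sqr_ge0.
Qed.

Lemma sqnorm_mul g k : sqnorm_hor (heis_mul g k) <= 2 * (sqnorm_hor g + sqnorm_hor k).
Proof.
rewrite /sqnorm_hor -big_split /= mulr_sumr; apply: ler_sum => i _; rewrite mxE.
exact: sqrD_le.
Qed.

(** A quasi-triangle inequality for the fourth power of the norm. Here 14 = 8 + 3 * 2: the 8 comes
    from the horizontal part, the 3 from squaring a sum of three terms in t, and the 2 from the
    square of the symplectic term. *)
Lemma homN_mul g k : homN (heis_mul g k) <= 14 * (homN g + homN k).
Proof.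
have h1 := sqnorm_mul g k; have h2 := symplectic_bound g k.
have r1 := sqnorm_hor_ge0 g; have r2 := sqnorm_hor_ge0 k.
have r3 := sqnorm_hor_ge0 (heis_mul g k).
pose S := 2 * \sum_(j < n) (g.1 ord0 (rshift n j) * k.1 ord0 (lshift n j)
   - g.1 ord0 (lshift n j) * k.1 ord0 (rshift n j)).
have e : (heis_mul g k).2 = g.2 + k.2 + S by [].
have a1 : sqnorm_hor (heis_mul g k) ^+ 2 <= 8 * (sqnorm_hor g ^+ 2 + sqnorm_hor k ^+ 2).
  apply: (@le_trans _ _ ((2 * (sqnorm_hor g + sqnorm_hor k)) ^+ 2)).
    by rewrite ler_pXn2r ?nnegrE// mulr_ge0// addr_ge0.
  rewrite exprMn; have := sqrD_le (sqnorm_hor g) (sqnorm_hor k).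
  by move: ((_ + _) ^+ 2) => x; lra.
have a2 : S ^+ 2 <= 2 * (sqnorm_hor g ^+ 2 + sqnorm_hor k ^+ 2).
  apply: le_trans (sqrD_le _ _).
  by rewrite -[S ^+ 2]real_normK ?num_real// ler_pXn2r ?nnegrE// addr_ge0.
have a3 : (g.2 + k.2 + S) ^+ 2 <= 3 * (g.2 ^+ 2 + k.2 ^+ 2 + S ^+ 2).
  rewrite -subr_ge0 (_ : _ - _ = (g.2 - k.2) ^+ 2 + (g.2 - S) ^+ 2 + (k.2 - S) ^+ 2); last by ring.
  by rewrite !addr_ge0 ?sqr_ge0.
rewrite {1}/homN e /homN.
have b1 := sqr_ge0 (sqnorm_hor g); have b2 := sqr_ge0 (sqnorm_hor k).
have b3 := sqr_ge0 g.2; have b4' := sqr_ge0 k.2.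
move: a1 a2 a3 b1 b2 b3 b4'.
move: (sqnorm_hor (heis_mul g k) ^+ 2) (sqnorm_hor g ^+ 2) (sqnorm_hor k ^+ 2) ((g.2 + k.2 + S) ^+ 2) (g.2 ^+ 2) (k.2 ^+ 2) (S ^+ 2) => A B C D E F G.
by move=> *; lra.
Qed.

Lemma heis_invK g : heis_inv (heis_inv g) = g.
Proof. by rewrite /heis_inv /= !opprK -surjective_pairing. Qed.

Lemma heis_mulVK g k : heis_mul g (heis_mul (heis_inv g) k) = k.
Proof. by rewrite -{1}(heis_invK g) heis_mulK. Qed.

Lemma homN_inv g : homN (heis_inv g) = homN g.
Proof.
rewrite /homN /sqnorm_hor /= sqrrN; congr (_ ^+ 2 + _).
by apply: eq_bigr => i _; rewrite mxE sqrrN.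
Qed.

Lemma heis_mul_dil r g k : r != 0 ->
  heis_mul g (dil r k) = dil r (heis_mul (dil r^-1 g) k).
Proof.
move=> r0; rewrite /heis_mul /dil /=; apply: (congr2 pair).
  by rewrite scalerDr scalerA mulfV// scale1r.
rewrite !mulrDr mulrA -exprMn mulfV// expr1n mul1r; congr (_ + _).
rewrite mulrCA; congr (_ * _); rewrite mulr_sumr; apply: eq_bigr => j _; rewrite !mxE.
move: (g.1 ord0 (rshift n j)) (g.1 ord0 (lshift n j))
  (k.1 ord0 (rshift n j)) (k.1 ord0 (lshift n j)) => a c d e.
by field.
Qed.

Lemma heis_ballE g r : 0 < r -> heis_ball g r = [set h | NB (r ^+ 4) (heis_mul (heis_inv g) h)].
Proof.
move=> r0; apply/seteqP; split => h; rewrite /heis_ball /NB /= heis_normE => hh.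
  rewrite ltNge; apply/negP => h1; move: hh; rewrite ltNge => /negP; apply.
  have -> : r = (r ^+ 4) `^ 4^-1.
    by rewrite -powR_mulrn ?ltW// -powRrM mulfV ?powRr1 ?ltW// pnatr_eq0.
  by apply: ge0_ler_powR; rewrite ?nnegrE ?invr_ge0 ?homN_ge0 ?exprn_ge0 ?(ltW r0).
have -> : r = (r ^+ 4) `^ 4^-1.
  by rewrite -powR_mulrn ?ltW// -powRrM mulfV ?powRr1 ?ltW// pnatr_eq0.
by apply: gt0_ltr_powR; rewrite ?nnegrE ?invr_gt0 ?homN_ge0 ?exprn_ge0 ?(ltW r0).
Qed.

Lemma measurable_heis_ball g r : 0 < r -> measurable (heis_ball g r).
Proof.
move=> r0; rewrite heis_ballE// -[X in measurable X]setTI.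
by apply: (mpres_mul (heis_inv g)).1 => //; exact: measurable_NB.
Qed.

Lemma integral_heis_ball g r (F : H -> \bar R) : 0 < r ->
  measurable_fun setT F -> (forall h, (0 <= F h)%E) ->
  (\int[mu]_(h in heis_ball g r) F h = \int[mu]_(k in NB (r ^+ 4)) F (heis_mul g k))%E.
Proof.
move=> r0 mF F0; have mB := measurable_heis_ball g r0.
rewrite integral_mkcond [RHS]integral_mkcond.
rewrite -((mpres_mul g).2 (F \_ (heis_ball g r))).
- apply: eq_integral => k _; rewrite !patchE.
  by congr (if _ then _ else _); apply/idP/idP; rewrite !inE heis_ballE//= heis_mulK.
- exact/(measurable_restrictT F mB)/measurable_funTS.
- exact: erestrict_ge0.
Qed.

Lemma integral_heis_ball_dil g r (F : H -> \bar R) : 0 < r ->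
  measurable_fun setT F -> (forall h, (0 <= F h)%E) ->
  (\int[mu]_(h in heis_ball g r) F h =
   (r ^+ Q)%:E * \int[mu]_(k in NB 1) F (dil r (heis_mul (dil r^-1 g) k)))%E.
Proof.
move=> r0 mF F0; rewrite integral_heis_ball//.
have mG : measurable_fun setT (fun k => F (heis_mul g k)).
  by apply: (measurableT_comp mF); exact: (mpres_mul g).1.
have := @ge0_integral_dil_set R n r (NB (r ^+ 4 * 1)) _ r0 (measurable_NB _) mG (fun k => F0 _).
rewrite dil_NB// mulr1 => h.
have -> : (\int[mu]_(k in NB 1) F (dil r (heis_mul (dil r^-1 g) k)) =
   \int[mu]_(k in NB 1) F (heis_mul g (dil r k)))%E.
  by apply: eq_integral => k _; rewrite heis_mul_dil// gt_eqF.
by rewrite h muleA -EFinM mulfV ?mul1e// expf_neq0// gt_eqF.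
Qed.

Lemma Vb_dil r h : 0 < r -> V (dil r h) = r `^ (4 * b - 2) * V h.
Proof.
move=> r0; rewrite /Vb sqnorm_dil homN_dil powRM ?exprn_ge0 ?homN_ge0 ?(ltW r0)//.
rewrite mulrACA; congr (_ * _).
rewrite -(powR_mulrn 2 (ltW r0)) -(powR_mulrn 4 (ltW r0)) -powRrM -powRD_gt0//.
by congr (_ `^ _); ring.
Qed.

Lemma Vb_le h : V h <= homN h `^ (- (2^-1 - b)).
Proof.
have := homN_ge0 h; rewrite le_eqVlt => /predU1P[N0|N0].
  by have [r0 _] := homN_eq0_sqnorm (esym N0); rewrite /Vb r0 mul0r powR_ge0.
have -> : - (2^-1 - b) = 2^-1 + (b - 1) by field.
by rewrite powRD_gt0// ler_wpM2r ?powR_ge0// sqnorm_le_sqrtN.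
Qed.

Lemma measurable_VbX (s : R) : measurable_fun setT (fun h => (V h `^ s)%:E).
Proof. by apply/measurable_EFinP; apply: measurable_powR_comp; exact: measurable_Vb. Qed.

Lemma VbX_ge0 (s : R) h : (0 <= (V h `^ s)%:E)%E.
Proof. by rewrite lee_fin powR_ge0. Qed.

Lemma int_VbX_fin (s l : R) : 0 < s -> (2 - 4 * b) * s < Q%:R -> 0 < l ->
  (\int[mu]_(h in NB (l ^+ 4)) (V h `^ s)%:E < +oo)%E.
Proof.
move=> s0 sQ l0.
have h1 : (\int[mu]_(h in NB 1) (V h `^ s)%:E < +oo)%E.
  have b4' := b4.
  have t0 : 0 < (2^-1 - b) * s by rewrite mulr_gt0//; lra.
  apply: le_lt_trans (int_homN_pow t0 (_ : 4 * ((2^-1 - b) * s) < Q%:R)); last first.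
    by have -> : 4 * ((2^-1 - b) * s) = (2 - 4 * b) * s by field.
  apply: ge0_le_integral => //.
  - exact: measurable_NB.
  - by move=> h _; exact: VbX_ge0.
  - exact: measurable_funTS (measurable_VbX s).
  - apply: measurable_funTS; apply/measurable_EFinP; apply: measurable_powR_comp.
    exact: measurable_homN.
  - move=> h _; rewrite lee_fin -mulNr powRrM.
    by apply: ge0_ler_powR; rewrite ?nnegrE ?Vb_ge0 ?powR_ge0 ?(ltW s0) ?Vb_le.
have := @ge0_integral_dil_set R n l (NB (l ^+ 4 * 1)) _ l0 (measurable_NB _) (measurable_VbX s) (VbX_ge0 s).
rewrite dil_NB// mulr1 => e.
have -> : (\int[mu]_(h in NB (l ^+ 4)) (V h `^ s)%:E =
   (l ^+ Q)%:E * \int[mu]_(h in NB 1) (V (dil l h) `^ s)%:E)%E.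
  by rewrite e muleA -EFinM mulfV ?mul1e// expf_neq0// gt_eqF.
have -> : (\int[mu]_(h in NB 1) (V (dil l h) `^ s)%:E =
    ((l `^ (4 * b - 2)) `^ s)%:E * \int[mu]_(h in NB 1) (V h `^ s)%:E)%E.
  rewrite -ge0_integralZl//; last 4 first.
  - exact: measurable_NB.
  - exact: measurable_funTS (measurable_VbX s).
  - by move=> h _; exact: VbX_ge0.
  - by rewrite lee_fin powR_ge0.
  by apply: eq_integral => h _; rewrite Vb_dil// powRM ?powR_ge0 ?Vb_ge0// EFinM.
have F : (\int[mu]_(h in NB 1) (V h `^ s)%:E)%E \is a fin_num.
  by rewrite ge0_fin_numE// integral_ge0// => h _; exact: VbX_ge0.
by rewrite -(fineK F) -!EFinM ltry.
Qed.

End ReverseHolder.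

(** * The reverse Hoelder inequality on balls of radius 1 *)

Section UnitBall.
Context {R : realType} {n : nat}.
Local Notation H := (heis R n).
Local Notation mu := (@heis_leb R n).
Local Notation Q := (2 * n + 2)%N.
Variable b : R.
Hypotheses (n0 : (0 < n)%N) (b4 : b < 4^-1).
Implicit Types (g h k : H) (r s l : R).
Local Notation V := (@Vb R n b).

Lemma heis_mulKV g k : heis_mul (heis_mul g k) (heis_inv k) = g.
Proof.
rewrite [RHS]surjective_pairing /heis_mul /heis_inv /=.
apply: (congr2 pair); first by rewrite addrK.
set S1 := \sum_(j < n) _; set S2 := \sum_(j < n) _.
have -> : S2 = - S1.
  rewrite /S1 /S2 -sumrN; apply: eq_bigr => j _; rewrite !mxE; ring.
by ring.
Qed.

Lemma int_sqnorm_NB1 : exists2 kap : R, 0 < kap &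
  (\int[mu]_(k in NB 1) (sqnorm_hor k)%:E = kap%:E)%E.
Proof.
pose f k : \bar R := (sqnorm_hor k)%:E.
have f0 k : (0 <= f k)%E by rewrite lee_fin sqnorm_hor_ge0.
have mf : measurable_fun setT f by apply/measurable_EFinP; exact: measurable_sqnorm.
have mN : measurable (NB 1 : set H) := measurable_NB 1.
have fin : (\int[mu]_(k in NB 1) f k < +oo)%E.
  apply: (@le_lt_trans _ _ (\int[mu]_(k in NB 1) (cst 1%E k))%E).
    apply: ge0_le_integral => //; first exact: measurable_funTS.
    move=> k Nk; rewrite lee_fin leNgt; apply/negP => h.
    have := le_lt_trans (sqnorm_le_homN k) Nk; rewrite ltNge => /negP; apply.
    by rewrite -[1](expr1n _ 2) ler_pXn2r ?nnegrE ?sqnorm_hor_ge0 ?(ltW h).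
  by rewrite integral_cst// mul1e mu_NB_fin.
have F : (\int[mu]_(k in NB 1) f k)%E \is a fin_num by rewrite ge0_fin_numE// integral_ge0.
exists (fine (\int[mu]_(k in NB 1) f k)%E); last by rewrite fineK.
rewrite fine_gt0// fin andbT lt_def integral_ge0// andbT; apply/eqP => e0.
have /ae_eq_integral_abs h : measurable_fun (NB 1) f by exact: measurable_funTS.
have fabs : (\int[mu]_(k in NB 1) `|f k| = 0)%E.
  by rewrite -[RHS]e0; apply: eq_integral => g _; rewrite gee0_abs.
have {}h : ae_eq mu (NB 1) f (cst 0%E) by apply/h.
have hr := sqnorm_gt0_ae n0 : {ae mu, forall g : H, 0 < sqnorm_hor g}.
have := mu_NB_gt0 (n := n) (@ltr01 R).
suff -> : mu (NB 1) = 0%E by rewrite ltxx.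
apply/negligibleP => //.
have [N [mN' N0 hN]] := filterI h hr.
exists N; split => // g Ag; apply: hN => /= -[h1 h2].
by have [] := h1 Ag; apply/eqP; rewrite gt_eqF.
Qed.

(* Averaging over k and its reflection cancels the cross terms of |x + y|^2. *)
Lemma int_sqnorm_mul kap g : (\int[mu]_(k in NB 1) (sqnorm_hor k)%:E = kap%:E)%E ->
  ((fine (mu (NB 1)) * sqnorm_hor g + kap)%:E <=
   \int[mu]_(k in NB 1) (sqnorm_hor (heis_mul g k))%:E)%E.
Proof.
move=> ek; pose f k : \bar R := (sqnorm_hor (heis_mul g k))%:E.
have f0 k : (0 <= f k)%E by rewrite lee_fin sqnorm_hor_ge0.
have ms := @measurable_sqnorm R n.
have mf : measurable_fun setT f.
  by apply/measurable_EFinP; apply: (measurableT_comp ms); exact: (mpres_mul g).1.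
have mN : measurable (NB 1 : set H) := measurable_NB 1.
have sym : (\int[mu]_(k in NB 1) f k = \int[mu]_(k in NB 1) f (refl_hor k))%E.
  rewrite integral_mkcond [RHS]integral_mkcond.
  rewrite -((@mpres_refl R n).2 (f \_ (NB 1))).
  - apply: eq_integral => k _; rewrite !patchE.
    have e : homN (refl_hor k) = homN k.
      rewrite /homN /refl_hor /sqnorm_hor /=; congr (_ ^+ 2 + _).
      by apply: eq_bigr => i _; rewrite mxE sqrrN.
    by congr (if _ then _ else _); apply/idP/idP; rewrite !inE /NB /= e.
  - exact/(measurable_restrictT f mN)/measurable_funTS.
  - exact: erestrict_ge0.
have muF : mu (NB 1) \is a fin_num by rewrite ge0_fin_numE// mu_NB_fin.
have two : (\int[mu]_(k in NB 1) f k + \int[mu]_(k in NB 1) f k =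
   (2 * (fine (mu (NB 1)) * sqnorm_hor g + kap))%:E)%E.
  rewrite {2}sym -ge0_integralD//; last 2 first.
  - exact: measurable_funTS.
  - apply: measurable_funTS; apply: (measurableT_comp mf).
    exact: (@mpres_refl R n).1.
  transitivity (\int[mu]_(k in NB 1) ((2 * sqnorm_hor g)%:E + 2%:E * (sqnorm_hor k)%:E))%E.
    apply: eq_integral => k _; rewrite -EFinM -!EFinD; congr (_%:E).
    rewrite /sqnorm_hor -big_split !mulr_sumr -big_split /=; apply: eq_bigr => i _.
    rewrite !mxE; move: (g.1 ord0 i) (k.1 ord0 i) => x y; ring.
  have m1 : measurable_fun (NB 1) (fun k : H => (sqnorm_hor k)%:E).
    by apply: measurable_funTS; exact/measurable_EFinP.
  rewrite ge0_integralD//; last 3 first.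
  - by move=> k _; rewrite lee_fin mulr_ge0// sqnorm_hor_ge0.
  - by move=> k _; rewrite -EFinM lee_fin mulr_ge0// sqnorm_hor_ge0.
  - by apply: emeasurable_funM.
  rewrite ge0_integralZl//; last by move=> k _; rewrite lee_fin sqnorm_hor_ge0.
  rewrite ek integral_cst// -(fineK muF) -!EFinM -EFinD; congr (_%:E).
  rewrite (fineK muF); ring.
move: two; case: (\int[mu]_(k in NB 1) f k)%E => [x| |] //=.
by rewrite -EFinD => -[]; rewrite lee_fin; move: (_ * _ + kap) => y e; lra.
Qed.

Lemma homN_mul_NB g k l : 14 * (homN g + 1) <= l -> NB 1 k -> NB l (heis_mul g k).
Proof.
move=> hl hk; apply: lt_le_trans hl; apply: le_lt_trans (homN_mul g k) _.
by rewrite ltr_pM2l// ltrD2l.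
Qed.

Let J s g := (\int[mu]_(k in NB 1) (V (heis_mul g k) `^ s)%:E)%E.

Let J_ge0 s g : (0 <= J s g)%E.
Proof. by apply: integral_ge0 => k _; rewrite lee_fin powR_ge0. Qed.

Let mVm s g : measurable_fun setT (fun k => (V (heis_mul g k) `^ s)%:E).
Proof. by apply: (measurableT_comp (@measurable_VbX R n b s)); exact: (mpres_mul g).1. Qed.

Let J_le s g l : 14 * (homN g + 1) <= l -> (J s g <= \int[mu]_(h in NB l) (V h `^ s)%:E)%E.
Proof.
move=> hl.
have mV := @measurable_VbX R n b s.
have := @integral_heis_ball R n g 1 _ ltr01 mV (@VbX_ge0 R n b s).
rewrite expr1n /J => <-; apply: ge0_subset_integral => //.
- exact: measurable_heis_ball.
- exact: measurable_NB.
- exact: measurable_funTS.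
- by move=> h _; exact: VbX_ge0.
- move=> h; rewrite heis_ballE// expr1n /= => hh.
  by rewrite -(heis_mulVK g h); exact: homN_mul_NB hh.
Qed.

Lemma int_Vb_mul_fin s g : 0 < s -> (2 - 4 * b) * s < Q%:R -> J s g \is a fin_num.
Proof.
move=> s0 sQ; rewrite ge0_fin_numE//.
pose l := 14 * (homN g + 1).
have l1 : 1 <= l by have := homN_ge0 g; rewrite /l; move: (homN g) => x; lra.
apply: le_lt_trans (int_VbX_fin b4 s0 sQ (lt_le_trans ltr01 l1)).
by apply: J_le; rewrite -/l exprS ler_peMr ?exprn_ege1// (le_trans ler01).
Qed.

Lemma Vb_homN_lower g k : NB 1 k ->
  sqnorm_hor (heis_mul g k) * (14 * (homN g + 1)) `^ (b - 1) <= V (heis_mul g k).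
Proof.
move=> hk; have := @homN_mul_NB g k _ (lexx _) hk; rewrite /NB /Vb /=.
have := homN_ge0 (heis_mul g k); rewrite le_eqVlt => /predU1P[N0 _|N0 Nl].
  by have [-> _] := homN_eq0_sqnorm (esym N0); rewrite !mul0r.
rewrite ler_wpM2l ?sqnorm_hor_ge0// -opprB !powRN lef_pV2 ?posrE ?powR_gt0//; last exact: lt_trans Nl.
apply: ge0_ler_powR; rewrite ?nnegrE ?(ltW N0) ?(ltW (lt_trans N0 Nl)) ?(ltW Nl)//.
by have := b4; lra.
Qed.

(** As b < 1, the power of [homN] is at least its value at 14 ([homN g] + 1), and the integral of
    rho over the ball is at least a multiple of rho(g) + 1. The summand 1 keeps the bound positive
    when g is on the axis x = 0, where V vanishes. *)
Lemma int_Vb_lower : exists2 c, 0 < c & forall g,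
  ((c * (sqnorm_hor g + 1) * (14 * (homN g + 1)) `^ (b - 1))%:E <= J 1 g)%E.
Proof.
have [kap kap0 ek] := int_sqnorm_NB1.
have muF : mu (NB 1) \is a fin_num by rewrite ge0_fin_numE// mu_NB_fin.
pose om := fine (mu (NB 1)).
have om0 : 0 < om by rewrite fine_gt0// mu_NB_gt0//= mu_NB_fin.
exists (Num.min om kap) => [|g]; first by rewrite lt_min om0.
pose P := (14 * (homN g + 1)) `^ (b - 1).
have P0 : 0 <= P by exact: powR_ge0.
have mN : measurable (NB 1 : set H) := measurable_NB 1.
have mf : measurable_fun setT (fun k => (sqnorm_hor (heis_mul g k))%:E).
  apply/measurable_EFinP; apply: (measurableT_comp (@measurable_sqnorm R n)).
  exact: (mpres_mul g).1.
apply: (@le_trans _ _ (\int[mu]_(k in NB 1) (P%:E * (sqnorm_hor (heis_mul g k))%:E))%E); last first.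
  apply: ge0_le_integral => //.
  - by move=> k _; rewrite -EFinM lee_fin mulr_ge0// sqnorm_hor_ge0.
  - by apply: emeasurable_funM => //; exact: measurable_funTS.
  - exact: measurable_funTS.
  - by move=> k Nk; rewrite -EFinM lee_fin powRr1 ?Vb_ge0// mulrC; exact: Vb_homN_lower.
rewrite ge0_integralZl//; last 2 first.
- exact: measurable_funTS.
- by move=> k _; rewrite lee_fin sqnorm_hor_ge0.
apply: le_trans (lee_wpmul2l _ (int_sqnorm_mul g ek)); last by rewrite lee_fin.
rewrite -EFinM lee_fin mulrC ler_wpM2l// mulrDr mulr1 lerD//.
  by rewrite ler_wpM2r ?sqnorm_hor_ge0// ge_min lexx.
by rewrite ge_min lexx orbT.
Qed.

Let mean_le_bound q g (T : R) : 0 < q -> J q g \is a fin_num -> 0 <= T ->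
  (forall k, NB 1 k -> V (heis_mul g k) <= T) ->
  ((fine (mu (NB 1)))^-1 * fine (J q g)) `^ q^-1 <= T.
Proof.
move=> q0 JF T0 VT; pose om := fine (mu (NB 1)).
have muF : mu (NB 1) \is a fin_num by rewrite ge0_fin_numE// mu_NB_fin.
have om0 : 0 < om by rewrite fine_gt0// mu_NB_gt0//= mu_NB_fin.
have mN : measurable (NB 1 : set H) := measurable_NB 1.
have JT : fine (J q g) <= om * T `^ q.
  rewrite -lee_fin fineK//.
  apply: (@le_trans _ _ (\int[mu]_(k in NB 1) (cst (T `^ q)%:E k))%E).
    apply: ge0_le_integral => //; first by move=> k _; rewrite lee_fin powR_ge0.
      exact: measurable_funTS.
    move=> k Nk; rewrite lee_fin ge0_ler_powR ?nnegrE ?Vb_ge0 ?(ltW q0)//.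
    exact: VT.
  by rewrite integral_cst// -(fineK muF) -EFinM mulrC.
apply: (@le_trans _ _ ((T `^ q) `^ q^-1)).
  apply: ge0_ler_powR; rewrite ?nnegrE ?invr_ge0 ?powR_ge0 ?(ltW q0)//.
    by rewrite mulr_ge0 ?invr_ge0 ?(ltW om0)// fine_ge0.
  by rewrite ler_pdivrMl.
by rewrite -powRrM mulfV ?powRr1// gt_eqF.
Qed.

Let mono q (x z w : R) : 0 < q -> 0 <= x -> 0 <= z -> z <= w ->
  (x * z) `^ q^-1 <= (x * w) `^ q^-1.
Proof.
move=> q0 x0 z0 zw; apply: ge0_ler_powR; rewrite ?nnegrE ?invr_ge0 ?(ltW q0)//.
- exact: mulr_ge0.
- by rewrite mulr_ge0// (le_trans z0).
- exact: ler_wpM2l.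
Qed.

(** The threshold is 28 = 2 * 14. If [homN g] >= 28, the quasi-triangle inequality keeps [homN]
    above [homN g] / 28 on the ball, so V is bounded pointwise by a multiple of its mean. Otherwise
    the ball lies in a fixed [NB l] where V^q has finite integral, while the mean of V is bounded
    below. *)
Lemma unit_rev_holder q : 1 < q -> (2 - 4 * b) * q < Q%:R ->
  exists2 C, 0 < C & forall g,
    ((fine (mu (NB 1)))^-1 * fine (J q g)) `^ q^-1 <= C * fine (J 1 g).
Proof.
move=> q1 qQ; have q0 : 0 < q by exact: lt_trans q1.
have s1Q : (2 - 4 * b) * 1 < Q%:R.
  by apply: lt_trans qQ; rewrite ltr_pM2l//; have := b4; lra.
have [c c0 hc] := int_Vb_lower.
pose om := fine (mu (NB 1)).
have muF : mu (NB 1) \is a fin_num by rewrite ge0_fin_numE// mu_NB_fin.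
have om0 : 0 < om by rewrite fine_gt0// mu_NB_gt0//= mu_NB_fin.
have mN : measurable (NB 1 : set H) := measurable_NB 1.
have low g : c * (sqnorm_hor g + 1) * (14 * (homN g + 1)) `^ (b - 1) <= fine (J 1 g).
  by rewrite -lee_fin fineK ?int_Vb_mul_fin.
have [K' K1' Ke'] : exists2 K : R, 1 <= K &
    forall x, x < 28 -> 14 * (x + 1) <= K.
  by exists (14 * 29) => [|x x28]; lra.
(* [int_VbX_fin] concerns sets [NB (l ^+ 4)], so the fourth power of K' is taken, which is at least
   K' as K' >= 1. *)
have [l [Kl Ml]] : exists l, K' <= l /\ (\int[mu]_(h in NB l) (V h `^ q)%:E < +oo)%E.
  exists (K' ^+ 4); split; last by apply: (int_VbX_fin b4) => //; exact: lt_le_trans K1'.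
  by rewrite ler_eXnr.
have K0' : 0 < K' by apply: lt_le_trans K1'.
pose M := fine (\int[mu]_(h in NB l) (V h `^ q)%:E)%E.
have MF : (\int[mu]_(h in NB l) (V h `^ q)%:E)%E \is a fin_num.
  rewrite ge0_fin_numE//.
  by apply: integral_ge0 => k _; rewrite lee_fin powR_ge0.
(* For x >= 14 already 14 (x + 1) <= 15 x, hence K = 15 * 28. *)
have [K K0 Ke] : exists2 K : R, 0 < K &
    forall x, 28 <= x -> 14 * (x + 1) <= K * (x / 28).
  by exists (15 * 28) => [|x x28]; [rewrite mulr_gt0|lra].
pose C1 := 2 / (c * K `^ (b - 1)).
pose C2 := (om^-1 * M) `^ q^-1 / (c * K' `^ (b - 1)).
have C10 : 0 < C1 by rewrite divr_gt0// mulr_gt0// powR_gt0.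
have C20 : 0 <= C2 by rewrite divr_ge0 ?powR_ge0// mulr_ge0 ?powR_ge0// ltW.
exists (C1 + C2) => [|g]; first by rewrite ltr_wpDr.
have g0 := sqnorm_hor_ge0 g; have N0 := homN_ge0 g.
have b1 : 0 <= 1 - b by have := b4; lra.
have dec x y : 0 < x -> x <= y -> y `^ (b - 1) <= x `^ (b - 1).
  move=> x0 xy; rewrite -opprB !powRN lef_pV2 ?posrE ?powR_gt0//; last exact: lt_le_trans xy.
  by apply: ge0_ler_powR; rewrite ?nnegrE// ltW// (lt_le_trans x0).
have [Ng|Ng] := leP 28 (homN g).
- pose T := 2 * (sqnorm_hor g + 1) * (homN g / 28) `^ (b - 1).
  have T0 : 0 <= T by rewrite !mulr_ge0 ?powR_ge0// addr_ge0.
  have VT k : NB 1 k -> V (heis_mul g k) <= T.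
    move=> Nk; have rk : sqnorm_hor k <= 1.
      rewrite leNgt; apply/negP => h.
      have := le_lt_trans (sqnorm_le_homN k) Nk; rewrite ltNge => /negP; apply.
      by rewrite -[1](expr1n _ 2) ler_pXn2r ?nnegrE ?sqnorm_hor_ge0 ?(ltW h).
    apply: ler_pM; rewrite ?sqnorm_hor_ge0 ?powR_ge0//.
      by apply: le_trans (sqnorm_mul g k) _; rewrite ler_wpM2l// lerD2l.
    apply: dec; first by rewrite divr_gt0// (lt_le_trans _ Ng).
    have := homN_mul (heis_mul g k) (heis_inv k); rewrite homN_inv.
    have -> : heis_mul (heis_mul g k) (heis_inv k) = g.
      exact: heis_mulKV.
    move: Nk; rewrite /NB /=; move: (homN g) (homN k) (homN (heis_mul g k)) Ng => x y z hx hy hz.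
    lra.
  have h1 := mean_le_bound q0 (int_Vb_mul_fin g q0 qQ) T0 VT.
  apply: le_trans h1 _; apply: (@le_trans _ _ (C1 * fine (J 1 g))); last first.
    by rewrite mulrDl lerDl mulr_ge0// fine_ge0.
  apply: le_trans (ler_wpM2l (ltW C10) (low g)).
  have h2 : K `^ (b - 1) * (homN g / 28) `^ (b - 1) <= (14 * (homN g + 1)) `^ (b - 1).
    rewrite -powRM ?divr_ge0 ?(ltW K0)//; apply: dec; first by rewrite mulr_gt0// ltr_wpDl.
    exact: Ke.
  rewrite [leRHS]mulrA; apply: le_trans (ler_wpM2l _ h2); last by rewrite mulr_ge0 ?(ltW C10)// mulr_ge0 ?(ltW c0)// addr_ge0.
  rewrite /T /C1 le_eqVlt; apply/orP; left; apply/eqP.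
  have : K `^ (b - 1) != 0 by rewrite gt_eqF// powR_gt0.
  have : c != 0 by rewrite gt_eqF.
  move: (K `^ (b - 1)) ((homN g / 28) `^ (b - 1)) (sqnorm_hor g) => x y z xn yn.
  by field; rewrite xn yn.
- have JM : fine (J q g) <= M.
    have JF := int_Vb_mul_fin g q0 qQ.
    apply: (fine_le JF MF).
    apply: (@J_le q g l).
    by apply: le_trans Kl; exact: Ke'.
  apply: (@le_trans _ _ (C2 * fine (J 1 g))); last first.
    by rewrite mulrDl lerDr mulr_ge0 ?fine_ge0// ltW.
  have h2 : c * K' `^ (b - 1) <= fine (J 1 g).
    apply: le_trans (low g).
    apply: ler_pM; rewrite ?powR_ge0 ?(ltW c0)//.
      by rewrite ler_peMr ?(ltW c0)// lerDr.
    apply: dec; first by rewrite mulr_gt0// ltr_wpDl.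
    exact: Ke'.
  clear Ng Ke Ke' Kl.
  have := ler_wpM2l C20 h2; apply: le_trans.
  rewrite /C2 mulfVK; last by rewrite gt_eqF// mulr_gt0// powR_gt0.
  have oV : 0 <= om^-1 by rewrite invr_ge0 ltW.
  have J0 : 0 <= fine (J q g) by rewrite fine_ge0.
  exact: (@mono q _ _ _ q0 oV J0 JM).
Qed.

End UnitBall.

Section ReverseHolderVb.
Context {R : realType} {n : nat}.
Local Notation H := (heis R n).
Local Notation mu := (@heis_leb R n).
Local Notation Q := (2 * n + 2)%N.
Variables (b q : R).
Hypotheses (n0 : (0 < n)%N) (b4 : b < 4^-1) (q1 : 1 < q).
Hypothesis qQ : (2 - 4 * b) * q < Q%:R.
Implicit Types (g h k : H) (r s l : R).
Local Notation V := (@Vb R n b).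

Lemma compact_sub_NB (K : set H) : compact K -> exists2 l : R, 0 < l & K `<=` NB (l ^+ 4).
Proof.
move=> cK; have /compact_bounded[M [Mr MP]] := cK.
have M1 : M < `|M| + 1 by rewrite (le_lt_trans (ler_norm M))// ltrDl.
pose r := `|M| + 2.
have r0 : 0 < r by rewrite ltr_wpDl.
pose c : R := ((n + n)%:R * r ^+ 2) ^+ 2 + r ^+ 2.
have c0 : 0 <= c by rewrite addr_ge0// sqr_ge0.
exists (c + 1) => [|g Kg]; first by rewrite ltr_wpDl.
have hg : `|g| < r.
  by apply: (@le_lt_trans _ _ (`|M| + 1)); [exact: MP|rewrite ltrD2l ltr1n].
have [h1 h2] := (hboxE g r0).2 hg.
have sq (x : R) : `|x| < r -> x ^+ 2 < r ^+ 2.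
  by move=> h; rewrite -[x ^+ 2]real_normK ?num_real// ltr_pXn2r ?nnegrE// ltW.
have a1 : sqnorm_hor g <= (n + n)%:R * r ^+ 2.
  have -> : (n + n)%:R * r ^+ 2 = \sum_(i < n + n) r ^+ 2.
    by rewrite sumr_const card_ord mulr_natl.
  by apply: ler_sum => i _; rewrite ltW// sq.
apply: (@lt_le_trans _ _ c).
  apply: ler_ltD; last exact: sq.
  by rewrite ler_pXn2r ?nnegrE ?sqnorm_hor_ge0// mulr_ge0// sqr_ge0.
apply: (@le_trans _ _ (c + 1)); first by rewrite lerDl.
by rewrite ler_eXnr// lerDr.
Qed.

Let int_Vb_dil s g r : 0 < r ->
  (\int[mu]_(k in NB 1) (V (dil r (heis_mul g k)) `^ s)%:E =
   ((r `^ (4 * b - 2)) `^ s)%:E * \int[mu]_(k in NB 1) (V (heis_mul g k) `^ s)%:E)%E.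
Proof.
move=> r0; have mV : measurable_fun setT (fun k => (V (heis_mul g k) `^ s)%:E).
  by apply: (measurableT_comp (measurable_VbX b s)); exact: (mpres_mul _).1.
rewrite -ge0_integralZl; first last.
- by rewrite lee_fin powR_ge0.
- by move=> h _; exact: VbX_ge0.
- exact: measurable_funTS.
- exact: measurable_NB.
by apply: eq_integral => h _; rewrite Vb_dil// powRM ?powR_ge0 ?Vb_ge0// EFinM.
Qed.

Let Rint_ball s g r : 0 < s -> (2 - 4 * b) * s < Q%:R -> 0 < r ->
  \int[mu]_(h in heis_ball g r) (V h `^ s) =
  r ^+ Q * ((r `^ (4 * b - 2)) `^ s *
    fine (\int[mu]_(k in NB 1) (V (heis_mul (dil r^-1 g) k) `^ s)%:E)%E).
Proof.
move=> s0 sQ r0; rewrite /Rintegral integral_heis_ball_dil//; last 2 first.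
- exact: measurable_VbX.
- exact: VbX_ge0.
have F := int_Vb_mul_fin b4 (dil r^-1 g) s0 sQ.
apply: etrans (congr1 (fun z => fine ((r ^+ Q)%:E * z)%E) (int_Vb_dil s (dil r^-1 g) r0)) _.
by move: (r ^+ Q) (_ `^ s) => x y; rewrite -(fineK F) -!EFinM.
Qed.

Lemma rev_holder_Vb : rev_holder q V.
Proof.
have q0 : 0 < q by exact: lt_trans q1.
split.
- exact: Vb_ge0.
- exact: measurable_Vb.
- move=> K mK cK; have [l l0 Kl] := compact_sub_NB cK.
  apply: le_lt_trans (int_VbX_fin b4 q0 qQ l0).
  apply: ge0_subset_integral => //.
  + exact: measurable_NB.
  + exact: measurable_funTS (measurable_VbX b q).
  + by move=> h _; exact: VbX_ge0.
have s1Q : (2 - 4 * b) * 1 < Q%:R.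
  by apply: lt_trans qQ; rewrite ltr_pM2l//; have := b4; lra.
have [C C0 hC] := unit_rev_holder n0 b4 q1 qQ.
pose om := fine (mu (NB 1)).
have muF : mu (NB 1) \is a fin_num by rewrite ge0_fin_numE// mu_NB_fin.
have om0 : 0 < om by rewrite fine_gt0// mu_NB_gt0//= mu_NB_fin.
(* [unit_rev_holder] has the bare integral of V on its right-hand side; the factor om compensates
   for the division by the measure of the ball. *)
exists (C * om); first by rewrite mulr_gt0.
move=> g r r0; set B := heis_ball g r; cbv zeta.
have muB : fine (mu B) = r ^+ Q * om.
  have := @integral_heis_ball_dil R n g r (cst 1%E) r0 (measurable_cst _) (fun=> lee01).
  rewrite !integral_cst; [|exact: measurable_NB|exact: measurable_heis_ball].
  by rewrite !mul1e => ->; rewrite -[mu (NB 1)](fineK muF).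
have rQ : 0 < r ^+ Q by rewrite exprn_gt0.
have e1 : \int[mu]_(h in B) V h = \int[mu]_(h in B) (V h `^ 1).
  by rewrite /Rintegral; congr fine; apply: eq_integral => h _; rewrite powRr1// Vb_ge0.
rewrite e1 (Rint_ball g q0 qQ r0) (Rint_ball g ltr01 s1Q r0) muB; set g' := dil r^-1 g.
have := hC g'; rewrite -/om.
set J1 := fine (integral _ _ _); set J2 := fine (integral _ _ _).
have J20 : 0 <= J2 by rewrite fine_ge0// integral_ge0// => k _; exact: VbX_ge0.
set a := r `^ (4 * b - 2); have a0 : 0 <= a by exact: powR_ge0.
rewrite powRr1// => h.
have -> : (r ^+ Q * om)^-1 * (r ^+ Q * (a `^ q * J1)) = a `^ q * (om^-1 * J1).
  by field; rewrite !gt_eqF.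
have J10 : 0 <= J1 by rewrite fine_ge0// integral_ge0// => k _; exact: VbX_ge0.
rewrite powRM ?powR_ge0 ?mulr_ge0 ?invr_ge0 ?(ltW om0)//.
rewrite -powRrM mulfV ?powRr1 ?gt_eqF//.
have -> : C * om / (r ^+ Q * om) * (r ^+ Q * (a * J2)) = a * (C * J2).
  by field; rewrite !gt_eqF.
by rewrite ler_wpM2l.
Qed.

End ReverseHolderVb.

(** * Unboundedness of the Riesz transforms *)

Section Counterexample.
Context {R : realType} {n : nat}.
Local Notation H := (heis R n).
Local Notation mu := (@heis_leb R n).
Local Notation Q := (2 * n + 2)%N.
Implicit Types (g h : H) (b p q : R).

Lemma crit_VE q g : crit_V q g = Vb ((2 - hom_dim n / q) / 4) g.
Proof.
rewrite /crit_V /psi /Vb heis_normE; move: (hom_dim n / q) => al.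
have := homN_ge0 g; rewrite le_eqVlt => /predU1P[N0|N0].
  by have [r0 _] := homN_eq0_sqnorm (esym N0); rewrite r0 !mul0r mulr0.
rewrite -powR_mulrn ?powR_ge0// -!powRrM -powRN mulrCA -powRD_gt0//.
by congr (_ * _ `^ _); field.
Qed.

(** Interpolation between L2 and L-infinity: |h|^p <= K^(p - 2) h^2, which is where p >= 2
    enters. *)
Lemma Lfun_L2_bounded p K (h : H -> R) : 2 <= p -> L2 h -> {ae mu, forall g, `|h g| <= K} ->
  h \in Lfun mu p%:E.
Proof.
move=> p2 Lh hK; have p0 : 0 < p by apply: lt_le_trans p2.
have mh := L2_measurable Lh; have /L2P[_ fi] := Lh.
rewrite inE; apply/andP; split; first by rewrite inE.
rewrite inE /finite_norm /= unlock; apply: poweR_lty.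
have mhp : measurable_fun setT (fun g => (`|h g| `^ p)%:E).
  apply/measurable_EFinP; apply: measurable_powR_comp.
  exact: (measurableT_comp (@normr_measurable _ _)).
have mh2 : measurable_fun setT (fun g => (h g ^+ 2)%:E).
  by apply/measurable_EFinP; exact: measurable_funX.
apply: (@le_lt_trans _ _ (\int[mu]_g ((K `^ (p - 2))%:E * (h g ^+ 2)%:E))%E).
  apply: ae_ge0_le_integral => //.
  - by move=> g _; rewrite lee_fin powR_ge0.
  - by move=> g _; rewrite -EFinM lee_fin mulr_ge0 ?powR_ge0 ?sqr_ge0.
  - by apply: emeasurable_funM.
  apply: filterS hK => g hg _; rewrite /= -EFinM lee_fin.
  have := normr_ge0 (h g); rewrite le_eqVlt => /predU1P[e|h0].
    by rewrite -e powR0 ?gt_eqF// mulr_ge0 ?powR_ge0 ?sqr_ge0.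
  have -> : `|h g| `^ p = `|h g| `^ (p - 2) * h g ^+ 2.
    rewrite -[h g ^+ 2]real_normK ?num_real// -powR_mulrn// -powRD_gt0//.
    by congr (_ `^ _); ring.
  rewrite ler_wpM2r ?sqr_ge0//; apply: ge0_ler_powR; rewrite ?nnegrE ?subr_ge0//.
  exact: le_trans hg.
rewrite ge0_integralZl//; last 2 first.
- by move=> g _; rewrite lee_fin sqr_ge0.
- by rewrite lee_fin powR_ge0.
have F : (\int[mu]_g (h g ^+ 2)%:E)%E \is a fin_num.
  by rewrite ge0_fin_numE// integral_ge0// => g _; rewrite lee_fin sqr_ge0.
by rewrite -(fineK F) -EFinM ltry.
Qed.

Lemma Lnorm_lty_integral p c (w : H -> R) : 0 < p -> 0 < c -> measurable_fun setT w ->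
  (Lnorm mu p%:E (EFin \o (fun g => (c * w g)%R)) < +oo)%E ->
  (\int[mu]_g (`|w g| `^ p)%:E < +oo)%E.
Proof.
move=> p0 c0 mw hl.
have := poweR_lty p hl; rewrite (powR_Lnorm mu _ (lt0r_neq0 p0)) => h.
have mwp : measurable_fun setT (fun g => (`|w g| `^ p)%:E).
  apply/measurable_EFinP; apply: measurable_powR_comp.
  exact: (measurableT_comp (@normr_measurable _ _)).
have e : (\int[mu]_g (`|(EFin \o (fun g => (c * w g)%R)) g| `^ p) =
    (c `^ p)%:E * \int[mu]_g (`|w g| `^ p)%:E)%E.
  rewrite -ge0_integralZl//; last by rewrite lee_fin powR_ge0.
  by apply: eq_integral => g _ /=; rewrite normrM (gtr0_norm c0) powRM ?(ltW c0).
rewrite ltey; apply/eqP => h1; move: h.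
by rewrite e h1 gt0_muley ?lte_fin ?powR_gt0// ltxx.
Qed.

(** One function h defeats all the bounds together: if each transform were bounded, every component
    of the gradient of u0 would be in L^p, against [U0_not_Lp]. Which component fails is left
    open. *)
Lemma riesz_unbounded b p : (0 < n)%N -> 0 < b -> b < 4^-1 -> 2 <= p ->
  p * (1 - 4 * b) = Q%:R ->
  ~ forall k : 'I_(n + n), bounded_Lp p (riesz (Vb b : H -> R) k).
Proof.
move=> n0 b0 b4 p2 pb hbd.
have p0 : 0 < p by apply: lt_le_trans p2.
have V0 := @Vb_ge0 R n b; have mV := @measurable_Vb R n b.
have Lu0 : L2 (u0 b : H -> R) := L2_u0 b0 b4.
have sf := schrodinger_u0 n0 b0 b4.
have [Cu Cu0 hu] := @u0_bound R n b b0 b4.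
have [Cf Cf0 hf] := @f0_bound R n b b0.
have [h Lh hh] := half_exists V0 mV Lu0 sf.
have hb := half_bounded V0 mV Lu0 sf Cu0 Cf0 hu hf Lh hh.
have aeV : {ae mu, forall g, 0 < Vb b g}.
  apply: filterS (sqnorm_gt0_ae n0) => g r0; rewrite mulr_gt0// powR_gt0//.
  by apply: lt_le_trans (sqnorm_le_homN g); rewrite exprn_gt0.
have iv := inv_sqrt_half V0 mV Lu0 sf aeV Lh hh.
set c := fine _ / _ in iv.
have c0 : 0 < c.
  by rewrite divr_gt0 ?exprn_gt0 ?pi_gt0// fine_gt0// kern_int_gt0 kern_int_fin.
have hp := Lfun_L2_bounded p2 Lh hb.
have hfin : Lnorm mu p%:E (EFin \o h) \is a fin_num.
  rewrite ge0_fin_numE// ?Lnorm_ge0//.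
  by move: hp; rewrite inE => /andP[_]; rewrite inE.
apply: (U0_not_Lp n0 b0 b4 p0 pb) => k.
have LU := L2_U0 n0 b0 b4 k.
have rz : riesz (Vb b) k h (fun g => c * U0 b k g).
  split; first exact: L2Z.
  exists (fun g => c * u0 b g) => //.
  have wk := weak_X_u0 n0 b0 b4 k.
  (* The multiple c u0 is written as (c - 1) u0 + u0, the shape that [weak_X_lin] handles. *)
  have := weak_X_lin (c - 1) Lu0 LU Lu0 LU wk wk.
  have e (f : H -> R) : (fun g => (c - 1) * f g + f g) = (fun g => c * f g).
    by apply/funext => g; ring.
  by rewrite !e.
have [C hC] := hbd k.
apply: (Lnorm_lty_integral p0 c0 (L2_measurable LU)).
apply: le_lt_trans (hC _ _ hp rz) _.
by rewrite -(fineK hfin) -EFinM ltry.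
Qed.

End Counterexample.

Theorem mainTheorem4 (R : realType) (n : nat) (hn : (0 < n)%N) (q1 p1 : R)
    (hq1 : hom_dim n / 2 < q1) (hq1' : q1 < hom_dim n)
    (hp1 : p1^-1 = q1^-1 - (hom_dim n)^-1) :
  (forall q : R, 1 < q -> q < q1 ->
     rev_holder q (crit_V q1 : heis R n -> R)) /\
  ~ (forall j : 'I_(n + n),
       bounded_Lp p1 (riesz (crit_V q1 : heis R n -> R) j)).
Proof.
(* V has degree -al, and Q / 2 < q1 < Q means 1 < al < 2, whence 0 < b < 1/4. Moreover 1 / p1 = (al
   - 1) / Q, so p1 (1 - 4 b) = Q and p1 >= Q >= 4. *)
pose al : R := hom_dim n / q1; pose b : R := (2 - al) / 4.
have VE : crit_V q1 = Vb b :> (heis R n -> R) by apply/funext => g; exact: crit_VE.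
have Q0 : 0 < hom_dim n :> R by rewrite ltr0n addn2.
have q0 : 0 < q1 by apply: lt_trans hq1; rewrite divr_gt0.
have al1 : 1 < al by rewrite ltr_pdivlMr// mul1r.
have al2 : al < 2 by rewrite ltr_pdivrMr// mulrC -ltr_pdivrMr.
have b0 : 0 < b by rewrite divr_gt0// subr_gt0.
have bE : 4 * b = 2 - al by rewrite mulrC mulfVK// pnatr_eq0.
have b4 : b < 4^-1.
  by rewrite -[4^-1]mul1r ltr_pdivlMr// mulrC bE ltrBlDr -[2]/(1 + 1) ltrD2l.
have qn : q1 != 0 by rewrite gt_eqF.
have Qn : hom_dim n != 0 :> R by rewrite gt_eqF.
have pE : p1^-1 = (al - 1) / hom_dim n.
  by rewrite hp1 /al; move: (hom_dim n) Qn => x xn; field; rewrite qn xn.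
have pV0 : 0 < p1^-1 by rewrite pE divr_gt0// subr_gt0.
have p0 : 0 < p1 by rewrite -invr_gt0.
have pn : p1 != 0 by rewrite gt_eqF.
have an : al - 1 != 0 by rewrite subr_eq0 gt_eqF.
have p1E : p1 * (al - 1) = hom_dim n.
  have -> : al - 1 = p1^-1 * hom_dim n by rewrite pE mulfVK.
  by rewrite mulVKf.
have p2 : 2 <= p1.
  have Q4 : 4 <= hom_dim n :> R.
    by rewrite /hom_dim ler_nat -[4%N]/(2 * 1 + 2)%N leq_add2r leq_mul2l.
  have a1 : al - 1 <= 1 by rewrite lerBlDr ltW.
  have : p1 * (al - 1) <= p1 by rewrite ler_piMr// ltW.
  rewrite p1E; apply: le_trans; apply: le_trans Q4; by rewrite ler_nat.
rewrite VE; split.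
  move=> q q1' qq1; apply: rev_holder_Vb => //.
  have -> : 2 - 4 * b = al by rewrite bE subKr.
  by rewrite /al mulrAC ltr_pdivrMr// ltr_pM2l.
apply: (riesz_unbounded hn b0 b4 p2).
by rewrite -[RHS]p1E bE; congr (_ * _); rewrite opprB addrCA -[2]/(1 + 1) opprD addNKr.
Qed.
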